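(* Let $v$ be the solution of $$\nabla^2v=0\text{ in }D',\qquad v=f\text{ on }S,\qquad v=O\left(\frac1r\right),\quad r=|x|\to\infty,$$ where $f\in L^2(S)$. For an arbitrarily small $\epsilon>0$ there exist $L(\epsilon)$ and coefficients $c_\ell(\epsilon)$, $0\le\ell\le L(\epsilon)$, such that $$\left\|\sum_{\ell=0}^{L(\epsilon)}c_\ell(\epsilon)H_\ell-f\right\|_{L^2(S)}\le\epsilon$$ and, with $v_\epsilon:=\sum_{\ell=0}^{L(\epsilon)}c_\ell(\epsilon)H_\ell$, $$|||v_\epsilon-v|||=O(\epsilon),\qquad \epsilon\to0,$$ where $|||\cdot|||:=\|\cdot\|_{H^m_{loc}(D')}+\|\cdot\|_{L^2(D';(1+|x|)^{-\gamma})}$, $\gamma>1$, and $m>0$ is an arbitrary integer.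
   Context: $D\subset\mathbb{R}^3$ is a bounded domain with Lipschitz boundary $S$, and $D'=\mathbb{R}^3\setminus D$ is the exterior domain. The origin of coordinates is an interior point of $D$. $Y_\ell=Y_{\ell m}$, $-\ell\le m\le\ell$, are the orthonormal spherical harmonics on the unit sphere $S^2\subset\mathbb{R}^3$, and $$H_\ell(x):=\frac{Y_\ell(x/r)}{r^{\ell+1}},\qquad r=|x|,\ \ell\ge0.$$ The index $m$ of the spherical harmonics is suppressed: $c_\ell$ stands for all $c_{\ell,m}$, $-\ell\le m\le\ell$, and every sum over $\ell$ includes summation over $-\ell\le m\le\ell$. $\|\cdot\|_{L^2(D';(1+|x|)^{-\gamma})}$ is the $L^2$ norm on $D'$ with weight $(1+|x|)^{-\gamma}$. $H^m$ is the Sobolev space; $H^m_{loc}(D')$ is the set of functions lying in $H^m(\tilde D)$ for every compact strictly inner subdomain $\tilde D$ of $D'$ (so $\mathrm{dist}(\tilde D,S)>0$); an estimate in the $H^m_{loc}(D')$ norm means that the estimate holds in $H^m(\tilde D)$ for each such $\tilde D$, with constant allowed to depend on $\tilde D$ (and on $m$). *)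

(* Defs.v *)
From HB Require Import structures.
From mathcomp Require Import all_boot all_order all_algebra.
From mathcomp Require Import all_classical all_reals all_analysis.
From mathcomp Require Import complex.
Set Implicit Arguments.
Unset Strict Implicit.
Unset Printing Implicit Defensive.
Import Order.TTheory GRing.Theory Num.Theory numFieldNormedType.Exports.
Local Open Scope classical_set_scope.
Local Open Scope ring_scope.
Local Open Scope complex_scope.

(* E3 R and M3 R are the same type R^3; E3 carries the normed-module structure
   and M3 the product Borel sigma-algebra on which the Lebesgue measure of the
   library lives. The norm `|x| of E3 is the maximum norm: it is only used for
   the topology, the Euclidean norm is enorm. *)
Notation E3 R := (R * R * R)%type.
Notation M2 R := (measurableTypeR R * measurableTypeR R)%type.
Notation M3 R := (measurableTypeR R * measurableTypeR R * measurableTypeR R)%type.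

Definition leb2 (R : realType) : {measure set (M2 R) -> \bar R} :=
  (@lebesgue_measure R \x @lebesgue_measure R)%E.
Definition leb3 (R : realType) : {measure set (M3 R) -> \bar R} :=
  (leb2 R \x @lebesgue_measure R)%E.

Section euclidean_space.
Context {R : realType}.
Implicit Types (x y : E3 R) (D U : set (E3 R)).

Definition dot x y : R := x.1.1 * y.1.1 + x.1.2 * y.1.2 + x.2 * y.2.
Definition enorm x : R := Num.sqrt (dot x x).
Definition basis3 (i : 'I_3) : E3 R :=
  ((i == 0%N :> nat)%:R, (i == 1%N :> nat)%:R, (i == 2%N :> nat)%:R).

Definition bdry D : set (E3 R) := closure D `\` D°.

(* The open set underlying D' = R^3 \ D; it differs from the complement of D
   by the boundary of D only. *)
Definition exterior D : set (E3 R) := (~` D)°.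

Definition dist x (A : set (E3 R)) : R := inf [set enorm (x - s) | s in A].

(* In the orthonormal frame e1, e2, e3, the part of D lying in U is the part
   of the strict epigraph of the Lipschitz function phi lying in U. *)
Definition lipschitz_chart D (e1 e2 e3 : E3 R) (phi : R * R -> R) U : Prop :=
  [/\ [/\ dot e1 e1 = 1, dot e2 e2 = 1 & dot e3 e3 = 1],
      [/\ dot e1 e2 = 0, dot e1 e3 = 0 & dot e2 e3 = 0],
      [lipschitz phi y | y in setT],
      open U
    & forall x, U x -> (D x <-> phi (dot x e1, dot x e2) < dot x e3)].

Definition lipschitz_boundary D : Prop :=
  forall p, bdry D p -> exists e1 e2 e3 phi U,
    lipschitz_chart D e1 e2 e3 phi U /\ U p.

Definition graph_pt (e1 e2 e3 : E3 R) (phi : R * R -> R) (y : R * R) : E3 R :=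
  y.1 *: e1 + y.2 *: e2 + phi y *: e3.

(* dS = sqrt(1 + |grad phi|^2) dy in every Lipschitz chart. This determines
   sigma on the Borel subsets of the boundary; sigma is unconstrained
   elsewhere and is only ever used on the boundary. The gradient of phi exists
   almost everywhere by Rademacher's theorem. *)
Definition surface_measure D (sigma : {measure set (M3 R) -> \bar R}) : Prop :=
  forall e1 e2 e3 phi U, lipschitz_chart D e1 e2 e3 phi U ->
  forall A : set (M3 R), measurable A -> A `<=` bdry D `&` U ->
  sigma A =
    (\int[leb2 R]_(y in graph_pt e1 e2 e3 phi @^-1` A)
      (Num.sqrt (1 + ('D_((1, 0) : R * R) phi y) ^+ 2
                   + ('D_((0, 1) : R * R) phi y) ^+ 2))%:E)%E.

Definition partial (i : 'I_3) (u : E3 R -> R) : E3 R -> R :=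
  fun x => 'D_(basis3 i) u x.

Definition C1_on U (u : E3 R -> R) : Prop :=
  forall i x, U x -> derivable u x (basis3 i) /\ {for x, continuous (partial i u)}.
Definition C2_on U (u : E3 R -> R) : Prop :=
  C1_on U u /\ forall i, C1_on U (partial i u).

Definition harmonic_on U (u : E3 R -> R) : Prop :=
  C2_on U u /\ forall x, U x -> \sum_(i < 3) partial i (partial i u) x = 0.

Definition cre (w : E3 R -> R[i]) : E3 R -> R := fun x => complex.Re (w x).
Definition cim (w : E3 R -> R[i]) : E3 R -> R := fun x => complex.Im (w x).

Definition charmonic_on U (w : E3 R -> R[i]) : Prop :=
  harmonic_on U (cre w) /\ harmonic_on U (cim w).

End euclidean_space.

Section norms.
Context {R : realType}.
Implicit Types (A : set (E3 R)) (w : E3 R -> R[i]).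

Definition cabs (z : R[i]) : R := Normc.normc z.

Definition L2norm (mu : {measure set (M3 R) -> \bar R}) A w : \bar R :=
  sqrte (\int[mu]_(x in A) (cabs (w x) ^+ 2)%:E)%E.

Definition square_integrable (mu : {measure set (M3 R) -> \bar R}) A w : Prop :=
  [/\ measurable_fun (A : set (M3 R)) (cre w : M3 R -> R),
      measurable_fun (A : set (M3 R)) (cim w : M3 R -> R)
    & (L2norm mu A w < +oo)%E].

Definition L2wnorm (gamma : R) A w : \bar R :=
  sqrte (\int[leb3 R]_(x in A)
           (cabs (w x) ^+ 2 * (1 + enorm x) `^ (- gamma))%:E)%E.

Definition Dmulti (a b c : nat) (u : E3 R -> R) : E3 R -> R :=
  iter a (partial (inord 0)) (iter b (partial (inord 1)) (iter c (partial (inord 2)) u)).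

(* The norm of H^m(A). It is only applied to differences of harmonic functions
   on open sets, whose weak derivatives are their classical derivatives. *)
Definition Hnorm (m : nat) A w : \bar R :=
  sqrte (\sum_(a < m.+1) \sum_(b < m.+1) \sum_(c < m.+1 | (a + b + c <= m)%N)
           \int[leb3 R]_(x in A)
             ((Dmulti a b c (cre w) x) ^+ 2 + (Dmulti a b c (cim w) x) ^+ 2)%:E)%E.

Definition strictly_inner (D Dt : set (E3 R)) : Prop :=
  [/\ open Dt, connected Dt, compact (closure Dt) & closure Dt `<=` exterior D].

End norms.

Section spherical_harmonics.
Context {R : realType}.

Definition hompoly (l : nat) (q : nat -> nat -> R[i]) (x : E3 R) : R[i] :=
  \sum_(a < l.+1) \sum_(b < l.+1 | (a + b <= l)%N)
    q a b * (x.1.1 ^+ a * x.1.2 ^+ b * x.2 ^+ (l - a - b))%:C.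

(* Spherical harmonics of degree l: restrictions to the unit sphere of the
   harmonic homogeneous polynomials of degree l. *)
Definition spherical_harmonic (l : nat) (Y : E3 R -> R[i]) : Prop :=
  exists q, charmonic_on setT (hompoly l q) /\
    forall x, enorm x = 1 -> Y x = hompoly l q x.

Definition sphere_int (F : E3 R -> R) : R :=
  \int[@lebesgue_measure R]_(t in `[0, pi])
    \int[@lebesgue_measure R]_(p in `[0, pi *+ 2])
      (F (sin t * cos p, sin t * sin p, cos t) * sin t).

Definition sphere_dot (f g : E3 R -> R[i]) : R[i] :=
  sphere_int (cre (fun x => f x * conjc (g x)))
  +i* sphere_int (cim (fun x => f x * conjc (g x))).

(* The order m in -l..l is encoded by its shift m + l in 'I_(2l+1). *)
Definition orthonormal_spherical_harmonics
    (Y : forall l : nat, 'I_(l.*2.+1) -> E3 R -> R[i]) : Prop :=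
  (forall l m, spherical_harmonic l (Y l m)) /\
  (forall l m l' m',
     sphere_dot (Y l m) (Y l' m') = ((l == l') && (m == m' :> nat))%:R).

Definition multipole (Y : forall l : nat, 'I_(l.*2.+1) -> E3 R -> R[i])
    (l : nat) (m : 'I_(l.*2.+1)) (x : E3 R) : R[i] :=
  Y l m ((enorm x)^-1 *: x) / ((enorm x) ^+ l.+1)%:C.

Definition multipole_sum (Y : forall l : nat, 'I_(l.*2.+1) -> E3 R -> R[i])
    (L : nat) (c : forall l : nat, 'I_(l.*2.+1) -> R[i]) (x : E3 R) : R[i] :=
  \sum_(l < L.+1) \sum_(m < l.*2.+1) c l m * multipole Y m x.

End spherical_harmonics.

Section dirichlet_problem.
Context {R : realType}.
Implicit Types (D : set (E3 R)) (v f : E3 R -> R[i]).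

Definition nt_region D (alpha : R) (y : E3 R) : set (E3 R) :=
  [set x | exterior D x /\ enorm (x - y) < (1 + alpha) * dist x (bdry D)].

Definition nt_maximal D (alpha : R) v (y : E3 R) : \bar R :=
  maxe 0%E (ereal_sup [set (cabs (v x))%:E | x in nt_region D alpha y]).

Definition nt_limit D (alpha : R) v (y : E3 R) (l : R[i]) : Prop :=
  cabs (v x - l) @[x --> within (nt_region D alpha y) (nbhs y)] --> (0 : R).

(* Boundary data in L^2(S) on a Lipschitz surface are attained as
   nontangential limits almost everywhere on S, the nontangential maximal
   function of the solution being in L^2(S). *)
Definition attains_boundary_data D (sigma : {measure set (M3 R) -> \bar R}) f v : Prop :=
  forall alpha : R, 0 < alpha ->
    {ae sigma, forall y, bdry D y -> nt_limit D alpha v y (f y)} /\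
    (\int[sigma]_(y in bdry D)
        (nt_maximal D alpha v y * nt_maximal D alpha v y) < +oo)%E.

Definition decays_like_inverse_r D v : Prop :=
  exists C r0 : R, forall x, exterior D x -> r0 <= enorm x ->
    cabs (v x) <= C / enorm x.

Definition exterior_dirichlet_solution D sigma f v : Prop :=
  [/\ charmonic_on (exterior D) v,
      attains_boundary_data D sigma f v
    & decays_like_inverse_r D v].

End dirichlet_problem.

(* Main.v *)
Require Import Defs.
From HB Require Import structures.
From mathcomp Require Import all_boot all_order all_algebra.
From mathcomp Require Import all_classical all_reals all_analysis.
From mathcomp Require Import measurable_realfun complex.
From mathcomp Require Import ring lra.
Set Implicit Arguments.
Unset Strict Implicit.
Unset Printing Implicit Defensive.
Import Order.TTheory GRing.Theory Num.Theory numFieldNormedType.Exports.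
Local Open Scope classical_set_scope.
Local Open Scope ring_scope.
Local Open Scope complex_scope.

(** On S, f is approximated by translates of v that push its singularities into
    D.  Choose a partition of unity chi_k near S, subordinate to balls in which
    S is a Lipschitz graph over directions e_k.  Up to a constant, v is near S
    the sum over k of the integrals of v Laplacian(N_r chi_k), where N_r is the
    Newton kernel averaged over a ball whose radius r is proportional to a
    small t.  Translate the k-th summand by t e_k: by Green's formula it becomes
    a potential of Newton and dipole kernels with poles in a compact subset of
    D.  Runge's pole pushing moves the poles to the origin, where the Legendre
    expansion turns them into multipoles, uniformly on the complement of D with
    weight 1 + |x|.  As t -> 0 the translates converge to f on S and to v off S;
    dominated convergence gives convergence in L2(S) and in L2 near S, the
    dominating functions being the nontangential maximal function of v, its
    averages over cones, and a Riesz potential.  Far away, convergence is uniform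
    with decay 1/|x|.  The mean value property turns L2 bounds into interior
    bounds on all derivatives. *)

(** No single translation pushes the singularities of v into D, because S is a graph over different
    directions at different places; hence one translation per piece of the partition. After
    translation the pieces no longer add up to v by Green's formula. What saves the sum is the
    splitting of the Laplacian of N_r chi_k, up to sign, into a bump of radius r, which averages
    chi_k v, and a kernel of order |x-y|^(-2), whose potential changes little under shifts of order
    r. The kernel parts cancel in the limit, and the averages add up to v because the chi_k and 1
    minus their sum add up to 1.

    The radius is c t / 2, half of the depth c t that a shift by t gains in the exterior cone. Each
    average then only sees v inside a nontangential region, where the maximal function controls it.
    One family of functions thus approximates f on S and v in D' at the same time.

    Kernels and cutoffs are made from cubes of positive parts and Taylor polynomials, which are just
    smooth enough for Green's formula and have explicit derivatives. Real and imaginary parts are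
    approximated separately and joined at the end. *)

Local Notation ax1 := (lift ord0 ord0).
Local Notation ax2 := (lift ord0 (lift ord0 ord0)).
Local Notation sfin3 R := {sigma_finite_measure set (M3 R) -> \bar R}.

(** * Euclidean norm, balls and compactness in R^3 *)

Section euclidean_geometry.
Context {R : realType}.
Implicit Types (x y z p : E3 R) (s r e : R).

Lemma E3ext x y : x.1.1 = y.1.1 -> x.1.2 = y.1.2 -> x.2 = y.2 -> x = y.
Proof. by move: x y => [[a b] c] [[a' b'] c'] /= -> -> ->. Qed.

Lemma dotC x y : dot x y = dot y x.
Proof. by rewrite /dot; ring. Qed.
Lemma dotDl x y z : dot (x + y) z = dot x z + dot y z.
Proof. by rewrite /dot /=; ring. Qed.
Lemma dotDr x y z : dot z (x + y) = dot z x + dot z y.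
Proof. by rewrite /dot /=; ring. Qed.
Lemma dotNl x z : dot (- x) z = - dot x z.
Proof. by rewrite /dot /=; ring. Qed.
Lemma dotNr x z : dot z (- x) = - dot z x.
Proof. by rewrite /dot /=; ring. Qed.
Lemma dotBl x y z : dot (x - y) z = dot x z - dot y z.
Proof. by rewrite dotDl dotNl. Qed.
Lemma dotBr x y z : dot z (x - y) = dot z x - dot z y.
Proof. by rewrite dotDr dotNr. Qed.
Lemma dotZl s x z : dot (s *: x) z = s * dot x z.
Proof. by rewrite /dot /= /GRing.scale /=; ring. Qed.
Lemma dotZr s x z : dot z (s *: x) = s * dot z x.
Proof. by rewrite /dot /= /GRing.scale /=; ring. Qed.
Lemma dot0l z : dot 0 z = 0.
Proof. by rewrite /dot /=; ring. Qed.

Lemma dot_ge0 x : 0 <= dot x x.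
Proof. by rewrite /dot !addr_ge0 // -expr2 sqr_ge0. Qed.

Lemma enorm_ge0 x : 0 <= enorm x.
Proof. exact: sqrtr_ge0. Qed.
Hint Resolve enorm_ge0 : core.

Lemma enorm_sqr x : enorm x ^+ 2 = dot x x.
Proof. by rewrite sqr_sqrtr // dot_ge0. Qed.

Lemma enorm_le_sqr x s : 0 <= s -> (enorm x <= s) = (dot x x <= s ^+ 2).
Proof. by move=> s0; rewrite -enorm_sqr ler_sqr // nnegrE. Qed.

Lemma dot_sqr_le x y : dot x y ^+ 2 <= dot x x * dot y y.
Proof.
rewrite -subr_ge0 (_ : _ - _ = (x.1.1 * y.1.2 - x.1.2 * y.1.1) ^+ 2
  + (x.1.1 * y.2 - x.2 * y.1.1) ^+ 2 + (x.1.2 * y.2 - x.2 * y.1.2) ^+ 2).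
  by rewrite !addr_ge0 // sqr_ge0.
by rewrite /dot; ring.
Qed.

Lemma dot_le x y : `|dot x y| <= enorm x * enorm y.
Proof.
rewrite -ler_sqr ?nnegrE ?mulr_ge0 // exprMn !enorm_sqr real_normK ?num_real //.
exact: dot_sqr_le.
Qed.

Lemma enormD x y : enorm (x + y) <= enorm x + enorm y.
Proof.
rewrite enorm_le_sqr ?addr_ge0 // sqrrD !enorm_sqr dotDl !dotDr (dotC y x).
by have := ler_norm (dot x y); have := dot_le x y; lra.
Qed.

Lemma enormN x : enorm (- x) = enorm x.
Proof. by rewrite /enorm dotNl dotNr opprK. Qed.

Lemma enormB x y : enorm (x - y) = enorm (y - x).
Proof. by rewrite -enormN opprB. Qed.

Lemma enormZ s x : enorm (s *: x) = `|s| * enorm x.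
Proof.
by rewrite /enorm dotZl dotZr mulrA -expr2 sqrtrM ?sqr_ge0 // sqrtr_sqr.
Qed.

Lemma enorm0 : enorm (0 : E3 R) = 0.
Proof. by rewrite /enorm dot0l sqrtr0. Qed.

Lemma enormDB x y z : enorm (x - z) <= enorm (x - y) + enorm (y - z).
Proof. by have := enormD (x - y) (y - z); rewrite addrA subrK. Qed.

Lemma enorm_sub_le x y : `|enorm x - enorm y| <= enorm (x - y).
Proof.
have h (a b : E3 R) : enorm a <= enorm (a - b) + enorm b.
  by have := enormD (a - b) b; rewrite subrK.
by rewrite ler_norml; have := h x y; have := h y x; rewrite (enormB y x); lra.
Qed.

Lemma enorm_coord x : [/\ `|x.1.1| <= enorm x, `|x.1.2| <= enorm x & `|x.2| <= enorm x].
Proof.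
have h (a b c : R) : dot x x = a ^+ 2 + b ^+ 2 + c ^+ 2 -> `|a| <= enorm x.
  move=> E; rewrite -sqrtr_sqr ler_wsqrtr // E.
  by have := sqr_ge0 b; have := sqr_ge0 c; lra.
split; [apply: (h _ x.1.2 x.2)|apply: (h _ x.1.1 x.2)|apply: (h _ x.1.1 x.1.2)];
  by rewrite /dot; ring.
Qed.

Lemma norm_le_enorm x : `|x| <= enorm x.
Proof. by have [a b c] := enorm_coord x; rewrite !prod_normE !ge_max a b c. Qed.

Lemma enorm_le_norm x : enorm x <= 2 * `|x|.
Proof.
rewrite enorm_le_sqr ?mulr_ge0 // /dot.
have [a b c] : [/\ `|x.1.1| <= `|x|, `|x.1.2| <= `|x| & `|x.2| <= `|x|].
  by rewrite !prod_normE !le_max !lexx !orbT.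
have h (u : R) : `|u| <= `|x| -> u * u <= `|x| ^+ 2.
  by move=> hu; rewrite -expr2 -real_normK ?num_real // ler_sqr ?nnegrE.
have := h _ a; have := h _ b; have := h _ c; have := sqr_ge0 `|x|; rewrite exprMn.
by lra.
Qed.

Lemma enorm_gt0 x : x != 0 -> 0 < enorm x.
Proof. by move=> x0; apply: lt_le_trans (norm_le_enorm x); rewrite normr_gt0. Qed.

Lemma enorm_eq0 x : enorm x = 0 -> x = 0.
Proof. by move=> h; apply/eqP; apply: contraT => /enorm_gt0; rewrite h ltxx. Qed.

Lemma enorm_le_coord x s : `|x.1.1| <= s -> `|x.1.2| <= s -> `|x.2| <= s -> enorm x <= 2 * s.
Proof.
move=> a b c; apply: (le_trans (enorm_le_norm x)); rewrite ler_wpM2l //.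
by rewrite !prod_normE !ge_max a b c.
Qed.

Definition eball p r : set (E3 R) := [set x | enorm (x - p) < r].

Lemma nbhs_eball p (P : set (E3 R)) :
  nbhs p P <-> exists2 r : R, 0 < r & eball p r `<=` P.
Proof.
split=> [/nbhs_ballP [r /= r0 h]|[r r0 h]].
  exists r => // x xr; apply: h; rewrite -ball_normE /= distrC.
  exact: le_lt_trans (norm_le_enorm _) xr.
apply/nbhs_ballP; exists (r / 2) => /=; first by rewrite divr_gt0.
move=> x; rewrite -ball_normE /= distrC => xr; apply: h.
by apply: (le_lt_trans (enorm_le_norm _)); lra.
Qed.

Lemma openE3 (A : set (E3 R)) :
  open A <-> forall x, A x -> exists2 r : R, 0 < r & eball x r `<=` A.
Proof.
rewrite openE; split=> h x Ax; first by apply/nbhs_eball; exact: h.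
by apply/nbhs_eball; exact: h.
Qed.

Lemma open_eball p r : open (eball p r).
Proof.
apply/openE3 => x /= xr; exists (r - enorm (x - p)); first by rewrite subr_gt0.
by move=> y /= yx; apply: (le_lt_trans (enormDB _ x _)); rewrite /eball /= in xr yx *; lra.
Qed.

Lemma continuousE3 (u : E3 R -> R) x :
  {for x, continuous u} <->
  forall e : R, 0 < e -> exists2 d : R, 0 < d & forall y, enorm (y - x) < d -> `|u y - u x| < e.
Proof.
split=> [h e e0|h].
  move/cvgrPdist_lt : h => /(_ e e0)/nbhs_eball[d d0 h]; exists d => // y yx.
  by rewrite distrC; exact: h.
apply/cvgrPdist_lt => e /h [d d0 hd]; apply/nbhs_eball; exists d => // y yx.
by rewrite distrC; exact: hd.
Qed.

Lemma closureE3 (A : set (E3 R)) x :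
  closure A x <-> forall e : R, 0 < e -> exists2 y, A y & enorm (y - x) < e.
Proof.
split=> [h e e0|h B /nbhs_eball[e /h [y Ay yx] eB]].
  by have [|y [Ay yx]] := h (eball x e); [apply/nbhs_eball; exists e|exists y].
by exists y; split=> //; exact: eB.
Qed.

Lemma interiorE3 (A : set (E3 R)) x :
  A° x <-> exists2 r : R, 0 < r & eball x r `<=` A.
Proof. exact: nbhs_eball. Qed.

Lemma lipschitz_continuousE3 (u : E3 R -> R) (k : R) :
  (forall x y, `|u x - u y| <= k * enorm (x - y)) -> continuous u.
Proof.
move=> h x; apply/continuousE3 => e e0.
exists (e / (`|k| + 1)); first by rewrite divr_gt0.
move=> y; rewrite ltr_pdivlMr // mulrC; apply: le_lt_trans.
apply: (le_trans (h y x)); rewrite ler_wpM2r //.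
by apply: (le_trans (ler_norm _)); rewrite lerDl.
Qed.

Lemma continuous_enorm : continuous (enorm : E3 R -> R).
Proof.
by apply: (@lipschitz_continuousE3 _ 1) => x y; rewrite mul1r; exact: enorm_sub_le.
Qed.

Lemma closed_bounded_compactE3 (A : set (E3 R)) r :
  closed A -> (forall x, A x -> enorm x <= r) -> compact A.
Proof.
move=> cA bA.
apply: (@subclosed_compact _ _ ((`[- r, r] `*` `[- r, r]) `*` `[- r, r])) => //.
  by apply: compact_setX; [apply: compact_setX|]; exact: segment_compact.
move=> x /bA xr; have [a b c] := enorm_coord x.
by rewrite /= !in_itv /= -!ler_norml; split; [split|]; exact: le_trans xr.
Qed.

Lemma compact_boundedE3 (A : set (E3 R)) :
  compact A -> exists r : R, forall x, A x -> enorm x <= r.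
Proof.
move=> /compact_bounded [M [_ h]]; exists (2 * (M + 1)) => x Ax.
apply: (le_trans (enorm_le_norm _)); rewrite ler_wpM2l //.
by apply: (h (M + 1)) => //; rewrite ltrDl.
Qed.

(** The near-covering form of compactness is used with the filter of properties that hold for all
    sufficiently large finite lists of centres in A. Locally near x, every list containing x covers;
    hence one list covers all of A. *)
Lemma compact_eball_cover (A : set (E3 R)) (rad : E3 R -> R) :
  compact A -> (forall x, A x -> 0 < rad x) ->
  exists s : seq (E3 R), (forall p, p \in s -> A p) /\
    (forall x, A x -> exists2 p, p \in s & enorm (x - p) < rad p).
Proof.
move=> /compact_near_coveringP cA rA.
pose F : set_system (seq (E3 R)) := [set Q | exists s0 : seq (E3 R),
  (forall p, p \in s0 -> A p) /\ forall s1 : seq (E3 R), {subset s0 <= s1} -> Q s1].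
have FF : Filter F.
  split.
  - by exists [::]; split.
  - move=> P Q [s1 [s1A h1]] [s2 [s2A h2]]; exists (s1 ++ s2); split.
      by move=> p; rewrite mem_cat => /orP[/s1A|/s2A].
    by move=> s ss; split; [apply: h1|apply: h2] => p ps; apply: ss; rewrite mem_cat ps ?orbT.
  - by move=> P Q PQ [s1 [s1A h1]]; exists s1; split=> // s /h1 /PQ.
have [|s0 [s0A h]] := cA _ F (fun (s : seq (E3 R)) x => exists2 p, p \in s & enorm (x - p) < rad p) FF.
  move=> x Ax; exists (eball x (rad x), [set s1 : seq (E3 R) | x \in s1]); first split => /=.
  - by apply/nbhs_eball; exists (rad x) => //; exact: rA.
  - exists [:: x]; split; first by move=> p; rewrite inE => /eqP ->.
    by move=> s ss /=; apply: ss; rewrite inE.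
  - by move=> [y s] /= [yx xs]; exists x.
by exists s0; split=> // x Ax; exact: (h s0 (fun=> id) x Ax).
Qed.

End euclidean_geometry.
#[global] Hint Extern 0 (is_true (0 <= enorm _)) => exact: enorm_ge0 : core.

Section measure_preliminaries.
Context {R : realType}.

Section sigma_finite_pack.
Context d (T : measurableType d) (mu : {measure set T -> \bar R})
  (h : sigma_finite setT mu).
(** Fubini and Tonelli require a bundled sigma-finite measure. This copy of [mu] carries the proof
    [h], so that measures such as [leb3], or restrictions, can be used there. *)
Definition sigma_finite_copy & sigma_finite setT mu := mu : set T -> \bar R.
HB.instance Definition _ := Measure.copy (sigma_finite_copy h) mu.
HB.instance Definition _ := Measure_isSigmaFinite.Build _ _ _ (sigma_finite_copy h) h.
Definition sigma_finite_pack : {sigma_finite_measure set T -> \bar R} := sigma_finite_copy h.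
Lemma integral_sigma_finite_pack (A : set T) (f : T -> \bar R) :
  (\int[sigma_finite_pack]_(x in A) f x = \int[mu]_(x in A) f x)%E.
Proof. by apply: eq_measure_integral. Qed.
End sigma_finite_pack.

Lemma product_sigma_finite d1 d2 (T1 : measurableType d1) (T2 : measurableType d2)
    (m1 : {sigma_finite_measure set T1 -> \bar R})
    (m2 : {sigma_finite_measure set T2 -> \bar R}) :
  sigma_finite setT (m1 \x m2)%E.
Proof.
have /sigma_finiteP[F [TF ndF Foo]] := sigma_finiteT m1.
have /sigma_finiteP[G [TG ndG Goo]] := sigma_finiteT m2.
exists (fun n => F n `*` G n).
  rewrite -setXTT TF TG; apply/seteqP; split => [[x y] [/= [n _ Fnx] [k _ Gky]]|].
    exists (maxn n k) => //; split => /=.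
      by have /subsetPset := ndF _ _ (leq_maxl n k); exact.
    by have /subsetPset := ndG _ _ (leq_maxr n k); exact.
  by move=> [x y] [n _ [/= Fnx Gny]]; split; exists n.
move=> k; have [mFk Fk] := Foo k; have [mGk Gk] := Goo k; split; first exact: measurableX.
by rewrite product_measure1E // lte_mul_pinfty// ge0_fin_numE.
Qed.

Definition leb1s : {sigma_finite_measure set (measurableTypeR R) -> \bar R} :=
  @lebesgue_measure R.

Lemma leb2_sigma_finite : sigma_finite setT (leb2 R).
Proof. exact: (@product_sigma_finite _ _ _ _ leb1s leb1s). Qed.

Definition leb2s : {sigma_finite_measure set (M2 R) -> \bar R} :=
  sigma_finite_pack leb2_sigma_finite.

Lemma leb3_sigma_finite : sigma_finite setT (leb3 R).
Proof. exact: (@product_sigma_finite _ _ _ _ leb2s leb1s). Qed.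

Definition leb3s : sfin3 R :=
  sigma_finite_pack leb3_sigma_finite.

Lemma measurable_coord11 : measurable_fun setT (fun x : M3 R => x.1.1 : R).
Proof. by apply: measurableT_comp => //; exact: measurable_fst. Qed.
Lemma measurable_coord12 : measurable_fun setT (fun x : M3 R => x.1.2 : R).
Proof. by apply: (measurableT_comp measurable_snd); exact: measurable_fst. Qed.
Lemma measurable_coord2 : measurable_fun setT (fun x : M3 R => x.2 : R).
Proof. exact: measurable_snd. Qed.

Definition box (p : E3 R) (r : R) : set (M3 R) :=
  (`]p.1.1 - r, p.1.1 + r[%classic `*` `]p.1.2 - r, p.1.2 + r[%classic)
   `*` `]p.2 - r, p.2 + r[%classic.

Lemma boxE p r (x : E3 R) :
  box p r x <-> [/\ `|x.1.1 - p.1.1| < r, `|x.1.2 - p.1.2| < r & `|x.2 - p.2| < r].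
Proof.
rewrite /box /= !in_itv /= !ltr_distl.
by split=> [[[]]|[]] //.
Qed.

Lemma measurable_box p r : measurable (box p r).
Proof.
by apply: measurableX; [apply: measurableX|]; exact: measurable_itv.
Qed.

Lemma leb3_box p r : 0 < r -> leb3 R (box p r) = (8 * r ^+ 3)%:E.
Proof.
move=> r0.
rewrite [LHS](@product_measure1E _ _ _ _ R (leb2 R) leb1s) //; last exact: measurableX.
rewrite [X in (X * _)%E = _](@product_measure1E _ _ _ _ R leb1s leb1s) //.
have h1 (a : R) : leb1s (`]a - r, a + r[%classic) = (2 * r)%:E.
  rewrite [LHS]lebesgue_measure_itv /= lte_fin (_ : a - r < a + r); last lra.
  by rewrite -EFinB; congr _%:E; ring.
transitivity ((2 * r)%:E * (2 * r)%:E * (2 * r)%:E)%E.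
  by congr (_ * _ * _)%E; exact: h1.
by rewrite -!EFinM; congr _%:E; ring.
Qed.

Lemma eball_sub_box (p : E3 R) r : eball p r `<=` box p r.
Proof.
move=> x xp; apply/boxE; have [a b c] := enorm_coord (x - p).
by split; [exact: (le_lt_trans a)|exact: (le_lt_trans b)|exact: (le_lt_trans c)].
Qed.

Lemma box_enorm (p x : E3 R) r : box p r x -> enorm (x - p) <= 2 * r.
Proof. by move/boxE => [a b c]; apply: enorm_le_coord; apply: ltW. Qed.

(** The sigma-algebra is the product one, so open sets have to be written as countable unions of
    cubes with rational centres and radii 1/(n+1). *)
Lemma open_measurable3 (A : set (E3 R)) : open A -> measurable (A : set (M3 R)).
Proof.
move=> /openE3 oA.
pose q3 (i : (rat * rat) * (rat * nat)) : E3 R := (ratr i.1.1, ratr i.1.2, ratr i.2.1).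
pose B (i : (rat * rat) * (rat * nat)) : set (M3 R) := box (q3 i) (i.2.2.+1%:R^-1).
pose I := [set i | B i `<=` A].
have -> : (A : set (M3 R)) = \bigcup_(i in I) B i.
  apply/seteqP; split=> [x Ax|x [i Ii]]; last exact: Ii.
  have [r r0 rA] := oA _ Ax.
  (* Two points of a cube of half-side e are at Euclidean distance at most 4 e, by [box_enorm] at
     both points; n makes this smaller than r. *)
  pose n := Num.truncn (4 / r).
  pose e : R := n.+1%:R^-1.
  have e0 : 0 < e by rewrite invr_gt0.
  have er : 4 * e < r.
    rewrite /e -ltr_pdivlMl // mulrC -invf_div ltf_pV2 ?posrE ?divr_gt0 //.
    exact: truncnS_gt.
  have rq (a : R) : exists q : rat, `|a - ratr q| < e.
    have [|q] := @rat_in_itvoo R (a - e) (a + e); first lra.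
    by rewrite in_itv /= => /andP[qa qb]; exists q; rewrite ltr_distl; apply/andP; split; lra.
  have [a ha] := rq x.1.1; have [b hb] := rq x.1.2; have [c hc] := rq x.2.
  have xB : box (ratr a, ratr b, ratr c) e x by apply/boxE; split.
  exists ((a, b), (c, n)); last exact: xB.
  move=> y /= yB; apply: rA; rewrite /eball /=.
  apply: (le_lt_trans (enormDB _ (ratr a, ratr b, ratr c) _)).
  have := box_enorm yB; have := box_enorm xB; rewrite (enormB x) -/e /q3 /=; lra.
rewrite bigcup_mkcond; apply: countable_bigcupT_measurable => // i.
by case: ifP => _ //; exact: measurable_box.
Qed.

Lemma closed_measurable3 (A : set (E3 R)) : closed A -> measurable (A : set (M3 R)).
Proof.
move=> /closed_openC /open_measurable3 mA; rewrite -(setCK (A : set (M3 R))).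
exact: measurableC.
Qed.

Lemma continuous_measurable_on (A : set (E3 R)) (u : E3 R -> R) : open A ->
  (forall x, A x -> {for x, continuous u}) ->
  measurable_fun (A : set (M3 R)) (u : M3 R -> R).
Proof.
move=> oA cu.
apply: (@measurability _ _ _ _ _ _ (@measurable_realfun.RGenOInfty.G R)).
  exact: measurable_realfun.RGenOInfty.measurableE.
move=> _ [_ [t ->] <-].
apply: open_measurable3; apply/openE3 => x [/= Ax].
rewrite in_itv /= andbT => tx.
have /openE3/(_ _ Ax)[r r0 rA] := oA.
have /continuousE3/(_ (u x - t))[|d d0 h] := cu _ Ax; first by rewrite subr_gt0.
exists (Num.min r d); first by rewrite lt_min r0.
move=> y; rewrite /eball /= lt_min => /andP[/rA Ay /h].
by rewrite ltr_distl => /andP[+ _]; split => //=; rewrite in_itv /= andbT; lra.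
Qed.

Lemma continuous_measurable3 (u : E3 R -> R) : continuous u ->
  measurable_fun setT (u : M3 R -> R).
Proof.
move=> cu; have := @continuous_measurable_on [set: E3 R] u openT; apply => x _; exact: cu.
Qed.

End measure_preliminaries.

(** * Integrals of real functions over R^3 *)

Section integral_R3.
Context {R : realType}.
Implicit Types (u w g : E3 R -> R).

Definition I3 u : R := Rintegral (leb3 R) setT (u : M3 R -> R).
Definition int3 u : Prop := (leb3 R).-integrable setT (EFin \o (u : M3 R -> R)).

Lemma int3_measurable u : int3 u -> measurable_fun setT (u : M3 R -> R).
Proof. by move=> /measurable_int /measurable_EFinP. Qed.

Lemma I3_integral u : int3 u -> (\int[leb3 R]_x (u x)%:E)%E = (I3 u)%:E.
Proof. by move=> iu; rewrite /I3 /Rintegral fineK //; exact: integrable_fin_num. Qed.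

Lemma int3D u w : int3 u -> int3 w -> int3 (fun x => u x + w x).
Proof. by move=> iu iw; have := integrableD measurableT iu iw. Qed.

Lemma I3D u w : int3 u -> int3 w -> I3 (fun x => u x + w x) = I3 u + I3 w.
Proof. by move=> iu iw; exact: RintegralD. Qed.

Lemma int3Z c u : int3 u -> int3 (fun x => c * u x).
Proof. by move=> iu; have := integrableZl measurableT c iu. Qed.

Lemma I3Z c u : int3 u -> I3 (fun x => c * u x) = c * I3 u.
Proof. by move=> iu; exact: RintegralZl. Qed.

Lemma int3N u : int3 u -> int3 (fun x => - u x).
Proof. by move=> iu; have := integrableN iu. Qed.

Lemma int3B u w : int3 u -> int3 w -> int3 (fun x => u x - w x).
Proof. by move=> iu iw; have := integrableB measurableT iu iw. Qed.

Lemma I3B u w : int3 u -> int3 w -> I3 (fun x => u x - w x) = I3 u - I3 w.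
Proof. by move=> iu iw; exact: RintegralB. Qed.

Lemma int3_0 : int3 (fun=> 0).
Proof. exact: integrable0. Qed.

Lemma I3_0 : I3 (fun=> 0) = 0.
Proof. by rewrite /I3 /Rintegral integral0. Qed.

Lemma eq_I3 u w : u =1 w -> I3 u = I3 w.
Proof. by move=> uw; congr I3; exact: funext. Qed.

Lemma eq_int3 u w : u =1 w -> int3 u -> int3 w.
Proof. by move=> /funext ->. Qed.

Lemma int3_sum (I : Type) (s : seq I) (P : pred I) (h : I -> E3 R -> R) :
  (forall i, P i -> int3 (h i)) -> int3 (fun x => \sum_(i <- s | P i) h i x).
Proof.
move=> ih; elim: s => [|i s IH].
  by apply: eq_int3 int3_0 => x; rewrite big_nil.
case Pi: (P i); last by apply: eq_int3 IH => x; rewrite big_cons Pi.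
by apply: (eq_int3 _ (int3D (ih i Pi) IH)) => x; rewrite big_cons Pi.
Qed.

Lemma I3_sum (I : Type) (s : seq I) (P : pred I) (h : I -> E3 R -> R) :
  (forall i, P i -> int3 (h i)) ->
  I3 (fun x => \sum_(i <- s | P i) h i x) = \sum_(i <- s | P i) I3 (h i).
Proof.
move=> ih; elim: s => [|i s IH].
  by rewrite big_nil -[RHS]I3_0; apply: eq_I3 => x; rewrite big_nil.
rewrite big_cons; case Pi: (P i); last first.
  by rewrite -IH; apply: eq_I3 => x; rewrite big_cons Pi.
rewrite -IH -I3D //; [|exact: ih|exact: int3_sum].
by apply: eq_I3 => x; rewrite big_cons Pi.
Qed.

Lemma le_int3 u g : measurable_fun setT (u : M3 R -> R) ->
  (forall x, `|u x| <= g x) -> int3 g -> int3 u.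
Proof.
move=> mu ug ig; apply: (le_integrable measurableT _ _ ig).
  exact/measurable_EFinP.
by move=> x _ /=; rewrite lee_fin (le_trans (ug x)) // ler_norm.
Qed.

Lemma int3_abs u : int3 u -> int3 (fun x => `|u x|).
Proof. by move=> iu; exact: integrable_norm. Qed.

Lemma I3_le u w : int3 u -> int3 w -> (forall x, u x <= w x) -> I3 u <= I3 w.
Proof. by move=> iu iw uw; apply: le_Rintegral. Qed.

Lemma I3_ge0 u : (forall x, 0 <= u x) -> 0 <= I3 u.
Proof. by move=> u0; apply: Rintegral_ge0. Qed.

Lemma I3_norm u : int3 u -> `|I3 u| <= I3 (fun x => `|u x|).
Proof. by move=> iu; exact: le_normr_Rintegral. Qed.

Lemma int3_box (p : E3 R) r : 0 < r -> int3 (\1_(box p r)).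
Proof.
move=> r0; have mb := @measurable_box R p r; apply/integrableP; split.
  by apply/measurable_EFinP; exact: measurable_indic.
rewrite (eq_integral (fun x => (\1_(box p r) x)%:E)); last first.
  by move=> t _; rewrite gee0_abs // lee_fin.
by rewrite integral_indic // setIT leb3_box // ltry.
Qed.

Lemma I3_box (p : E3 R) r : 0 < r -> I3 (\1_(box p r)) = 8 * r ^+ 3.
Proof.
move=> r0; rewrite /I3 /Rintegral integral_indic //; last exact: measurable_box.
by rewrite setIT leb3_box.
Qed.

Lemma int3_bounded u p r M : 0 < r -> measurable_fun setT (u : M3 R -> R) ->
  (forall x, box p r x -> `|u x| <= M) -> (forall x, ~ box p r x -> u x = 0) -> int3 u.
Proof.
move=> r0 mu uM u0; apply: (@le_int3 _ (fun x => M * \1_(box p r) x)) => //.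
  move=> x; rewrite indicE; have [xb|xb] := pselect (box p r x).
    by rewrite mem_set // mulr1; exact: uM.
  by rewrite memNset // mulr0 u0 // normr0.
by apply: int3Z; exact: int3_box.
Qed.

Lemma I3_bounded u p r M : 0 < r -> int3 u ->
  (forall x, box p r x -> `|u x| <= M) -> (forall x, ~ box p r x -> u x = 0) ->
  `|I3 u| <= M * (8 * r ^+ 3).
Proof.
move=> r0 iu uM u0; apply: (le_trans (I3_norm iu)).
rewrite -(I3_box p r0) -I3Z; last exact: int3_box.
apply: I3_le; [exact: int3_abs|by apply: int3Z; exact: int3_box|].
move=> x; rewrite indicE; have [xb|xb] := pselect (box p r x).
  by rewrite mem_set // mulr1; exact: uM.
by rewrite memNset // mulr0 u0 // normr0.
Qed.

Lemma continuous_bounded_on (A : set (E3 R)) u : compact A ->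
  (forall x, A x -> {for x, continuous u}) -> exists M : R, forall x, A x -> `|u x| <= M.
Proof.
move=> cA cu.
have rad (x : E3 R) : exists d, A x -> 0 < d /\ forall y, enorm (y - x) < d -> `|u y| <= `|u x| + 1.
  have [Ax|nAx] := pselect (A x); last by exists 0.
  have /continuousE3/(_ 1 ltr01)[d d0 h] := cu x Ax.
  exists d => _; split=> // y /h yx; have := lerB_normD (u y) (- u x) ; rewrite normrN; lra.
pose d x := sval (cid (rad x)).
have dP x : A x -> 0 < d x /\ forall y, enorm (y - x) < d x -> `|u y| <= `|u x| + 1.
  by rewrite /d; case: cid.
have [s [sA sc]] := @compact_eball_cover _ A d cA (fun x Ax => (dP x Ax).1).
exists (\sum_(p <- s) (`|u p| + 1)) => x /sc [p ps xp].
apply: (le_trans ((dP p (sA p ps)).2 _ xp)).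
rewrite (big_rem p) //= lerDl sumr_ge0 // => i _; exact: addr_ge0.
Qed.

Lemma compact_cball (p : E3 R) r : compact [set x | enorm (x - p) <= r].
Proof.
apply: (@closed_bounded_compactE3 _ _ (r + enorm p)).
  rewrite (_ : [set x | _] = ~` [set x : E3 R | r < enorm (x - p)]); last first.
    by apply/seteqP; split=> x /=; [move=> h; apply/negP; rewrite -leNgt|move/negP; rewrite -leNgt].
  apply: open_closedC; apply/openE3 => x /= xr.
  exists (enorm (x - p) - r); first by rewrite subr_gt0.
  by move=> y /=; rewrite /eball /= => yx; have := enormDB x y p; rewrite (enormB x y); lra.
by move=> x /= xr; have := enormD (x - p) p; rewrite subrK; lra.
Qed.

Lemma int3_continuous u p r : continuous u ->
  (forall x, r < enorm (x - p) -> u x = 0) -> int3 u.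
Proof.
move=> cu u0.
have [M hM] := @continuous_bounded_on _ u (@compact_cball p (2 * (`|r| + 1))) (fun x _ => cu x).
apply: (@int3_bounded _ p (`|r| + 1) M) => //; first exact: continuous_measurable3.
  by move=> x /box_enorm xp; exact: hM.
move=> x xb; apply: u0; rewrite ltNge; apply/negP => xr; apply: xb.
by apply: eball_sub_box; rewrite /eball /=; have := ler_norm r; lra.
Qed.

Lemma integral_derivative_compact_support (f F : R -> R) (b : R) : 0 < b ->
  (forall t : R, is_derive t 1 F (f t)) -> continuous f ->
  (forall t : R, b <= `|t| -> F t = 0 /\ f t = 0) ->
  (\int[@lebesgue_measure R]_t (f t)%:E = 0)%E.
Proof.
move=> b0 dF cf Z.
have -> : (\int[@lebesgue_measure R]_t (f t)%:E =
           \int[@lebesgue_measure R]_(t in `[(- b)%R, b]) (f t)%:E)%E.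
  rewrite [RHS]integral_mkcond; apply: eq_integral => t _.
  rewrite patchE; case: ifPn => //; rewrite notin_setE /= in_itv /= -ler_norml => /negP.
  by rewrite -ltNge => /ltW /Z [_ ->].
have cF : continuous F.
  by move=> t; apply: differentiable_continuous; apply/derivable1_diffP; exact: ex_derive.
rewrite (@continuous_FTC2 _ f F).
- by have [-> _] := Z b (ler_norm b); have [|-> _] := Z (- b); rewrite ?normrN ?ler_norm // subee.
- by lra.
- exact: continuous_subspaceT.
- split.
  + by move=> t _; exact: ex_derive.
  + exact: cvg_at_right_filter (cF _).
  + exact: cvg_at_left_filter (cF _).
- by move=> t _; rewrite derive1E derive_val.
Qed.

End integral_R3.

(** * Differentiation and Green's identity *)

Section directional_derivatives.
Context {R : realType}.

Lemma is_deriveP (V : normedModType R) (u : V -> R) (x v : V) (d : R) :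
  is_derive x v u d <->
  forall e : R, 0 < e -> exists2 r : R, 0 < r &
    forall h : R, `|h| < r -> `|u (x + h *: v) - u x - h * d| <= e * `|h|.
Proof.
split=> [du e e0|H].
  have := @ex_derive _ _ _ _ _ _ _ du; rewrite /derivable => /cvg_ex[l hl].
  have ld : l = d by have := derive_val (is_derive := du) ; rewrite /derive (cvg_lim _ hl).
  move/cvgrPdist_le : hl => /(_ e e0); rewrite near_withinE => /nbhs_ballP[r /= r0 H].
  exists r => // h hr; have [->|h0] := eqVneq h 0.
    by rewrite scale0r addr0 subrr mul0r subr0 normr0 mulr0.
  have := H h; rewrite -ball_normE /= sub0r normrN => /(_ hr h0).
  have nh : 0 < `|h| by rewrite normr_gt0.
  rewrite -(ler_pM2r nh) -normrM ld distrC.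
  by rewrite mulrBl /GRing.scale /= mulrAC mulVf // mul1r [x + _]addrC (mulrC d).
have hl : (fun h => h^-1 *: ((u \o shift x) (h *: v) - u x)) @ 0^' --> d.
  apply/cvgrPdist_le => e /H [r r0 hr]; rewrite near_withinE.
  apply/nbhs_ballP; exists r => //= h; rewrite -ball_normE /= sub0r normrN => hh h0.
  have nh : 0 < `|h| by rewrite normr_gt0.
  rewrite distrC -(ler_pM2r nh) -normrM.
  rewrite mulrBl /GRing.scale /= mulrAC mulVf // mul1r [h *: v + _]addrC (mulrC d).
  exact: hr.
split; first by apply/cvg_ex; exists d.
by rewrite /derive; apply: cvg_lim.
Qed.

Lemma eq_near_is_derive (V : normedModType R) (u w : V -> R) (x v : V) (d r : R) :
  0 < r -> (forall h : R, `|h| < r -> u (x + h *: v) = w (x + h *: v)) ->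
  is_derive x v u d -> is_derive x v w d.
Proof.
move=> r0 uw /is_deriveP H; apply/is_deriveP => e /H[s s0 hs].
exists (Num.min r s); first by rewrite lt_min r0.
move=> h; rewrite lt_min => /andP[hr /hs]; rewrite uw //.
by have := uw 0; rewrite normr0 scale0r addr0 => ->.
Qed.

Lemma is_derive_unique (V : normedModType R) (u : V -> R) (x v : V) (d d' : R) :
  is_derive x v u d -> is_derive x v u d' -> d = d'.
Proof. by move=> h1 h2; rewrite -(derive_val (is_derive := h1)) (derive_val (is_derive := h2)). Qed.

Lemma is_derive_eqf (V : normedModType R) (u : V -> R) (x v : V) (a b : R) :
  is_derive x v u a -> a = b -> is_derive x v u b.
Proof. by move=> ? <-. Qed.

Lemma is_deriveDf (V : normedModType R) (u w : V -> R) (x v : V) (a b : R) :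
  is_derive x v u a -> is_derive x v w b -> is_derive x v (fun y => u y + w y) (a + b).
Proof. by move=> A B; exact: is_deriveD. Qed.

Lemma is_deriveMf (V : normedModType R) (u w : V -> R) (x v : V) (a b : R) :
  is_derive x v u a -> is_derive x v w b ->
  is_derive x v (fun y => u y * w y) (u x * b + w x * a).
Proof. by move=> A B; exact: is_deriveM. Qed.

Lemma is_deriveXf (V : normedModType R) (u : V -> R) (x v : V) (d : R) n :
  is_derive x v u d -> is_derive x v (fun y => u y ^+ n) (n%:R * u x ^+ n.-1 * d).
Proof.
move=> D; elim: n => [|n IH].
  by rewrite !mul0r; exact: (is_derive_cst (1 : R)).
have := is_deriveMf D IH.
rewrite (_ : (fun y => u y * u y ^+ n) = (fun y => u y ^+ n.+1)); last first.
  by apply/funext => y; rewrite exprS.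
move=> H; apply: (is_derive_eqf H); case: n {IH H} => [|n] /=; first by rewrite !expr0; ring.
rewrite exprS -(natr1 n.+1); ring.
Qed.

Lemma is_deriveVf (V : normedModType R) (u : V -> R) (x v : V) (d : R) : u x != 0 ->
  is_derive x v u d -> is_derive x v (fun y => (u y)^-1) (- (u x) ^- 2 * d).
Proof.
move=> ux D; have dv := @ex_derive _ _ _ _ _ _ _ D.
have H := @derivableP _ _ _ _ _ _ (derivableV ux dv).
by apply: (is_derive_eqf H); rewrite deriveV // derive_val.
Qed.

End directional_derivatives.

Section twice_differentiable.
Context {R : realType}.
Implicit Types (O : set (E3 R)) (u w v : E3 R -> R) (g h : 'I_3 -> E3 R -> R).

(** The functions at hand are total, with uncontrolled values outside the open set where they are
    harmonic. Integrals over R^3 therefore use the extension by zero. *)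
Definition ext0 O u : E3 R -> R := fun x => if x \in O then u x else 0.

Lemma ext0_in O u x : O x -> ext0 O u x = u x.
Proof. by move=> Ox; rewrite /ext0 mem_set. Qed.
Lemma ext0_out O u x : ~ O x -> ext0 O u x = 0.
Proof. by move=> Ox; rewrite /ext0 memNset. Qed.

Lemma enorm_basis3 (i : 'I_3) : enorm (basis3 i : E3 R) = 1.
Proof.
apply/eqP; rewrite -sqrp_eq1 // enorm_sqr /dot /basis3 /=; apply/eqP.
by case: i => [[|[|[|//]]]] ? /=; ring.
Qed.

Lemma enorm_basis3Z (i : 'I_3) (t : R) : enorm (t *: basis3 i : E3 R) = `|t|.
Proof. by rewrite enormZ enorm_basis3 mulr1. Qed.

Lemma eq_ball_is_derive u w (i : 'I_3) x d r : 0 < r ->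
  (forall y, enorm (y - x) < r -> u y = w y) ->
  is_derive x (basis3 i) u d -> is_derive x (basis3 i) w d.
Proof.
move=> r0 uw; apply: (@eq_near_is_derive _ _ _ _ _ _ _ r) => // t tr.
by apply: uw; rewrite addrAC subrr add0r enorm_basis3Z.
Qed.

Lemma eq_ball_continuous u w x r : 0 < r ->
  (forall y, enorm (y - x) < r -> u y = w y) ->
  {for x, continuous u} -> {for x, continuous w}.
Proof.
move=> r0 uw /continuousE3 cu; apply/continuousE3 => e /cu[d d0 hd].
exists (Num.min r d); first by rewrite lt_min r0.
move=> y; rewrite lt_min => /andP[yr /hd]; rewrite !uw //.
by rewrite subrr enorm0.
Qed.

(* [g i] and [h i] are the first and second derivatives in direction [i];
   mixed derivatives are never needed. *)
Record D2on O u g h : Prop := {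
  D2_1 : forall i x, O x -> is_derive x (basis3 i) u (g i x);
  D2_2 : forall i x, O x -> is_derive x (basis3 i) (g i) (h i x);
  D2_c0 : forall x, O x -> {for x, continuous u};
  D2_c1 : forall i x, O x -> {for x, continuous (g i)};
  D2_c2 : forall i x, O x -> {for x, continuous (h i)} }.

Lemma D2on_sub O O' u g h : O' `<=` O -> D2on O u g h -> D2on O' u g h.
Proof.
by move=> s [a b c d e]; split; intros; [apply: a|apply: b|apply: c|apply: d|apply: e]; exact: s.
Qed.

Lemma D2on_cst O c : D2on O (fun=> c) (fun _ _ => 0) (fun _ _ => 0).
Proof. by split=> *; [exact: is_derive_cst|exact: is_derive_cst|exact: cvg_cst|exact: cvg_cst|exact: cvg_cst]. Qed.

Lemma D2onD O u g h u' g' h' : D2on O u g h -> D2on O u' g' h' ->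
  D2on O (fun x => u x + u' x) (fun i x => g i x + g' i x) (fun i x => h i x + h' i x).
Proof.
move=> [a b c d e] [a' b' c' d' e']; split=> [i x Ox|i x Ox|x Ox|i x Ox|i x Ox].
- by have A := a i x Ox; have A' := a' i x Ox; exact: is_deriveD.
- by have A := b i x Ox; have A' := b' i x Ox; exact: is_deriveD.
- by apply: cvgD; [exact: c|exact: c'].
- by apply: cvgD; [exact: d|exact: d'].
- by apply: cvgD; [exact: e|exact: e'].
Qed.

Lemma D2onM O u g h u' g' h' : D2on O u g h -> D2on O u' g' h' ->
  D2on O (fun x => u x * u' x) (fun i x => u x * g' i x + u' x * g i x)
    (fun i x => u x * h' i x + u' x * h i x + 2 * (g i x * g' i x)).
Proof.
move=> [a b c d e] [a' b' c' d' e']; split=> [i x Ox|i x Ox|x Ox|i x Ox|i x Ox].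
- by have A := a i x Ox; have A' := a' i x Ox; exact: is_deriveM.
- have A := a i x Ox; have A' := a' i x Ox; have B := b i x Ox; have B' := b' i x Ox.
  have C := is_deriveDf (is_deriveMf A B') (is_deriveMf A' B).
  apply: (is_derive_eqf C).
  by rewrite /=; ring.
- by apply: cvgM; [exact: c|exact: c'].
- apply: cvgD; apply: cvgM; [exact: c|exact: d'|exact: c'|exact: d].
- apply: cvgD; [apply: cvgD; apply: cvgM|apply: cvgM; [exact: cvg_cst|apply: cvgM]];
   [exact: c|exact: e'|exact: c'|exact: e|exact: d|exact: d'].
Qed.

Lemma D2onZ O c u g h : D2on O u g h ->
  D2on O (fun x => c * u x) (fun i x => c * g i x) (fun i x => c * h i x).
Proof.
move=> [a b d e f]; split=> [i x Ox|i x Ox|x Ox|i x Ox|i x Ox].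
- by have A := a i x Ox; exact: is_deriveZ.
- by have A := b i x Ox; exact: is_deriveZ.
- by apply: cvgM; [exact: cvg_cst|exact: d].
- by apply: cvgM; [exact: cvg_cst|exact: e].
- by apply: cvgM; [exact: cvg_cst|exact: f].
Qed.

Lemma eq_D2on O u g h u' g' h' : D2on O u g h ->
  u =1 u' -> g =2 g' -> h =2 h' -> D2on O u' g' h'.
Proof.
move=> D /funext <- gg hh.
have <- : g = g' by apply/funext => i; apply/funext => x; exact: gg.
by have <- : h = h' by apply/funext => i; apply/funext => x; exact: hh.
Qed.

(** Only the derivative of u along the single vector v is assumed, not differentiability of u at x,
    so the difference quotient is estimated directly. *)
Lemma is_derive_comp1 (V : normedModType R) (f : R -> R) (u : V -> R) (x v : V) (d d' : R) :
  is_derive (u x) 1 f d -> is_derive x v u d' -> is_derive x v (f \o u) (d * d').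
Proof.
move=> /is_deriveP H1 /is_deriveP H2; apply/is_deriveP => e e0.
pose e1 : R := Num.min 1 (e / (`|d| + `|d'| + 2)).
have e10 : 0 < e1 by rewrite lt_min ltr01 divr_gt0.
have [r1 r10 h1] := H1 e1 e10.
have [r2 r20 h2] := H2 e1 e10.
exists (Num.min r2 (r1 / (`|d'| + 2))); first by rewrite lt_min r20 divr_gt0 //; have := normr_ge0 d'; lra.
move=> t; rewrite lt_min => /andP[/h2 tr2 tr1].
set a := u (x + t *: v) - u x.
have ale : `|a| <= (`|d'| + 1) * `|t|.
  have : `|a| <= `|a - t * d'| + `|t * d'| by rewrite -{1}(subrK (t * d') a) ler_normD.
  have le1 : e1 <= 1 by rewrite ge_min lexx.
  have : e1 * `|t| <= 1 * `|t| by rewrite ler_wpM2r.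
  rewrite normrM; move: tr2; rewrite -/a; have := mulrC `|t| `|d'|; lra.
have ar1 : `|a| < r1.
  apply: (le_lt_trans ale); move: tr1; rewrite ltr_pdivlMr; last by have := normr_ge0 d'; lra.
  by have := normr_ge0 t; lra.
have ua : u x + a = u (x + t *: v) by rewrite /a addrC subrK.
have := h1 a ar1; rewrite /GRing.scale /= mulr1 ua => fa.
rewrite (_ : _ - _ - _ = f (u (x + t *: v)) - f (u x) - a * d + (a - t * d') * d); last by ring.
apply: (le_trans (ler_normD _ _)); rewrite normrM.
have : `|a - t * d'| * `|d| <= e1 * `|t| * `|d| by rewrite ler_wpM2r.
have : e1 * `|a| <= e1 * ((`|d'| + 1) * `|t|) by rewrite ler_wpM2l // ltW.
have e1e : e1 * (`|d| + `|d'| + 2) <= e by rewrite -ler_pdivlMr // ge_min lexx orbT.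
have : e1 * (`|d| + `|d'| + 2) * `|t| <= e * `|t| by rewrite ler_wpM2r.
have : 0 <= e1 * `|t| by rewrite mulr_ge0 // ltW.
lra.
Qed.

Lemma D2on_comp O (f f1 f2 : R -> R) u g h :
  (forall t : R, is_derive t 1 f (f1 t)) -> (forall t : R, is_derive t 1 f1 (f2 t)) ->
  continuous f2 -> D2on O u g h ->
  D2on O (f \o u) (fun i x => f1 (u x) * g i x)
    (fun i x => f1 (u x) * h i x + f2 (u x) * g i x ^+ 2).
Proof.
move=> df df1 cf2 [a b c d e].
have cf : continuous f.
  by move=> t; apply: differentiable_continuous; apply/derivable1_diffP; exact: (@ex_derive _ _ _ _ _ _ _ (df t)).
have cf1 : continuous f1.
  by move=> t; apply: differentiable_continuous; apply/derivable1_diffP; exact: (@ex_derive _ _ _ _ _ _ _ (df1 t)).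
split=> [i x Ox|i x Ox|x Ox|i x Ox|i x Ox].
- exact: is_derive_comp1 (df _) (a i x Ox).
- have A := a i x Ox; have B := b i x Ox.
  have C := is_derive_comp1 (df1 (u x)) A.
  have E := is_deriveMf C B.
  apply: (is_derive_eqf E).
  by rewrite /=; ring.
- by apply: continuous_comp; [exact: c|exact: cf].
- by apply: cvgM; [apply: continuous_comp; [exact: c|exact: cf1]|exact: d].
- apply: cvgD; apply: cvgM; [|exact: e| |].
  + by apply: continuous_comp; [exact: c|exact: cf1].
  + by apply: continuous_comp; [exact: c|exact: cf2].
  + by rewrite expr2; apply: cvgM; exact: d.
Qed.

Lemma is_derive_zero_ball u (i : 'I_3) x d r : 0 < r ->
  (forall y, enorm (y - x) < r -> u y = 0) -> is_derive x (basis3 i) u d -> d = 0.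
Proof.
move=> r0 u0 du; apply: (is_derive_unique du).
by apply: (@eq_ball_is_derive (fun=> 0) u _ _ _ r) => // y /u0 ->.
Qed.

End twice_differentiable.

Section green_identity.
Context {R : realType}.
Implicit Types (O : set (E3 R)) (u w v F G : E3 R -> R) (g h : 'I_3 -> E3 R -> R).

(** [leb3] is a product of a product, so Fubini is applied twice. The second application needs
    integrability of the slice at a fixed third coordinate. *)
Lemma integrable_slice G (r t : R) : continuous G ->
  (forall x, r < enorm x -> G x = 0) ->
  (leb2 R).-integrable setT (fun p : M2 R => (G (p, t))%:E).
Proof.
move=> cG G0; pose b : R := `|r| + 1.
have rb : r < b by rewrite /b; have := ler_norm r; lra.
have b0 : 0 < b by rewrite ltr_wpDl.
have mG : measurable_fun setT (G : M3 R -> R) by exact: continuous_measurable3.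
have mGt : measurable_fun setT (fun p : M2 R => G (p, t)).
  by apply: (measurableT_comp mG); exact: measurable_fun_pair.
apply/integrableP; split; first exact/measurable_EFinP.
have [M hM] := @continuous_bounded_on _ _ G (@compact_cball _ 0 r) (fun x _ => cG x).
pose Q : set (M2 R) := `]- b, b[%classic `*` `]- b, b[%classic.
have mQ : measurable Q by exact: measurableX.
apply: (@le_lt_trans _ _ (\int[leb2 R]_p (`|M| * \1_Q p)%:E)%E).
  apply: ge0_le_integral => //.
  - by apply: measurableT_comp => //; exact/measurable_EFinP.
  - by apply/measurable_EFinP; apply: measurable_funM => //; exact: measurable_indic.
  move=> p _ /=; rewrite lee_fin indicE.
  have [pr|pr] := ltP r (enorm ((p, t) : E3 R)).
    by rewrite G0 // normr0 mulr_ge0.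
  have [h1 h2 _] := enorm_coord ((p, t) : E3 R).
  rewrite mem_set; last first.
    by rewrite /Q /= !in_itv /= -!ltr_norml; split; [apply: (le_lt_trans h1)|apply: (le_lt_trans h2)]; lra.
  rewrite mulr1; apply: (le_trans (hM _ _)); last exact: ler_norm.
  by rewrite /= subr0.
under eq_integral do rewrite EFinM.
rewrite ge0_integralZl //; last by apply/measurable_EFinP; exact: measurable_indic.
rewrite integral_indic // setIT.
have -> : leb2 R Q = ((2 * b) * (2 * b))%:E.
  rewrite [LHS](@product_measure1E _ _ _ _ R leb1s leb1s) //.
  rewrite [RHS]EFinM; congr (_ * _)%E;
    rewrite [LHS]lebesgue_measure_itv /= lte_fin (_ : - b < b) ?oppr_lt0 -?EFinB; 
    [by congr _%:E; ring|lra|by congr _%:E; ring|lra].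
by rewrite -EFinM ltry.
Qed.

Lemma integral_partial_zero (i : 'I_3) F G (r : R) :
  (forall x, is_derive x (basis3 i) F (G x)) -> continuous G ->
  (forall x, r < enorm x -> F x = 0) -> I3 G = 0.
Proof.
move=> dF cG F0.
pose b : R := 2 * (`|r| + 1).
have b0 : 0 < b by rewrite mulr_gt0 // ltr_wpDl.
have rb : r < b by have := ler_norm r; have := normr_ge0 r; rewrite /b; lra.
have G0 x : r < enorm x -> G x = 0.
  move=> xr; apply: (@is_derive_zero_ball _ F i x _ (enorm x - r)); rewrite ?subr_gt0 //.
  move=> y yx; apply: F0; have := enorm_sub_le y x; rewrite ler_norml; lra.
have iG : int3 G.
  by apply: (@int3_continuous _ G 0 r cG) => x; rewrite subr0; exact: G0.
have big x : b <= `|x.1.1| \/ b <= `|x.1.2| \/ b <= `|x.2| -> F x = 0 /\ G x = 0.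
  move=> bx; have [h1 h2 h3] := enorm_coord x.
  have : r < enorm x by case: bx => [|[]] ?; lra.
  by move=> rx; split; [exact: F0|exact: G0].
have slice (F' f' : R -> R) :
    (forall t : R, is_derive t 1 F' (f' t)) -> continuous f' ->
    (forall t : R, b <= `|t| -> F' t = 0 /\ f' t = 0) ->
    (\int[@lebesgue_measure R]_t (f' t)%:E = 0)%E.
  exact: integral_derivative_compact_support.
rewrite /I3 /Rintegral.
have cline (q : R -> E3 R) : (forall s t, enorm (q s - q t) <= `|s - t|) -> continuous (G \o q).
  move=> hq t; apply/(@cvgrPdist_lt _ R) => e e0.
  have /continuousE3/(_ e e0)[d d0 hd] := cG (q t).
  exists d => //= s /= st.
  by rewrite distrC; apply: hd; apply: (le_lt_trans (hq _ _)); rewrite distrC.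
have dline (q : R -> E3 R) (t : R) : (forall s, q (t + s) = q t + s *: basis3 i) ->
    is_derive t 1 (F \o q) (G (q t)).
  move=> hq; have /is_deriveP H := dF (q t); apply/is_deriveP => e /H[d d0 hd].
  by exists d => // s /hd; rewrite /GRing.scale /= mulr1 hq.
(* The order of the iterated integrals is chosen so that coordinate i is innermost; that
   one-dimensional integral is zero by the fundamental theorem of calculus. *)
case: i dF dline => [[|[|[|//]]] ilt] dF dline.
- rewrite -[X in fine X](@integral21_prod_meas1 _ _ _ _ R leb2s leb1s) //.
  rewrite integral0_eq // => t _; rewrite /fubini_G.
  pose Gt (p : M2 R) := (G (p, t))%:E.
  have iGt : (leb2 R).-integrable setT Gt by have := @integrable_slice G r t cG G0.
  have := @integral21_prod_meas1 _ _ _ _ R leb1s leb1s _ iGt.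
  rewrite /leb2s => <-; rewrite integral0_eq // => s _; rewrite /fubini_G.
  apply: (@slice (fun a => F ((a, s), t)) (fun a => G ((a, s), t))).
  + move=> a; apply: (@dline (fun a => ((a, s), t)) a) => c.
    by apply: E3ext; rewrite /= /GRing.scale /= ?mulr1 ?mulr0 ?addr0.
  + apply: (@cline (fun a => ((a, s), t))) => a c.
    by rewrite (_ : _ - _ = (a - c) *: basis3 (Ordinal ilt)) ?enorm_basis3Z //; apply: E3ext; rewrite /= /GRing.scale /= ?mulr1 ?mulr0 ?subrr.
  + by move=> a ba; apply: big; left.
- rewrite -[X in fine X](@integral21_prod_meas1 _ _ _ _ R leb2s leb1s) //.
  rewrite integral0_eq // => t _; rewrite /fubini_G.
  pose Gt (p : M2 R) := (G (p, t))%:E.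
  have iGt : (leb2 R).-integrable setT Gt by have := @integrable_slice G r t cG G0.
  have := @integral12_prod_meas1 _ _ _ _ R leb1s leb1s _ iGt.
  rewrite /leb2s => <-; rewrite integral0_eq // => s _; rewrite /fubini_F.
  apply: (@slice (fun a => F ((s, a), t)) (fun a => G ((s, a), t))).
  + move=> a; apply: (@dline (fun a => ((s, a), t)) a) => c.
    by apply: E3ext; rewrite /= /GRing.scale /= ?mulr1 ?mulr0 ?addr0.
  + apply: (@cline (fun a => ((s, a), t))) => a c.
    by rewrite (_ : _ - _ = (a - c) *: basis3 (Ordinal ilt)) ?enorm_basis3Z //; apply: E3ext; rewrite /= /GRing.scale /= ?mulr1 ?mulr0 ?subrr.
  + by move=> a ba; apply: big; right; left.
- rewrite -[X in fine X](@integral12_prod_meas1 _ _ _ _ R leb2s leb1s) //.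
  rewrite integral0_eq // => p _; rewrite /fubini_F.
  apply: (@slice (fun a => F (p, a)) (fun a => G (p, a))).
  + move=> a; apply: (@dline (fun a => (p, a)) a) => c.
    by apply: E3ext; rewrite /= /GRing.scale /= ?mulr1 ?mulr0 ?addr0.
  + apply: (@cline (fun a => (p, a))) => a c.
    by rewrite (_ : _ - _ = (a - c) *: basis3 (Ordinal ilt)) ?enorm_basis3Z //; apply: E3ext; rewrite /= /GRing.scale /= ?mulr1 ?mulr0 ?subrr.
  + by move=> a ba; apply: big; right; right.
Qed.
(* [u] vanishes on the part of [O] near every point outside [O]. *)
Definition tame O u := forall x, ~ O x ->
  exists2 r : R, 0 < r & forall y, enorm (y - x) < r -> O y -> u y = 0.

Lemma tameM O u w : tame O u -> tame O (fun x => w x * u x).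
Proof. by move=> tu x /tu[r r0 h]; exists r => // y yx Oy; rewrite h // mulr0. Qed.

Lemma tameB O u w : tame O u -> tame O w -> tame O (fun x => u x - w x).
Proof.
move=> tu tw x nx; have [r r0 h] := tu x nx; have [s s0 k] := tw x nx.
exists (Num.min r s); first by rewrite lt_min r0.
by move=> y; rewrite lt_min => /andP[yr ys] Oy; rewrite h // k // subr0.
Qed.

Lemma tame_derive O u w (i : 'I_3) : open O ->
  (forall x, O x -> is_derive x (basis3 i) u (w x)) -> tame O u -> tame O w.
Proof.
move=> /openE3 oO du tu x /tu[r r0 h]; exists r => // y yx Oy.
have [s s0 sO] := oO _ Oy.
apply: (@is_derive_zero_ball _ u i y _ (Num.min s (r - enorm (y - x)))).
- by rewrite lt_min s0 subr_gt0.
- move=> z; rewrite lt_min => /andP[zs zy]; apply: h; last exact: sO.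
  by have := enormDB z y x; lra.
- exact: du.
Qed.

Lemma ext0_is_derive O u w (i : 'I_3) : open O ->
  (forall x, O x -> is_derive x (basis3 i) u (w x)) -> tame O u ->
  forall x, is_derive x (basis3 i) (ext0 O u) (ext0 O w x).
Proof.
move=> oO du tu x; have [Ox|nx] := pselect (O x).
  have /openE3/(_ _ Ox)[r r0 rO] := oO.
  rewrite (ext0_in w Ox); apply: (@eq_ball_is_derive _ u _ _ _ _ r r0 _ (du x Ox)).
  by move=> y yx; rewrite ext0_in //; exact: rO.
have [r r0 h] := tu x nx.
rewrite (ext0_out w nx); apply: (@eq_ball_is_derive _ (fun=> 0) _ _ _ _ r r0) => //.
move=> y yx; have [Oy|ny] := pselect (O y); last by rewrite ext0_out.
by rewrite ext0_in // h.
Qed.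

Lemma ext0_continuous O u : open O ->
  (forall x, O x -> {for x, continuous u}) -> tame O u -> continuous (ext0 O u).
Proof.
move=> oO du tu x; have [Ox|nx] := pselect (O x).
  have /openE3/(_ _ Ox)[r r0 rO] := oO.
  apply: (@eq_ball_continuous _ u _ _ r r0 _ (du x Ox)).
  by move=> y yx; rewrite ext0_in //; exact: rO.
have [r r0 h] := tu x nx.
apply: (@eq_ball_continuous _ (fun=> 0) _ _ r r0); last exact: cvg_cst.
move=> y yx; have [Oy|ny] := pselect (O y); last by rewrite ext0_out.
by rewrite ext0_in // h.
Qed.

Lemma int3_ext0 O u r : open O ->
  (forall x, O x -> {for x, continuous u}) -> tame O u ->
  (forall x, r < enorm x -> u x = 0) -> int3 (ext0 O u).
Proof.
move=> oO cu tu u0; apply: (@int3_continuous _ _ 0 r); first exact: ext0_continuous.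
by move=> x; rewrite subr0 => /u0 ux; rewrite /ext0 ux; case: ifP.
Qed.

Lemma partial_integral_ext0 O u w (i : 'I_3) r : open O ->
  (forall x, O x -> is_derive x (basis3 i) u (w x)) ->
  (forall x, O x -> {for x, continuous w}) -> tame O u ->
  (forall x, r < enorm x -> u x = 0) -> I3 (ext0 O w) = 0.
Proof.
move=> oO du cw tu u0; apply: (@integral_partial_zero i (ext0 O u) _ r).
- exact: ext0_is_derive.
- by apply: ext0_continuous => //; exact: (tame_derive oO du).
- by move=> x /u0 ux; rewrite /ext0 ux; case: ifP.
Qed.

Definition lap h : E3 R -> R := fun x => \sum_(i < 3) h i x.

(** The field v grad psi - psi grad v vanishes in O near the complement of O and near infinity,
    because psi does. Its i-th component, extended by zero, has an i-th derivative of integral zero.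
    In the sum over i the products of first derivatives cancel and the Laplace equation for v
    removes the term with psi. *)
Lemma green O v gv hv psi gp hp r : open O -> D2on O v gv hv ->
  (forall x, O x -> lap hv x = 0) -> D2on O psi gp hp -> tame O psi ->
  (forall x, r < enorm x -> psi x = 0) ->
  int3 (ext0 O (fun x => v x * lap hp x)) /\ I3 (ext0 O (fun x => v x * lap hp x)) = 0.
Proof.
move=> oO [v1 v2 v3 v4 v5] hv0 [p1 p2 p3 p4 p5] tp p0.
pose F i x := v x * gp i x - psi x * gv i x.
pose G i x := v x * hp i x - psi x * hv i x.
have dF i x : O x -> is_derive x (basis3 i) (F i) (G i x).
  move=> Ox; have A := is_deriveMf (v1 i x Ox) (p2 i x Ox).
  have B := is_deriveMf (p1 i x Ox) (v2 i x Ox).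
  have := @is_deriveB _ _ _ _ _ _ _ _ _ A B; move=> C.
  by apply: (is_derive_eqf C); rewrite /G; ring.
have cG i x : O x -> {for x, continuous (G i)}.
  by move=> Ox; apply: cvgB; apply: cvgM; [exact: v3|exact: p5|exact: p3|exact: v5].
have tgp i : tame O (gp i) by exact: (tame_derive oO (p1 i)).
have tF i : tame O (F i).
  apply: tameB; first exact: tameM.
  by move=> x /tp[s s0 h]; exists s => // y ys Oy; rewrite h // mul0r.
have F0 i x : O x -> r < enorm x -> F i x = 0.
  move=> Ox rx; rewrite /F p0 // mul0r subr0.
  rewrite (_ : gp i x = 0) ?mulr0 //.
  apply: (@is_derive_zero_ball _ psi i x _ (enorm x - r)); rewrite ?subr_gt0 //; last exact: p1.
  by move=> y yx; apply: p0; have := enorm_sub_le y x; rewrite ler_norml; lra.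
pose F' i := ext0 O (F i).
have F'0 i x : r < enorm x -> F' i x = 0.
  by move=> rx; rewrite /F' /ext0; case: ifP => // /set_mem Ox; exact: F0.
have cG' i : continuous (ext0 O (G i)).
  by apply: ext0_continuous => //; [exact: cG|apply: (tame_derive oO (dF i))].
have dF' i x : is_derive x (basis3 i) (F' i) (ext0 O (G i) x) by exact: ext0_is_derive.
have G'0 i x : r < enorm (x - 0) -> ext0 O (G i) x = 0.
  rewrite subr0 => rx; apply: (@is_derive_zero_ball _ (F' i) i x _ (enorm x - r)); rewrite ?subr_gt0 //.
  by move=> y yx; apply: F'0; have := enorm_sub_le y x; rewrite ler_norml; lra.
have iG i : int3 (ext0 O (G i)) by exact: int3_continuous (cG' i) (G'0 i).
have I0 i : I3 (ext0 O (G i)) = 0 by exact: integral_partial_zero (dF' i) (cG' i) (@F'0 i).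
have E : (fun x => \sum_(i < 3) ext0 O (G i) x) =1 ext0 O (fun x => v x * lap hp x).
  move=> x; rewrite /ext0; case: ifP => [/set_mem Ox|_]; last by rewrite big1.
  rewrite /G sumrB -!mulr_sumr.
  by have := hv0 x Ox; rewrite /lap => ->; rewrite mulr0 subr0.
split; first by apply: (eq_int3 E); apply: int3_sum => i _.
rewrite -(eq_I3 E) I3_sum // big1 // => i _; exact: I0.
Qed.

End green_identity.

(** * The averaged Newton kernel and mean values *)

Section one_variable.
Context {R : realType}.
Implicit Types (a b : R -> R) (c t : R).

Definition piecewise c a b t : R := if t <= c then a t else b t.

Lemma piecewise_is_derive c a b (a' b' : R -> R) :
  (forall t : R, t <= c -> is_derive t 1 a (a' t)) ->
  (forall t : R, c <= t -> is_derive t 1 b (b' t)) ->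
  a c = b c -> a' c = b' c ->
  forall t : R, is_derive t 1 (piecewise c a b) (piecewise c a' b' t).
Proof.
move=> da db ac ac' t.
have [tc|ct|->] := ltgtP t c.
- rewrite /piecewise (ltW tc); apply: (@eq_near_is_derive _ _ a _ _ _ _ (c - t)); last exact: da (ltW tc).
    by rewrite subr_gt0.
  move=> h hr; rewrite /GRing.scale /= mulr1 ifT //.
  by have := ler_norm h; lra.
- rewrite /piecewise leNgt ct /=; apply: (@eq_near_is_derive _ _ b _ _ _ _ (t - c)); last exact: db (ltW ct).
    by rewrite subr_gt0.
  move=> h hr; rewrite /GRing.scale /= mulr1 ifF //.
  by apply/negbTE; rewrite -ltNge; have := ler_norm (- h); rewrite normrN; lra.
- have /is_deriveP A := da c (lexx _); have /is_deriveP B := db c (lexx _).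
  rewrite /piecewise lexx; apply/is_deriveP => e e0.
  have [r r0 hr] := A e e0; have [s s0 hs] := B e e0.
  exists (Num.min r s); first by rewrite lt_min r0.
  move=> h; rewrite lt_min lexx => /andP[/hr h1 /hs h2].
  by case: ifP => _ //; rewrite ac ac'.
Qed.

Lemma continuousRP (f : R -> R) t : {for t, continuous f} <->
  forall e : R, 0 < e -> exists2 r : R, 0 < r & forall s, `|s - t| < r -> `|f s - f t| < e.
Proof.
split=> [h e e0|h].
  move/cvgrPdist_lt : h => /(_ e e0)/nbhs_ballP[d /= d0 h]; exists d => // y yx.
  by rewrite distrC; apply: h; rewrite -ball_normE /= distrC.
apply/cvgrPdist_lt => e /h [d d0 hd]; apply/nbhs_ballP; exists d => // y.
by move=> ty; rewrite distrC; apply: hd; rewrite distrC.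
Qed.

Lemma piecewise_continuous c a b :
  (forall t : R, t <= c -> {for t, continuous a}) ->
  (forall t : R, c <= t -> {for t, continuous b}) -> a c = b c -> continuous (piecewise c a b).
Proof.
move=> ca cb ac t; apply/continuousRP => e e0.
have [tc|ct|->] := ltgtP t c.
- have /continuousRP/(_ e e0)[r r0 hr] := ca t (ltW tc).
  exists (Num.min r (c - t)); first by rewrite lt_min r0 subr_gt0.
  move=> s; rewrite lt_min /piecewise (ltW tc) => /andP[/hr h1 h2]; rewrite ifT //.
  by have := ler_norm (s - t); lra.
- have /continuousRP/(_ e e0)[r r0 hr] := cb t (ltW ct).
  exists (Num.min r (t - c)); first by rewrite lt_min r0 subr_gt0.
  move=> s; rewrite lt_min /piecewise [t <= c]leNgt ct /= => /andP[/hr h1 h2]; rewrite ifF //.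
  by apply/negbTE; rewrite -ltNge; have := ler_norm (- (s - t)); rewrite normrN; lra.
- have /continuousRP/(_ e e0)[r r0 hr] := ca c (lexx _).
  have /continuousRP/(_ e e0)[s s0 hs] := cb c (lexx _).
  exists (Num.min r s); first by rewrite lt_min r0.
  move=> u; rewrite lt_min /piecewise lexx => /andP[/hr h1 /hs h2].
  by case: ifP => _ //; rewrite ac.
Qed.


Lemma is_derive_shift_pow (k c t : R) n :
  is_derive t 1 (fun s => k * (s - c) ^+ n) (k * (n%:R * (t - c) ^+ n.-1)).
Proof.
have D : is_derive t 1 (fun s : R => s - c) 1.
  by have := is_deriveDf (is_derive_id t (1 : R)) (is_derive_cst (- c) t (1 : R)); rewrite addr0.
have H := is_deriveMf (is_derive_cst k t (1 : R)) (is_deriveXf n D).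
by apply: (is_derive_eqf H); rewrite mulr0 addr0 mulr1.
Qed.

Lemma is_derive_continuous (f : R -> R) (t d : R) :
  is_derive t 1 f d -> {for t, continuous f}.
Proof.
move=> D; apply: differentiable_continuous; apply/derivable1_diffP.
exact: (@ex_derive _ _ _ _ _ _ _ D).
Qed.

(** Three is the smallest exponent for which the power of the positive part is twice continuously
    differentiable. The redundant factor 1 and shift by 0 match the form of
    [is_derive_shift_pow]. *)
Definition cube_pos : R -> R := piecewise 0 (fun=> 0) (fun t => 1 * (t - 0) ^+ 3).
Definition cube_pos1 : R -> R := piecewise 0 (fun=> 0) (fun t => 3 * (t - 0) ^+ 2).
Definition cube_pos2 : R -> R := piecewise 0 (fun=> 0) (fun t => 6 * (t - 0) ^+ 1).

Lemma cube_pos_derive t : is_derive t 1 cube_pos (cube_pos1 t).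
Proof.
apply: piecewise_is_derive => [s _||]; try by rewrite subrr expr0n mulr0.
by apply: (is_derive_eqf (is_derive_shift_pow 1 0 s 3)); rewrite /= subr0; ring.
Qed.

Lemma cube_pos1_derive t : is_derive t 1 cube_pos1 (cube_pos2 t).
Proof.
apply: piecewise_is_derive => [s _||]; try by rewrite subrr expr0n mulr0.
by apply: (is_derive_eqf (is_derive_shift_pow 3 0 s 2)); rewrite /= subr0; ring.
Qed.

Lemma cube_pos2_continuous : continuous cube_pos2.
Proof.
apply: piecewise_continuous => [t _|t _|]; last by rewrite subr0 mulr0.
  exact: cvg_cst.
exact: is_derive_continuous (is_derive_shift_pow 6 0 t 1).
Qed.

Lemma cube_pos_ge0 t : 0 <= cube_pos t.
Proof.
rewrite /cube_pos /piecewise; case: ifPn => //.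
by rewrite -ltNge subr0 mul1r => /ltW t0; exact: exprn_ge0.
Qed.

Lemma cube_pos_out t : t <= 0 -> cube_pos t = 0.
Proof. by rewrite /cube_pos /piecewise => ->. Qed.

Lemma cube_pos_in t : 0 <= t -> cube_pos t = t ^+ 3.
Proof.
rewrite /cube_pos /piecewise subr0 mul1r le_eqVlt => /orP[/eqP <-|].
  by rewrite lexx expr0n.
by move=> t0; rewrite leNgt t0.
Qed.

Definition invsqrt (t : R) : R := (Num.sqrt t)^-1.

Lemma invsqrt_derive t : 0 < t -> is_derive t 1 invsqrt (- 2^-1 * invsqrt t ^+ 3).
Proof.
move=> t0; have s0 : Num.sqrt t != 0 by rewrite gt_eqF // sqrtr_gt0.
apply: (is_derive_eqf (is_deriveVf s0 (is_derive1_sqrt t0))).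
by rewrite /invsqrt; field.
Qed.

Lemma invsqrt_pow_derive k n t : 0 < t ->
  is_derive t 1 (fun s => k * invsqrt s ^+ n) (k * (n%:R * invsqrt t ^+ n.-1 * (- 2^-1 * invsqrt t ^+ 3))).
Proof.
move=> t0; have H := is_deriveMf (is_derive_cst k t (1 : R)) (is_deriveXf n (invsqrt_derive t0)).
by apply: (is_derive_eqf H); rewrite mulr0 addr0.
Qed.

(* The Taylor polynomial of order 4 of [invsqrt] at 1, continued by [invsqrt]
   itself: in the variable |x|^2 this is the Newton kernel 1/|x| regularised
   inside the unit ball. *)
Definition newton_profile : R -> R := piecewise 1
  (fun t => 1 + - 2^-1 * (t - 1) ^+ 1 + 3 / 8 * (t - 1) ^+ 2
    + - (5 / 16) * (t - 1) ^+ 3 + 35 / 128 * (t - 1) ^+ 4)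
  (fun t => 1 * invsqrt t ^+ 1).
Definition newton_profile1 : R -> R := piecewise 1
  (fun t => - 2^-1 + 3 / 4 * (t - 1) ^+ 1
    + - (15 / 16) * (t - 1) ^+ 2 + 35 / 32 * (t - 1) ^+ 3)
  (fun t => - 2^-1 * invsqrt t ^+ 3).
Definition newton_profile2 : R -> R := piecewise 1
  (fun t => 3 / 4 + - (15 / 8) * (t - 1) ^+ 1 + 105 / 32 * (t - 1) ^+ 2)
  (fun t => 3 / 4 * invsqrt t ^+ 5).

Lemma invsqrt1 : invsqrt 1 = 1.
Proof. by rewrite /invsqrt sqrtr1 invr1. Qed.

Lemma newton_profile_derive t : is_derive t 1 newton_profile (newton_profile1 t).
Proof.
apply: piecewise_is_derive => [s _|s s1||]; rewrite ?subrr ?expr0n ?invsqrt1 ?expr1n /=; try by ring.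
- have H := is_deriveDf (is_deriveDf (is_deriveDf (is_deriveDf (is_derive_cst (1 : R) s (1 : R))
    (is_derive_shift_pow (- 2^-1) 1 s 1)) (is_derive_shift_pow (3 / 8) 1 s 2))
    (is_derive_shift_pow (- (5 / 16)) 1 s 3)) (is_derive_shift_pow (35 / 128) 1 s 4).
  by apply: (is_derive_eqf H) => /=; field.
- by apply: (is_derive_eqf (invsqrt_pow_derive 1 1 (lt_le_trans ltr01 s1))) => /=; ring.
Qed.

Lemma newton_profile1_derive t : is_derive t 1 newton_profile1 (newton_profile2 t).
Proof.
apply: piecewise_is_derive => [s _|s s1||]; rewrite ?subrr ?expr0n ?invsqrt1 ?expr1n /=; try by ring.
- have H := is_deriveDf (is_deriveDf (is_deriveDf (is_derive_cst (- 2^-1 : R) s (1 : R))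
    (is_derive_shift_pow (3 / 4) 1 s 1)) (is_derive_shift_pow (- (15 / 16)) 1 s 2))
    (is_derive_shift_pow (35 / 32) 1 s 3).
  by apply: (is_derive_eqf H) => /=; field.
- by apply: (is_derive_eqf (invsqrt_pow_derive (- 2^-1) 3 (lt_le_trans ltr01 s1))) => /=; field.
Qed.

Lemma newton_profile2_continuous : continuous newton_profile2.
Proof.
apply: piecewise_continuous => [s _|s s1|]; last by rewrite ?subrr ?expr0n ?invsqrt1 ?expr1n /=; ring.
- have H := is_deriveDf (is_deriveDf (is_derive_cst (3 / 4 : R) s (1 : R))
    (is_derive_shift_pow (- (15 / 8)) 1 s 1)) (is_derive_shift_pow (105 / 32) 1 s 2).
  exact: is_derive_continuous H.
- exact: is_derive_continuous (invsqrt_pow_derive (3 / 4) 5 (lt_le_trans ltr01 s1)).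
Qed.

(** The left side is the Laplacian of F(|x|^2) in R^3 at t = |x|^2. For t > 1 it vanishes since
    1/|x| is harmonic. For t <= 1 it is a polynomial of degree 3 in t, and the Taylor polynomial of
    order 4 makes it vanish to third order at t = 1; so it is a multiple of (1 - t)^3. *)
Lemma newton_profile_laplace t : 0 <= t ->
  6 * newton_profile1 t + 4 * t * newton_profile2 t = - (315 / 16) * cube_pos (1 - t).
Proof.
move=> t0; rewrite /newton_profile1 /newton_profile2 /piecewise.
case: ifPn => [t1|]; first by rewrite cube_pos_in ?subr_ge0 //; field.
rewrite -ltNge => t1; rewrite cube_pos_out ?subr_le0 ?(ltW t1) // mulr0.
have E : t * invsqrt t ^+ 2 = 1.
  by rewrite /invsqrt exprVn sqr_sqrtr // mulfV // gt_eqF // (lt_trans ltr01 t1).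
rewrite (_ : 4 * t * _ = 3 * (t * invsqrt t ^+ 2) * invsqrt t ^+ 3); last by field.
by rewrite E; field.
Qed.

End one_variable.

Section kernels.
Context {R : realType}.
Implicit Types (x y p a : E3 R) (r : R) (i : 'I_3).

Definition co i x : R := dot x (basis3 i).

Lemma coB i x y : co i (x - y) = co i x - co i y.
Proof. exact: dotBl. Qed.

Lemma sum3 (F : 'I_3 -> R) :
  \sum_(i < 3) F i = F ord0 + F ax1 + F ax2.
Proof. by rewrite !big_ord_recl big_ord0 addr0 addrA. Qed.

Lemma sum_co_sqr x : \sum_(i < 3) co i x ^+ 2 = dot x x.
Proof. by rewrite sum3 /co /dot /basis3 /=; ring. Qed.

Lemma sum_co_dot x y : \sum_(i < 3) co i x * co i y = dot x y.
Proof. by rewrite sum3 /co /dot /basis3 /=; ring. Qed.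

Lemma co_le i x : `|co i x| <= enorm x.
Proof. by have := dot_le x (basis3 i); rewrite enorm_basis3 mulr1. Qed.

Lemma co_basis3 i : co i (basis3 i) = 1 :> R.
Proof. by have := enorm_sqr (basis3 i : E3 R); rewrite enorm_basis3 expr1n => ->. Qed.

Lemma is_derive_dot a x v : is_derive x v (dot a) (dot a v).
Proof.
apply/is_deriveP => e e0; exists 1 => // h _.
have -> : dot a (x + h *: v) - dot a x - h * dot a v = 0 by rewrite dotDr dotZr; ring.
by rewrite normr0 mulr_ge0 // ltW.
Qed.

Lemma continuous_dot a : continuous (dot a).
Proof.
apply: (@lipschitz_continuousE3 _ _ (enorm a)) => x y.
by rewrite -dotBr; exact: dot_le.
Qed.

Definition sqd p x : R := dot (x - p) (x - p).

Lemma sqdC p x : sqd p x = sqd x p.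
Proof. by rewrite /sqd -opprB dotNl dotNr opprK. Qed.

Lemma sqd_enorm p x : sqd p x = enorm (x - p) ^+ 2.
Proof. by rewrite enorm_sqr. Qed.

Lemma sqd_ge0 p x : 0 <= sqd p x. Proof. exact: dot_ge0. Qed.

Lemma sqd_D2on O p : D2on O (sqd p) (fun i x => 2 * co i (x - p)) (fun _ _ => 2).
Proof.
have D i x : is_derive x (basis3 i) (sqd p) (2 * co i (x - p)).
  apply/is_deriveP => e e0; exists e => // h he.
  have -> : sqd p (x + h *: basis3 i) - sqd p x - h * (2 * co i (x - p)) = h ^+ 2.
    have -> : sqd p (x + h *: basis3 i) =
        sqd p x + 2 * h * co i (x - p) + h ^+ 2 * co i (basis3 i).
      rewrite /sqd /co (_ : x + h *: basis3 i - p = x - p + h *: basis3 i); last by rewrite addrAC.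
      by move: (x - p) => y; rewrite !(dotDl, dotDr, dotZl, dotZr) (dotC (basis3 i) y); ring.
    by rewrite co_basis3; ring.
  by rewrite expr2 normrM ler_wpM2r // ltW.
have cc i : continuous (fun x => 2 * co i (x - p)).
  apply: (@lipschitz_continuousE3 _ _ 2) => x y.
  rewrite -mulrBr normrM (ger0_norm (ler0n _ 2)) -coB opprB addrA subrK.
  by rewrite ler_wpM2l // co_le.
split => //.
- move=> i x _.
  have := is_deriveDf (is_derive_cst (- (2 * co i p)) x (basis3 i))
     (is_deriveMf (is_derive_cst (2 : R) x (basis3 i)) (is_derive_dot (basis3 i) x (basis3 i))).
  rewrite (_ : (fun y => _ + _ * _) = (fun y => 2 * co i (y - p))); last first.
    by apply/funext => y /=; rewrite coB /co (dotC y); ring.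
  move=> H; apply: (is_derive_eqf H).
  by have := co_basis3 i; rewrite /co => ->; rewrite mulr0 add0r addr0 mulr1.
- move=> x _; apply/continuousE3 => e e0.
  have k0 : 0 < 2 * enorm (x - p) + 1 by rewrite ltr_wpDl ?mulr_ge0.
  exists (Num.min 1 (e / (2 * enorm (x - p) + 1))); first by rewrite lt_min ltr01 divr_gt0.
  move=> y; rewrite lt_min => /andP[y1]; rewrite ltr_pdivlMr // => ye.
  apply: le_lt_trans ye; rewrite !sqd_enorm subr_sqr normrM.
  have := enorm_sub_le (y - p) (x - p); rewrite opprB addrA subrK => h.
  apply: ler_pM => //; rewrite ger0_norm ?addr_ge0 //.
  by move: h; rewrite ler_norml; lra.
- by move=> i x _; exact: cc.
- by move=> *; exact: cvg_cst.
Qed.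

Definition newt r p x : R := r^-1 * newton_profile (r ^- 2 * sqd p x).
Definition newt1 r p i x : R :=
  r^-1 * (newton_profile1 (r ^- 2 * sqd p x) * (r ^- 2 * (2 * co i (x - p)))).
Definition newt2 r p i x : R :=
  r^-1 * (newton_profile1 (r ^- 2 * sqd p x) * (r ^- 2 * 2) +
    newton_profile2 (r ^- 2 * sqd p x) * (r ^- 2 * (2 * co i (x - p))) ^+ 2).

Lemma newt_D2on O r p : D2on O (newt r p) (newt1 r p) (newt2 r p).
Proof.
apply: D2onZ; apply: (D2on_comp newton_profile_derive newton_profile1_derive newton_profile2_continuous).
by apply: D2onZ; exact: sqd_D2on.
Qed.

(** The factor of [newton_profile_laplace]. With it minus the Laplacian of [newt] is exactly [bump],
    at the price that [bump] has total mass [mass] instead of 1. *)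
Definition bump_const : R := 315 / 16.
Lemma bump_const_gt0 : 0 < bump_const. Proof. by rewrite /bump_const; lra. Qed.

Definition bump_arg r p x : R := 1 + - r ^- 2 * sqd p x.
Definition bump_coef r : R := bump_const * r ^- 3.
Definition bump r p x : R := bump_coef r * cube_pos (bump_arg r p x).
Definition bump1 r p i x : R :=
  bump_coef r * (cube_pos1 (bump_arg r p x) * (0 + - r ^- 2 * (2 * co i (x - p)))).
Definition bump2 r p i x : R :=
  bump_coef r * (cube_pos1 (bump_arg r p x) * (0 + - r ^- 2 * 2) +
    cube_pos2 (bump_arg r p x) * (0 + - r ^- 2 * (2 * co i (x - p))) ^+ 2).

Lemma bump_D2on O r p : D2on O (bump r p) (bump1 r p) (bump2 r p).
Proof.
apply: D2onZ; apply: (D2on_comp cube_pos_derive cube_pos1_derive cube_pos2_continuous).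
by apply: D2onD; [exact: D2on_cst|apply: D2onZ; exact: sqd_D2on].
Qed.

Lemma lap_newt r p x : 0 < r -> lap (newt2 r p) x = - bump r p x.
Proof.
move=> r0; rewrite /lap /newt2 /bump /bump_coef /bump_arg.
have s0 : 0 <= r ^- 2 * sqd p x by rewrite mulr_ge0 ?sqd_ge0 // invr_ge0 exprn_ge0 // ltW.
have := newton_profile_laplace s0; set s := _ * sqd p x.
rewrite -!mulr_sumr big_split /= sumr_const card_ord -mulr_sumr.
under eq_bigr do rewrite exprMn (exprMn 2).
rewrite -!mulr_sumr sum_co_sqr -/(sqd p x) => E.
rewrite (_ : _ + _ = r ^- 2 * (6 * newton_profile1 s + 4 * s * newton_profile2 s)).
  rewrite E (_ : 1 + _ = 1 - s) /bump_const; last by rewrite /s mulNr.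
  by field; exact: lt0r_neq0.
by rewrite -mulr_natr /s; field; exact: lt0r_neq0.
Qed.

Lemma bump_ge0 r p x : 0 < r -> 0 <= bump r p x.
Proof.
move=> r0; rewrite mulr_ge0 ?cube_pos_ge0 // mulr_ge0 ?(ltW bump_const_gt0) //.
by rewrite invr_ge0 exprn_ge0 // ltW.
Qed.

Lemma bump_arg_le0 r p x : 0 < r -> r <= enorm (x - p) -> bump_arg r p x <= 0.
Proof.
move=> r0 rx; rewrite /bump_arg mulNr subr_le0 mulrC ler_pdivlMr ?exprn_gt0 // mul1r.
by rewrite sqd_enorm lerXn2r // nnegrE // ltW.
Qed.

Lemma bump_arg_le1 r p x : bump_arg r p x <= 1.
Proof.
by rewrite /bump_arg mulNr gerDl oppr_le0 mulr_ge0 ?sqd_ge0 // invr_ge0 sqr_ge0.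
Qed.

Lemma bump_out r p x : 0 < r -> r <= enorm (x - p) -> bump r p x = 0.
Proof. by move=> r0 rx; rewrite /bump cube_pos_out ?mulr0 ?bump_arg_le0. Qed.

Lemma bump1_out r p i x : 0 < r -> r <= enorm (x - p) -> bump1 r p i x = 0.
Proof.
by move=> r0 rx; rewrite /bump1 /cube_pos1 /piecewise ifT ?mul0r ?mulr0 // bump_arg_le0.
Qed.

Lemma cube_pos1_le (t : R) : t <= 1 -> `|cube_pos1 t| <= 3.
Proof.
rewrite /cube_pos1 /piecewise; case: ifPn => [_ _|]; first by rewrite normr0.
rewrite -ltNge subr0 => t0 t1; have h : t ^+ 2 <= 1 by apply: exprn_ile1 => //; exact: ltW.
by have h' := sqr_ge0 t; rewrite ger0_norm; lra.
Qed.

Lemma cube_pos2_le (t : R) : t <= 1 -> `|cube_pos2 t| <= 6.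
Proof.
rewrite /cube_pos2 /piecewise; case: ifPn => [_ _|]; first by rewrite normr0.
by rewrite -ltNge subr0 expr1 => t0 t1; rewrite ger0_norm; lra.
Qed.

Lemma bumpC r p x : bump r p x = bump r x p.
Proof. by rewrite /bump /bump_arg sqdC. Qed.

Lemma bump1C r p i x : bump1 r p i x = - bump1 r x i p.
Proof. by rewrite /bump1 /bump_arg sqdC -opprB /co dotNl; ring. Qed.

Lemma bump_coef_gt0 r : 0 < r -> 0 < bump_coef r.
Proof. by move=> r0; rewrite mulr_gt0 ?bump_const_gt0 // invr_gt0 exprn_gt0. Qed.

Lemma bump_le r p x : 0 < r -> bump r p x <= bump_coef r.
Proof.
move=> r0; rewrite /bump ger_pMr ?bump_coef_gt0 //.
have [h|h] := leP (bump_arg r p x) 0; first by rewrite cube_pos_out.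
by rewrite cube_pos_in ?(ltW h) // exprn_ile1 ?(ltW h) // bump_arg_le1.
Qed.

Lemma bump1_le r p i x : 0 < r -> `|bump1 r p i x| <= 6 * bump_coef r / r.
Proof.
move=> r0; have c0 := bump_coef_gt0 r0.
have [rx|xr] := leP r (enorm (x - p)).
  rewrite bump1_out // normr0; exact: divr_ge0 (mulr_ge0 (ler0n _ 6) (ltW c0)) (ltW r0).
rewrite /bump1 normrM (gtr0_norm c0) add0r.
rewrite (_ : 6 * bump_coef r / r = bump_coef r * (6 / r)); last by ring.
rewrite ler_wpM2l ?(ltW c0) //.
rewrite normrM mulNr normrN !normrM (ger0_norm (ler0n _ 2)) (@ger0_norm _ (r ^- 2)) ?invr_ge0 ?sqr_ge0 //.
have h1 := cube_pos1_le (bump_arg_le1 r p x).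
have h2 : r ^- 2 * (2 * `|co i (x - p)|) <= 2 / r.
  rewrite mulrC ler_pdivrMr ?exprn_gt0 // (_ : 2 / r * _ = 2 * r); last by field; exact: lt0r_neq0.
  by rewrite ler_wpM2l //; apply: (le_trans (co_le _ _)); exact: ltW.
rewrite (_ : 6 / r = 3 * (2 / r)); last by field; exact: lt0r_neq0.
by apply: ler_pM => //; rewrite !mulr_ge0 // invr_ge0 sqr_ge0.
Qed.

Lemma bump2_le r p i x : 0 < r -> `|bump2 r p i x| <= 30 * bump_coef r / r ^+ 2.
Proof.
move=> r0; have c0 := bump_coef_gt0 r0.
have r2 : 0 < r ^+ 2 by rewrite exprn_gt0.
have [rx|xr] := leP r (enorm (x - p)).
  rewrite /bump2 /cube_pos1 /cube_pos2 /piecewise !ifT ?bump_arg_le0 // !mul0r addr0 mulr0 normr0.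
  exact: divr_ge0 (mulr_ge0 (ler0n _ 30) (ltW c0)) (ltW r2).
rewrite /bump2 normrM (gtr0_norm c0) !add0r.
rewrite (_ : 30 * bump_coef r / r ^+ 2 = bump_coef r * (30 / r ^+ 2)); last by ring.
rewrite ler_wpM2l ?(ltW c0) //.
have b1 := bump_arg_le1 r p x.
have h1 := cube_pos1_le b1.
have h2 := cube_pos2_le b1.
have h3 : `|(- r ^- 2 * (2 * co i (x - p))) ^+ 2| <= 4 / r ^+ 2.
  rewrite ger0_norm ?sqr_ge0 // (_ : (- r ^- 2 * (2 * co i (x - p))) ^+ 2 = 4 * (co i (x - p)) ^+ 2 / r ^+ 2 / r ^+ 2); last by field; exact: lt0r_neq0.
  apply: ler_wpM2r; first by rewrite invr_ge0 ltW.
  rewrite ler_pdivrMr // ler_wpM2l //.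
  rewrite -(real_normK (num_real (co i _))) lerXn2r // ?nnegrE ?(ltW r0) //.
  by apply: (le_trans (co_le _ _)); exact: ltW.
rewrite (_ : 30 / r ^+ 2 = 3 * (r ^- 2 * 2) + 6 * (4 / r ^+ 2)); last by field; exact: lt0r_neq0.
have h4 : `|- r ^- 2 * 2| = r ^- 2 * 2.
  by rewrite mulNr normrN ger0_norm // mulr_ge0 // invr_ge0 ltW.
apply: (le_trans (ler_normD _ _)).
rewrite (normrM (cube_pos1 _)) (normrM (cube_pos2 _)) h4; apply: lerD; apply: ler_pM => //.
by rewrite mulr_ge0 // invr_ge0 ltW.
Qed.

End kernels.

Section mean_value.
Context {R : realType}.
Implicit Types (x y p : E3 R) (r s t : R) (i : 'I_3) (O : set (E3 R)) (u v h : E3 R -> R).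

Lemma newt_far r p x : 0 < r -> r <= enorm (x - p) -> newt r p x = (enorm (x - p))^-1.
Proof.
move=> r0 rx; rewrite /newt /newton_profile /piecewise sqd_enorm.
have n0 : 0 < enorm (x - p) by exact: lt_le_trans r0 rx.
have E : r ^- 2 * enorm (x - p) ^+ 2 = (enorm (x - p) / r) ^+ 2 by rewrite expr_div_n mulrC.
have h1 : 1 <= enorm (x - p) / r by rewrite ler_pdivlMr // mul1r.
have F : r^-1 * (1 * invsqrt (r ^- 2 * enorm (x - p) ^+ 2) ^+ 1) = (enorm (x - p))^-1.
  rewrite E /invsqrt sqrtr_sqr ger0_norm ?(le_trans ler01) // mul1r expr1.
  by field; rewrite !lt0r_neq0.
case: ifPn => // h2; rewrite -F /invsqrt.
have -> : r ^- 2 * enorm (x - p) ^+ 2 = 1.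
  by apply/eqP; rewrite eq_le h2 E exprn_ege1.
by rewrite subrr sqrtr1 invr1; congr (_ * _); field.
Qed.

Lemma newt1_far r p i x : 0 < r -> r <= enorm (x - p) ->
  newt1 r p i x = - (co i (x - p) / enorm (x - p) ^+ 3).
Proof.
move=> r0 rx; rewrite /newt1 /newton_profile1 /piecewise sqd_enorm.
have n0 : 0 < enorm (x - p) by exact: lt_le_trans r0 rx.
have E : r ^- 2 * enorm (x - p) ^+ 2 = (enorm (x - p) / r) ^+ 2 by rewrite expr_div_n mulrC.
have h1 : 1 <= enorm (x - p) / r by rewrite ler_pdivlMr // mul1r.
set V := (X in r^-1 * (X * _)).
have -> : V = - 2^-1 * invsqrt (r ^- 2 * enorm (x - p) ^+ 2) ^+ 3.
  rewrite /V; case: ifPn => // h2.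
  have -> : r ^- 2 * enorm (x - p) ^+ 2 = 1.
    by apply/eqP; rewrite eq_le h2 E exprn_ege1.
  by rewrite invsqrt1 subrr !expr0n /= !mulr0 !addr0 expr1n mulr1.
rewrite E /invsqrt sqrtr_sqr ger0_norm ?(le_trans ler01) //.
by field; rewrite !lt0r_neq0.
Qed.

Lemma taylor2 (F F1 F2 : R -> R) (K t : R) :
  (forall s : R, is_derive s 1 F (F1 s)) -> (forall s : R, is_derive s 1 F1 (F2 s)) ->
  (forall s, `|F2 s| <= K) -> `|F t - F 0 - t * F1 0| <= K * t ^+ 2.
Proof.
move=> d1 d2 FK.
have mvt (G G1 : R -> R) (a b : R) : (forall s : R, is_derive s 1 G (G1 s)) ->
    exists2 c, `|c - a| <= `|b - a| & G b - G a = G1 c * (b - a).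
  move=> dG; have cG (z : R) : {for z, continuous G} by exact: is_derive_continuous (dG z).
  have [ab|ba|<-] := ltgtP a b; last by exists a; rewrite ?subrr ?mulr0.
    have [c] := MVT ab (fun z _ => dG z) (continuous_subspaceT cG).
    by rewrite in_itv /= => /andP[ac cb] ->; exists c => //; rewrite !ger0_norm; lra.
  have [c] := MVT ba (fun z _ => dG z) (continuous_subspaceT cG).
  rewrite in_itv /= => /andP[ac cb] E; exists c; first by rewrite !ler0_norm; lra.
  by rewrite -opprB E; ring.
have [c hc E] := mvt F F1 0 t d1; have [d hd E'] := mvt F1 F2 0 c d2.
rewrite !subr0 in hc E E' hd *.
rewrite E (_ : _ - _ = (F1 c - F1 0) * t); last by ring.
rewrite E' !normrM -(real_normK (num_real t)) expr2 mulrA.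
rewrite ler_wpM2r //; apply: ler_pM => //.
Qed.

Lemma is_derive_line (V : normedModType R) (f : V -> R) (x v : V) (s d : R) :
  is_derive (x + s *: v) v f d -> is_derive s 1 (fun z : R => f (x + z *: v)) d.
Proof.
move=> /is_deriveP H; apply/is_deriveP => e /H[e' e'0 he']; exists e' => // h /he'.
rewrite (_ : x + (s + h *: 1) *: v = x + s *: v + h *: v) //.
by rewrite -addrA -scalerDl; congr (_ + _ *: _); rewrite /GRing.scale /= mulr1.
Qed.

Lemma bump_taylor r i p x t : 0 < r ->
  `|bump r (p + t *: basis3 i) x - bump r p x - t * bump1 r x i p|
     <= 30 * bump_coef r / r ^+ 2 * t ^+ 2.
Proof.
move=> r0; have [d1 d2 _ _ _] := bump_D2on setT r x.
rewrite !(bumpC r _ x).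
have := @taylor2 (fun s => bump r x (p + s *: basis3 i)) (fun s => bump1 r x i (p + s *: basis3 i))
  (fun s => bump2 r x i (p + s *: basis3 i)) (30 * bump_coef r / r ^+ 2) t
  (fun s => is_derive_line (d1 i _ I)) (fun s => is_derive_line (d2 i _ I)).
by rewrite scale0r addr0; apply => s; exact: bump2_le.
Qed.

Lemma bump_continuous r p : continuous (bump r p).
Proof. by move=> x; have [_ _ c _ _] := bump_D2on setT r p; exact: c. Qed.

Lemma bump1_continuous r p i : continuous (bump1 r p i).
Proof. by move=> x; have [_ _ _ c _] := bump_D2on setT r p; exact: c. Qed.

Lemma int3_bump r p : 0 < r -> int3 (bump r p).
Proof.
move=> r0; apply: (@int3_continuous _ _ p r) => [|x rx]; first exact: bump_continuous.
by apply: bump_out => //; exact: ltW.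
Qed.

Lemma int3_bump1 r p i : 0 < r -> int3 (bump1 r p i).
Proof.
move=> r0; apply: (@int3_continuous _ _ p r) => [|x rx]; first exact: bump1_continuous.
by apply: bump1_out => //; exact: ltW.
Qed.

Lemma I3_bump1 r p i : 0 < r -> I3 (bump1 r p i) = 0.
Proof.
move=> r0; have [d1 _ _ _ _] := bump_D2on setT r p.
apply: (@integral_partial_zero R i (bump r p) (bump1 r p i) (r + enorm p)).
- by move=> x; exact: d1.
- exact: bump1_continuous.
- by move=> x rx; apply: bump_out => //; have := enorm_sub_le x p; rewrite ler_norml; lra.
Qed.

(** This is 4 pi in value, as minus the Laplacian of [newt] is [bump] and [newt] is 1/|x| far away.
    It is the normalising constant of all averages below. *)
Definition mass : R := I3 (bump 1 (0 : E3 R)).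

Lemma tame_setT u : tame setT u.
Proof. by move=> x []. Qed.

Lemma ext0_setT u : ext0 setT u = u.
Proof. by apply/funext => x; rewrite ext0_in. Qed.

Lemma D2onB O u (g h : 'I_3 -> E3 R -> R) u' (g' h' : 'I_3 -> E3 R -> R) : D2on O u g h -> D2on O u' g' h' ->
  D2on O (fun x => u x - u' x) (fun i x => g i x - g' i x) (fun i x => h i x - h' i x).
Proof.
move=> D D'; apply: (eq_D2on (D2onD D (D2onZ (-1) D'))).
- by move=> x; rewrite mulN1r.
- by move=> i x; rewrite mulN1r.
- by move=> i x; rewrite mulN1r.
Qed.

Lemma lapB (h h' : 'I_3 -> E3 R -> R) x :
  lap (fun i y => h i y - h' i y) x = lap h x - lap h' x.
Proof. by rewrite /lap sumrB. Qed.

(** Two regularised Newton kernels agree outside the larger ball, so their difference has compact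
    support and Green's formula with v = 1 applies. *)
Lemma I3_bump_radius r s p : 0 < r -> 0 < s -> I3 (bump r p) = I3 (bump s p).
Proof.
move=> r0 s0; have ir := int3_bump p r0; have is' := int3_bump p s0.
apply/eqP; rewrite -subr_eq0 -(I3B ir is'); apply/eqP.
have D := D2onB (newt_D2on setT s p) (newt_D2on setT r p).
have := @green _ setT _ _ _ _ _ _ (Num.max r s + enorm p) openT (D2on_cst setT 1) _ D (tame_setT _).
case.
- by move=> x _; rewrite /lap big1.
- move=> x rx; have : Num.max r s < enorm (x - p).
    by have := enorm_sub_le x p; rewrite ler_norml; lra.
  by rewrite gt_max => /andP[/ltW rx' /ltW sx]; rewrite !newt_far // subrr.
move=> _ <-; rewrite ext0_setT; apply: eq_I3 => x.
by rewrite lapB !lap_newt // mul1r opprK addrC.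
Qed.

(** The derivative in t is the integral of a partial derivative of [bump], which has compact
    support; hence it is zero. *)
Lemma I3_bump_shift r i p t : 0 < r -> I3 (bump r (p + t *: basis3 i)) = I3 (bump r p).
Proof.
move=> r0; pose g s := I3 (bump r (p + s *: basis3 i)).
suff dg : forall s : R, is_derive s 1 g 0.
  by have := is_derive_0_is_cst t 0 dg; rewrite /g scale0r addr0.
move=> s; apply/is_deriveP => e e0.
set q := p + s *: basis3 i.
(* The second-order Taylor constant of [bump] times the volume of a cube that contains the original
   support and the one shifted by at most 1. *)
pose K := 30 * bump_coef r / r ^+ 2 * (8 * (r + 1) ^+ 3).
have K0 : 0 <= K.
  apply: mulr_ge0.
    exact: divr_ge0 (mulr_ge0 (ler0n _ 30) (ltW (bump_coef_gt0 r0))) (exprn_ge0 _ (ltW r0)).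
  by rewrite mulr_ge0 // exprn_ge0 // addr_ge0 // ltW.
exists (Num.min 1 (e / (K + 1))); first by rewrite lt_min ltr01 divr_gt0 // ltr_wpDl.
move=> h; rewrite lt_min => /andP[h1 he].
have -> : g (s + h *: 1) = I3 (bump r (q + h *: basis3 i)).
  have E : s + h *: (1 : R) = s + h by congr (_ + _); exact: mulr1.
  by rewrite /g E scalerDl addrA.
rewrite mulr0 subr0 /g -/q.
have Z : I3 (fun x => h * bump1 r x i q) = 0.
  rewrite (_ : (fun x => _) = (fun x => - h * bump1 r q i x)); last first.
    by apply/funext => x; rewrite (bump1C r x) mulrN mulNr.
  by rewrite (I3Z _ (int3_bump1 q i r0)) I3_bump1 // mulr0.
have iZ : int3 (fun x => h * bump1 r x i q).
  apply: (@eq_int3 _ (fun x => - h * bump1 r q i x)); last by apply: int3Z; exact: int3_bump1.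
  by move=> x; rewrite (bump1C r x) mulrN mulNr.
have ib p' := int3_bump p' r0.
rewrite -[X in `|X|]subr0 -Z -(I3B (ib _) (ib _)) -(I3B (int3B (ib _) (ib _)) iZ).
apply: (@le_trans _ _ (30 * bump_coef r / r ^+ 2 * h ^+ 2 * (8 * (r + 1) ^+ 3))).
  apply: (@I3_bounded _ _ q) => //; first by rewrite addr_gt0.
  - exact: int3B (int3B (ib _) (ib _)) iZ.
  - by move=> x _; exact: bump_taylor.
  - move=> x xb; have rx : r + 1 <= enorm (x - q).
      by rewrite leNgt; apply/negP => xq; apply: xb; exact: eball_sub_box.
    have rx' : r <= enorm (x - q) by lra.
    have rxh : r <= enorm (x - (q + h *: basis3 i)).
      have := enorm_sub_le (x - q) (x - (q + h *: basis3 i)).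
      rewrite (_ : x - q - _ = h *: basis3 i) ?enorm_basis3Z ?ler_norml; first lra.
      by move: (h *: _) => w; apply: E3ext; rewrite /=; ring.
    rewrite (bump_out r0 rx') (bump_out r0 rxh) bump1C (bump1_out _ r0 rx').
    by ring.
rewrite -(real_normK (num_real h)) expr2 (_ : _ * _ = K * `|h| * `|h|); last by rewrite /K; ring.
rewrite ler_wpM2r // ltW //; move: he; rewrite ltr_pdivlMr ?ltr_wpDl //.
by have := normr_ge0 h; lra.
Qed.

Lemma I3_bump r p : 0 < r -> I3 (bump r p) = mass.
Proof.
move=> r0; rewrite (I3_bump_radius p r0 ltr01) /mass.
have -> : p = 0 + p.1.1 *: basis3 ord0 + p.1.2 *: basis3 ax1
   + p.2 *: basis3 ax2.
  by apply: E3ext; rewrite /= /GRing.scale /=; ring.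
by rewrite I3_bump_shift // I3_bump_shift // I3_bump_shift.
Qed.

Lemma mass_gt0 : 0 < mass.
Proof.
have b0 : 0 < bump_coef 1 :> R by exact: bump_coef_gt0.
pose c : R := bump_coef 1 / 8.
have q0 : 0 < 4^-1 :> R by [].
apply: (@lt_le_trans _ _ (c * (8 * 4^-1 ^+ 3))); first by rewrite !mulr_gt0 // exprn_gt0.
rewrite -(@I3_box R 0 _ q0) -I3Z; last exact: int3_box.
apply: I3_le; [by apply: int3Z; exact: int3_box|exact: int3_bump|].
move=> x; rewrite indicE; have [xb|xb] := pselect (box 0 4^-1 x); last first.
  by rewrite memNset // mulr0 bump_ge0.
rewrite mem_set // mulr1 /bump /c; apply: ler_wpM2l; first exact: ltW.
have h : 2^-1 <= bump_arg 1 0 x.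
  rewrite /bump_arg expr1n invr1 mulN1r sqd_enorm.
  have := box_enorm xb => xh; have : enorm (x - 0) ^+ 2 <= (2 * 4^-1) ^+ 2 by rewrite lerXn2r ?nnegrE.
  by rewrite exprMn exprVn; lra.
have h0 : 0 <= bump_arg 1 0 x by exact: le_trans h.
rewrite cube_pos_in // (_ : 8^-1 = 2^-1 ^+ 3); last by field.
by rewrite lerXn2r ?nnegrE.
Qed.


Lemma int3_mul_ext0 O u h r : open O -> (forall x, O x -> {for x, continuous h}) ->
  (forall x, O x -> {for x, continuous u}) -> tame O u -> (forall x, r < enorm x -> u x = 0) ->
  int3 (fun y => u y * ext0 O h y).
Proof.
move=> oO ch cu tu u0.
apply: (@eq_int3 _ (ext0 O (fun y => h y * u y))).
  by move=> y; rewrite /ext0; case: ifP; rewrite ?mulr0 // mulrC.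
apply: (@int3_ext0 _ _ _ r) => //; last by move=> x /u0 ->; rewrite mulr0.
- by move=> x Ox; apply: cvgM; [exact: ch|exact: cu].
- exact: tameM.
Qed.

Lemma tame_bump O r x : 0 < r -> (forall y, enorm (y - x) <= r -> O y) -> tame O (bump r x).
Proof.
move=> r0 rO z nz; exists (enorm (z - x) - r).
  by rewrite subr_gt0 ltNge; apply/negP => /rO.
by move=> y yz _; apply: bump_out => //; have := enormDB z y x; rewrite (enormB z y); lra.
Qed.

Lemma bump_far r x y : 0 < r -> r + enorm x < enorm y -> bump r x y = 0.
Proof.
by move=> r0 h; apply: bump_out => //; have := enorm_sub_le y x; rewrite ler_norml; lra.
Qed.

(** The mean value property with the C^2 weight [bump]. It replaces harmonicity in the interior
    estimates, because it passes to partial derivatives and linear combinations without any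
    discussion of higher derivatives. *)
Definition MVP O h := (forall x, O x -> {for x, continuous h}) /\
  forall x r, 0 < r -> (forall y, enorm (y - x) <= r -> O y) ->
    I3 (fun y => bump r x y * ext0 O h y) = mass * h x.

Lemma int3_bump_ext0 O h x r : open O -> (forall x, O x -> {for x, continuous h}) ->
  0 < r -> (forall y, enorm (y - x) <= r -> O y) -> int3 (fun y => bump r x y * ext0 O h y).
Proof.
move=> oO ch r0 rO; apply: (@int3_mul_ext0 _ _ _ (r + enorm x)) => //.
- by move=> y _; exact: bump_continuous.
- exact: tame_bump.
- by move=> y /(bump_far r0).
Qed.

Lemma bump_average_cvg O h x (e : R) : open O -> (forall x, O x -> {for x, continuous h}) ->
  O x -> 0 < e -> exists2 d : R, 0 < d &
  forall r, 0 < r -> r < d -> (forall y, enorm (y - x) <= r -> O y) /\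
    `|I3 (fun y => bump r x y * ext0 O h y) - mass * h x| <= mass * e.
Proof.
move=> oO ch Ox e0; have /openE3/(_ _ Ox)[d1 d10 d1O] := oO.
have /continuousE3/(_ e e0)[d2 d20 hd] := ch _ Ox.
exists (Num.min d1 d2); first by rewrite lt_min d10.
move=> r r0; rewrite lt_min => /andP[rd1 rd2].
have rO y : enorm (y - x) <= r -> O y by move=> yr; apply: d1O; exact: le_lt_trans rd1.
split=> //.
have ib := int3_bump x r0; have ic := int3_bump_ext0 oO ch r0 rO.
rewrite -(I3_bump x r0) mulrC -(I3Z _ ib) -(I3B ic (int3Z _ ib)) [leRHS]mulrC -(I3Z _ ib).
have id := int3B ic (int3Z (h x) ib).
apply: (le_trans (I3_norm id)); apply: I3_le; [exact: int3_abs|exact: int3Z|].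
move=> y; rewrite mulrC -mulrBl normrM (ger0_norm (bump_ge0 _ _ r0)).
have [yr|ry] := ltP (enorm (y - x)) r; last by rewrite bump_out // !mulr0.
apply: ler_wpM2r; first exact: bump_ge0.
by rewrite ext0_in; [apply: ltW; apply: hd; exact: lt_trans rd2|apply: rO; exact: ltW].
Qed.

(** The kernels [newt] of radii s < r differ only inside the ball of radius r, so Green's formula
    shows that the averages over the two radii coincide. Letting s tend to 0 gives the value at the
    centre. *)
Lemma harmonic_MVP O v (g h : 'I_3 -> E3 R -> R) : open O -> D2on O v g h -> (forall x, O x -> lap h x = 0) -> MVP O v.
Proof.
move=> oO D hv; have cv := D2_c0 D; split=> // x r r0 rO.
have Ox : O x by apply: rO; rewrite subrr enorm0 ltW.
have same s : 0 < s -> s <= r ->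
    I3 (fun y => bump r x y * ext0 O v y) = I3 (fun y => bump s x y * ext0 O v y).
  move=> s0 sr.
  have sO y : enorm (y - x) <= s -> O y by move=> ys; apply: rO; exact: le_trans sr.
  have D' := D2onB (newt_D2on O s x) (newt_D2on O r x).
  have Z y : r <= enorm (y - x) -> newt s x y - newt r x y = 0.
    by move=> ry; rewrite !newt_far ?subrr // (le_trans sr).
  have := @green _ O _ _ _ _ _ _ (r + enorm x) oO D hv D'.
  case.
  - move=> z nz; exists (enorm (z - x) - r).
      by rewrite subr_gt0 ltNge; apply/negP => /rO.
    by move=> y yz _; apply: Z; have := enormDB z y x; rewrite (enormB z y); lra.
  - by move=> y ry; apply: Z; have := enorm_sub_le y x; rewrite ler_norml; lra.
  move=> _ E; apply/eqP; rewrite -subr_eq0; apply/eqP.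
  rewrite -(I3B (int3_bump_ext0 oO cv r0 rO) (int3_bump_ext0 oO cv s0 sO)) -E.
  apply: eq_I3 => y; rewrite /ext0; case: ifP => _; last by rewrite !mulr0 subrr.
  by rewrite lapB !lap_newt //; ring.
apply/eqP; rewrite -subr_eq0 -normr_eq0; apply/eqP/le_anti; rewrite normr_ge0 andbT.
apply/ler_addgt0Pr => e e0; rewrite add0r.
have e1 : 0 < e / mass by rewrite divr_gt0 // mass_gt0.
have [d d0 hd] := bump_average_cvg oO cv Ox e1.
pose s := Num.min r (d / 2).
have s0 : 0 < s by rewrite lt_min r0 divr_gt0.
have sd : s < d by rewrite /s gt_min; apply/orP; right; lra.
rewrite (same s) ?ge_min ?lexx //; have [_ H] := hd s s0 sd.
by apply: (le_trans H); rewrite mulrC divfK // lt0r_neq0 // mass_gt0.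
Qed.

End mean_value.

Section interior_estimates.
Context {R : realType}.
Implicit Types (x y p : E3 R) (r s t M : R) (i : 'I_3) (O K : set (E3 R)) (u v h : E3 R -> R).

Lemma compact_open_margin K O : compact K -> open O -> K `<=` O ->
  exists2 d : R, 0 < d & forall x y, K x -> enorm (y - x) <= d -> O y.
Proof.
move=> cK oO KO.
have rad x : exists d, K x -> 0 < d /\ forall y, enorm (y - x) < d -> O y.
  have [Kx|nKx] := pselect (K x); last by exists 0.
  by have /openE3/(_ _ (KO _ Kx))[d d0 h] := oO; exists d.
pose d x := sval (cid (rad x)) / 2.
have dP x : K x -> 0 < d x /\ forall y, enorm (y - x) < 2 * d x -> O y.
  rewrite /d; case: cid => e /= H /H [e0 h]; split; first by rewrite divr_gt0.
  by move=> y; rewrite mulrC divfK //; exact: h.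
have [s [sK sc]] := @compact_eball_cover _ K d cK (fun x Kx => (dP x Kx).1).
have [e e0 he] : exists2 e : R, 0 < e & forall p, p \in s -> e <= d p.
  elim: s sK {sc} => [|p s IH] sK; first by exists 1.
  have [|e e0 he] := IH; first by move=> q qs; apply: sK; rewrite inE qs orbT.
  have dp : 0 < d p by have [] := dP p (sK p (mem_head _ _)).
  exists (Num.min e (d p)); first by rewrite lt_min e0.
  move=> q; rewrite inE => /orP[/eqP ->|/he qe]; first by rewrite ge_min lexx orbT.
  by rewrite ge_min qe.
exists e => // x y /sc [p ps xp] yx; apply: (dP p (sK _ ps)).2.
by apply: (le_lt_trans (enormDB _ x _)); have := he p ps; lra.
Qed.

Lemma cball_margin O x r : 0 <= r -> open O -> (forall y, enorm (y - x) <= r -> O y) ->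
  exists2 d : R, 0 < d & forall y, enorm (y - x) <= r + d -> O y.
Proof.
move=> r0 oO rO; have [d d0 hd] := compact_open_margin (@compact_cball _ x r) oO rO.
exists d => // y yr.
have [yr'|ry] := leP (enorm (y - x)) r; first exact: rO.
have n0 : 0 < enorm (y - x) by exact: le_lt_trans ry.
pose z := x + (r / enorm (y - x)) *: (y - x).
have zE : enorm (z - x) = r.
  rewrite /z addrAC subrr add0r enormZ ger0_norm ?divr_ge0 // divfK //.
  exact: lt0r_neq0.
apply: (hd z y); first by rewrite /= zE.
have -> : y - z = (1 - r / enorm (y - x)) *: (y - x).
  by rewrite /z scalerBl scale1r opprD addrA.
rewrite enormZ ger0_norm; last by rewrite subr_ge0 ler_pdivrMr // mul1r ltW.
by rewrite mulrBl mul1r divfK ?lt0r_neq0 //; lra.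
Qed.

(** The mean value formula differentiated with respect to its centre: [bump1 r y i x] is the
    derivative at x of the weight, which is symmetric in x and y. *)
Definition avg1 r i O h x : R := mass^-1 * I3 (fun y => bump1 r y i x * ext0 O h y).

Lemma bump1_far r x y i : 0 < r -> r <= enorm (y - x) -> bump1 r y i x = 0.
Proof. by move=> r0 h; rewrite bump1_out // enormB. Qed.

Lemma int3_bump1_ext0 O h x r i : open O -> (forall x, O x -> {for x, continuous h}) ->
  0 < r -> (forall y, enorm (y - x) <= r -> O y) -> int3 (fun y => bump1 r y i x * ext0 O h y).
Proof.
move=> oO ch r0 rO; apply: (@eq_int3 _ (fun y => - (bump1 r x i y * ext0 O h y))).
  by move=> y; rewrite (bump1C r y) mulNr.
apply: int3N; apply: (@int3_mul_ext0 _ _ _ _ (r + enorm x)) => //.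
- by move=> y _; exact: bump1_continuous.
- move=> z nz; exists (enorm (z - x) - r).
    by rewrite subr_gt0 ltNge; apply/negP => /rO.
  by move=> y yz _; apply: bump1_out => //; have := enormDB z y x; rewrite (enormB z y); lra.
- by move=> y ry; apply: bump1_out => //; have := enorm_sub_le y x; rewrite ler_norml; lra.
Qed.

Lemma MVP_taylor O h i x r s M : open O -> MVP O h -> 0 < r -> 0 < s ->
  (forall y, enorm (y - x) <= r + s -> O y) ->
  (forall y, enorm (y - x) <= r + s -> `|h y| <= M) ->
  forall t, `|t| <= s ->
  `|h (x + t *: basis3 i) - h x - t * avg1 r i O h x|
    <= mass^-1 * (30 * bump_coef r / r ^+ 2 * M * (8 * (r + s + 1) ^+ 3)) * t ^+ 2.
Proof.
move=> oO [ch mv] r0 s0 rsO hM t ts.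
have m0 := @mass_gt0 R.
set q := x + t *: basis3 i.
have qx : enorm (q - x) <= s by rewrite /q addrAC subrr add0r enorm_basis3Z.
have rO y : enorm (y - x) <= r -> O y by move=> yr; apply: rsO; lra.
have rOq y : enorm (y - q) <= r -> O y.
  by move=> yr; apply: rsO; have := enormDB y q x; lra.
have iq := int3_bump_ext0 oO ch r0 rOq; have ix := int3_bump_ext0 oO ch r0 rO.
have i1 := int3Z t (int3_bump1_ext0 i oO ch r0 rO).
have E : mass * (h q - h x - t * avg1 r i O h x) =
    I3 (fun y => bump r q y * ext0 O h y - bump r x y * ext0 O h y
          - t * (bump1 r y i x * ext0 O h y)).
  rewrite (I3B (int3B iq ix) i1) (I3B iq ix) (mv q) // (mv x) //.
  rewrite I3Z; last exact: int3_bump1_ext0.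
  by rewrite /avg1; set J := I3 _; field; exact: lt0r_neq0.
rewrite -(ler_pM2l m0) -{1}(gtr0_norm m0) -normrM E.
set A := 30 * bump_coef r / r ^+ 2; set B := 8 * (r + s + 1) ^+ 3.
have -> : mass * (mass^-1 * (A * M * B) * t ^+ 2) = A * t ^+ 2 * M * B.
  by field; exact: lt0r_neq0.
rewrite /B; clear E.
apply: (@I3_bounded _ _ x); first by rewrite !addr_gt0.
- exact: int3B (int3B iq ix) i1.
- move=> y _; rewrite -mulrBl (mulrA t) -mulrBl normrM.
  have [yr|ry] := leP (enorm (y - x)) (r + s); last first.
    have h1 : r <= enorm (y - q) by have := enormDB y q x; lra.
    have h2 : r <= enorm (y - x) by lra.
    rewrite (bump_out r0 h1) (bump_out r0 h2) (bump1_far _ r0 h2).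
      rewrite subrr mulr0 subr0 normr0 mul0r.
      have M0 : 0 <= M by apply: le_trans (hM x _); rewrite // subrr enorm0 addr_ge0 // ltW.
      apply: mulr_ge0 => //; apply: mulr_ge0; last exact: sqr_ge0.
      exact: divr_ge0 (mulr_ge0 (ler0n _ 30) (ltW (bump_coef_gt0 r0))) (exprn_ge0 _ (ltW r0)).
  apply: ler_pM => //; first exact: bump_taylor.
  by rewrite ext0_in; [exact: hM|exact: rsO].
- move=> y yb; have ry : r + s + 1 <= enorm (y - x).
    by rewrite leNgt; apply/negP => xq; apply: yb; exact: eball_sub_box.
  have h1 : r <= enorm (y - q) by have := enormDB y q x; lra.
  have h2 : r <= enorm (y - x) by lra.
  by rewrite (bump_out r0 h1) (bump_out r0 h2) (bump1_far _ r0 h2); ring.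
Qed.

Lemma quadratic_is_derive h i x d s C : 0 < s ->
  (forall t, `|t| <= s -> `|h (x + t *: basis3 i) - h x - t * d| <= C * t ^+ 2) ->
  is_derive x (basis3 i) h d.
Proof.
move=> s0 H; apply/is_deriveP => e e0.
exists (Num.min s (e / (`|C| + 1))); first by rewrite lt_min s0 divr_gt0.
move=> t; rewrite lt_min => /andP[/ltW/H h1]; rewrite ltr_pdivlMr // => h2.
apply: (le_trans h1); rewrite -(real_normK (num_real t)) expr2 mulrA.
apply: ler_wpM2r => //; have := ler_norm C; have := normr_ge0 t => t0 Cn.
have : C * `|t| <= `|C| * `|t| by exact: ler_wpM2r.
by lra.
Qed.

Lemma MVP_bounded O h x r : MVP O h -> (forall y, enorm (y - x) <= r -> O y) ->
  exists M, forall y, enorm (y - x) <= r -> `|h y| <= M.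
Proof.
move=> [ch _] rO; apply: (@continuous_bounded_on _ [set y | enorm (y - x) <= r] h).
  exact: compact_cball.
by move=> y /rO; exact: ch.
Qed.

Lemma MVP_is_derive O h i x r : open O -> MVP O h -> 0 < r ->
  (forall y, enorm (y - x) <= r -> O y) -> is_derive x (basis3 i) h (avg1 r i O h x).
Proof.
move=> oO mh r0 rO; have [s s0 sO] := cball_margin (ltW r0) oO rO.
have [M hM] := MVP_bounded mh sO.
exact: (quadratic_is_derive s0 (MVP_taylor i oO mh r0 s0 sO hM)).
Qed.

Lemma MVP_partialE O h i x r : open O -> MVP O h -> 0 < r ->
  (forall y, enorm (y - x) <= r -> O y) -> partial i h x = avg1 r i O h x.
Proof.
move=> oO mh r0 rO; have D := MVP_is_derive i oO mh r0 rO.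
exact: (derive_val (is_derive := D)).
Qed.

Lemma MVP_partial_derive O h i x : open O -> MVP O h -> O x ->
  is_derive x (basis3 i) h (partial i h x).
Proof.
move=> oO mh Ox; have /openE3/(_ _ Ox)[r r0 rO] := oO.
have r2 : 0 < r / 2 by rewrite divr_gt0.
have rO' y : enorm (y - x) <= r / 2 -> O y by move=> h1; apply: rO; rewrite /eball /=; lra.
by rewrite (MVP_partialE i oO mh r2 rO'); exact: MVP_is_derive.
Qed.

(** [MVP_taylor] holds with the same constant at all points near x. A difference quotient with fixed
    small step t is thus uniformly close to the partial derivative, and it is continuous because h
    is. *)
Lemma MVP_partial_continuous O h i x : open O -> MVP O h -> O x ->
  {for x, continuous (partial i h)}.
Proof.
move=> oO mh Ox; have /openE3/(_ _ Ox)[r' r'0 rO'] := oO.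
(* Three layers of thickness r are used, for the moving point, the step and the averaging ball; the
   closed ball of radius 4 r still lies in the open ball of radius r'. *)
pose r := r' / 5; have r0 : 0 < r by rewrite divr_gt0.
have rO y : enorm (y - x) <= 4 * r -> O y.
  by move=> h1; apply: rO'; rewrite /eball /=; apply: (le_lt_trans h1); rewrite /r; lra.
have [M hM] := MVP_bounded mh rO.
pose C := mass^-1 * (30 * bump_coef r / r ^+ 2 * M * (8 * (r + r + 1) ^+ 3)).
have key y t : enorm (y - x) <= r -> `|t| <= r ->
    `|h (y + t *: basis3 i) - h y - t * partial i h y| <= C * t ^+ 2.
  move=> yx tr.
  have bO z : enorm (z - y) <= r + r -> O z by move=> zy; apply: rO; have := enormDB z y x; lra.
  rewrite (@MVP_partialE O h i y r) //; last by move=> z zy; apply: bO; lra.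
  apply: MVP_taylor => // z zy; apply: hM.
  by have := enormDB z y x; lra.
have [ch _] := mh.
apply/continuousE3 => e e0.
pose t := Num.min r (e / (4 * (`|C| + 1))).
have t0 : 0 < t by rewrite lt_min r0 divr_gt0 // mulr_gt0.
have tr : `|t| <= r by rewrite gtr0_norm // ge_min lexx.
have te : t * (4 * (`|C| + 1)) <= e by rewrite -ler_pdivlMr ?mulr_gt0 // ge_min lexx orbT.
have /continuousE3/(_ (e * t / 8))[|d1 d10 hd1] := ch _ Ox; first by rewrite divr_gt0 // mulr_gt0.
have Oxt : O (x + t *: basis3 i).
  by apply: rO; rewrite addrAC subrr add0r enorm_basis3Z; lra.
have /continuousE3/(_ (e * t / 8))[|d2 d20 hd2] := ch _ Oxt; first by rewrite divr_gt0 // mulr_gt0.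
exists (Num.min r (Num.min d1 d2)); first by rewrite !lt_min r0 d10.
move=> y; rewrite !lt_min => /andP[yr /andP[/hd1 h1 y2]].
have h2 : `|h (y + t *: basis3 i) - h (x + t *: basis3 i)| < e * t / 8.
  by apply: hd2; rewrite opprD addrACA subrr addr0.
have k1 := key y t (ltW yr) tr.
have k2 := key x t; rewrite subrr enorm0 in k2; have {}k2 := k2 (ltW r0) tr.
rewrite -(ltr_pM2l t0) -{1}(gtr0_norm t0) -normrM.
have CC : C * t ^+ 2 <= e * t / 4.
  have : C * t ^+ 2 <= `|C| * t ^+ 2 by apply: ler_wpM2r; [exact: sqr_ge0|exact: ler_norm].
  have : t * (4 * (`|C| + 1)) * t <= e * t by apply: ler_wpM2r => //; exact: ltW.
  by have := sqr_ge0 t; rewrite expr2; lra.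
move: h1 h2 k1 k2; rewrite !ltr_norml !ler_norml mulrBr.
set a := t * _; set b := t * _; lra.
Qed.

(** Integration by parts moves the derivative from h to the weight, which yields [avg1]; and [avg1]
    is the partial derivative by [MVP_partialE]. *)
Lemma MVP_partial O h i : open O -> MVP O h -> MVP O (partial i h).
Proof.
move=> oO mh; have [ch mv] := mh.
have cp x : O x -> {for x, continuous (partial i h)} by exact: MVP_partial_continuous.
split=> // x r r0 rO.
have [db _ cb cb1 _] := bump_D2on O r x.
pose w y := bump r x y * partial i h y + h y * bump1 r x i y.
have dw y : O y -> is_derive y (basis3 i) (fun y => bump r x y * h y) (w y).
  by move=> Oy; exact: (is_deriveMf (db i y Oy) (MVP_partial_derive i oO mh Oy)).
have cw y : O y -> {for y, continuous w}.
  by move=> Oy; apply: cvgD; apply: cvgM; [exact: cb|exact: cp|exact: ch|exact: cb1].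
have tu : tame O (fun y => bump r x y * h y).
  by move=> z /(tame_bump r0 rO)[s s0 hs]; exists s => // y yz Oy; rewrite hs // mul0r.
have Z := partial_integral_ext0 (r := r + enorm x) oO dw cw tu.
have i1 := int3_bump_ext0 oO cp r0 rO; have i2 := int3_bump1_ext0 i oO ch r0 rO.
rewrite (MVP_partialE i oO mh r0 rO) /avg1 mulrA mulfV ?mul1r ?lt0r_neq0 ?mass_gt0 //.
apply/eqP; rewrite -subr_eq0; apply/eqP; rewrite -(I3B i1 i2) -Z.
  apply: eq_I3 => y; rewrite /ext0 /w; case: ifP => _; last by rewrite !mulr0 subrr.
  by rewrite (bump1C r y); ring.
by move=> y /(bump_far r0) ->; rewrite mul0r.
Qed.

Lemma MVP_partial_le O h i x r M : open O -> MVP O h -> 0 < r ->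
  (forall y, enorm (y - x) <= r -> O y) -> (forall y, enorm (y - x) <= r -> `|h y| <= M) ->
  `|partial i h x| <= mass^-1 * (6 * bump_coef r / r * (8 * (r + 1) ^+ 3)) * M.
Proof.
move=> oO mh r0 rO hM; have [ch mv] := mh; have m0 := @mass_gt0 R.
rewrite (MVP_partialE i oO mh r0 rO) /avg1 normrM gtr0_norm ?invr_gt0 // -mulrA.
rewrite ler_pM2l ?invr_gt0 //.
have M0 : 0 <= M by apply: le_trans (hM x _); rewrite // subrr enorm0 ltW.
have b0 : 0 <= 6 * bump_coef r / r.
  exact: divr_ge0 (mulr_ge0 (ler0n _ 6) (ltW (bump_coef_gt0 r0))) (ltW r0).
rewrite mulrAC; apply: (@I3_bounded _ _ x); first by rewrite addr_gt0.
- exact: int3_bump1_ext0.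
- move=> y _; rewrite normrM.
  have [yr|ry] := leP (enorm (y - x)) r; last first.
    by rewrite (bump1_far _ r0 (ltW ry)) normr0 mul0r; exact: mulr_ge0.
  apply: ler_pM => //; first exact: bump1_le.
  by rewrite ext0_in; [exact: hM|exact: rO].
- move=> y yb; have ry : r + 1 <= enorm (y - x).
    by rewrite leNgt; apply/negP => xq; apply: yb; exact: eball_sub_box.
  by rewrite bump1_far ?mul0r //; lra.
Qed.

Definition partials (s : seq 'I_3) u := foldr (fun i w => partial i w) u s.

Lemma MVP_partials O h (s : seq 'I_3) : open O -> MVP O h -> MVP O (partials s h).
Proof. by move=> oO mh; elim: s => //= i s IH; exact: MVP_partial. Qed.

(** Each derivative costs one layer of thickness r and one constant factor, whence the radius
    [size s] times r. *)
Lemma MVP_partials_le O h (s : seq 'I_3) x r M : open O -> MVP O h -> 0 < r ->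
  (forall y, enorm (y - x) <= (size s)%:R * r -> O y /\ `|h y| <= M) ->
  `|partials s h x| <= (mass^-1 * (6 * bump_coef r / r * (8 * (r + 1) ^+ 3))) ^+ (size s) * M.
Proof.
move=> oO mh r0; elim: s x => [|i s IH] x H /=.
  by rewrite expr0 mul1r; have [] := H x; rewrite ?subrr ?enorm0 ?mul0r.
rewrite exprS -mulrA; apply: (@MVP_partial_le O) => //; first exact: MVP_partials.
- move=> y yx; apply: (H y _).1; rewrite /= -natr1 mulrDl mul1r.
  by apply: (le_trans yx); rewrite lerDr mulr_ge0 // ltW.
- move=> y yx; apply: IH => z zy; apply: H; rewrite /= -natr1 mulrDl mul1r.
  by apply: (le_trans (enormDB _ y _)); exact: lerD.
Qed.

Lemma iter_partials i n (s : seq 'I_3) u : iter n (partial i) (partials s u) = partials (nseq n i ++ s) u.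
Proof. by elim: n => //= n ->. Qed.

Lemma DmultiE (a b c : nat) u :
  Dmulti a b c u = partials (nseq a (inord 0) ++ (nseq b (inord 1) ++ nseq c (inord 2))) u.
Proof.
rewrite /Dmulti -!iter_partials -[iter c _ u]/(iter c _ (partials [::] u)).
by rewrite iter_partials cats0.
Qed.

End interior_estimates.

(** * Solid harmonics *)

Section polynomial_functions.
Context {R : realType}.
Implicit Types (x y : E3 R) (u w : E3 R -> R) (i : 'I_3) (l n : nat).

(** A class closed under partial derivatives. [C2_on] also asks for mixed second derivatives, which
    [D2on] does not record; for this class they come from the closure property. *)
Inductive polyfun : (E3 R -> R) -> Prop :=
| polyfun_cst c : polyfun (fun=> c)
| polyfun_co i : polyfun (co i)
| polyfunD u w : polyfun u -> polyfun w -> polyfun (fun x => u x + w x)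
| polyfunM u w : polyfun u -> polyfun w -> polyfun (fun x => u x * w x).

Lemma polyfun_continuous u : polyfun u -> continuous u.
Proof.
elim=> [c|i|v w _ cv _ cw|v w _ cv _ cw] x.
- exact: cvg_cst.
- by rewrite /co (_ : (fun _ => _) = dot (basis3 i)); [exact: continuous_dot|apply/funext => y; rewrite dotC].
- by apply: cvgD; [exact: cv|exact: cw].
- by apply: cvgM; [exact: cv|exact: cw].
Qed.

Lemma polyfun_partial u i : polyfun u ->
  exists2 w, polyfun w & forall x, is_derive x (basis3 i) u (w x).
Proof.
elim=> [c|j|v w pv [v' pv' dv] pw [w' pw' dw]|v w pv [v' pv' dv] pw [w' pw' dw]].
- by exists (fun=> 0); [exact: polyfun_cst|move=> x; exact: is_derive_cst].
- exists (fun=> dot (basis3 j) (basis3 i)); [exact: polyfun_cst|move=> x].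
  by rewrite /co (_ : (fun _ => _) = dot (basis3 j)); [exact: is_derive_dot|apply/funext => y; rewrite dotC].
- exists (fun x => v' x + w' x); [exact: polyfunD|move=> x; exact: (is_deriveDf (dv x) (dw x))].
- exists (fun x => v x * w' x + w x * v' x); last by move=> x; exact: (is_deriveMf (dv x) (dw x)).
  by apply: polyfunD; exact: polyfunM.
Qed.

Lemma is_derive_partialE u w i : (forall x, is_derive x (basis3 i) u (w x)) -> partial i u = w.
Proof. by move=> D; apply/funext => x; exact: (derive_val (is_derive := D x)). Qed.

Lemma polyfun_partialP u i : polyfun u -> polyfun (partial i u).
Proof. by move=> /(polyfun_partial i)[w pw /is_derive_partialE ->]. Qed.

Lemma polyfun_C1 u (U : set (E3 R)) : polyfun u -> C1_on U u.
Proof.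
move=> pu i x _; have [w pw D] := polyfun_partial i pu.
split; first exact: (@ex_derive _ _ _ _ _ _ _ (D x)).
by rewrite (is_derive_partialE D); exact: polyfun_continuous.
Qed.

Lemma polyfun_C2 u (U : set (E3 R)) : polyfun u -> C2_on U u.
Proof. by move=> pu; split=> [|i]; apply: polyfun_C1 => //; exact: polyfun_partialP. Qed.

Lemma polyfun_sum (I : Type) (s : seq I) (P : pred I) (F : I -> E3 R -> R) :
  (forall j, P j -> polyfun (F j)) -> polyfun (fun x => \sum_(j <- s | P j) F j x).
Proof.
move=> pF; elim: s => [|i s IH].
  by rewrite (_ : (fun x => _) = (fun=> 0)); [exact: polyfun_cst|apply/funext => x; rewrite big_nil].
case Pi: (P i).
  rewrite (_ : (fun x => _) = (fun x => F i x + \sum_(j <- s | P j) F j x)).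
    by apply: polyfunD => //; exact: pF.
  by apply/funext => x; rewrite big_cons Pi.
by rewrite (_ : (fun x => _) = (fun x => \sum_(j <- s | P j) F j x)) //; apply/funext => x; rewrite big_cons Pi.
Qed.

Lemma polyfunX u n : polyfun u -> polyfun (fun x => u x ^+ n).
Proof.
move=> pu; elim: n => [|n IH]; first exact: polyfun_cst.
rewrite (_ : (fun x => _) = (fun x => u x * u x ^+ n)); first exact: polyfunM.
by apply/funext => x; rewrite exprS.
Qed.

Lemma harmonic_on_lap u (g h : 'I_3 -> E3 R -> R) (U : set (E3 R)) : C2_on setT u ->
  D2on setT u g h -> (forall x, lap h x = 0) -> harmonic_on U u.
Proof.
move=> c2 [d1 d2 _ _ _] lh; split.
  split; first by move=> i x _; exact: c2.1.
  by move=> i j x _; exact: c2.2.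
move=> x _; transitivity (lap h x); last exact: lh.
rewrite /lap; apply: eq_bigr => i _.
have -> : partial i u = g i by apply: is_derive_partialE => y; exact: d1.
by have -> : partial i (g i) = h i by apply: is_derive_partialE => y; exact: d2.
Qed.

Definition mono (a b c : nat) x : R := x.1.1 ^+ a * x.1.2 ^+ b * x.2 ^+ c.

Lemma co0E x : co ord0 x = x.1.1.
Proof. by rewrite /co /dot /basis3 /=; ring. Qed.
Lemma co1E x : co ax1 x = x.1.2.
Proof. by rewrite /co /dot /basis3 /=; ring. Qed.
Lemma co2E x : co ax2 x = x.2.
Proof. by rewrite /co /dot /basis3 /=; ring. Qed.

Lemma polyfun_mono a b c : polyfun (mono a b c).
Proof.
rewrite (_ : mono a b c = (fun x => (co ord0 x ^+ a * co ax1 x ^+ b)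
   * co ax2 x ^+ c)).
  by apply: polyfunM; [apply: polyfunM|]; apply: polyfunX; exact: polyfun_co.
by apply/funext => x; rewrite co0E co1E co2E.
Qed.

Definition ishom l (w : E3 R -> R[i]) := exists q, forall x, w x = hompoly l q x.

Lemma ishom_ext l (w w' : E3 R -> R[i]) : w =1 w' -> ishom l w -> ishom l w'.
Proof. by move=> e [q h]; exists q => x; rewrite -e. Qed.

Lemma ishom0 l : ishom l (fun=> 0).
Proof.
exists (fun _ _ => 0) => x; rewrite /hompoly big1 // => a _; rewrite big1 // => b _.
by rewrite mul0r.
Qed.

Lemma ishomD l (w w' : E3 R -> R[i]) : ishom l w -> ishom l w' -> ishom l (fun x => w x + w' x).
Proof.
move=> [q h] [q' h']; exists (fun a b => q a b + q' a b) => x.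
rewrite h h' /hompoly -big_split; apply: eq_bigr => a _; rewrite -big_split.
by apply: eq_bigr => b _; rewrite mulrDl.
Qed.

Lemma ishomZ l c (w : E3 R -> R[i]) : ishom l w -> ishom l (fun x => c * w x).
Proof.
move=> [q h]; exists (fun a b => c * q a b) => x.
rewrite h /hompoly mulr_sumr; apply: eq_bigr => a _; rewrite mulr_sumr.
by apply: eq_bigr => b _; rewrite mulrA.
Qed.

Lemma ishom_sum l (I : Type) (s : seq I) (P : pred I) (F : I -> E3 R -> R[i]) :
  (forall j, P j -> ishom l (F j)) -> ishom l (fun x => \sum_(j <- s | P j) F j x).
Proof.
move=> pF; elim: s => [|i s IH].
  by apply: ishom_ext (ishom0 l) => x; rewrite big_nil.
case Pi: (P i).
  by apply: (ishom_ext _ (ishomD (pF _ Pi) IH)) => x; rewrite big_cons Pi.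
by apply: ishom_ext IH => x; rewrite big_cons Pi.
Qed.

Lemma ishom_mono l a b c : (a + b + c = l)%N -> ishom l (fun x => (mono a b c x)%:C).
Proof.
move=> E; exists (fun a' b' => ((a' == a) && (b' == b))%:R) => x.
have al : (a < l.+1)%N by rewrite ltnS -E -addnA leq_addr.
have bl : (b < l.+1)%N by rewrite ltnS -E (addnC a) -addnA leq_addr.
rewrite /hompoly (bigD1 (Ordinal al)) //= (bigD1 (Ordinal bl)) /=; last by rewrite -E leq_addr.
rewrite !eqxx mul1r big1 ?addr0; last first.
  move=> b' /andP[_ nb]; rewrite (_ : (b' == b :> nat) = false) ?mul0r //.
  by apply: contraNF nb => /eqP bb; apply/eqP/val_inj.
rewrite big1 ?addr0; last first.
  move=> a' na; rewrite big1 // => b' _; rewrite (_ : (a' == a :> nat) = false) ?mul0r //.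
  by apply: contraNF na => /eqP aa; apply/eqP/val_inj.
by rewrite /mono -E -addnA addKn addKn.
Qed.

Lemma hompoly_mono l q x :
  hompoly l q x = \sum_(a < l.+1) \sum_(b < l.+1 | (a + b <= l)%N) q a b * (mono a b (l - a - b) x)%:C.
Proof. by []. Qed.

Lemma ishomM_co l (w : E3 R -> R[i]) i : ishom l w -> ishom l.+1 (fun x => (co i x)%:C * w x).
Proof.
move=> [q h].
apply: (@ishom_ext _ (fun x => \sum_(a < l.+1) \sum_(b < l.+1 | (a + b <= l)%N)
   q a b * (co i x * mono a b (l - a - b) x)%:C)).
  move=> x; rewrite h hompoly_mono mulr_sumr; apply: eq_bigr => a _.
  by rewrite mulr_sumr; apply: eq_bigr => b _; rewrite rmorphM /= mulrCA.
apply: ishom_sum => a _; apply: ishom_sum => b ab; apply: ishomZ.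
have E : (a + b + (l - a - b) = l)%N by rewrite -subnDA subnKC.
case: i => [[|[|[|//]]] ilt].
- apply: (ishom_ext _ (@ishom_mono l.+1 a.+1 b (l - a - b) _)); last by rewrite !addSn E.
  by move=> x; congr (_%:C); rewrite (_ : Ordinal ilt = ord0) ?co0E /mono ?exprS; [ring|exact: val_inj].
- apply: (ishom_ext _ (@ishom_mono l.+1 a b.+1 (l - a - b) _)); last by rewrite addnS addSn E.
  by move=> x; congr (_%:C); rewrite (_ : Ordinal ilt = lift ord0 ord0) ?co1E /mono ?exprS; [ring|exact: val_inj].
- apply: (ishom_ext _ (@ishom_mono l.+1 a b (l - a - b).+1 _)); last by rewrite addnS E.
  by move=> x; congr (_%:C); rewrite (_ : Ordinal ilt = lift ord0 ax1) ?co2E /mono ?exprS; [ring|exact: val_inj].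
Qed.

End polynomial_functions.

Section solid_harmonics.
Context {R : realType}.
Implicit Types (x h : E3 R) (n : nat).

(* Solid zonal harmonics |x|^n |h|^n P_n(cos(x,h)), by the Legendre recurrence
   (n+2) Q_(n+2) = (2n+3) (x.h) Q_(n+1) - (n+1) |x|^2 |h|^2 Q_n. *)
Fixpoint zonal_pair n h x : R * R :=
  if n is k.+1 then
    let: (q0, q1) := zonal_pair k h x in
    (q1, ((2 * k%:R + 3) / (k%:R + 2)) * (dot h x * q1)
         + (- (k%:R + 1) * dot h h / (k%:R + 2)) * (dot x x * q0))
  else (1, dot h x).
Definition zonal n h x : R := (zonal_pair n h x).1.

Lemma zonal0 h x : zonal 0 h x = 1. Proof. by []. Qed.
Lemma zonal1 h x : zonal 1 h x = dot h x. Proof. by []. Qed.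
Lemma zonalSS n h x : zonal n.+2 h x =
  ((2 * n%:R + 3) / (n%:R + 2)) * (dot h x * zonal n.+1 h x)
         + (- (n%:R + 1) * dot h h / (n%:R + 2)) * (dot x x * zonal n h x).
Proof. by rewrite /zonal /=; case: (zonal_pair n h x). Qed.

Lemma zonal_rec n h x : (n%:R + 1) * zonal n.+1 h x =
  (2 * n%:R + 1) * (dot h x * zonal n h x) - n%:R * dot h h * dot x x * zonal n.-1 h x.
Proof.
case: n => [|n]; first by rewrite zonal0 zonal1; ring.
rewrite zonalSS -natr1 /=; field.
by rewrite lt0r_neq0 // ltr_wpDl.
Qed.

(** Induction along the recurrence. The Laplacian of (h.x) Q_(n+1) produces h . grad Q_(n+1), and
    that of |x|^2 Q_n produces x . grad Q_n. The induction therefore carries the lowering identity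
    in the direction h and Euler's identity together with harmonicity. *)
Lemma zonal_D2on n h : exists g k, [/\ D2on setT (zonal n h) g k,
  forall x, lap k x = 0,
  forall x, \sum_(i < 3) co i h * g i x = n%:R * dot h h * zonal n.-1 h x &
  forall x, \sum_(i < 3) co i x * g i x = n%:R * zonal n h x].
Proof.
have Ddot : D2on setT (dot h) (fun i _ => co i h) (fun _ _ => 0).
  split => //.
  - by move=> i x _; apply: (is_derive_eqf (is_derive_dot h x (basis3 i))).
  - by move=> *; exact: is_derive_cst.
  - by move=> x _; exact: continuous_dot.
  - by move=> *; exact: cvg_cst.
  - by move=> *; exact: cvg_cst.
have Dsq : D2on setT (fun x : E3 R => dot x x) (fun i x => 2 * co i x) (fun _ _ => 2).
  apply: (eq_D2on (sqd_D2on setT 0)) => //; first by move=> x; rewrite /sqd subr0.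
  by move=> i x; rewrite subr0.
elim/ltn_ind: n => -[|[|n]] IH.
- exists (fun _ _ => 0), (fun _ _ => 0); split.
  + exact: D2on_cst.
  + by move=> x; rewrite /lap big1.
  + by move=> x; rewrite big1 ?mul0r // => i _; rewrite mulr0.
  + by move=> x; rewrite big1 ?mul0r // => i _; rewrite mulr0.
- exists (fun i _ => co i h), (fun _ _ => 0); split => //.
  + by move=> x; rewrite /lap big1.
  + by move=> x; rewrite sum_co_dot mul1r zonal0 mulr1.
  + by move=> x; rewrite sum_co_dot mul1r zonal1 dotC.
have [g0 [k0 [D0 L0 H0 E0]]] := IH n (ltnW (ltnSn _)).
have [g1 [k1 [D1 L1 H1 E1]]] := IH n.+1 (ltnSn _).
pose al : R := (2 * n%:R + 3) / (n%:R + 2).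
pose be : R := - (n%:R + 1) * dot h h / (n%:R + 2).
have D := D2onD (D2onZ al (D2onM Ddot D1)) (D2onZ be (D2onM Dsq D0)).
exists (fun i x => al * (dot h x * g1 i x + zonal n.+1 h x * co i h) +
   be * (dot x x * g0 i x + zonal n h x * (2 * co i x))).
exists (fun i x => al * (dot h x * k1 i x + zonal n.+1 h x * 0 + 2 * (co i h * g1 i x)) +
   be * (dot x x * k0 i x + zonal n h x * 2 + 2 * (2 * co i x * g0 i x))).
split.
- by apply: (eq_D2on D) => // x; rewrite zonalSS.
- move=> x; have := L0 x; have := L1 x; have := H1 x; have := E0 x.
  rewrite /lap !sum3 /= -natr1 => a1 a2 a3 a4.
  transitivity (al * (dot h x * (k1 ord0 x + k1 ax1 x + k1 ax2 x)
     + 2 * (co ord0 h * g1 ord0 x + co ax1 h * g1 ax1 x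
            + co ax2 h * g1 ax2 x))
    + be * (dot x x * (k0 ord0 x + k0 ax1 x + k0 ax2 x)
     + 6 * zonal n h x
     + 4 * (co ord0 x * g0 ord0 x + co ax1 x * g0 ax1 x
            + co ax2 x * g0 ax2 x))).
    by ring.
  by rewrite a1 a2 a3 a4 /al /be; field.
- move=> x; have := H0 x; have := H1 x; have R1 := zonal_rec n h x.
  have := sum_co_dot h h; have := sum_co_dot h x.
  rewrite !sum3 /= -!natr1 => b1 b2 a1 a2.
  transitivity (al * (dot h x * (co ord0 h * g1 ord0 x + co ax1 h * g1 ax1 x
            + co ax2 h * g1 ax2 x)
     + zonal n.+1 h x * (co ord0 h * co ord0 h + co ax1 h * co ax1 h
            + co ax2 h * co ax2 h))
    + be * (dot x x * (co ord0 h * g0 ord0 x + co ax1 h * g0 ax1 x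
            + co ax2 h * g0 ax2 x)
     + 2 * zonal n h x * (co ord0 h * co ord0 x + co ax1 h * co ax1 x
            + co ax2 h * co ax2 x))).
    by ring.
  rewrite a1 a2 b1 b2.
  have -> : dot x x * (n%:R * dot h h * zonal n.-1 h x) =
     (2 * n%:R + 1) * (dot h x * zonal n h x) - (n%:R + 1) * zonal n.+1 h x.
    by rewrite R1; ring.
  by rewrite /al /be; field.
- move=> x; have := E0 x; have := E1 x.
  have := sum_co_dot x x; have := sum_co_dot x h.
  rewrite !sum3 /= -!natr1 zonalSS -/al -/be => b1 b2 a1 a2.
  transitivity (al * (dot h x * (co ord0 x * g1 ord0 x + co ax1 x * g1 ax1 x
            + co ax2 x * g1 ax2 x)
     + zonal n.+1 h x * (co ord0 x * co ord0 h + co ax1 x * co ax1 h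
            + co ax2 x * co ax2 h))
    + be * (dot x x * (co ord0 x * g0 ord0 x + co ax1 x * g0 ax1 x
            + co ax2 x * g0 ax2 x)
     + 2 * zonal n h x * (co ord0 x * co ord0 x + co ax1 x * co ax1 x
            + co ax2 x * co ax2 x))).
    by ring.
  by rewrite a1 a2 b1 b2 (dotC x h); ring.
Qed.

Lemma polyfun_dot h : polyfun (dot h).
Proof.
rewrite (_ : dot h = (fun x => \sum_(i < 3) co i h * co i x)).
  by apply: polyfun_sum => i _; apply: polyfunM; [exact: polyfun_cst|exact: polyfun_co].
by apply/funext => x; rewrite sum_co_dot.
Qed.

Lemma polyfun_sqr : polyfun (fun x : E3 R => dot x x).
Proof.
rewrite (_ : (fun x => _) = (fun x => \sum_(i < 3) co i x * co i x)).
  by apply: polyfun_sum => i _; apply: polyfunM; exact: polyfun_co.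
by apply/funext => x; rewrite sum_co_dot.
Qed.

Lemma polyfun_zonal n h : polyfun (zonal n h).
Proof.
elim/ltn_ind: n => -[|[|n]] IH; [exact: polyfun_cst|exact: polyfun_dot|].
rewrite (_ : zonal n.+2 h = (fun x => ((2 * n%:R + 3) / (n%:R + 2)) * (dot h x * zonal n.+1 h x)
         + (- (n%:R + 1) * dot h h / (n%:R + 2)) * (dot x x * zonal n h x))); last first.
  by apply/funext => x; rewrite zonalSS.
apply: polyfunD; apply: polyfunM; try exact: polyfun_cst; apply: polyfunM.
- exact: polyfun_dot.
- exact: IH.
- exact: polyfun_sqr.
- by apply: IH; rewrite ltnW.
Qed.

Lemma harmonic_zonal n h (U : set (E3 R)) : harmonic_on U (zonal n h).
Proof.
have [g [k [D L _ _]]] := zonal_D2on n h.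
by apply: (harmonic_on_lap _ _ D L); apply: polyfun_C2; exact: polyfun_zonal.
Qed.

Lemma ishom_zonal n h : ishom n (fun x => (zonal n h x)%:C).
Proof.
have hdot (w : E3 R -> R[i]) l : ishom l w -> ishom l.+1 (fun x => (dot h x)%:C * w x).
  move=> hw; apply: (@ishom_ext _ _ (fun x => \sum_(i < 3) (co i h)%:C * ((co i x)%:C * w x))).
    move=> x; rewrite -sum_co_dot raddf_sum mulr_suml; apply: eq_bigr => i _ /=.
    by rewrite rmorphM mulrA.
  by apply: ishom_sum => i _; apply: ishomZ; exact: ishomM_co.
elim/ltn_ind: n => -[|[|n]] IH.
- by apply: (ishom_ext _ (@ishom_mono R 0 0 0 0 erefl)) => x; rewrite /mono !expr0 !mulr1.
- apply: (ishom_ext _ (hdot _ _ (@ishom_mono R 0 0 0 0 erefl))) => x.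
  by rewrite /mono !expr0 !mulr1 zonal1.
apply: (@ishom_ext _ _ (fun x => ((2 * n%:R + 3) / (n%:R + 2))%:C * ((dot h x)%:C * (zonal n.+1 h x)%:C)
   + (- (n%:R + 1) * dot h h / (n%:R + 2))%:C * (\sum_(i < 3) (co i x)%:C * ((co i x)%:C * (zonal n h x)%:C)))).
  move=> x; have -> : \sum_(i < 3) (co i x)%:C * ((co i x)%:C * (zonal n h x)%:C)
      = (dot x x)%:C * (zonal n h x)%:C.
    rewrite -sum_co_dot raddf_sum mulr_suml; apply: eq_bigr => i _ /=.
    by rewrite rmorphM mulrA.
  by rewrite zonalSS -!rmorphM -rmorphD.
apply: ishomD; apply: ishomZ; first by apply: hdot; exact: IH.
apply: ishom_sum => i _; apply: ishomM_co; apply: ishomM_co.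
by apply: IH; rewrite ltnW.
Qed.

End solid_harmonics.

(** * A harmonic homogeneous polynomial of degree l is determined by 2l+1 coefficients *)

Section harmonic_dimension.
Context {R : realType}.
Implicit Types (x y : E3 R) (l a b c n : nat) (q : nat -> nat -> R[i]).

Lemma poly_zero_on_nat (p : {poly R[i]}) : (forall n, p.[n%:R] = 0) -> p = 0.
Proof.
move=> p0; apply: (@roots_geq_poly_eq0 _ _ [seq n%:R | n <- iota 0 (size p)]).
- by apply/allP => z /mapP[n _ ->]; rewrite /root p0 eqxx.
- by rewrite map_inj_uniq ?iota_uniq //; exact: mulrIn (oner_neq0 _).
- by rewrite size_map size_iota.
Qed.

Lemma poly_def_zero n (F : nat -> R[i]) :
  (forall k : nat, \sum_(a < n) F a * k%:R ^+ a = 0) -> forall a, (a < n)%N -> F a = 0.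
Proof.
move=> H a an; have : (\poly_(j < n) F j) = 0.
  by apply: poly_zero_on_nat => k; rewrite horner_poly H.
by move/(congr1 (fun p : {poly R[i]} => p`_a)); rewrite coef_poly an coef0.
Qed.

Lemma bivariate_zero n (F : nat -> nat -> R[i]) :
  (forall k m : nat, \sum_(a < n) \sum_(b < n) F a b * k%:R ^+ a * m%:R ^+ b = 0) ->
  forall a b, (a < n)%N -> (b < n)%N -> F a b = 0.
Proof.
move=> H a b an bn.
have H1 (m : nat) : \sum_(b < n) F a b * m%:R ^+ b = 0.
  apply: (@poly_def_zero n (fun a => \sum_(b < n) F a b * m%:R ^+ b)) => // k.
  rewrite -[RHS](H k m); apply: eq_bigr => a' _; rewrite mulr_suml.
  by apply: eq_bigr => b' _; rewrite mulrAC.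
exact: (@poly_def_zero n (F a)).
Qed.

Definition ffact2 (a : nat) : R := a%:R * a.-1%:R.

Lemma ffact2_small a : (a < 2)%N -> ffact2 a = 0.
Proof. by case: a => [|[|//]] _; rewrite /ffact2 ?mul0r ?mulr0. Qed.

(** The truncated exponents do no harm: for an exponent below 2 the factor [ffact2] is zero. *)
Definition lapmono a b c x : R :=
  ffact2 a * mono a.-2 b c x + ffact2 b * mono a b.-2 c x + ffact2 c * mono a b c.-2 x.

Lemma co_pow_D2on (i : 'I_3) n : D2on setT (fun x : E3 R => co i x ^+ n)
  (fun j x => (n%:R * co i x ^+ n.-1) * co i (basis3 j))
  (fun j x => (ffact2 n * co i x ^+ n.-2) * co i (basis3 j) ^+ 2).
Proof.
have D : D2on setT (co i : E3 R -> R) (fun j _ => co i (basis3 j)) (fun _ _ => 0).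
  have E : (co i : E3 R -> R) = dot (basis3 i) by apply/funext => y; rewrite /co dotC.
  split.
  - by move=> j x _; rewrite E; exact: is_derive_dot.
  - by move=> *; exact: is_derive_cst.
  - by move=> x _; rewrite E; exact: continuous_dot.
  - by move=> *; exact: cvg_cst.
  - by move=> *; exact: cvg_cst.
have d1 (t : R) : is_derive t 1 (fun s : R => s ^+ n) (n%:R * t ^+ n.-1).
  by have := is_deriveXf n (is_derive_id t (1 : R)); rewrite mulr1.
have d2 (t : R) : is_derive t 1 (fun s : R => n%:R * s ^+ n.-1) (ffact2 n * t ^+ n.-2).
  have := is_deriveMf (is_derive_cst (n%:R : R) t (1 : R)) (is_deriveXf n.-1 (is_derive_id t (1 : R))).
  by move=> H; apply: (is_derive_eqf H); rewrite /ffact2 mulr0 addr0 mulr1 mulrA.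
have cf2 : continuous (fun t : R => ffact2 n * t ^+ n.-2).
  move=> t; have H := is_deriveMf (is_derive_cst (ffact2 n) t (1 : R)) (is_deriveXf n.-2 (is_derive_id t (1 : R))).
  exact: is_derive_continuous H.
apply: (eq_D2on (D2on_comp d1 d2 cf2 D)) => // j x.
by rewrite mulr0 add0r.
Qed.

Lemma mono_D2on a b c : exists g h,
  [/\ D2on setT (mono a b c : E3 R -> R) g h, forall x, lap h x = lapmono a b c x &
    forall x, \sum_(i < 3) co i x * g i x = (a + b + c)%:R * mono a b c x].
Proof.
have D := D2onM (D2onM (co_pow_D2on ord0 a) (co_pow_D2on ax1 b))
   (co_pow_D2on ax2 c).
eexists; eexists; split.
- apply: (eq_D2on D) => //.
  by move=> x; rewrite co0E co1E co2E /mono.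
- move=> x; rewrite /lap sum3 /= /lapmono /mono !co0E !co1E !co2E /basis3 /=.
  by ring.
- move=> x; rewrite sum3 /= /mono !co0E !co1E !co2E /basis3 /= !natrD.
  have E (t : R) n : t * (n%:R * t ^+ n.-1) = n%:R * t ^+ n.
    by case: n => [|n]; rewrite ?mul0r ?mulr0 // exprS mulrCA.
  have := E x.1.1 a; have := E x.1.2 b; have := E x.2 c.
  move: (x.1.1 ^+ a.-1) (x.1.2 ^+ b.-1) (x.2 ^+ c.-1) (x.1.1 ^+ a) (x.1.2 ^+ b) (x.2 ^+ c).
  move=> A' B' C' A B C eC eB eA.
  transitivity (x.1.1 * (a%:R * A') * (B * C) + x.1.2 * (b%:R * B') * (A * C) + x.2 * (c%:R * C') * (A * B)); first by ring.
  by rewrite eA eB eC; ring.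
Qed.

Definition clap l q x : R[i] :=
  \sum_(a < l.+1) \sum_(b < l.+1 | (a + b <= l)%N) q a b * (lapmono a b (l - a - b) x)%:C.

Lemma ReM_real (z : R[i]) (t : R) : complex.Re (z * t%:C) = complex.Re z * t.
Proof. by case: z => a b /=; rewrite mulr0 subr0. Qed.
Lemma ImM_real (z : R[i]) (t : R) : complex.Im (z * t%:C) = complex.Im z * t.
Proof. by case: z => a b /=; rewrite mulr0 add0r. Qed.

Definition rpoly l (f : nat -> nat -> R) x : R :=
  \sum_(a < l.+1) \sum_(b < l.+1 | (a + b <= l)%N) f a b * mono a b (l - a - b) x.

Lemma cre_hompoly l q x : cre (hompoly l q) x = rpoly l (fun a b => complex.Re (q a b)) x.
Proof.
rewrite /cre /hompoly raddf_sum; apply: eq_bigr => a _; rewrite raddf_sum.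
by apply: eq_bigr => b _; rewrite -ReM_real.
Qed.
Lemma cim_hompoly l q x : cim (hompoly l q) x = rpoly l (fun a b => complex.Im (q a b)) x.
Proof.
rewrite /cim /hompoly raddf_sum; apply: eq_bigr => a _; rewrite raddf_sum.
by apply: eq_bigr => b _; rewrite -ImM_real.
Qed.

Lemma polyfun_rpoly l f : polyfun (rpoly l f : E3 R -> R).
Proof.
apply: polyfun_sum => a _; apply: polyfun_sum => b _.
by apply: polyfunM; [exact: polyfun_cst|exact: polyfun_mono].
Qed.

Lemma D2on_sum n (P : pred nat) (O : set (E3 R)) (F : nat -> E3 R -> R)
    (G H : nat -> 'I_3 -> E3 R -> R) :
  (forall j, P j -> D2on O (F j) (G j) (H j)) ->
  D2on O (fun x => \sum_(j < n | P j) F j x) (fun i x => \sum_(j < n | P j) G j i x)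
    (fun i x => \sum_(j < n | P j) H j i x).
Proof.
move=> D; elim: (index_enum _) => [|j s IH].
  apply: (eq_D2on (D2on_cst O 0)); first by move=> x; rewrite big_nil.
  - by move=> i x; rewrite big_nil.
  - by move=> i x; rewrite big_nil.
case Pj: (P j).
  apply: (eq_D2on (D2onD (D _ Pj) IH)); first by move=> x; rewrite big_cons Pj.
  - by move=> i x; rewrite big_cons Pj.
  - by move=> i x; rewrite big_cons Pj.
apply: (eq_D2on IH); first by move=> x; rewrite big_cons Pj.
- by move=> i x; rewrite big_cons Pj.
- by move=> i x; rewrite big_cons Pj.
Qed.

Lemma rpoly_D2on l f : exists g h, [/\ D2on setT (rpoly l f : E3 R -> R) g h,
  forall x, lap h x = \sum_(a < l.+1) \sum_(b < l.+1 | (a + b <= l)%N) f a b * lapmono a b (l - a - b) x &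
  forall x, \sum_(i < 3) co i x * g i x = l%:R * rpoly l f x].
Proof.
pose Q a b c (g h : 'I_3 -> E3 R -> R) := [/\ D2on setT (mono a b c : E3 R -> R) g h,
    forall x, lap h x = lapmono a b c x &
    forall x, \sum_(i < 3) co i x * g i x = (a + b + c)%:R * mono a b c x].
have [G P0] : exists G : nat -> nat -> nat -> 'I_3 -> E3 R -> R, forall a b c, exists h, Q a b c (G a b c) h.
  exists (fun a b c => sval (cid (mono_D2on a b c))) => a b c.
  exact: (svalP (cid (mono_D2on a b c))).
have [H P] : exists H : nat -> nat -> nat -> 'I_3 -> E3 R -> R, forall a b c, Q a b c (G a b c) (H a b c).
  exists (fun a b c => sval (cid (P0 a b c))) => a b c.
  exact: (svalP (cid (P0 a b c))).
have PD a b c : D2on setT (mono a b c : E3 R -> R) (G a b c) (H a b c) by have [] := P a b c.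
have D := @D2on_sum l.+1 xpredT setT
  (fun a x => \sum_(b < l.+1 | (a + b <= l)%N) f a b * mono a b (l - a - b) x)
  (fun a i x => \sum_(b < l.+1 | (a + b <= l)%N) f a b * G a b (l - a - b)%N i x)
  (fun a i x => \sum_(b < l.+1 | (a + b <= l)%N) f a b * H a b (l - a - b)%N i x)
  (fun a _ => @D2on_sum l.+1 (fun b => (a + b <= l)%N) setT
     (fun b x => f a b * mono a b (l - a - b) x)
     (fun b i x => f a b * G a b (l - a - b)%N i x)
     (fun b i x => f a b * H a b (l - a - b)%N i x)
     (fun b _ => D2onZ (f a b) (PD a b (l - a - b)%N))).
eexists; eexists; split; first exact: D.
- move=> x; rewrite /lap exchange_big; apply: eq_bigr => a _ /=.
  rewrite exchange_big; apply: eq_bigr => b _ /=.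
  by have [_ <- _] := P a b (l - a - b)%N; rewrite -mulr_sumr.
- move=> x; transitivity (\sum_(a < l.+1) \sum_(b < l.+1 | (a + b <= l)%N)
     f a b * \sum_(i < 3) co i x * G a b (l - a - b)%N i x).
    under eq_bigr do rewrite mulr_sumr.
    rewrite exchange_big; apply: eq_bigr => a _ /=.
    under eq_bigr do rewrite mulr_sumr.
    rewrite exchange_big; apply: eq_bigr => b _ /=.
    by rewrite mulr_sumr; apply: eq_bigr => i _; rewrite mulrCA.
  rewrite /rpoly mulr_sumr; apply: eq_bigr => a _; rewrite mulr_sumr; apply: eq_bigr => b ab.
  have [_ _ ->] := P a b (l - a - b)%N.
  by rewrite (_ : (a + b + (l - a - b))%N = l) 1?mulrCA // -subnDA subnKC.
Qed.

Lemma charmonic_clap l q : charmonic_on setT (hompoly l q) -> forall x, clap l q x = 0.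
Proof.
have key f : harmonic_on setT (rpoly l f : E3 R -> R) -> forall x,
    \sum_(a < l.+1) \sum_(b < l.+1 | (a + b <= l)%N) f a b * lapmono a b (l - a - b) x = 0.
  move=> [_ H] x; have [g [h [[d1 d2 _ _ _] <- _]]] := rpoly_D2on l f.
  rewrite -[RHS](H x I) /lap; apply: eq_bigr => i _.
  have -> : partial i (rpoly l f) = g i by apply: is_derive_partialE => y; exact: d1.
  by have -> : partial i (g i) = h i by apply: is_derive_partialE => y; exact: d2.
move=> [hr hi] x.
have er : cre (hompoly l q) = rpoly l (fun a b => complex.Re (q a b)) by apply/funext => y; exact: cre_hompoly.
have ei : cim (hompoly l q) = rpoly l (fun a b => complex.Im (q a b)) by apply/funext => y; exact: cim_hompoly.
rewrite er in hr; rewrite ei in hi.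
apply/eqP; rewrite eq_complex /clap !raddf_sum; apply/andP; split; apply/eqP.
  rewrite -[RHS](key _ hr x); apply: eq_bigr => a _; rewrite raddf_sum.
  by apply: eq_bigr => b _; rewrite -ReM_real.
rewrite -[RHS](key _ hi x); apply: eq_bigr => a _; rewrite raddf_sum.
by apply: eq_bigr => b _; rewrite -ImM_real.
Qed.

(* The coefficients of z^0 and z^1 determine a harmonic polynomial: the
   Laplace equation expresses the coefficients of z^k by those of z^(k-2). *)
Lemma clap_zero l q : (forall x, clap l q x = 0) ->
  (forall a b, (a + b <= l)%N -> (l - a - b < 2)%N -> q a b = 0) ->
  forall a b, (a + b <= l)%N -> q a b = 0.
Proof.
move=> H H01.
suff lvl k : forall a b, (a + b <= l)%N -> (l - a - b = k)%N -> q a b = 0.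
  by move=> a b ab; exact: lvl (l - a - b)%N _ _ ab erefl.
elim/ltn_ind: k => k IH a0 b0 ab0 k0.
have [k2|k2] := ltnP k 2; first by apply: H01 => //; rewrite k0.
pose F a b : R[i] := if (a + b <= l)%N && (l - a - b == k)%N then q a b else 0.
have an : (a0 < l.+1)%N by rewrite ltnS (leq_trans _ ab0) // leq_addr.
have bn : (b0 < l.+1)%N by rewrite ltnS (leq_trans _ ab0) // leq_addl.
suff F0 : F a0 b0 = 0 by rewrite -F0 /F ab0 k0 eqxx.
apply: (@bivariate_zero l.+1 F) => // m n.
pose A a b : R[i] := (ffact2 a * (m%:R ^+ a.-2 * n%:R ^+ b) + ffact2 b * (m%:R ^+ a * n%:R ^+ b.-2))%:C.
(* The Laplacian restricted to the vertical line through the integer point (m, n), as a polynomial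
   in z. Its coefficient of z^(k-2) receives the level k through the second z-derivative and the
   level k-2 through the other two; the latter is zero by induction. *)
pose P : {poly R[i]} := \sum_(a < l.+1) \sum_(b < l.+1 | (a + b <= l)%N)
   ((q a b * A a b) *: 'X^(l - a - b) + (q a b * (ffact2 (l - a - b) * (m%:R ^+ a * n%:R ^+ b))%:C) *: 'X^((l - a - b).-2)).
have P0 : P = 0.
  apply: poly_zero_on_nat => j; rewrite -[RHS](H (m%:R, n%:R, j%:R)) /P /clap horner_sum.
  apply: eq_bigr => a _; rewrite horner_sum; apply: eq_bigr => b _.
  rewrite hornerD !hornerZ !hornerXn -!mulrA -mulrDr; congr (_ * _).
  rewrite /lapmono /mono /A /= !(rmorphD, rmorphM, rmorphXn, rmorph_nat) /=.
  by ring.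
have := congr1 (fun p : {poly R[i]} => p`_k.-2) P0.
rewrite coef0 /P coef_sum => E.
have kk : (ffact2 k)%:C != 0 :> R[i].
  rewrite fmorph_eq0 /ffact2 mulf_neq0 // pnatr_eq0; first by rewrite -lt0n (leq_trans _ k2).
  by rewrite -lt0n -ltnS prednK // (leq_trans _ k2).
apply: (mulfI kk); rewrite mulr0 -[RHS]E mulr_sumr; apply: eq_bigr => a _.
rewrite coef_sum mulr_sumr [RHS]big_mkcond; apply: eq_bigr => b _.
rewrite /F; case: ifPn => [/andP[ab /eqP abk]|].
  rewrite ab abk coefD !coefZ !coefXn eqxx mulr1.
  rewrite (_ : (k.-2 == k) = false) ?mulr0 ?add0r; last first.
    by apply/negbTE; rewrite neq_ltn; case: (k) k2 => [|[|k']] //= _; rewrite ltnS leqnSn.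
  by rewrite !(rmorphM, rmorphXn, rmorph_nat) /=; ring.
rewrite negb_and mul0r mul0r mulr0; case: ifPn => //= ab abk.
rewrite coefD !coefZ !coefXn.
have [E2|] := eqVneq k.-2 (l - a - b)%N.
  have kk2 : (k.-2 < k)%N by case: (k) k2 => [|[|k']] //= _; rewrite ltnS leqnSn.
  by rewrite (IH _ kk2 _ _ ab (esym E2)) !mul0r addr0.
(* Another level j with the same [j.-2] as k can only arise by truncation; then j < 2 and [ffact2]
   kills the term. *)
rewrite mulr0 add0r => _; case: eqP => [E2|]; last by rewrite mulr0.
rewrite ffact2_small ?mul0r ?rmorph0 ?mulr0 ?mul0r //.
move: abk E2; case: (l - a - b)%N => [|[|j]] //= jk E2; case: (k) k2 jk E2 => [|[|k']] //= _ jk E2.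
by rewrite E2 eqxx in jk.
Qed.


(** First the l+1 coefficients of z^0, then the l coefficients of z^1. Their number 2l+1 is the
    number of orders m in degree l. *)
Definition low_coeffs l q : 'rV[R[i]]_(l.*2.+1) :=
  \row_j (if (j < l.+1)%N then q j (l - j)%N else q (j - l.+1)%N (l - (j - l.+1)).-1).

Lemma low_coeffs_zero l q : low_coeffs l q = 0 ->
  forall a b, (a + b <= l)%N -> (l - a - b < 2)%N -> q a b = 0.
Proof.
move=> /rowP H a b ab; rewrite ltnS leq_eqVlt ltnS leqn0 => /orP[/eqP E|/eqP E].
- have la : (a < l)%N by rewrite -subn_gt0 (leq_trans _ (leq_subr b _)) // E.
  have jl : (l.+1 + a < l.*2.+1)%N by rewrite addSn ltnS -addnn ltn_add2l.
  have := H (Ordinal jl); rewrite !mxE /= ltnNge leq_addr /= addKn.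
  by rewrite (_ : (l - a).-1 = b) // -subn1 -E subKn // leq_subRL // ltnW.
- have al : (a < l.+1)%N by rewrite ltnS (leq_trans _ ab) // leq_addr.
  have jl : (a < l.*2.+1)%N by rewrite (leq_trans al) // ltnS -addnn leq_addr.
  have := H (Ordinal jl); rewrite !mxE /= al.
  rewrite (_ : (l - a = b)%N) //; apply/eqP; rewrite eqn_leq -[X in X && _]/(_ - _ <= _)%N.
  by rewrite -subn_eq0 E eqxx /= leq_subRL ?(leq_trans _ ab) // leq_addr.
Qed.

Lemma hompoly_comb l n (q_ : 'I_n -> nat -> nat -> R[i]) (v : 'I_n -> R[i]) x :
  hompoly l (fun a b => \sum_m v m * q_ m a b) x = \sum_m v m * hompoly l (q_ m) x.
Proof.
transitivity (\sum_m \sum_(a < l.+1) \sum_(b < l.+1 | (a + b <= l)%N)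
   v m * (q_ m a b * (mono a b (l - a - b) x)%:C)).
  rewrite exchange_big; apply: eq_bigr => a _ /=; rewrite exchange_big; apply: eq_bigr => b _ /=.
  by rewrite mulr_suml; apply: eq_bigr => m _; rewrite mulrA.
apply: eq_bigr => m _; rewrite mulr_sumr; apply: eq_bigr => a _.
by rewrite mulr_sumr.
Qed.

Lemma clap_comb l n (q_ : 'I_n -> nat -> nat -> R[i]) (v : 'I_n -> R[i]) x :
  clap l (fun a b => \sum_m v m * q_ m a b) x = \sum_m v m * clap l (q_ m) x.
Proof.
transitivity (\sum_m \sum_(a < l.+1) \sum_(b < l.+1 | (a + b <= l)%N)
   v m * (q_ m a b * (lapmono a b (l - a - b) x)%:C)).
  rewrite exchange_big; apply: eq_bigr => a _ /=; rewrite exchange_big; apply: eq_bigr => b _ /=.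
  by rewrite mulr_suml; apply: eq_bigr => m _; rewrite mulrA.
apply: eq_bigr => m _; rewrite mulr_sumr; apply: eq_bigr => a _.
by rewrite mulr_sumr.
Qed.

Lemma low_coeffs_comb l n (q_ : 'I_n -> nat -> nat -> R[i]) (v : 'I_n -> R[i]) :
  low_coeffs l (fun a b => \sum_m v m * q_ m a b) = \sum_m v m *: low_coeffs l (q_ m).
Proof.
by apply/rowP => j; rewrite summxE mxE; case: ifP => jl; apply: eq_bigr => m _; rewrite !mxE jl.
Qed.

Lemma eq_hompoly l q q' x : (forall a b, (a + b <= l)%N -> q a b = q' a b) ->
  hompoly l q x = hompoly l q' x.
Proof. by move=> E; apply: eq_bigr => a _; apply: eq_bigr => b ab; rewrite E. Qed.

(* Independent harmonic polynomials, as many as low coefficients, span. *)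
Lemma harmonic_span l (q_ : 'I_(l.*2.+1) -> nat -> nat -> R[i]) :
  (forall m x, clap l (q_ m) x = 0) ->
  (forall v : 'I_(l.*2.+1) -> R[i],
     (forall x, enorm x = 1 -> \sum_m v m * hompoly l (q_ m) x = 0) -> forall m, v m = 0) ->
  forall q, (forall x, clap l q x = 0) ->
  exists v : 'I_(l.*2.+1) -> R[i], forall x, hompoly l q x = \sum_m v m * hompoly l (q_ m) x.
Proof.
move=> hq indep q hq0.
pose A : 'M[R[i]]_(l.*2.+1) := \matrix_m low_coeffs l (q_ m).
have mulA (v : 'rV_(l.*2.+1)) : v *m A = low_coeffs l (fun a b => \sum_m v ord0 m * q_ m a b).
  by rewrite low_coeffs_comb mulmx_sum_row; apply: eq_bigr => m _; rewrite rowK.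
(* A left kernel vector of A gives a harmonic combination with vanishing low coefficients, hence the
   zero polynomial; independence on the sphere makes the vector zero. *)
have fA : row_free A.
  apply/row_freeP; apply: contrapT => nA.
  have : kermx A != 0 by rewrite kermx_eq0; apply/negP => /row_freeP.
  case/rowV0Pn => v /sub_kermxP vA /eqP v0; apply: v0.
  rewrite mulA in vA.
  have H := clap_zero (fun x => _) (low_coeffs_zero vA).
  have {}H : forall a b, (a + b <= l)%N -> \sum_m v ord0 m * q_ m a b = 0.
    by apply: H => x; rewrite clap_comb big1 // => m _; rewrite hq mulr0.
  apply/rowP => m; rewrite mxE; apply: (indep (fun m => v ord0 m)) => x _.
  rewrite -hompoly_comb (@eq_hompoly _ _ (fun _ _ => 0)) //.
  by rewrite /hompoly big1 // => a _; rewrite big1 // => b _; rewrite mul0r.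
have [B AB] : exists B, B *m A = 1%:M by exists (invmx A); rewrite mulVmx // -row_free_unit.
pose w := low_coeffs l q *m B.
have wA : w *m A = low_coeffs l q by rewrite /w -mulmxA AB mulmx1.
exists (fun m => w ord0 m) => x; rewrite -hompoly_comb; apply: eq_hompoly => a b ab.
apply/eqP; rewrite -subr_eq0; apply/eqP.
(* The difference is written as a combination of two coefficient families, so that [clap_comb] and
   [low_coeffs_comb] apply to it. *)
pose d a b := \sum_(m < 2) (if m == ord0 then 1 else -1 : R[i]) *
   (if m == ord0 then q a b else \sum_m w ord0 m * q_ m a b).
have dE a' b' : q a' b' - \sum_m w ord0 m * q_ m a' b' = d a' b'.
  by rewrite /d !big_ord_recl big_ord0 /= mul1r mulN1r addr0.
pose r_ (m : 'I_2) := if m == ord0 then q else (fun a b => \sum_m w ord0 m * q_ m a b).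
have dE' : d = (fun a b => \sum_(m < 2) (if m == ord0 then 1 else -1 : R[i]) * r_ m a b).
  by apply/funext => a'; apply/funext => b'; apply: eq_bigr => m _; rewrite /r_; case: ifP.
suff H : forall a' b', (a' + b' <= l)%N -> d a' b' = 0 by rewrite dE; exact: H.
rewrite dE'; apply: clap_zero.
- move=> x'; rewrite clap_comb !big_ord_recl big_ord0 /r_ /= hq0 clap_comb big1 ?mulr0 ?addr0 //.
  by move=> m _; rewrite hq mulr0.
- apply: low_coeffs_zero; rewrite low_coeffs_comb !big_ord_recl big_ord0 /r_ /=.
  by rewrite -mulA wA scale1r scaleN1r addr0 subrr.
Qed.

End harmonic_dimension.

(** * Linearity of the sphere integral and completeness of the given spherical harmonics in each
    degree *)

Section sphere_integral.
Context {R : realType}.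
Implicit Types (u w : E3 R -> R) (F G : R -> R -> R).
Local Notation leb := (@lebesgue_measure R).

(** [sphere_int] is an iterated integral, additive only where both the inner and the outer
    integrands are integrable. For sums of products of continuous functions of one angle both are
    evident, and polynomials in spherical coordinates are of this kind. *)
Inductive separable : (R -> R -> R) -> Prop :=
| separable1 (g h : R -> R) : continuous g -> continuous h -> separable (fun t p => g t * h p)
| separableD F G : separable F -> separable G -> separable (fun t p => F t p + G t p).

Lemma separableM F G : separable F -> separable G -> separable (fun t p => F t p * G t p).
Proof.
move=> sF sG; elim: sF => [g h cg ch|F1 F2 _ IH1 _ IH2]; last first.
  rewrite (_ : (fun t p => _) = (fun t p => F1 t p * G t p + F2 t p * G t p)); first exact: separableD.
  by apply/funext => t; apply/funext => p; rewrite mulrDl.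
elim: sG => [g' h' cg' ch'|F1 F2 _ IH1 _ IH2]; last first.
  rewrite (_ : (fun t p => _) = (fun t p => g t * h p * F1 t p + g t * h p * F2 t p)); first exact: separableD.
  by apply/funext => t; apply/funext => p; rewrite mulrDr.
rewrite (_ : (fun t p => _) = (fun t p => (g t * g' t) * (h p * h' p))).
  by apply: (@separable1 (fun t => g t * g' t) (fun p => h p * h' p)) => t;
     apply: cvgM; [exact: cg|exact: cg'|exact: ch|exact: ch'].
by apply/funext => t; apply/funext => p; rewrite mulrACA.
Qed.

Definition sphere_pt (t p : R) : E3 R := (sin t * cos p, sin t * sin p, cos t).

Lemma enorm_sphere_pt t p : enorm (sphere_pt t p) = 1.
Proof.
rewrite /enorm /dot /= (_ : _ + _ = 1) ?sqrtr1 //.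
rewrite -[RHS](cos2Dsin2 t) -[X in _ = _ + X]mulr1 -(cos2Dsin2 p); ring.
Qed.

Lemma polyfun_separable u : polyfun u -> separable (fun t p => u (sphere_pt t p)).
Proof.
have c1 : continuous (fun _ : R => 1 : R) by move=> t; exact: cvg_cst.
elim => [c|i|u1 u2 _ IH1 _ IH2|u1 u2 _ IH1 _ IH2].
- rewrite (_ : (fun t p => _) = (fun _ _ => c * 1)).
    by apply: (@separable1 (fun=> c) (fun=> 1)) => // t; exact: cvg_cst.
  by apply/funext => t; apply/funext => p; rewrite mulr1.
- have : [\/ i = ord0, i = lift ord0 ord0 | i = lift ord0 ax1].
    case: i => -[|[|[|//]]] p; [apply: Or31|apply: Or32|apply: Or33]; exact: val_inj.
  case=> ->.
  + rewrite (_ : (fun t p => _) = (fun t p => sin t * cos p)).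
      by apply: separable1; [exact: continuous_sin|exact: continuous_cos].
    by apply/funext => t; apply/funext => p; rewrite co0E.
  + rewrite (_ : (fun t p => _) = (fun t p => sin t * sin p)).
      by apply: separable1; exact: continuous_sin.
    by apply/funext => t; apply/funext => p; rewrite co1E.
  + rewrite (_ : (fun t p => _) = (fun t p => cos t * 1)).
      by apply: (@separable1 _ (fun=> 1)) => //; exact: continuous_cos.
    by apply/funext => t; apply/funext => p; rewrite co2E mulr1.
- exact: separableD.
- exact: separableM.
Qed.

Lemma continuous_integrable_itv (g : R -> R) a b : continuous g -> leb.-integrable `[a, b] (EFin \o g).
Proof.
move=> cg; apply: (@continuous_compact_integrable R g) => //; first exact: segment_compact.
exact: continuous_subspaceT.
Qed.

Lemma separable_integrable F a b c d : separable F ->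
  (forall t, leb.-integrable `[c, d] (EFin \o F t)) /\
  leb.-integrable `[a, b] (EFin \o (fun t => \int[leb]_(p in `[c, d]) F t p)).
Proof.
elim=> [g h cg ch|F1 F2 _ [i1 j1] _ [i2 j2]].
  split=> [t|].
    apply: continuous_integrable_itv => p; apply: cvgM; first exact: cvg_cst.
    exact: ch.
  rewrite (_ : (fun t => _) = (fun t => g t * \int[leb]_(p in `[c, d]) h p)).
    apply: continuous_integrable_itv => t; apply: cvgM; first exact: cg.
    exact: cvg_cst.
  by apply/funext => t; rewrite RintegralZl //; exact: continuous_integrable_itv.
split=> [t|].
  have -> : EFin \o (fun p => F1 t p + F2 t p) = (EFin \o F1 t) \+ (EFin \o F2 t) by [].
  by apply: integrableD.
rewrite (_ : EFin \o _ = (EFin \o (fun t => \int[leb]_(p in `[c, d]) F1 t p)) \+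
  (EFin \o (fun t => \int[leb]_(p in `[c, d]) F2 t p))).
  exact: integrableD.
by apply/funext => t /=; rewrite RintegralD.
Qed.

Lemma sphere_separable u : polyfun u -> separable (fun t p => u (sphere_pt t p) * sin t).
Proof.
move=> /polyfun_separable s; apply: separableM => //.
rewrite (_ : (fun t p => _) = (fun t p => sin t * 1)).
  by apply: (@separable1 _ (fun=> 1)) => [|t]; [exact: continuous_sin|exact: cvg_cst].
by apply/funext => t; apply/funext => p; rewrite mulr1.
Qed.

Lemma sphere_intE u : sphere_int u =
  \int[leb]_(t in `[0, pi]) \int[leb]_(p in `[0, pi *+ 2]) (u (sphere_pt t p) * sin t).
Proof. by []. Qed.

Lemma sphere_intD u w : polyfun u -> polyfun w ->
  sphere_int (fun x => u x + w x) = sphere_int u + sphere_int w.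
Proof.
move=> /sphere_separable su /sphere_separable sw.
have [iu ju] := separable_integrable 0 pi 0 (pi *+ 2) su.
have [iw jw] := separable_integrable 0 pi 0 (pi *+ 2) sw.
rewrite !sphere_intE -RintegralD //; congr (Rintegral _ _ _); apply/funext => t.
by rewrite -RintegralD //; congr (Rintegral _ _ _); apply/funext => p; rewrite mulrDl.
Qed.

Lemma sphere_intZ c u : polyfun u -> sphere_int (fun x => c * u x) = c * sphere_int u.
Proof.
move=> /sphere_separable su.
have [iu ju] := separable_integrable 0 pi 0 (pi *+ 2) su.
rewrite !sphere_intE -RintegralZl //; congr (Rintegral _ _ _); apply/funext => t.
by rewrite -RintegralZl //; congr (Rintegral _ _ _); apply/funext => p; rewrite mulrA.
Qed.

Lemma eq_sphere_int u w : (forall x, enorm x = 1 -> u x = w x) -> sphere_int u = sphere_int w.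
Proof.
move=> E; apply: eq_Rintegral => t _; apply: eq_Rintegral => p _.
by rewrite (E (sphere_pt t p)) // enorm_sphere_pt.
Qed.

Definition cpolyfun (f : E3 R -> R[i]) := polyfun (cre f) /\ polyfun (cim f).

Lemma cpolyfun_hompoly l q : cpolyfun (hompoly l q).
Proof.
have er : cre (hompoly l q) = rpoly l (fun a b => complex.Re (q a b)) by apply/funext => y; exact: cre_hompoly.
have ei : cim (hompoly l q) = rpoly l (fun a b => complex.Im (q a b)) by apply/funext => y; exact: cim_hompoly.
by split; rewrite ?er ?ei; exact: polyfun_rpoly.
Qed.

Lemma eq_sphere_dot (f f' g g' : E3 R -> R[i]) : (forall x, enorm x = 1 -> f x = f' x) ->
  (forall x, enorm x = 1 -> g x = g' x) -> sphere_dot f g = sphere_dot f' g'.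
Proof.
move=> E E'; rewrite /sphere_dot.
rewrite (@eq_sphere_int (cre (fun x => f x * conjc (g x))) (cre (fun x => f' x * conjc (g' x)))); last first.
  by move=> x x1; rewrite /cre (E _ x1) (E' _ x1).
rewrite (@eq_sphere_int (cim (fun x => f x * conjc (g x))) (cim (fun x => f' x * conjc (g' x)))) //.
by move=> x x1; rewrite /cim (E _ x1) (E' _ x1).
Qed.

Lemma sphere_dotDZ (f1 f2 g : E3 R -> R[i]) c : cpolyfun f1 -> cpolyfun f2 -> cpolyfun g ->
  sphere_dot (fun x => f1 x + c * f2 x) g = sphere_dot f1 g + c * sphere_dot f2 g.
Proof.
move=> [p1 q1] [p2 q2] [pg qg].
have P f : polyfun (cre f) -> polyfun (cim f) ->
    polyfun (cre (fun x => f x * conjc (g x))) /\ polyfun (cim (fun x => f x * conjc (g x))).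
  move=> pf qf; split.
    rewrite (_ : cre _ = (fun x => cre f x * cre g x + cim f x * cim g x)).
      by apply: polyfunD; exact: polyfunM.
    by apply/funext => x; rewrite /cre /cim; case: (f x) (g x) => a b [a' b'] /=; rewrite mulrN opprK.
  rewrite (_ : cim _ = (fun x => cim f x * cre g x + (-1) * (cre f x * cim g x))).
    by apply: polyfunD; [exact: polyfunM|apply: polyfunM; [exact: polyfun_cst|exact: polyfunM]].
  by apply/funext => x; rewrite /cre /cim; case: (f x) (g x) => a b [a' b'] /=; ring.
have [a1 b1] := P _ p1 q1; have [a2 b2] := P _ p2 q2.
have Z k u : polyfun u -> polyfun (fun x => k * u x) by move=> pu; apply: polyfunM => //; exact: polyfun_cst.
case: c => s t; rewrite /sphere_dot; apply/eqP; rewrite eq_complex /=; apply/andP; split; apply/eqP.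
  rewrite (_ : cre _ = (fun x => cre (fun x => f1 x * conjc (g x)) x +
    (s * cre (fun x => f2 x * conjc (g x)) x + (- t) * cim (fun x => f2 x * conjc (g x)) x))).
    rewrite sphere_intD //; last by apply: polyfunD; exact: Z.
    by rewrite sphere_intD ?sphere_intZ //; try exact: Z; rewrite mulNr.
  by apply/funext => x; rewrite /cre /cim; case: (f1 x) (f2 x) (g x) => a b [a' b'] [a'' b''] /=; ring.
rewrite (_ : cim _ = (fun x => cim (fun x => f1 x * conjc (g x)) x +
    (s * cim (fun x => f2 x * conjc (g x)) x + t * cre (fun x => f2 x * conjc (g x)) x))).
  rewrite sphere_intD //; last by apply: polyfunD; exact: Z.
  by rewrite sphere_intD ?sphere_intZ //; try exact: Z.
by apply/funext => x; rewrite /cre /cim; case: (f1 x) (f2 x) (g x) => a b [a' b'] [a'' b''] /=; ring.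
Qed.

Lemma sphere_dot0 (g : E3 R -> R[i]) : cpolyfun g -> sphere_dot (fun=> 0) g = 0.
Proof.
have c0 : cpolyfun (fun=> 0 : R[i]) by split; exact: polyfun_cst.
move=> cg; have := sphere_dotDZ (-1) c0 c0 cg.
by rewrite mulr0 addr0 mulN1r subrr.
Qed.

Lemma cpolyfunDZ (f1 f2 : E3 R -> R[i]) c : cpolyfun f1 -> cpolyfun f2 -> cpolyfun (fun x => f1 x + c * f2 x).
Proof.
move=> [p1 q1] [p2 q2]; case: c => s t.
have Z k u : polyfun u -> polyfun (fun x => k * u x) by move=> pu; apply: polyfunM => //; exact: polyfun_cst.
split.
  rewrite (_ : cre _ = (fun x => cre f1 x + (s * cre f2 x + (- t) * cim f2 x))).
    by apply: polyfunD => //; apply: polyfunD; exact: Z.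
  by apply/funext => x; rewrite /cre /cim; case: (f1 x) (f2 x) => a b [a' b'] /=; ring.
rewrite (_ : cim _ = (fun x => cim f1 x + (s * cim f2 x + t * cre f2 x))).
  by apply: polyfunD => //; apply: polyfunD; exact: Z.
by apply/funext => x; rewrite /cre /cim; case: (f1 x) (f2 x) => a b [a' b'] /=; ring.
Qed.

Lemma sphere_dot_sum n (f : 'I_n -> E3 R -> R[i]) (v : 'I_n -> R[i]) (g : E3 R -> R[i]) :
  (forall m, cpolyfun (f m)) -> cpolyfun g ->
  sphere_dot (fun x => \sum_m v m * f m x) g = \sum_m v m * sphere_dot (f m) g.
Proof.
move=> pf pg; suff : forall s : seq 'I_n, cpolyfun (fun x => \sum_(m <- s) v m * f m x) /\
    sphere_dot (fun x => \sum_(m <- s) v m * f m x) g = \sum_(m <- s) v m * sphere_dot (f m) g.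
  by move=> H; exact: (H _).2.
elim=> [|m s [IH1 IH2]].
  rewrite (_ : (fun x => _) = (fun=> 0)); last by apply/funext => x; rewrite big_nil.
  by rewrite big_nil sphere_dot0 //; split=> //; split; exact: polyfun_cst.
rewrite (_ : (fun x => _) = (fun x => \sum_(m <- s) v m * f m x + v m * f m x)); last first.
  by apply/funext => x; rewrite big_cons addrC.
split; first exact: cpolyfunDZ.
by rewrite sphere_dotDZ // IH2 big_cons addrC.
Qed.

(** Orthonormality makes the 2l+1 functions of degree l independent, and [harmonic_span] turns
    independence into spanning. *)
Lemma spherical_harmonics_span (Y : forall l : nat, 'I_(l.*2.+1) -> E3 R -> R[i]) :
  orthonormal_spherical_harmonics Y -> forall l q, charmonic_on setT (hompoly l q) ->
  exists v : 'I_(l.*2.+1) -> R[i],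
    forall x, enorm x = 1 -> hompoly l q x = \sum_m v m * Y l m x.
Proof.
move=> [sY oY] l q hq.
have [q_ q_P] : exists q_ : 'I_(l.*2.+1) -> nat -> nat -> R[i], forall m,
    charmonic_on setT (hompoly l (q_ m)) /\ forall x, enorm x = 1 -> Y l m x = hompoly l (q_ m) x.
  exists (fun m => sval (cid (sY l m))) => m; exact: (svalP (cid (sY l m))).
have [] := @harmonic_span R l q_ _ _ q (charmonic_clap hq).
- by move=> m; exact: charmonic_clap (q_P m).1.
- move=> v v0 m; transitivity (\sum_k v k * sphere_dot (Y l k) (Y l m)).
    rewrite (bigD1 m) //= oY !eqxx mulr1 big1 ?addr0 // => k km.
    by rewrite oY eqxx (negbTE (_ : (k != m :> nat))) ?mulr0.
  transitivity (\sum_k v k * sphere_dot (hompoly l (q_ k)) (hompoly l (q_ m))).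
    apply: eq_bigr => k _; congr (_ * _); apply: eq_sphere_dot => x x1; exact: (q_P _).2.
  rewrite -sphere_dot_sum; [|by move=> k; exact: cpolyfun_hompoly|exact: cpolyfun_hompoly].
  rewrite (@eq_sphere_dot _ (fun=> 0) _ (hompoly l (q_ m))) //; first exact/sphere_dot0/cpolyfun_hompoly.
- move=> v vE; exists v => x x1; rewrite vE; apply: eq_bigr => m _.
  by rewrite (q_P m).2.
Qed.

End sphere_integral.

(** * Multipole expansion and pole pushing *)

Section newton_expansion.
Context {R : realType}.
Implicit Types (x h z : E3 R) (n N : nat).

(** The recurrence has coefficients at most 2 and 1 in absolute value, and 2 * 3 + 1 <= 3^2. The
    factor 3^n in place of |P_n| <= 1 only shrinks the radius of convergence, which pole pushing
    tolerates. *)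
Lemma zonal_le n h x : `|zonal n h x| <= (3 * (enorm h * enorm x)) ^+ n.
Proof.
have := dot_le h x; set m := enorm h * enorm x => dm.
have m0 : 0 <= m by rewrite mulr_ge0 ?enorm_ge0.
have m2 : dot h h * dot x x = m ^+ 2 by rewrite -!enorm_sqr /m exprMn.
elim/ltn_ind: n => -[|[|n]] IH.
- by rewrite zonal0 expr0 normr1.
- by rewrite zonal1 expr1; apply: (le_trans dm); rewrite ler_peMl //; lra.
have I0 := IH n (ltnW (ltnSn _)); have I1 := IH n.+1 (ltnSn _).
have c1 : `|(2 * n%:R + 3) / (n%:R + 2) : R| <= 2.
  by rewrite ger0_norm ?divr_ge0 ?addr_ge0 ?mulr_ge0 // ler_pdivrMr //; lra.
have c2 : `|- (n%:R + 1) / (n%:R + 2) : R| <= 1.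
  by rewrite mulNr normrN ger0_norm ?divr_ge0 ?addr_ge0 // ler_pdivrMr //; lra.
rewrite zonalSS; apply: (le_trans (ler_normD _ _)).
have P0 : 0 <= (3 * m) ^+ n by rewrite exprn_ge0 // mulr_ge0.
have B1 : `|(2 * n%:R + 3) / (n%:R + 2) * (dot h x * zonal n.+1 h x)| <= 2 * (m * (3 * m) ^+ n.+1).
  by rewrite normrM; apply: ler_pM => //; rewrite normrM; apply: ler_pM.
have B2 : `|- (n%:R + 1) * dot h h / (n%:R + 2) * (dot x x * zonal n h x)| <= m ^+ 2 * (3 * m) ^+ n.
  rewrite (_ : _ * _ = (- (n%:R + 1) / (n%:R + 2)) * (m ^+ 2 * zonal n h x)); last by rewrite -m2; ring.
  rewrite normrM -[leRHS]mul1r; apply: ler_pM => //.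
  by rewrite normrM ger0_norm ?sqr_ge0 // ler_wpM2l ?sqr_ge0.
apply: (le_trans (lerD B1 B2)); rewrite !exprS expr0.
have : 0 <= m * m * (3 * m) ^+ n by rewrite mulr_ge0 // mulr_ge0.
lra.
Qed.

Lemma zonalZ n h x (s : R) : zonal n (s *: h) x = s ^+ n * zonal n h x.
Proof.
elim/ltn_ind: n => -[|[|n]] IH.
- by rewrite !zonal0 mulr1.
- by rewrite !zonal1 dotZl expr1.
rewrite !zonalSS (IH n.+1) // (IH n) ?(ltnW (ltnSn _)) // !dotZl dotZr !exprS; ring.
Qed.

Lemma dist_le_derive (F f : R -> R) (K : R) :
  (forall s : R, 0 <= s <= 1 -> is_derive s 1 F (f s)) ->
  (forall s : R, 0 <= s <= 1 -> `|f s| <= K) -> `|F 1 - F 0| <= K.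
Proof.
move=> D B.
have [s s01 ->] : exists2 s : R, s \in `]0, 1[ & F 1 - F 0 = f s * (1 - 0).
  apply: MVT => //; first by move=> s; rewrite in_itv /= => /andP[a b]; apply: D; rewrite !ltW.
  apply: derivable_within_continuous => s; rewrite in_itv /= => s01.
  by have [] := D s s01.
rewrite subr0 mulr1; apply: B; move: s01; rewrite in_itv /= => /andP[a b]; by rewrite !ltW.
Qed.

(** The term of degree n in the expansion of 1/|x-h| in powers of h. It is the Kelvin transform in x
    of the zonal harmonic, of size |h|^n / |x|^(n+1) up to 3^n. *)
Definition qker n h x : R := zonal n h x / enorm x ^+ n.*2.+1.

Lemma qker0 h x : qker 0 h x = (enorm x)^-1.
Proof. by rewrite /qker zonal0 mul1r expr1. Qed.

Lemma qkerZ n h x (s : R) : qker n (s *: h) x = s ^+ n * qker n h x.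
Proof. by rewrite /qker zonalZ mulrA. Qed.

Lemma qker_le n h x : 0 < enorm x -> `|qker n h x| <= (3 * (enorm h / enorm x)) ^+ n / enorm x.
Proof.
move=> x0; rewrite /qker normrM normrV ?unitfE ?gt_eqF ?exprn_gt0 // (ger0_norm (exprn_ge0 _ (ltW x0))).
rewrite exprS invfM -addnn exprD invfM.
have z := zonal_le n h x; have i0 : 0 < (enorm x)^-1 by rewrite invr_gt0.
apply: (@le_trans _ _ ((3 * (enorm h * enorm x)) ^+ n * ((enorm x)^-1 * ((enorm x ^+ n)^-1 * (enorm x ^+ n)^-1)))).
  apply: ler_wpM2r => //; apply: mulr_ge0; first exact: ltW.
  by rewrite -exprVn mulr_ge0 // exprn_ge0 // ltW.
rewrite !exprMn -!exprVn; set X := enorm x.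
rewrite (_ : (3 ^+ n * (enorm h ^+ n * X ^+ n)) * (X^-1 * (X^-1 ^+ n * X^-1 ^+ n)) =
  (X * X^-1) ^+ n * (3 ^+ n * (enorm h ^+ n * X^-1 ^+ n) / X)); first by rewrite divff ?gt_eqF // expr1n mul1r.
by rewrite exprMn; ring.
Qed.

Lemma qker_rec n h x : 0 < enorm x ->
  (n%:R + 1) * enorm x ^+ 2 * qker n.+1 h x =
  (2 * n%:R + 1) * dot h x * qker n h x - n%:R * dot h h * qker n.-1 h x.
Proof.
move=> x0; have xn : enorm x != 0 by rewrite gt_eqF.
have xn2 k : enorm x ^+ k != 0 by rewrite expf_neq0.
rewrite /qker; case: n => [|n].
  by rewrite zonal0 zonal1 /=; field.
have := zonal_rec n.+1 h x; rewrite -[dot x x]enorm_sqr /= => E.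
apply: (mulIf (xn2 n.+1.*2.+1)); rewrite mulrBl.
rewrite doubleS !doubleS.
rewrite (_ : _ * _ * (zonal n.+2 h x / _) * _ = (n.+1%:R + 1) * zonal n.+2 h x); last first.
  by rewrite [in _ / _]exprS [in _ / _]exprS; field; rewrite xn2 xn.
rewrite E; congr (_ - _); first by field; exact: xn2.
rewrite -enorm_sqr (_ : enorm x ^+ n.*2.+3 = enorm x ^+ 2 * enorm x ^+ n.*2.+1); last by rewrite -exprD.
by field; exact: xn2.
Qed.

Definition taylor_sum N h x (s : R) : R := \sum_(n < N.+1) s ^+ n * qker n h x.
Definition taylor_sum1 N h x (s : R) : R := \sum_(n < N.+1) (n%:R * s ^+ n.-1) * qker n h x.

Lemma taylor_sum_derive N h x (s : R) : is_derive s 1 (taylor_sum N h x) (taylor_sum1 N h x s).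
Proof.
elim: N => [|N IH].
  rewrite (_ : taylor_sum 0 h x = fun=> qker 0 h x); last first.
    by apply/funext => t; rewrite /taylor_sum big_ord1 mul1r.
  by rewrite /taylor_sum1 big_ord1 !mul0r; exact: is_derive_cst.
rewrite (_ : taylor_sum N.+1 h x = fun t => taylor_sum N h x t + t ^+ N.+1 * qker N.+1 h x); last first.
  by apply/funext => t; rewrite /taylor_sum big_ord_recr.
rewrite /taylor_sum1 big_ord_recr /= -/(taylor_sum1 N h x s).
have := is_deriveMf (is_deriveXf N.+1 (is_derive_id s (1 : R))) (is_derive_cst (qker N.+1 h x) s (1 : R)).
by move=> H; apply: (is_derive_eqf (is_deriveDf IH H)); rewrite mulr0 add0r mulr1 mulrC.
Qed.

(* The Legendre recurrence makes all but the last two terms of the derivative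
   of |x - s h| * taylor_sum N cancel. *)
Lemma taylor_sum_identity N h x (s : R) : 0 < enorm x ->
  (- dot h x + s * dot h h) * taylor_sum N h x s
    + (enorm x ^+ 2 - 2 * s * dot h x + s ^+ 2 * dot h h) * taylor_sum1 N h x s
  = (N%:R + 1) * s ^+ N * (- enorm x ^+ 2 * qker N.+1 h x + s * dot h h * qker N h x).
Proof.
move=> x0; elim: N => [|N IH].
  have := qker_rec 0 h x0; rewrite /taylor_sum /taylor_sum1 !big_ord1 /= !mul0r !mulr0 !add0r subr0 !mul1r => E.
  by rewrite addr0 mulNr E; ring.
have := qker_rec N.+1 h x0; rewrite /= => E.
rewrite /taylor_sum /taylor_sum1 big_ord_recr [in X in _ + X]big_ord_recr /=.
rewrite -/(taylor_sum N h x s) -/(taylor_sum1 N h x s).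
rewrite (_ : _ + _ = ((- dot h x + s * dot h h) * taylor_sum N h x s
    + (enorm x ^+ 2 - 2 * s * dot h x + s ^+ 2 * dot h h) * taylor_sum1 N h x s)
   + ((- dot h x + s * dot h h) * s ^+ N.+1
    + (enorm x ^+ 2 - 2 * s * dot h x + s ^+ 2 * dot h h) * (N.+1%:R * s ^+ N)) * qker N.+1 h x); last by ring.
rewrite IH (_ : (N.+1%:R + 1) * s ^+ N.+1 * (- enorm x ^+ 2 * qker N.+2 h x + _) =
  - s ^+ N.+1 * ((N.+1%:R + 1) * enorm x ^+ 2 * qker N.+2 h x) + (N.+1%:R + 1) * s ^+ N.+1 * (s * dot h h * qker N.+1 h x)); last by ring.
rewrite E -natr1 !exprS; ring.
Qed.

(** F(s) = |x - s h| times the partial sum at s h satisfies F(0) = 1, and by [taylor_sum_identity]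
    its derivative on [0, 1] is small. So F(1) is close to 1; dividing by |x - h| >= (3/4) |x| gives
    the estimate. *)
Lemma newton_expansion N h x : 0 < enorm x -> 4 * enorm h <= enorm x ->
  `|(enorm (x - h))^-1 - \sum_(n < N.+1) qker n h x|
    <= 3 * (N%:R + 1) * (3 * (enorm h / enorm x)) ^+ N.+1 / enorm x.
Proof.
move=> x0 hx.
have X (s : R) : 0 <= s <= 1 -> 3 / 4 * enorm x <= enorm (x - s *: h).
  move=> /andP[s0 s1]; have := le_trans (ler_norm _) (enorm_sub_le x (x - s *: h)).
  rewrite opprB addrCA subrr addr0 enormZ (ger0_norm s0) => H.
  have : s * enorm h <= enorm h by rewrite ler_piMl ?enorm_ge0.
  lra.
pose Q (s : R) : R := enorm x ^+ 2 - 2 * s * dot h x + s ^+ 2 * dot h h.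
have QE (s : R) : Q s = enorm (x - s *: h) ^+ 2.
  by rewrite enorm_sqr !(dotBl, dotBr, dotZl, dotZr) -enorm_sqr (dotC x h) /Q; ring.
have sQ (s : R) : Num.sqrt (Q s) = enorm (x - s *: h) by rewrite QE sqrtr_sqr ger0_norm ?enorm_ge0.
have X0 (s : R) : 0 <= s <= 1 -> 0 < enorm (x - s *: h).
  by move=> /X; apply: lt_le_trans; rewrite mulr_gt0 // divr_gt0.
have Q0 (s : R) : 0 <= s <= 1 -> 0 < Q s by move=> /X0 p; rewrite QE exprn_gt0.
pose F (s : R) : R := Num.sqrt (Q s) * taylor_sum N h x s.
pose f (s : R) : R := (N%:R + 1) * s ^+ N * (- enorm x ^+ 2 * qker N.+1 h x + s * dot h h * qker N h x) / enorm (x - s *: h).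
have dF (s : R) : 0 <= s <= 1 -> is_derive s 1 F (f s).
  move=> s01.
  have dQ : is_derive s 1 Q (2 * (- dot h x + s * dot h h)).
    have d1 : is_derive s 1 (fun s : R => s * (- 2 * dot h x)) (- 2 * dot h x).
      have := is_deriveMf (is_derive_id s (1 : R)) (is_derive_cst (- 2 * dot h x) s (1 : R)).
      by move=> H; apply: (is_derive_eqf H); rewrite mulr0 add0r mulr1.
    have d2 : is_derive s 1 (fun s : R => s ^+ 2 * dot h h) (2 * s * dot h h).
      have := is_deriveMf (is_deriveXf 2 (is_derive_id s (1 : R))) (is_derive_cst (dot h h) s (1 : R)).
      by move=> H; apply: (is_derive_eqf H); rewrite mulr0 add0r mulr1 mulrC.
    have := is_deriveDf (is_deriveDf (is_derive_cst (enorm x ^+ 2) s (1 : R)) d1) d2.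
    rewrite (_ : (fun y => _ + _) = Q); last by apply/funext => t; rewrite /Q /cst /=; ring.
    by move=> H; apply: (is_derive_eqf H); rewrite add0r; ring.
  have dS := is_derive_comp1 (is_derive1_sqrt (Q0 _ s01)) dQ.
  have := is_deriveMf dS (taylor_sum_derive N h x s).
  move=> H; apply: (is_derive_eqf H); rewrite /f -taylor_sum_identity // -/(Q s) /= sQ.
  rewrite QE; have := X0 _ s01; move: (enorm (x - s *: h)) (taylor_sum N h x s) (taylor_sum1 N h x s) => E a b E0.
  by field; rewrite gt_eqF.
(* The ratio of the geometric majorant from [qker_le]; the hypothesis gives k <= 3/4. *)
pose k := 3 * (enorm h / enorm x).
have k0 : 0 <= k by rewrite mulr_ge0 // divr_ge0 // enorm_ge0.
have kh : enorm h = k / 3 * enorm x by rewrite /k; field; rewrite gt_eqF.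
have k1 : k <= 3 / 4 by rewrite /k -(ler_pM2r x0); rewrite mulrA mulfVK ?gt_eqF //; lra.
have p0 n : 0 <= k ^+ n by rewrite exprn_ge0.
have fB (s : R) : 0 <= s <= 1 -> `|f s| <= 2 * (N%:R + 1) * k ^+ N.+1.
  move=> s01; have /andP[s0 s1] := s01.
  have q1 : `|enorm x ^+ 2 * qker N.+1 h x| <= enorm x * k ^+ N.+1.
    rewrite normrM ger0_norm ?sqr_ge0 // expr2 -mulrA ler_pM2l //.
    by rewrite mulrC -ler_pdivlMr //; exact: qker_le.
  have q2 : `|s * dot h h * qker N h x| <= enorm x * k ^+ N.+1 * (1 / 4).
    have q3 : `|qker N h x| * enorm x <= k ^+ N by rewrite -ler_pdivlMr //; exact: qker_le.
    rewrite (normrM (s * dot h h)) (normrM s) (ger0_norm s0) (ger0_norm (dot_ge0 h)) -enorm_sqr kh.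
    apply: (@le_trans _ _ ((k / 3 * enorm x) ^+ 2 * `|qker N h x|)).
      by rewrite -mulrA ler_piMl // mulr_ge0 // sqr_ge0.
    rewrite [leLHS](_ : _ = (k * k / 9 * enorm x) * (`|qker N h x| * enorm x)); last by field.
    apply: (@le_trans _ _ ((k * k / 9 * enorm x) * k ^+ N)).
      apply: ler_wpM2l => //; apply: mulr_ge0; last exact: ltW.
      by rewrite divr_ge0 // mulr_ge0.
    rewrite exprS [leRHS](_ : _ = (k * (9 / 4)) / 9 * enorm x * k ^+ N); last by field.
    apply: ler_wpM2r => //; apply: ler_wpM2r; first exact: ltW.
    by rewrite ler_pM2r ?invr_gt0 // ler_wpM2l //; lra.
  have q : `|- enorm x ^+ 2 * qker N.+1 h x + s * dot h h * qker N h x| <= enorm x * k ^+ N.+1 * (5 / 4).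
    apply: (le_trans (ler_normD _ _)); rewrite mulNr normrN; lra.
  have sN : `|s ^+ N| <= 1 by rewrite ger0_norm ?exprn_ge0 // exprn_ile1.
  rewrite /f normrM normrV ?unitfE ?gt_eqF ?X0 // (ger0_norm (enorm_ge0 _)) ler_pdivrMr ?X0 //.
  rewrite normrM; apply: (@le_trans _ _ ((N%:R + 1) * (enorm x * k ^+ N.+1 * (5 / 4)))).
    apply: ler_pM => //; rewrite normrM (@ger0_norm _ (N%:R + 1)) ?addr_ge0 //.
    by rewrite ler_piMr // addr_ge0.
  have N1 : 0 <= (N%:R + 1) * k ^+ N.+1 by rewrite mulr_ge0 // addr_ge0.
  have := ler_wpM2l N1 (X _ s01); have := mulr_ge0 N1 (enorm_ge0 x).
  move: (k ^+ N.+1) (N%:R + 1) => K M; lra.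
have := dist_le_derive dF fB.
have o01 : 0 <= (1 : R) <= 1 by rewrite lexx ler01.
have E0 : F 0 = 1.
  rewrite /F sQ scale0r subr0 /taylor_sum big_ord_recl expr0 mul1r big1 ?addr0.
    by rewrite qker0 divff // gt_eqF.
  by move=> i _; rewrite expr0n mul0r.
have E1 : F 1 = enorm (x - h) * \sum_(n < N.+1) qker n h x.
  by rewrite /F sQ scale1r /taylor_sum; congr (_ * _); apply: eq_bigr => n _; rewrite expr1n mul1r.
have y0 := X _ o01; have yp := X0 _ o01; rewrite scale1r in y0 yp.
rewrite E0 E1 => H.
rewrite -(ler_pM2l yp) -{1}(ger0_norm (ltW yp)) -normrM mulrBr divff ?gt_eqF // distrC.
apply: (le_trans H); rewrite -/k.
have K0 : 0 <= (N%:R + 1) * k ^+ N.+1 by rewrite mulr_ge0 // addr_ge0.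
have := ler_wpM2l (divr_ge0 K0 (ltW x0)) y0.
rewrite (_ : _ / enorm x * (3 / 4 * enorm x) = 3 / 4 * ((N%:R + 1) * k ^+ N.+1)); last first.
  by field; rewrite gt_eqF.
rewrite [in X in _ -> X](_ : enorm (x - h) * _ = 3 * ((N%:R + 1) * k ^+ N.+1 / enorm x * enorm (x - h))); last by ring.
move: K0; move: (_ / enorm x * enorm (x - h)) => W; move: (k ^+ N.+1) (N%:R + 1) => K M; lra.
Qed.

End newton_expansion.

Section multipole_closure.
Context {R : realType} (Y : forall l : nat, 'I_(l.*2.+1) -> E3 R -> R[i]).
Implicit Types (D : set (E3 R)) (u w : E3 R -> R) (x y z h : E3 R) (n L : nat).

Lemma cabsD (z w : R[i]) : cabs (z + w) <= cabs z + cabs w.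
Proof. exact: (@le_normcD R z w). Qed.
Lemma cabsM (z w : R[i]) : cabs (z * w) = cabs z * cabs w.
Proof. exact: Normc.normcM. Qed.
Lemma cabsR (a : R) : cabs a%:C = `|a|.
Proof. by rewrite /cabs /= expr0n addr0 sqrtr_sqr. Qed.
Lemma cabs_ge0 (z : R[i]) : 0 <= cabs z.
Proof. by case: z => a b; exact: sqrtr_ge0. Qed.
Lemma cabs_sqr (z : R[i]) : cabs z ^+ 2 = complex.Re z ^+ 2 + complex.Im z ^+ 2.
Proof. by case: z => a b; rewrite /cabs /= sqr_sqrtr // addr_ge0 ?sqr_ge0. Qed.

Lemma multipole_sum_widen L L' c x : (L <= L')%N ->
  multipole_sum Y L' (fun l m => if (l <= L)%N then c l m else 0) x = multipole_sum Y L c x.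
Proof.
move=> LL; rewrite /multipole_sum.
rewrite (big_ord_widen L'.+1 (fun l => \sum_(m < l.*2.+1) c l m * multipole Y m x)) //.
rewrite [RHS]big_mkcond; apply: eq_bigr => l _; rewrite ltnS; case: ifP => // _.
by rewrite big1 // => m _; rewrite mul0r.
Qed.

Lemma multipole_sumDZ (k : R[i]) L c L' c' : exists L'' c'', forall x,
  multipole_sum Y L'' c'' x = multipole_sum Y L c x + k * multipole_sum Y L' c' x.
Proof.
exists (maxn L L'), (fun l m => (if (l <= L)%N then c l m else 0) + k * (if (l <= L')%N then c' l m else 0)) => x.
rewrite -(multipole_sum_widen c x (leq_maxl L L')) -(multipole_sum_widen c' x (leq_maxr L L')).
rewrite /multipole_sum mulr_sumr -big_split; apply: eq_bigr => l _ /=.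
by rewrite mulr_sumr -big_split; apply: eq_bigr => m _ /=; rewrite mulrDl mulrA.
Qed.

(** The weight 1 + |x| is the natural rate, since multipoles decay at least like 1/|x|. A uniform
    error of this kind is square integrable over D' against (1+|x|)^(-gamma) when gamma > 1. *)
Definition mclosure D u := forall e : R, 0 < e -> exists L c, forall x, ~ D x ->
  (1 + enorm x) * cabs ((u x)%:C - multipole_sum Y L c x) <= e.

Lemma enorm1_gt0 x : 0 < 1 + enorm x.
Proof. by rewrite ltr_wpDr ?enorm_ge0. Qed.

Lemma mclosure_lim D u : (forall e : R, 0 < e -> exists2 w, mclosure D w &
    forall x, ~ D x -> (1 + enorm x) * `|u x - w x| <= e) -> mclosure D u.
Proof.
move=> H e e0; have e2 : 0 < e / 2 by rewrite divr_gt0.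
have [w mw uw] := H _ e2; have [L [c Hc]] := mw _ e2.
exists L, c => x nx; rewrite (_ : _ - _ = (u x - w x)%:C + ((w x)%:C - multipole_sum Y L c x)); last first.
  by rewrite rmorphB /= addrA subrK.
apply: (@le_trans _ _ ((1 + enorm x) * (`|u x - w x| + cabs ((w x)%:C - multipole_sum Y L c x)))).
  by apply: ler_wpM2l; [exact: ltW (enorm1_gt0 x)|rewrite -cabsR; exact: cabsD].
by rewrite mulrDr [leRHS](splitr e); apply: lerD; [exact: uw|exact: Hc].
Qed.

Lemma mclosure_ext D u w : (forall x, ~ D x -> u x = w x) -> mclosure D u -> mclosure D w.
Proof.
move=> E H e e0; have [L [c Hc]] := H _ e0; exists L, c => x nx.
by rewrite -E //; exact: Hc.
Qed.

Lemma mclosureDZ D u w (k : R) : mclosure D u -> mclosure D w -> mclosure D (fun x => u x + k * w x).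
Proof.
move=> mu mw e e0; have e2 : 0 < e / 2 by rewrite divr_gt0.
have ek : 0 < e / 2 / (`|k| + 1) by rewrite divr_gt0.
have [L [c Hc]] := mu _ e2; have [L' [c' Hc']] := mw _ ek.
have [L'' [c'' E]] := multipole_sumDZ k%:C L c L' c'.
exists L'', c'' => x nx; rewrite E.
rewrite (_ : _ - _ = ((u x)%:C - multipole_sum Y L c x) + k%:C * ((w x)%:C - multipole_sum Y L' c' x)); last first.
  by rewrite rmorphD rmorphM /=; ring.
have := Hc _ nx; have := Hc' _ nx.
have := cabsD ((u x)%:C - multipole_sum Y L c x) (k%:C * ((w x)%:C - multipole_sum Y L' c' x)).
rewrite cabsM cabsR; set A := cabs _; set B := cabs ((u x)%:C - _); set C := cabs _ => ABC hC hB.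
have n0 := ltW (enorm1_gt0 x).
apply: (le_trans (ler_wpM2l n0 ABC)); rewrite mulrDr [leRHS](splitr e); apply: lerD => //.
rewrite mulrCA; apply: (@le_trans _ _ ((`|k| + 1) * ((1 + enorm x) * C))).
  by apply: ler_wpM2r; [rewrite mulr_ge0 // cabs_ge0|rewrite lerDl].
by rewrite mulrC -ler_pdivlMr.
Qed.

Lemma mclosure0 D : mclosure D (fun=> 0).
Proof.
move=> e e0; exists 0%N, (fun _ _ => 0) => x _.
rewrite /multipole_sum big1; last by move=> l _; rewrite big1 // => m _; rewrite mul0r.
by rewrite subr0 cabsR normr0 mulr0 ltW.
Qed.

Lemma mclosureZ D u k : mclosure D u -> mclosure D (fun x => k * u x).
Proof.
move=> mu; apply: mclosure_ext (mclosureDZ k (@mclosure0 D) mu) => x _.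
by rewrite add0r.
Qed.

Lemma mclosure_sum D (I : Type) (s : seq I) (F : I -> E3 R -> R) :
  (forall j, mclosure D (F j)) -> mclosure D (fun x => \sum_(j <- s) F j x).
Proof.
move=> H; elim: s => [|j s IH].
  by apply: mclosure_ext (@mclosure0 D) => x _; rewrite big_nil.
apply: mclosure_ext (mclosureDZ 1 IH (H j)) => x _.
by rewrite big_cons mul1r addrC.
Qed.

Lemma zonalZr n h x (s : R) : zonal n h (s *: x) = s ^+ n * zonal n h x.
Proof.
elim/ltn_ind: n => -[|[|n]] IH.
- by rewrite !zonal0 mulr1.
- by rewrite !zonal1 dotZr expr1.
rewrite !zonalSS (IH n.+1) // (IH n) ?(ltnW (ltnSn _)) // !dotZl !dotZr !exprS; ring.
Qed.

Hypothesis YP : orthonormal_spherical_harmonics Y.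

Lemma qker_multipole n h : exists L c, forall x, 0 < enorm x -> (qker n h x)%:C = multipole_sum Y L c x.
Proof.
have [q qE] := ishom_zonal n h.
have er : cre (hompoly n q) = zonal n h by apply/funext => x; rewrite /cre -qE.
have ei : cim (hompoly n q) = (fun=> 0) by apply/funext => x; rewrite /cim -qE.
have hq : charmonic_on setT (hompoly n q).
  split; rewrite ?er ?ei; first exact: harmonic_zonal.
  have pc : polyfun (fun _ : E3 R => 0 : R) by exact: polyfun_cst.
  apply: (@harmonic_on_lap R (fun=> 0) (fun _ _ => 0) (fun _ _ => 0) setT).
  - exact: polyfun_C2.
  - exact: D2on_cst.
  - by move=> x; rewrite /lap big1.
have [v vE] := spherical_harmonics_span YP hq.
(* The type of the order depends on the degree; [inord] transports it to degree n, and is the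
   identity in the only degree that occurs. *)
exists n, (fun l (m : 'I_(l.*2.+1)) => if l == n then v (inord m) else 0) => x x0.
rewrite /multipole_sum big_ord_recr /= big1 ?add0r; last first.
  by move=> l _; rewrite big1 // => m _; rewrite ltn_eqF ?mul0r.
rewrite eqxx; under eq_bigr do rewrite inord_val.
have xE : x = enorm x *: ((enorm x)^-1 *: x) by rewrite scalerA divff ?gt_eqF // scale1r.
have n1 : enorm ((enorm x)^-1 *: x) = 1.
  by rewrite enormZ ger0_norm ?invr_ge0 ?enorm_ge0 // mulVf // gt_eqF.
rewrite /qker {1}xE zonalZr.
rewrite (_ : _ / _ = zonal n h ((enorm x)^-1 *: x) / enorm x ^+ n.+1); last first.
  rewrite (_ : n.*2.+1 = (n + n.+1)%N); last by rewrite addnS addnn.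
  by rewrite exprD; field; rewrite !expf_neq0 ?gt_eqF.
rewrite rmorphM /= qE (vE _ n1) mulr_suml; apply: eq_bigr => m _.
by rewrite /multipole fmorphV mulrA.
Qed.

Definition far D z (d : R) := forall x, ~ D x -> d <= enorm (x - z).

Lemma open_far D z : open D -> D z -> exists2 d : R, 0 < d & far D z d.
Proof.
move=> /openE3 oD /oD[r r0 rD]; exists r => // x nx; rewrite leNgt; apply/negP => xr.
exact/nx/rD.
Qed.

Lemma far_le D z d x : 0 < d -> far D z d -> ~ D x ->
  1 + enorm x <= (1 + (1 + enorm z) / d) * enorm (x - z).
Proof.
move=> d0 fd /fd dx.
have : (1 + enorm z) <= (1 + enorm z) / d * enorm (x - z).
  by rewrite mulrAC ler_pdivlMr // ler_wpM2l // ltW // enorm1_gt0.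
have := enormD (x - z) z; rewrite subrK; lra.
Qed.

(** The factor N + 1 is absorbed by 2^(N+1), leaving the ratio 2 * 3/8 = 3/4. *)
Lemma geom_small (C e : R) : 0 < e -> 0 <= C ->
  exists N : nat, 3 * (N%:R + 1) * (3 / 8) ^+ N.+1 * C <= e.
Proof.
move=> e0 C0; have k1 : `|3 / 4 : R| < 1 by rewrite ger0_norm //; lra.
have /cvgrPdist_lt H := cvg_expr k1.
have d0 : 0 < e / (3 * C + 1) by rewrite divr_gt0 // ltr_wpDl // mulr_ge0.
have [N _ HN] := H _ d0; exists N.
have := HN N.+1 (leqnSn N); rewrite /= sub0r normrN ger0_norm ?exprn_ge0 // => /ltW HN1.
have n2 : (N%:R + 1 : R) <= 2 ^+ N.+1 by rewrite natr1 -natrX ler_nat ltnW // ltn_expl.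
have p8 : 0 <= (3 / 8 : R) ^+ N.+1 by rewrite exprn_ge0.
have : (N%:R + 1) * (3 / 8) ^+ N.+1 <= (3 / 4 : R) ^+ N.+1.
  apply: (le_trans (ler_wpM2r p8 n2)); rewrite -exprMn lerXn2r ?nnegrE //; lra.
move=> /le_trans/(_ HN1); rewrite ler_pdivlMr ?ltr_wpDl ?mulr_ge0 //.
have : 0 <= (N%:R + 1) * (3 / 8 : R) ^+ N.+1 by rewrite mulr_ge0 // addr_ge0.
rewrite -(mulrA 3); move: (_ * _ ^+ N.+1) => W W0; nra.
Qed.

(** The expansion about z converges outside D with ratio at most 3/8, because |x - z| >= d >= 8 |h|
    there; [far_le] trades the factor 1/|x - z| for the weight. *)
Lemma push_pole D z d h : 0 < d -> far D z d ->
  (forall n k, mclosure D (fun x => qker n k (x - z))) -> 8 * enorm h <= d ->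
  mclosure D (fun x => (enorm (x - (z + h)))^-1).
Proof.
move=> d0 fd Mz hd; apply: mclosure_lim => e e0.
have C0 : 0 <= 1 + (1 + enorm z) / d by rewrite addr_ge0 // divr_ge0 ?(ltW d0) // ltW // enorm1_gt0.
have [N HN] := geom_small e0 C0.
exists (fun x => \sum_(n < N.+1) qker n h (x - z)); first exact: mclosure_sum.
move=> x nx; have dx := fd _ nx; have x0 : 0 < enorm (x - z) by exact: lt_le_trans dx.
rewrite (_ : x - (z + h) = (x - z) - h); last by rewrite opprD addrA.
have h4 : 4 * enorm h <= enorm (x - z) by have := enorm_ge0 h; lra.
have H := newton_expansion N x0 h4.
apply: (@le_trans _ _ ((1 + enorm x) * (3 * (N%:R + 1) * (3 * (enorm h / enorm (x - z))) ^+ N.+1 / enorm (x - z)))).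
  by apply: ler_wpM2l => //; exact: ltW (enorm1_gt0 x).
apply: le_trans HN.
have k1 : 3 * (enorm h / enorm (x - z)) <= 3 / 8.
  by rewrite -(ler_pM2r x0) -mulrA mulfVK ?gt_eqF //; lra.
have k2 : (3 * (enorm h / enorm (x - z))) ^+ N.+1 <= (3 / 8) ^+ N.+1.
  by rewrite lerXn2r ?nnegrE // mulr_ge0 // divr_ge0 // enorm_ge0.
have k3 : (1 + enorm x) / enorm (x - z) <= 1 + (1 + enorm z) / d.
  by rewrite ler_pdivrMr //; exact: far_le fd nx.
rewrite (_ : _ * _ = (3 * (N%:R + 1)) * ((3 * (enorm h / enorm (x - z))) ^+ N.+1 * ((1 + enorm x) / enorm (x - z)))); last by ring.
rewrite -[leRHS]mulrA; apply: ler_wpM2l => //; apply: ler_pM => //.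
- by rewrite exprn_ge0 // mulr_ge0 // divr_ge0 // enorm_ge0.
- by rewrite divr_ge0 ?enorm_ge0 // ltW // enorm1_gt0.
Qed.

(** The n-th coefficient is recovered by subtracting the lower terms from a Newton kernel with pole
    z + s k and dividing by s^n; by [newton_expansion] the error is of order s, uniformly with the
    weight. *)
Lemma taylor_coefficients D z d r : 0 < d -> far D z d -> 0 < r ->
  (forall h, enorm h < r -> mclosure D (fun x => (enorm (x - (z + h)))^-1)) ->
  forall n k, mclosure D (fun x => qker n k (x - z)).
Proof.
move=> d0 fd r0 H n k; elim/ltn_ind: n => n IH; apply: mclosure_lim => e e0.
pose C := 1 + (1 + enorm z) / d.
have C0 : 0 <= C by rewrite addr_ge0 // divr_ge0 ?(ltW d0) // ltW // enorm1_gt0.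
pose K := 3 * (n%:R + 1) * (3 * (enorm k / d)) ^+ n.+1 * C.
have K0 : 0 <= K.
  apply: mulr_ge0 => //; apply: mulr_ge0; first by rewrite mulr_ge0 // addr_ge0.
  by rewrite exprn_ge0 // mulr_ge0 // divr_ge0 ?enorm_ge0 // ltW.
have k1 : 0 < enorm k + 1 by rewrite ltr_wpDl ?enorm_ge0.
(* Three demands: the pole z + s k stays in the admissible ball, s |k| <= d/4 for the expansion, and
   s K <= e for the error. *)
pose s := Num.min (Num.min (r / 2) (d / 4) / (enorm k + 1)) (e / (K + 1)).
have s0 : 0 < s.
  by rewrite lt_min !divr_gt0 // ?lt_min ?divr_gt0 // ltr_wpDl.
have sm : s * (enorm k + 1) <= Num.min (r / 2) (d / 4) by rewrite -ler_pdivlMr // ge_min lexx.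
have sk : s * enorm k <= s * (enorm k + 1) by rewrite ler_pM2l // lerDl.
have /andP[sr sd] : (s * enorm k <= r / 2) && (s * enorm k <= d / 4).
  by rewrite -le_min (le_trans sk).
have se : s * K <= e.
  have : s <= e / (K + 1) by rewrite ge_min lexx orbT.
  rewrite ler_pdivlMr ?ltr_wpDl //; nra.
have nsk : enorm (s *: k) = s * enorm k by rewrite enormZ gtr0_norm.
pose w x := s ^- n * ((enorm (x - (z + s *: k)))^-1 + (-1) * \sum_(j < n) s ^+ j * qker j k (x - z)).
exists w.
  apply/mclosureZ/mclosureDZ; first by apply: H; rewrite nsk; lra.
  apply: (@mclosure_ext _ (fun x => \sum_(j <- iota 0 n) (if (j < n)%N then s ^+ j * qker j k (x - z) else 0))).
    move=> x _; rewrite -[n in iota 0 n]subn0 -/(index_iota 0 n) big_mkord.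
    by apply: eq_bigr => j _; rewrite ltn_ord.
  apply: (@mclosure_sum D nat (iota 0 n) (fun j x => if (j < n)%N then s ^+ j * qker j k (x - z) else 0)) => j.
  by case: ltnP => jn; [apply: mclosureZ; exact: IH|exact: mclosure0].
move=> x nx; have dx := fd _ nx; have x0 : 0 < enorm (x - z) by exact: lt_le_trans dx.
have h4 : 4 * enorm (s *: k) <= enorm (x - z) by rewrite nsk; lra.
have := newton_expansion n x0 h4.
rewrite big_ord_recr /= qkerZ (_ : x - z - s *: k = x - (z + s *: k)); last by rewrite opprD addrA.
under eq_bigr do rewrite qkerZ.
set A := (enorm _)^-1; set B := \sum_(j < n) _; set q := qker n k _ => E.
have sn : 0 < s ^+ n by rewrite exprn_gt0.
have -> : q - w x = - (s ^- n * (A - (B + s ^+ n * q))).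
  by rewrite /w -/A -/B; field; rewrite gt_eqF.
rewrite normrN normrM (gtr0_norm (_ : 0 < s ^- n)) ?invr_gt0 //.
apply: (@le_trans _ _ ((1 + enorm x) * (s ^- n * (3 * (n%:R + 1) * (3 * (enorm (s *: k) / enorm (x - z))) ^+ n.+1 / enorm (x - z))))).
  by apply: ler_wpM2l; [exact: ltW (enorm1_gt0 x)|rewrite ler_pM2l ?invr_gt0].
apply: le_trans se.
rewrite nsk (_ : 3 * (s * enorm k / enorm (x - z)) = s * (3 * (enorm k / enorm (x - z)))); last by ring.
rewrite exprMn exprS.
rewrite [leLHS](_ : _ = s * (3 * (n%:R + 1) * (3 * (enorm k / enorm (x - z))) ^+ n.+1 * ((1 + enorm x) / enorm (x - z)))); last first.
  by field; rewrite !gt_eqF.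
rewrite ler_pM2l //; apply: ler_pM.
- apply: mulr_ge0; first by rewrite mulr_ge0 // addr_ge0.
  by rewrite exprn_ge0 // mulr_ge0 // divr_ge0 ?enorm_ge0.
- by rewrite divr_ge0 ?enorm_ge0 // ltW // enorm1_gt0.
- apply: ler_wpM2l; first by rewrite mulr_ge0 // addr_ge0.
  have q0 : 0 <= 3 * (enorm k / enorm (x - z)) by apply: mulr_ge0 => //; apply: divr_ge0; exact: enorm_ge0.
  have q1 : 0 <= 3 * (enorm k / d) by rewrite mulr_ge0 // divr_ge0 ?enorm_ge0 // ltW.
  by rewrite lerXn2r ?nnegrE // ler_pM2l // ler_wpM2l ?enorm_ge0 // lef_pV2.
- by rewrite ler_pdivrMr //; exact: far_le fd nx.
Qed.

(* Runge's pole pushing: the set of admissible poles is open and relatively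
   closed in D, and it contains the origin. *)
Lemma runge_poles D : open D -> connected D -> D 0 ->
  forall z, D z -> forall n k, mclosure D (fun x => qker n k (x - z)).
Proof.
move=> oD cD D0; pose P := [set z | D z /\ forall n k, mclosure D (fun x => qker n k (x - z))].
suff PD : P = D by move=> z; rewrite -{1}PD => -[].
(* Poles z + h with |h| < d/16 lie within d/8 of z0, the reach of [push_pole]. Having all Newton
   kernels near z gives all coefficients at z. *)
have star z0 z d : P z0 -> 0 < d -> far D z0 d -> enorm (z - z0) < d / 16 -> P z.
  move=> [Dz0 Mz0] d0 fd zd; split.
    by apply: contrapT => /fd; lra.
  have fz : far D z (d / 2).
    by move=> x /fd dx; have := enormDB x z z0; lra.
  apply: (@taylor_coefficients _ _ (d / 2) (d / 16)); rewrite ?divr_gt0 // => h hd.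
  rewrite (_ : z + h = z0 + (z - z0 + h)); last by rewrite addrA addrCA subrr addr0.
  apply: (push_pole d0 fd Mz0); have := enormD (z - z0) h; lra.
(* Three goals remain: P is nonempty, it is the trace on D of an open set, and it is the trace on D
   of a closed set. *)
apply: cD.
- exists 0; split=> // n k; have [L [c E]] := qker_multipole n k.
  have [d d0 fd] := open_far oD D0.
  move=> e e0; exists L, c => x nx; rewrite subr0 -E ?subrr.
    by rewrite (cabsR 0) normr0 mulr0 ltW.
  by have := fd _ nx; rewrite subr0; exact: lt_le_trans.
- exists [set z | exists z0 d, [/\ P z0, 0 < d, far D z0 d & enorm (z - z0) < d / 16]].
    apply/openE3 => z [z0 [d [Pz0 d0 fd zd]]]; exists (d / 16 - enorm (z - z0)); first by rewrite subr_gt0.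
    by move=> y yz; exists z0, d; split=> //; rewrite /eball /= in yz; have := enormDB y z z0; lra.
  apply/seteqP; split=> [z Pz|z [_ [z0 [d [Pz0 d0 fd zd]]]]]; last exact: star zd.
  split; first by case: Pz.
  have [d d0 fd] := open_far oD (proj1 Pz); exists z, d; split=> //.
  by rewrite subrr enorm0 divr_gt0.
- exists (closure P); first exact: closed_closure.
  apply/seteqP; split=> [z Pz|z [Dz /closureE3 cz]].
    by split; [case: Pz|exact: subset_closure].
  have [d d0 fd] := open_far oD Dz.
  (* Seen from z0 the complement of D is still at distance d/2, and d/32 is the sixteenth part of it
     required by [star]. *)
  have [z0 Pz0 zz] := cz (d / 32) (divr_gt0 d0 (ltr0Sn _ _)).
  apply: (@star z0 z (d / 2)) => //; first by rewrite divr_gt0.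
    by move=> x /fd dx; have := enormDB x z0 z; lra.
  by rewrite enormB; lra.
Qed.

End multipole_closure.

(** * Potentials of densities with poles in a compact subset of D *)

Section runge_integrals.
Context {R : realType} (Y : forall l : nat, 'I_(l.*2.+1) -> E3 R -> R[i]).
Implicit Types (D K : set (E3 R)) (u w a : E3 R -> R) (x y z h : E3 R) (k : E3 R -> E3 R -> R).

Lemma int3_indic u (A : set (E3 R)) : measurable (A : set (M3 R)) -> int3 u ->
  int3 (fun x => \1_A x * u x).
Proof.
move=> mA iu; apply: (@le_int3 R _ (fun x => `|u x|)); last exact: int3_abs.
  apply: measurable_funM; last exact: int3_measurable.
  exact: measurable_indic.
move=> x; rewrite normrM indicE; case: (x \in A); by rewrite ?normr1 ?mul1r // normr0 mul0r.
Qed.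

(** A Riemann sum without a partition: the part of the density in the first ball is integrated
    against the kernel frozen at the centre, and the rest, supported in the remaining balls, is left
    to the induction. The density must therefore be arbitrary in the induction. *)
Lemma mclosure_pieces D K k (d e : R) (s : seq (E3 R)) a :
  0 < e -> int3 a -> (forall x, ~ D x -> int3 (fun y => a y * k x y)) ->
  (forall y, a y != 0 -> K y /\ exists2 p, p \in s & enorm (y - p) < d) ->
  (forall p, p \in s -> K p /\ mclosure Y D (k^~ p)) ->
  (forall x y y', ~ D x -> K y -> K y' -> enorm (y - y') < d ->
    (1 + enorm x) * `|k x y - k x y'| <= e) ->
  exists2 h, mclosure Y D h & forall x, ~ D x ->
    (1 + enorm x) * `|I3 (fun y => a y * k x y) - h x| <= e * I3 (fun y => `|a y|).
Proof.
move=> e0; elim: s a => [|p s IH] a ia iak sa ps osc.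
  have a0 y : a y = 0 by apply/eqP; apply: contraT => /sa[_ []].
  exists (fun=> 0); first exact: mclosure0.
  move=> x _; rewrite (eq_I3 (w := fun=> 0)); last by move=> y; rewrite a0 mul0r.
  by rewrite I3_0 subr0 normr0 mulr0 mulr_ge0 ?(ltW e0) // I3_ge0.
pose A := eball p d.
have mA : measurable (A : set (M3 R)) by apply: open_measurable3; exact: open_eball.
pose a1 y := \1_A y * a y; pose a2 y := a y - a1 y.
have i1 : int3 a1 by exact: int3_indic.
have i2 : int3 a2 by exact: int3B.
have i1k x : ~ D x -> int3 (fun y => a1 y * k x y).
  by move=> /iak /(int3_indic mA); apply: eq_int3 => y; rewrite mulrA.
have i2k x : ~ D x -> int3 (fun y => a2 y * k x y).
  move=> nx; apply: eq_int3 (int3B (iak _ nx) (i1k _ nx)) => y.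
  by rewrite /a2 mulrBl.
have E2 y : a2 y = \1_(~` A) y * a y.
  rewrite /a2 /a1 !indicE in_setC; case: (y \in A); rewrite ?mul1r ?mul0r ?subrr ?subr0 //.
have [h2 mh2 H2] : exists2 h, mclosure Y D h & forall x, ~ D x ->
    (1 + enorm x) * `|I3 (fun y => a2 y * k x y) - h x| <= e * I3 (fun y => `|a2 y|).
  apply: IH => //.
    move=> y; rewrite E2 indicE in_setC; case: (boolP (y \in A)) => [|yA]; first by rewrite mul0r eqxx.
    rewrite mul1r => /sa[Ky [p' ]]; rewrite in_cons => /orP[/eqP ->|p's] yp; last by split=> //; exists p'.
    by rewrite notin_setE in yA.
  by move=> p' p's; apply: ps; rewrite in_cons p's orbT.
have [Kp mp] := ps _ (mem_head _ _).
exists (fun x => h2 x + I3 a1 * k x p); first exact: mclosureDZ.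
move=> x nx; have x1 := enorm1_gt0 x.
have Eabs : I3 (fun y => `|a y|) = I3 (fun y => `|a1 y|) + I3 (fun y => `|a2 y|).
  rewrite -(I3D (int3_abs i1) (int3_abs i2)); apply: eq_I3 => y.
  rewrite E2 /a1 !indicE in_setC; case: (y \in A); by rewrite ?mul1r ?mul0r ?normr0 ?addr0 ?add0r.
have E : I3 (fun y => a y * k x y) = I3 (fun y => a1 y * k x y) + I3 (fun y => a2 y * k x y).
  rewrite -(I3D (i1k _ nx) (i2k _ nx)); apply: eq_I3 => y.
  by rewrite -mulrDl /a2 addrC subrK.
rewrite E Eabs mulrDr.
rewrite (_ : _ - _ = (I3 (fun y => a1 y * k x y) - I3 a1 * k x p) + (I3 (fun y => a2 y * k x y) - h2 x)); last by ring.
apply: (@le_trans _ _ ((1 + enorm x) * (`|I3 (fun y => a1 y * k x y) - I3 a1 * k x p| + `|I3 (fun y => a2 y * k x y) - h2 x|))).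
  by apply: ler_wpM2l; [exact: ltW|exact: ler_normD].
rewrite mulrDr; apply: lerD; last exact: H2.
have i1p : int3 (fun y => k x p * a1 y) by exact: int3Z.
rewrite (mulrC (I3 a1)) -(I3Z (k x p) i1) -(I3B (i1k _ nx) i1p).
have iB := int3B (i1k _ nx) i1p.
apply: (@le_trans _ _ ((1 + enorm x) * I3 (fun y => e / (1 + enorm x) * `|a1 y|))).
  apply: ler_wpM2l; first exact: ltW.
  apply: (le_trans (I3_norm iB)); apply: I3_le; first exact: int3_abs.
    exact/int3Z/int3_abs.
  move=> y; rewrite (_ : _ - _ = a1 y * (k x y - k x p)); last by ring.
  rewrite normrM; have [->|a1y] := eqVneq (a1 y) 0; first by rewrite normr0 mul0r mulr0.
  rewrite mulrC; apply: ler_wpM2r => //.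
  have yA : A y by apply: contrapT => nA; move: a1y; rewrite /a1 indicE memNset ?mul0r ?eqxx.
  have ay : a y != 0 by apply: contraNneq a1y => ay; rewrite /a1 ay mulr0.
  rewrite ler_pdivlMr // mulrC; apply: osc => //; exact: (sa _ ay).1.
rewrite (I3Z _ (int3_abs i1)) mulrA (mulrC (1 + _)) divfK // gt_eqF //.
Qed.

Lemma mclosure_I3 D K k a : compact K -> (forall y, ~ K y -> a y = 0) -> int3 a ->
  (forall x, ~ D x -> int3 (fun y => a y * k x y)) ->
  (forall y, K y -> mclosure Y D (k^~ y)) ->
  (forall e : R, 0 < e -> exists2 d : R, 0 < d & forall x y y', ~ D x -> K y -> K y' ->
     enorm (y - y') < d -> (1 + enorm x) * `|k x y - k x y'| <= e) ->
  mclosure Y D (fun x => I3 (fun y => a y * k x y)).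
Proof.
move=> cK aK ia iak mk osc; apply: mclosure_lim => e e0.
have A0 : 0 <= I3 (fun y => `|a y|) by exact: I3_ge0.
have e1 : 0 < e / (I3 (fun y => `|a y|) + 1) by rewrite divr_gt0 // ltr_wpDl.
have [d d0 hd] := osc _ e1.
have [s [sK sc]] := @compact_eball_cover R K (fun=> d) cK (fun _ _ => d0).
have [h mh Hh] : exists2 h, mclosure Y D h & forall x, ~ D x ->
    (1 + enorm x) * `|I3 (fun y => a y * k x y) - h x| <= e / (I3 (fun y => `|a y|) + 1) * I3 (fun y => `|a y|).
  apply: (@mclosure_pieces D K k d _ s) => //.
    move=> y ay; have Ky : K y by apply: contrapT => /aK ay0; rewrite ay0 eqxx in ay.
    by split=> //; exact: sc.
  by move=> p /sK Kp; split=> //; exact: mk.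
exists h => // x nx; apply: (le_trans (Hh _ nx)).
by rewrite mulrAC ler_pdivrMr ?ltr_wpDl // ler_pM2l // lerDl.
Qed.

Lemma inv_enorm_osc x y (d : R) : 0 < d -> d <= enorm x -> d <= enorm y ->
  `|(enorm x)^-1 - (enorm y)^-1| <= enorm (x - y) / (enorm x * enorm y).
Proof.
move=> d0 dx dy; have x0 := lt_le_trans d0 dx; have y0 := lt_le_trans d0 dy.
rewrite (_ : _ - _ = (enorm y - enorm x) / (enorm x * enorm y)); last by field; rewrite !gt_eqF.
rewrite normrM (ger0_norm (_ : 0 <= (enorm x * enorm y)^-1)); last by rewrite invr_ge0 mulr_ge0 // ltW.
apply: ler_wpM2r; first by rewrite invr_ge0 mulr_ge0 // ltW.
by rewrite enormB; exact: enorm_sub_le.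
Qed.

Definition dipole (i : 'I_3) x : R := co i x / enorm x ^+ 3.

Lemma dipole_osc (i : 'I_3) x y (d : R) : 0 < d -> d <= enorm x -> d <= enorm y ->
  `|dipole i x - dipole i y| <= enorm (x - y) * (4 / (d ^+ 2 * enorm x)).
Proof.
move=> d0 dx dy; have x0 := lt_le_trans d0 dx; have y0 := lt_le_trans d0 dy.
pose a := (enorm x)^-1; pose b := (enorm y)^-1.
have a0 : 0 < a by rewrite invr_gt0.
have b0 : 0 < b by rewrite invr_gt0.
have ad : a <= d^-1 by rewrite lef_pV2.
have bd : b <= d^-1 by rewrite lef_pV2.
have yb : enorm y * b = 1 by rewrite /b mulfV // gt_eqF.
have ab : `|a - b| <= enorm (x - y) * (a * b) by rewrite -invfM; exact: inv_enorm_osc dx dy.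
have cy := co_le i y; have cxy := co_le i (x - y).
rewrite /dipole -!exprVn -/a -/b.
rewrite (_ : _ - _ = co i (x - y) * a ^+ 3 + co i y * ((a - b) * (a ^+ 2 + a * b + b ^+ 2))); last first.
  by rewrite coB; ring.
apply: (le_trans (ler_normD _ _)).
rewrite (_ : enorm (x - y) * _ = enorm (x - y) * (a * (d^-1 * d^-1)) + enorm (x - y) * (a * (3 * (d^-1 * d^-1)))); last first.
  by rewrite /a; field; rewrite !gt_eqF.
have aa : a * a <= d^-1 * d^-1 by apply: ler_pM => //; exact: ltW.
have aab : a * b <= d^-1 * d^-1 by apply: ler_pM => //; exact: ltW.
have bb : b * b <= d^-1 * d^-1 by apply: ler_pM => //; exact: ltW.
apply: lerD.
  rewrite normrM; apply: ler_pM => //.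
  by rewrite ger0_norm; [rewrite exprS expr2 ler_pM2l|exact: exprn_ge0 (ltW a0)].
have s0 : 0 <= a ^+ 2 + a * b + b ^+ 2 by rewrite !addr_ge0 ?mulr_ge0 ?ltW // exprn_gt0.
rewrite normrM normrM (ger0_norm s0).
apply: (@le_trans _ _ (enorm y * (enorm (x - y) * (a * b) * (a ^+ 2 + a * b + b ^+ 2)))).
  by apply: ler_pM => //; [rewrite mulr_ge0|apply: ler_wpM2r].
rewrite (_ : enorm y * _ = (enorm y * b) * (enorm (x - y) * (a * (a ^+ 2 + a * b + b ^+ 2)))); last by ring.
by rewrite yb mul1r ler_wpM2l // ler_pM2l // !expr2; lra.
Qed.

Lemma qker1_dipole (i : 'I_3) x : qker 1 (basis3 i) x = dipole i x.
Proof. by rewrite /qker /dipole zonal1 /co dotC. Qed.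

Hypothesis YP : orthonormal_spherical_harmonics Y.

Lemma mclosure_inv_enorm D z : open D -> connected D -> D 0 -> D z ->
  mclosure Y D (fun x => (enorm (x - z))^-1).
Proof.
move=> oD cD D0 Dz; have := runge_poles YP oD cD D0 Dz 0 0.
by apply: mclosure_ext => x _; rewrite qker0.
Qed.

Lemma mclosure_dipole D z i : open D -> connected D -> D 0 -> D z ->
  mclosure Y D (fun x => dipole i (x - z)).
Proof.
move=> oD cD D0 Dz; have := runge_poles YP oD cD D0 Dz 1 (basis3 i).
by apply: mclosure_ext => x _; rewrite qker1_dipole.
Qed.

Lemma far_compact D K h : open D -> compact K -> (forall y, K y -> D (y + h)) ->
  exists2 d : R, 0 < d & forall y, K y -> far D (y + h) d.
Proof.
move=> oD cK KD; pose O := [set y | D (y + h)].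
have oO : open O.
  apply/openE3 => y /(proj1 (openE3 D) oD)[r r0 rD]; exists r => // z zy.
  by apply: rD; rewrite /eball /= in zy *; rewrite opprD addrACA subrr addr0.
have [d d0 hd] := compact_open_margin cK oO KD.
exists d => // y Ky x nx; rewrite leNgt; apply/negP => xy; apply: nx.
have : O (x - h) by apply: (hd y) => //; rewrite -addrA -opprD (addrC h); exact: ltW.
by rewrite /O /= subrK.
Qed.

Lemma far_le_compact D K h d : compact K -> 0 < d -> (forall y, K y -> far D (y + h) d) ->
  exists2 C : R, 0 < C & forall x y, ~ D x -> K y -> 1 + enorm x <= C * enorm (x - (y + h)).
Proof.
move=> cK d0 fd; have [r hr] := compact_boundedE3 cK.
exists (1 + (1 + (`|r| + enorm h)) / d).
  by rewrite ltr_wpDr // divr_ge0 ?(ltW d0) // !addr_ge0 // enorm_ge0.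
move=> x y nx Ky; apply: (le_trans (far_le d0 (fd _ Ky) nx)).
apply: ler_wpM2r; first exact: enorm_ge0.
rewrite lerD2l ler_pM2r ?invr_gt0 // lerD2l; apply: (le_trans (enormD _ _)).
by rewrite lerD2r (le_trans (hr _ Ky)) // ler_norm.
Qed.

Lemma mclosure_newton_potential D K a h : open D -> connected D -> D 0 -> compact K ->
  (forall y, K y -> D (y + h)) -> (forall y, ~ K y -> a y = 0) -> int3 a ->
  (forall x, ~ D x -> int3 (fun y => a y * (enorm (x - (y + h)))^-1)) ->
  mclosure Y D (fun x => I3 (fun y => a y * (enorm (x - (y + h)))^-1)).
Proof.
move=> oD cD D0 cK KD aK ia iak.
have [d d0 fd] := far_compact oD cK KD; have [C C0 hC] := far_le_compact cK d0 fd.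
apply: (mclosure_I3 cK aK ia iak).
  by move=> y Ky; apply: mclosure_inv_enorm => //; exact: KD.
move=> e e0; exists (e * d / C); first by rewrite divr_gt0 // mulr_gt0.
move=> x y y' nx Ky Ky' yy.
have dx := fd _ Ky _ nx; have dy := fd _ Ky' _ nx.
apply: (@le_trans _ _ ((1 + enorm x) * (enorm (y - y') / (enorm (x - (y + h)) * enorm (x - (y' + h)))))).
  apply: ler_wpM2l; first exact: ltW (enorm1_gt0 x).
  apply: (le_trans (inv_enorm_osc d0 dx dy)).
  by rewrite (_ : x - (y + h) - _ = y' - y) ?(enormB y') //; apply: E3ext; rewrite /=; ring.
have x0 := lt_le_trans d0 dx; have y0 := lt_le_trans d0 dy.
apply: (@le_trans _ _ (C * enorm (x - (y + h)) * (enorm (y - y') / (enorm (x - (y + h)) * enorm (x - (y' + h)))))).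
  apply: ler_wpM2r; last exact: hC.
  by rewrite divr_ge0 ?enorm_ge0 // mulr_ge0 // ltW.
rewrite (_ : _ * _ = C * enorm (y - y') / enorm (x - (y' + h))); last by field; rewrite !gt_eqF.
rewrite ler_pdivrMr //; apply: (@le_trans _ _ (e * d)); last by rewrite ler_pM2l.
by rewrite mulrC -ler_pdivlMr // ltW.
Qed.

Lemma mclosure_dipole_potential D K a h i : open D -> connected D -> D 0 -> compact K ->
  (forall y, K y -> D (y + h)) -> (forall y, ~ K y -> a y = 0) -> int3 a ->
  (forall x, ~ D x -> int3 (fun y => a y * dipole i (x - (y + h)))) ->
  mclosure Y D (fun x => I3 (fun y => a y * dipole i (x - (y + h)))).
Proof.
move=> oD cD D0 cK KD aK ia iak.
have [d d0 fd] := far_compact oD cK KD; have [C C0 hC] := far_le_compact cK d0 fd.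
apply: (mclosure_I3 cK aK ia iak).
  by move=> y Ky; apply: mclosure_dipole => //; exact: KD.
move=> e e0; exists (e * d ^+ 2 / (4 * C)); first by rewrite divr_gt0 ?mulr_gt0 // exprn_gt0.
move=> x y y' nx Ky Ky' yy.
have dx := fd _ Ky _ nx; have dy := fd _ Ky' _ nx; have x0 := lt_le_trans d0 dx.
apply: (@le_trans _ _ ((1 + enorm x) * (enorm (y - y') * (4 / (d ^+ 2 * enorm (x - (y + h))))))).
  apply: ler_wpM2l; first exact: ltW (enorm1_gt0 x).
  apply: (le_trans (dipole_osc i d0 dx dy)).
  by rewrite (_ : x - (y + h) - _ = y' - y) ?(enormB y') //; apply: E3ext; rewrite /=; ring.
apply: (@le_trans _ _ (C * enorm (x - (y + h)) * (enorm (y - y') * (4 / (d ^+ 2 * enorm (x - (y + h))))))).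
  apply: ler_wpM2r; last exact: hC.
  by rewrite mulr_ge0 ?enorm_ge0 // divr_ge0 // mulr_ge0 ?enorm_ge0 // exprn_ge0 // ltW.
rewrite (_ : _ * _ = enorm (y - y') * (4 * C) / d ^+ 2); last by field; rewrite !gt_eqF.
by rewrite ler_pdivrMr ?exprn_gt0 // -ler_pdivlMr ?mulr_gt0 // ltW.
Qed.

End runge_integrals.

Section harmonic_mean_value.
Context {R : realType}.
Implicit Types (O : set (E3 R)) (u w : E3 R -> R) (x y z : E3 R).

Lemma line_le u (i : 'I_3) z (t M : R) :
  (forall s : R, 0 <= s <= 1 -> derivable u (z + (s * t) *: basis3 i) (basis3 i) /\
      `|partial i u (z + (s * t) *: basis3 i)| <= M) ->
  `|u (z + t *: basis3 i) - u z| <= M * `|t|.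
Proof.
move=> H; pose F (s : R) := u (z + (s * t) *: basis3 i).
have D (s : R) : 0 <= s <= 1 -> is_derive s 1 F (partial i u (z + (s * t) *: basis3 i) * t).
  move=> /H[d _].
  have d1 := is_derive_line (derivableP d).
  have d2 : is_derive s 1 (fun s : R => s * t) t.
    have := is_deriveMf (is_derive_id s (1 : R)) (is_derive_cst t s (1 : R)).
    by move=> H'; apply: (is_derive_eqf H'); rewrite mulr0 add0r mulr1.
  have dS := @is_derive_comp1 R R (fun z0 : R => u (z + z0 *: basis3 i)) (fun s : R => s * t) s 1 _ _ d1 d2.
  rewrite (_ : F = (fun z0 : R => u (z + z0 *: basis3 i)) \o (fun s : R => s * t)) //.
have := @dist_le_derive R F _ (M * `|t|) D.
rewrite /F mul1r mul0r scale0r addr0; apply => s s01.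
by rewrite normrM ler_wpM2r //; exact: (H _ s01).2.
Qed.

(** [C1_on] speaks of directional derivatives only. These are bounded near x, so u is controlled
    along a path of three segments parallel to the axes. *)
Lemma C1_continuous O u x : open O -> C1_on O u -> O x -> {for x, continuous u}.
Proof.
move=> /openE3 oO c1 Ox; have [r r0 rO] := oO _ Ox.
have [M [d [M0 d0 dM]]] : exists M d : R, [/\ 0 < M, 0 < d & forall i y, enorm (y - x) < d -> `|partial i u y| <= M].
  suff H (s : seq 'I_3) : exists M d : R, [/\ 0 < M, 0 < d &
      forall i y, i \in s -> enorm (y - x) < d -> `|partial i u y| <= M].
    have [M [d [M0 d0 h]]] := H (enum 'I_3); exists M, d; split=> // i y; apply: h.
    by rewrite mem_enum.
  elim: s => [|i s [M [d [M0 d0 h]]]]; first by exists 1, 1.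
  have [_ /continuousE3/(_ 1 ltr01)[d' d'0 hd]] := c1 i x Ox.
  exists (M + (`|partial i u x| + 1)), (Num.min d d'); split.
  - by rewrite ltr_wpDr // addr_ge0.
  - by rewrite lt_min d0.
  move=> j y; rewrite in_cons lt_min => js /andP[yd yd'].
  case/orP: js => [/eqP -> {j}|js]; last first.
    by apply: (le_trans (h _ _ js yd)); rewrite lerDl addr_ge0.
  have := hd _ yd'; have := ler_normD (partial i u y - partial i u x) (partial i u x); rewrite subrK.
  move: `|_ - _| `|partial i u x| `|_| => A B C; lra.
apply/continuousE3 => e e0.
pose rho := Num.min r (Num.min d (e / (3 * M + 1))).
have M1 : 0 < 3 * M + 1 by lra.
have rho0 : 0 < rho by rewrite !lt_min r0 d0 divr_gt0.
exists rho => // y; rewrite !lt_min => /and3P[yr yd ye].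
have s1 (t : R) : t *: (1 : R) = t by exact: mulr1.
have s0 (t : R) : t *: (0 : R) = 0 by exact: mulr0.
have [c1' c2' c3'] := enorm_coord (y - x).
pose z1 := x + (y.1.1 - x.1.1) *: basis3 ord0.
pose z2 := z1 + (y.1.2 - x.1.2) *: basis3 ax1.
have E3' : y = z2 + (y.2 - x.2) *: basis3 ax2.
  apply: E3ext; rewrite /z2 /z1 /=.
  - by rewrite !s1 !s0 !addr0 addrC subrK.
  - by rewrite !s1 !s0 !addr0 addrC subrK.
  - by rewrite !s1 !s0 !addr0 addrC subrK.
(* No point of the axis-parallel path is farther from x than y itself. *)
have N z : `|z.1.1 - x.1.1| <= `|y.1.1 - x.1.1| -> `|z.1.2 - x.1.2| <= `|y.1.2 - x.1.2| ->
    `|z.2 - x.2| <= `|y.2 - x.2| -> enorm (z - x) <= enorm (y - x).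
  move=> a b c; rewrite enorm_le_sqr ?enorm_ge0 // enorm_sqr /dot /= -!expr2.
  rewrite -(real_normK (num_real (z.1.1 - x.1.1))) -(real_normK (num_real (y.1.1 - x.1.1))).
  rewrite -(real_normK (num_real (z.1.2 - x.1.2))) -(real_normK (num_real (y.1.2 - x.1.2))).
  rewrite -(real_normK (num_real (z.2 - x.2))) -(real_normK (num_real (y.2 - x.2))).
  by rewrite !lerD // lerXn2r // nnegrE.
have Ns (s t : R) : 0 <= s <= 1 -> `|s * t| <= `|t|.
  by move=> /andP[s00 s01]; rewrite normrM ger0_norm // ler_piMl.
have ok z : enorm (z - x) <= enorm (y - x) -> O z /\ enorm (z - x) < d.
  by move=> zy; split; [apply: rO; rewrite /eball /=|]; exact: le_lt_trans zy _.
have L1 : `|u z1 - u x| <= M * `|y.1.1 - x.1.1|.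
  apply: line_le => s s01; have [Oz zd] : O (x + (s * (y.1.1 - x.1.1)) *: basis3 ord0) /\
      enorm (x + (s * (y.1.1 - x.1.1)) *: basis3 ord0 - x) < d.
    apply: ok; apply: N; rewrite /=.
    - by rewrite !s1 addrAC subrr add0r; exact: Ns.
    - by rewrite !s0 addr0 subrr normr0.
    - by rewrite !s0 addr0 subrr normr0.
  by split; [exact: (c1 _ _ Oz).1|exact: dM].
have L2 : `|u z2 - u z1| <= M * `|y.1.2 - x.1.2|.
  apply: line_le => s s01; have [Oz zd] : O (z1 + (s * (y.1.2 - x.1.2)) *: basis3 ax1) /\
      enorm (z1 + (s * (y.1.2 - x.1.2)) *: basis3 ax1 - x) < d.
    apply: ok; apply: N; rewrite /z1 /=.
    - by rewrite !s1 !s0 addr0 addrAC subrr add0r.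
    - by rewrite !s1 !s0 addr0 addrAC subrr add0r; exact: Ns.
    - by rewrite !s0 !addr0 subrr normr0.
  by split; [exact: (c1 _ _ Oz).1|exact: dM].
have L3 : `|u y - u z2| <= M * `|y.2 - x.2|.
  rewrite {1}E3'; apply: line_le => s s01; have [Oz zd] : O (z2 + (s * (y.2 - x.2)) *: basis3 ax2) /\
      enorm (z2 + (s * (y.2 - x.2)) *: basis3 ax2 - x) < d.
    apply: ok; apply: N; rewrite /z2 /z1 /=.
    - by rewrite !s1 !s0 !addr0 addrAC subrr add0r.
    - by rewrite !s1 !s0 !addr0 addrAC subrr add0r.
    - by rewrite !s1 !s0 !addr0 addrAC subrr add0r; exact: Ns.
  by split; [exact: (c1 _ _ Oz).1|exact: dM].
rewrite (_ : u y - u x = (u y - u z2) + (u z2 - u z1) + (u z1 - u x)); last by ring.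
apply: (le_lt_trans (ler_normD _ _)); apply: (le_lt_trans (lerD (ler_normD _ _) (lexx _))).
have {}ye : enorm (y - x) * (3 * M + 1) < e by rewrite -ltr_pdivlMr.
rewrite /= in c1' c2' c3'.
have := ler_wpM2l (ltW M0) c1'; have := ler_wpM2l (ltW M0) c2'; have := ler_wpM2l (ltW M0) c3'.
have := enorm_ge0 (y - x); rewrite /= in L1 L2 L3 *; nra.
Qed.

Lemma harmonic_D2on O v : open O -> harmonic_on O v ->
  D2on O v (fun i => partial i v) (fun i => partial i (partial i v)) /\
  forall x, O x -> lap (fun i => partial i (partial i v)) x = 0.
Proof.
move=> oO [[c1 c2] lv]; split=> //; split.
- by move=> i x /(c1 i)[d _]; exact: derivableP.
- by move=> i x /(c2 i i)[d _]; exact: derivableP.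
- by move=> x Ox; exact: (C1_continuous oO c1).
- by move=> i x Ox; exact: (C1_continuous oO (c2 i)).
- by move=> i x /(c2 i i)[].
Qed.

Lemma harmonic_on_MVP O v : open O -> harmonic_on O v -> MVP O v.
Proof. by move=> oO /(harmonic_D2on oO)[D L]; exact: harmonic_MVP D L. Qed.

Lemma eq_MVP O u w : open O -> (forall x, O x -> u x = w x) -> MVP O u -> MVP O w.
Proof.
move=> oO E [cu mu]; split.
  move=> x Ox; have /openE3/(_ _ Ox)[r r0 rO] := oO.
  by apply: (eq_ball_continuous r0 _ (cu _ Ox)) => y /rO; exact: E.
move=> x r r0 rO; rewrite -E; last by apply: rO; rewrite subrr enorm0 ltW.
rewrite -(mu _ _ r0 rO); apply: eq_I3 => y; congr (_ * _); rewrite /ext0; case: ifPn => //.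
by rewrite inE => /E.
Qed.

Lemma MVPDZ O u w (k : R) : open O -> MVP O u -> MVP O w -> MVP O (fun x => u x + k * w x).
Proof.
move=> oO [cu mu] [cw mw]; split.
  move=> x Ox; apply: cvgD; first exact: cu.
  by apply: cvgM; [exact: cvg_cst|exact: cw].
move=> x r r0 rO; have iu := int3_bump_ext0 oO cu r0 rO; have iw := int3_bump_ext0 oO cw r0 rO.
rewrite (eq_I3 (w := fun y => bump r x y * ext0 O u y + k * (bump r x y * ext0 O w y))); last first.
  by move=> y; rewrite /ext0; case: ifP => _; ring.
by rewrite (I3D iu (int3Z k iw)) (I3Z k iw) mu // mw //; ring.
Qed.

Lemma MVP0 O : MVP O (fun=> 0).
Proof.
split; first by move=> *; exact: cvg_cst.
move=> x r _ _; rewrite mulr0 (eq_I3 (w := fun=> 0)) ?I3_0 // => y.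
by rewrite /ext0; case: ifP; rewrite mulr0.
Qed.

Definition cMVP O (f : E3 R -> R[i]) := MVP O (cre f) /\ MVP O (cim f).

Lemma cMVPDZ O (f g : E3 R -> R[i]) (c : R[i]) : open O -> cMVP O f -> cMVP O g ->
  cMVP O (fun x => f x + c * g x).
Proof.
case: c => s t oO [f1 f2] [g1 g2]; split.
  have := MVPDZ (- t) oO (MVPDZ s oO f1 g1) g2; apply: eq_MVP => // x _.
  by rewrite /cre /cim; case: (f x) (g x) => a b [a' b'] /=; ring.
have := MVPDZ t oO (MVPDZ s oO f2 g2) g1; apply: eq_MVP => // x _.
by rewrite /cre /cim; case: (f x) (g x) => a b [a' b'] /=; ring.
Qed.

Lemma eq_cMVP O (f g : E3 R -> R[i]) : open O -> (forall x, O x -> f x = g x) -> cMVP O f -> cMVP O g.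
Proof.
move=> oO E [f1 f2]; split; [move: f1|move: f2]; apply: eq_MVP => // x Ox; by rewrite /cre /cim E.
Qed.

Lemma cMVP_sum O (I : Type) (s : seq I) (c : I -> R[i]) (f : I -> E3 R -> R[i]) : open O ->
  (forall j, cMVP O (f j)) -> cMVP O (fun x => \sum_(j <- s) c j * f j x).
Proof.
move=> oO H; elim: s => [|j s IH].
  have : cMVP O (fun=> 0) by split; exact: MVP0.
  by apply: eq_cMVP => // x _; rewrite big_nil.
have := cMVPDZ (c j) oO IH (H j); apply: eq_cMVP => // x _.
by rewrite big_cons addrC.
Qed.

End harmonic_mean_value.

(** * Multipoles satisfy the mean value property away from the origin *)

Section multipole_harmonic.
Context {R : realType} (Y : forall l : nat, 'I_(l.*2.+1) -> E3 R -> R[i]).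
Implicit Types (O : set (E3 R)) (x y z : E3 R).

Lemma rpolyZ l f (s : R) x : rpoly l f (s *: x) = s ^+ l * rpoly l f x.
Proof.
rewrite /rpoly mulr_sumr; apply: eq_bigr => a _; rewrite mulr_sumr; apply: eq_bigr => b ab.
rewrite /mono /= !exprMn (_ : s ^+ l = s ^+ a * s ^+ b * s ^+ (l - a - b)); first by ring.
by rewrite -!exprD -subnDA subnKC.
Qed.

(* The Kelvin transform r^-(2l+1) u of a harmonic homogeneous polynomial u of
   degree l is harmonic, by Euler's identity x . grad u = l u. *)
Lemma kelvin_MVP O l (f : nat -> nat -> R) (r : R) : open O -> 0 < r -> (forall x, O x -> r <= enorm x) ->
  (forall x, \sum_(a < l.+1) \sum_(b < l.+1 | (a + b <= l)%N) f a b * lapmono a b (l - a - b) x = 0) ->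
  MVP O (fun x => rpoly l f x * (enorm x)^-1 ^+ l.*2.+1).
Proof.
move=> oO r0 rO hf; have [g [h [Du Lu Eu]]] := rpoly_D2on l f.
pose k := l.*2.+1.
have d1 (t : R) : is_derive t 1 (fun s : R => s ^+ k) (k%:R * t ^+ k.-1).
  by have := is_deriveXf k (is_derive_id t (1 : R)); rewrite mulr1.
have d2 (t : R) : is_derive t 1 (fun s : R => k%:R * s ^+ k.-1) (ffact2 k * t ^+ k.-2).
  have := is_deriveMf (is_derive_cst (k%:R : R) t (1 : R)) (is_deriveXf k.-1 (is_derive_id t (1 : R))).
  by move=> H; apply: (is_derive_eqf H); rewrite /ffact2 mulr0 addr0 mulr1 mulrA.
have cf2 : continuous (fun t : R => ffact2 k * t ^+ k.-2).
  move=> t; have H := is_deriveMf (is_derive_cst (ffact2 k) t (1 : R)) (is_deriveXf k.-2 (is_derive_id t (1 : R))).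
  exact: is_derive_continuous H.
(* [newt r 0] is 1/|x| on O and twice differentiable everywhere, so powers of 1/|x| can be treated
   as powers of it. *)
have Dw := D2on_comp d1 d2 cf2 (newt_D2on O r 0).
have D := D2onM (D2on_sub (fun _ _ => I) Du) Dw.
have N x : O x -> newt r 0 x = (enorm x)^-1 by move=> /rO rx; rewrite newt_far ?subr0.
suff L : MVP O (fun x => rpoly l f x * ((fun s : R => s ^+ k) \o newt r 0) x).
  by move: L; apply: eq_MVP => // x Ox /=; rewrite N.
apply: (harmonic_MVP oO D) => x Ox.
have rx := rO _ Ox; have x0 := lt_le_trans r0 rx.
pose a := (enorm x)^-1; have Nx : newt r 0 x = a by exact: N.
have N1 i : newt1 r 0 i x = - (co i x * a ^+ 3).
  by rewrite newt1_far ?subr0 // /a exprVn.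
have L2 : lap (newt2 r 0) x = 0 by rewrite lap_newt // bump_out ?subr0 // oppr0.
have Lu0 : lap h x = 0 by rewrite Lu hf.
have Ex := Eu x; have S2 := sum_co_sqr x; rewrite -enorm_sqr in S2.
have ax : a * enorm x = 1 by rewrite /a mulVf // gt_eqF.
rewrite /lap.
(* The gradient of a = 1/|x| has square a^4. What remains is u k (k-1) a^(k+2) from the power and -
   2 k l u a^(k+2) from Euler's identity; they cancel because k - 1 = 2 l. *)
transitivity (rpoly l f x * (k%:R * a ^+ k.-1 * lap (newt2 r 0) x)
  + rpoly l f x * (ffact2 k * a ^+ k.-2 * (a ^+ 3 * a ^+ 3 * \sum_(i < 3) co i x ^+ 2))
  + a ^+ k * lap h x
  - 2 * (k%:R * a ^+ k.-1 * a ^+ 3 * \sum_(i < 3) co i x * g i x)).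
  rewrite /lap !mulr_sumr -!big_split -sumrB; apply: eq_bigr => i _ /=.
  by rewrite Nx N1; ring.
rewrite L2 Lu0 Ex S2 !mulr0 add0r addr0.
rewrite /ffact2 /k /=.
case ln: (l.*2) => [|n].
  have -> : l = 0%N by apply/eqP; rewrite -double_eq0 ln.
  by rewrite !(mulr0, mul0r, oppr0, addr0, subr0).
rewrite /=; have -> : (n.+1%:R : R) = 2 * l%:R by rewrite -ln -muln2 natrM mulrC.
have -> : a ^+ n.+1 = a ^+ n * a by rewrite exprSr.
have -> : a ^+ 3 * a ^+ 3 * enorm x ^+ 2 = a ^+ 4 * (a * enorm x) ^+ 2 by ring.
by rewrite ax; ring.
Qed.

Lemma multipole_cMVP O l (m : 'I_(l.*2.+1)) (r : R) : open O -> 0 < r -> (forall x, O x -> r <= enorm x) ->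
  spherical_harmonic l (Y m) -> cMVP O (multipole Y m).
Proof.
move=> oO r0 rO [q [hq qE]].
have E x : O x -> multipole Y m x = hompoly l q x * ((enorm x)^-1 ^+ l.*2.+1)%:C.
  move=> /rO /(lt_le_trans r0) x0; rewrite /multipole qE; last first.
    by rewrite enormZ ger0_norm ?invr_ge0 ?enorm_ge0 // mulVf // gt_eqF.
  have hZ : hompoly l q ((enorm x)^-1 *: x) = ((enorm x)^-1 ^+ l)%:C * hompoly l q x.
    have := cre_hompoly l q ((enorm x)^-1 *: x); have := cim_hompoly l q ((enorm x)^-1 *: x).
    have := cre_hompoly l q x; have := cim_hompoly l q x; rewrite !rpolyZ /cre /cim.
    case: (hompoly l q x) => a b; case: (hompoly _ _ _) => a' b' /= <- <- -> ->.
    by apply/eqP; rewrite eq_complex /= !mul0r subr0 addr0 !eqxx.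
  rewrite hZ -fmorphV /= -mulrA mulrC -mulrA; congr (_ * _); rewrite -rmorphM /=; congr (_%:C).
  by rewrite -exprVn -exprD addSn addnn.
have H0 := charmonic_clap hq.
have hre x : \sum_(a < l.+1) \sum_(b < l.+1 | (a + b <= l)%N) complex.Re (q a b) * lapmono a b (l - a - b) x = 0.
  transitivity (complex.Re (clap l q x)); last by rewrite H0.
  rewrite /clap raddf_sum; apply: eq_bigr => a _.
  by rewrite raddf_sum; apply: eq_bigr => b _; rewrite -ReM_real.
have him x : \sum_(a < l.+1) \sum_(b < l.+1 | (a + b <= l)%N) complex.Im (q a b) * lapmono a b (l - a - b) x = 0.
  transitivity (complex.Im (clap l q x)); last by rewrite H0.
  rewrite /clap raddf_sum; apply: eq_bigr => a _.
  by rewrite raddf_sum; apply: eq_bigr => b _; rewrite -ImM_real.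
have M1 := @kelvin_MVP _ l (fun a b => complex.Re (q a b)) _ oO r0 rO hre.
have M2 := @kelvin_MVP _ l (fun a b => complex.Im (q a b)) _ oO r0 rO him.
split; [move: M1|move: M2]; apply: eq_MVP => // x Ox.
  by rewrite /cre E // ReM_real -cre_hompoly.
by rewrite /cim E // ImM_real -cim_hompoly.
Qed.

Lemma multipole_sum_cMVP O L c (r : R) : open O -> 0 < r -> (forall x, O x -> r <= enorm x) ->
  (forall l m, spherical_harmonic l (@Y l m)) -> cMVP O (multipole_sum Y L c).
Proof.
move=> oO r0 rO sY.
have H : cMVP O (fun x => \sum_(l < L.+1) 1 * \sum_(m < l.*2.+1) c l m * multipole Y m x).
  apply: (@cMVP_sum _ _ _ _ (fun=> 1) (fun (l : 'I_L.+1) x => \sum_(m < l.*2.+1) c l m * multipole Y m x)) => // l.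
  by apply: cMVP_sum => // m; exact: multipole_cMVP r0 rO _.
by move: H; apply: eq_cMVP => // x _; apply: eq_bigr => l _; rewrite mul1r.
Qed.

End multipole_harmonic.

(** * Lipschitz boundaries and the surface measure *)

Section boundary_geometry.
Context {R : realType} (D : set (E3 R)).
Hypotheses (oD : open D) (bD : bounded_set D) (D0 : D 0).
Implicit Types (x y z q : E3 R).

Lemma bdryE x : bdry D x <-> closure D x /\ ~ D x.
Proof.
rewrite /bdry (_ : D° = D) //; apply/seteqP; split; first exact: interior_subset.
by move=> y Dy; rewrite /interior /=; apply: open_nbhs_nbhs.
Qed.

Lemma exteriorE x : exterior D x <-> ~ closure D x.
Proof.
rewrite /exterior interiorE3 closureE3; split=> [[r r0 h] /(_ _ r0)[y Dy yx]|]; first exact: (h y yx).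
move=> H; apply: contrapT => K; apply: H => e e0; apply: contrapT => L.
by apply: K; exists e => // y yx Dy; apply: L; exists y.
Qed.

Lemma open_exterior : open (exterior D).
Proof. exact: open_interior. Qed.

Lemma notDE x : ~ D x <-> bdry D x \/ exterior D x.
Proof.
rewrite bdryE exteriorE; split=> [nx|[[_]//|nx Dx]]; last exact/nx/subset_closure.
by have [cx|ncx] := pselect (closure D x); [left|right].
Qed.

Lemma exterior_notD x : exterior D x -> ~ D x.
Proof. by move=> ex; apply/notDE; right. Qed.

Lemma bdry_notD x : bdry D x -> ~ D x.
Proof. by move=> ex; apply/notDE; left. Qed.

Lemma bdry_not_exterior x : bdry D x -> ~ exterior D x.
Proof. by move=> /bdryE[cx _] /exteriorE. Qed.

Lemma closed_bdry : closed (bdry D).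
Proof.
rewrite (_ : bdry D = closure D `&` ~` D); last by apply/seteqP; split=> x; [move=> /bdryE|move=> h; apply/bdryE].
by apply: closedI; [exact: closed_closure|exact: open_closedC].
Qed.

Lemma domain_bounded : exists2 r : R, 0 < r & forall x, closure D x -> enorm x <= r.
Proof.
have [M0 [_ HM]] := bD; pose M := `|M0| + 1.
have hM x : D x -> `|x| <= M.
  by apply: HM; rewrite /M; have := ler_norm M0; lra.
exists (2 * M + 1); first by rewrite ltr_wpDl // mulr_ge0 // /M addr_ge0.
move=> x /closureE3/(_ 1 ltr01)[y Dy yx].
have := enorm_le_norm y; have := hM _ Dy; have := enormDB x y 0; rewrite !subr0 (enormB x y); lra.
Qed.

Lemma compact_bdry : compact (bdry D).
Proof.
have [r _ hr] := domain_bounded; apply: (@closed_bounded_compactE3 _ _ r); first exact: closed_bdry.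
by move=> x /bdryE[/hr].
Qed.

Lemma bdry_cross z x : D z -> ~ D x ->
  exists2 s : R, 0 <= s <= 1 & bdry D (z + s *: (x - z)).
Proof.
move=> Dz nx; pose A : set R := [set s | 0 <= s <= 1 /\ D (z + s *: (x - z))].
have A0 : A 0 by split; rewrite ?lexx ?ler01 // scale0r addr0.
have hA : has_sup A by split; [exists 0|exists 1 => s [/andP[]]].
have s0 : 0 <= sup A by apply: ub_le_sup => //; exact: hA.2.
have s1 : sup A <= 1 by apply: ge_sup => [|s [/andP[]]] //; exists 0.
exists (sup A); first by rewrite s0.
apply/bdryE; split.
  apply/closureE3 => e e0; have n0 := enorm_ge0 (x - z).
  have d0 : 0 < e / (enorm (x - z) + 1) by rewrite divr_gt0 // ltr_wpDl.
  have [s [/andP[s0' s1'] Ds] ss] := sup_adherent d0 hA.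
  exists (z + s *: (x - z)) => //.
  have sA : s <= sup A by apply: ub_le_sup; [exact: hA.2|split=> //; rewrite s0'].
  rewrite (_ : _ - _ = (s - sup A) *: (x - z)); last by apply: E3ext; rewrite /= /GRing.scale /=; ring.
  rewrite enormZ distrC ger0_norm ?subr_ge0 //.
  apply: (@le_lt_trans _ _ ((sup A - s) * (enorm (x - z) + 1))).
    by apply: ler_wpM2l; [rewrite subr_ge0|rewrite lerDl].
  by rewrite -ltr_pdivlMr ?ltr_wpDl //; lra.
move=> Ds; have [r r0 rD] := proj1 (openE3 D) oD _ Ds.
have s1' : sup A < 1.
  rewrite lt_neqAle s1 andbT; apply/eqP => s1'; apply: nx.
  by move: Ds; rewrite s1' scale1r addrCA subrr addr0.
pose d := Num.min (1 - sup A) (r / 2 / (enorm (x - z) + 1)).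
have d0 : 0 < d by rewrite lt_min subr_gt0 s1' !divr_gt0 // ltr_wpDl.
have d1 : d <= 1 - sup A by rewrite ge_min lexx.
have d2 : d * (enorm (x - z) + 1) <= r / 2.
  by rewrite -ler_pdivlMr ?ltr_wpDl // ge_min lexx orbT.
have : A (sup A + d).
  split; first by apply/andP; split; lra.
  apply: rD; rewrite /eball /= (_ : _ - _ = d *: (x - z)); last by apply: E3ext; rewrite /= /GRing.scale /=; ring.
  rewrite enormZ gtr0_norm //; nra.
by move=> /(ub_le_sup hA.2); lra.
Qed.

Lemma bdry_nonempty : bdry D !=set0.
Proof.
have [r r0 hr] := domain_bounded.
have [|s _ h] := @bdry_cross 0 ((2 * r) *: basis3 ord0) D0; last by eexists; exact: h.
move=> /subset_closure/hr; rewrite enorm_basis3Z ger0_norm; [lra|by rewrite mulr_ge0 // ltW].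
Qed.

Local Notation delta x := (dist x (bdry D)).

Lemma dist_has_inf x : has_inf [set enorm (x - s) | s in bdry D].
Proof.
split; first by have [q Sq] := bdry_nonempty; exists (enorm (x - q)), q.
by exists 0 => _ [q _ <-]; exact: enorm_ge0.
Qed.

Lemma dist_le x q : bdry D q -> delta x <= enorm (x - q).
Proof. by move=> Sq; apply: ge_inf; [exact: (dist_has_inf x).2|exists q]. Qed.

Lemma dist_approx x (e : R) : 0 < e -> exists2 q, bdry D q & enorm (x - q) < delta x + e.
Proof. by move=> /inf_adherent/(_ (dist_has_inf x))[_ [q Sq <-] h]; exists q. Qed.

Lemma dist_ge x (d : R) : (forall q, bdry D q -> d <= enorm (x - q)) -> d <= delta x.
Proof.
by move=> H; apply: lb_le_inf; [exact: (dist_has_inf x).1|move=> _ [q Sq <-]; exact: H].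
Qed.

Lemma dist_ge0 x : 0 <= delta x.
Proof. by apply: dist_ge => q _; exact: enorm_ge0. Qed.

Lemma dist_lip x y : delta x <= enorm (x - y) + delta y.
Proof.
rewrite -lerBlDl; apply: dist_ge => q Sq; rewrite lerBlDl.
exact: le_trans (dist_le x Sq) (enormDB x y q).
Qed.

Lemma continuous_dist : continuous (fun x => delta x).
Proof.
apply: (@lipschitz_continuousE3 _ _ 1) => x y; rewrite mul1r ler_norml.
have := dist_lip x y; have := dist_lip y x; rewrite (enormB y x) => a b.
by apply/andP; split; lra.
Qed.

Lemma dist_exterior_ge x (r : R) : (forall y, enorm (y - x) < r -> exterior D y) -> r <= delta x.
Proof.
move=> H; apply: dist_ge => q Sq; rewrite leNgt; apply/negP => xq.
by apply: (bdry_not_exterior Sq); apply: H; rewrite enormB.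
Qed.

Lemma dist_gt0 x : exterior D x -> 0 < delta x.
Proof.
move=> ex; have [r r0 rO] := proj1 (openE3 _) open_exterior _ ex.
by apply: (lt_le_trans r0); apply: dist_exterior_ge => y /rO.
Qed.

Lemma dist_bdry x : bdry D x -> delta x = 0.
Proof.
move=> Sx; apply/eqP; rewrite eq_le dist_ge0 andbT.
by have := dist_le x Sx; rewrite subrr enorm0.
Qed.

End boundary_geometry.

Section charts.
Context {R : realType} (D : set (E3 R)).
Hypothesis (oD : open D).
Implicit Types (x y z q p : E3 R).

(** For a square matrix, orthonormal rows imply orthonormal columns ([mulmx1C]), which is the
    expansion read coordinatewise. *)
Lemma orthonormal_expansion (e1 e2 e3 x : E3 R) :
  dot e1 e1 = 1 -> dot e2 e2 = 1 -> dot e3 e3 = 1 -> dot e1 e2 = 0 -> dot e1 e3 = 0 -> dot e2 e3 = 0 ->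
  x = dot x e1 *: e1 + dot x e2 *: e2 + dot x e3 *: e3.
Proof.
move=> e11 e22 e33 e12 e13 e23.
pose e (i : 'I_3) := if i == 0%N :> nat then e1 else if i == 1%N :> nat then e2 else e3.
pose v (y : E3 R) (j : 'I_3) := if j == 0%N :> nat then y.1.1 else if j == 1%N :> nat then y.1.2 else y.2.
pose A : 'M[R]_3 := \matrix_(i, j) v (e i) j.
have dotE y z : dot y z = \sum_j v y j * v z j.
  by rewrite /dot !big_ord_recl big_ord0 /v /= addr0 addrA.
have AA : A *m A^T = 1%:M.
  apply/matrixP => i j; rewrite !mxE.
  rewrite (eq_bigr (fun k => v (e i) k * v (e j) k)); last by move=> k _; rewrite !mxE.
  rewrite -dotE; case: i => -[|[|[|//]]] Pi; case: j => -[|[|[|//]]] Pj; rewrite /e /= ?(e11, e22, e33, e12, e13, e23) //.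
  - by rewrite dotC e12.
  - by rewrite dotC e13.
  - by rewrite dotC e23.
have BB := mulmx1C AA.
have key (j : 'I_3) : v x j = \sum_i dot x (e i) * v (e i) j.
  transitivity (((\row_k v x k) *m (A^T *m A)) ord0 j); first by rewrite BB mulmx1 mxE.
  rewrite mulmxA mxE; apply: eq_bigr => i _; rewrite !mxE; congr (_ * _).
  by rewrite dotE; apply: eq_bigr => k _; rewrite !mxE.
have k0 := key (inord 0); have k1 := key (inord 1); have k2 := key (inord 2).
move: k0 k1 k2; rewrite /v !inordK //= !big_ord_recl !big_ord0 /e /= !addr0 => k0 k1 k2.
apply: E3ext; rewrite /= /GRing.scale /=.
- by rewrite {1}k0 addrA.
- by rewrite {1}k1 addrA.
- by rewrite {1}k2 addrA.
Qed.

Lemma lipschitz_bound (phi : R * R -> R) : [lipschitz phi y | y in setT] ->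
  exists2 L : R, 0 < L & forall a b a' b' : R, `|phi (a, b) - phi (a', b')| <= L * (`|a - a'| + `|b - b'|).
Proof.
move=> [M0 [_ HM]]; exists (`|M0| + 1); first by rewrite ltr_wpDl.
move=> a b a' b'; have := HM (`|M0| + 1) _ ((a, b), (a', b')) (conj I I).
rewrite /= => /(_ _)/le_trans; apply; first by have := ler_norm M0; lra.
apply: ler_wpM2l; first by rewrite addr_ge0.
by rewrite prod_normE /= ge_max lerDl lerDr !normr_ge0.
Qed.

Section one_chart.
Variables (e1 e2 e3 : E3 R) (phi : R * R -> R) (U : set (E3 R)).
Hypothesis (ch : lipschitz_chart D e1 e2 e3 phi U).

Lemma chart_unit : enorm e3 = 1.
Proof. by have [[_ _ e33] _ _ _ _] := ch; rewrite /enorm e33 sqrtr1. Qed.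

Lemma chart_coord_le x : [/\ `|dot x e1| <= enorm x, `|dot x e2| <= enorm x & `|dot x e3| <= enorm x].
Proof.
have [[e11 e22 e33] _ _ _ _] := ch.
have n y : dot y y = 1 -> `|dot x y| <= enorm x.
  by move=> y1; apply: (le_trans (dot_le _ _)); rewrite {2}/enorm y1 sqrtr1 mulr1.
by split; exact: n.
Qed.

Lemma chart_enorm_le x : enorm x <= `|dot x e1| + `|dot x e2| + `|dot x e3|.
Proof.
have [[e11 e22 e33] [e12 e13 e23] _ _ _] := ch.
rewrite {1}(orthonormal_expansion x e11 e22 e33 e12 e13 e23).
apply: (le_trans (enormD _ _)); apply: lerD; last by rewrite enormZ /enorm e33 sqrtr1 mulr1.
by apply: (le_trans (enormD _ _)); rewrite !enormZ /enorm e11 e22 sqrtr1 !mulr1.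
Qed.

Lemma chart_graph_dot (y : R * R) :
  [/\ dot (graph_pt e1 e2 e3 phi y) e1 = y.1, dot (graph_pt e1 e2 e3 phi y) e2 = y.2
    & dot (graph_pt e1 e2 e3 phi y) e3 = phi y].
Proof.
have [[e11 e22 e33] [e12 e13 e23] _ _ _] := ch.
rewrite /graph_pt; split; rewrite !dotDl !dotZl ?(e11, e22, e33, e12, e13, e23) ?(dotC e2 e1) ?(dotC e3 e1) ?(dotC e3 e2) ?(e12, e13, e23);
  by rewrite !(mulr0, mulr1, addr0, add0r).
Qed.

Lemma chart_bdry q : bdry D q -> U q -> phi (dot q e1, dot q e2) = dot q e3.
Proof.
have [_ _ /lipschitz_bound[L L0 hL] oU hU] := ch.
move=> /(bdryE oD)[cq nq] Uq; apply/eqP; rewrite eq_le; apply/andP; split; last first.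
  by rewrite leNgt; apply/negP => /(hU _ Uq).
rewrite -subr_le0 leNgt; apply/negP => h.
have [r r0 rU] := proj1 (openE3 U) oU _ Uq.
pose d := phi (dot q e1, dot q e2) - dot q e3.
have e0 : 0 < Num.min r (d / (2 * L + 1)).
  by rewrite lt_min r0 divr_gt0 // ltr_wpDl // mulr_ge0 // ltW.
have [y Dy] := proj1 (closureE3 D q) cq _ e0; rewrite lt_min => /andP[yr].
rewrite ltr_pdivlMr; last by rewrite ltr_wpDl // mulr_ge0 // ltW.
have /hU/proj1/(_ Dy) := rU _ yr.
have [] := chart_coord_le (y - q); rewrite !dotBl => c1 c2 c3.
have := hL (dot y e1) (dot y e2) (dot q e1) (dot q e2).
rewrite ler_norml => /andP[hL' _] lt ye.
have := ler_wpM2l (ltW L0) c1; have := ler_wpM2l (ltW L0) c2.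
move: c3; rewrite ler_norml => /andP[_ c3].
rewrite /d in ye; rewrite mulrDr in hL'; lra.
Qed.

Lemma chart_graph_bdry (y : R * R) : U (graph_pt e1 e2 e3 phi y) -> bdry D (graph_pt e1 e2 e3 phi y).
Proof.
have [[_ _ e33] [_ e13 e23] _ oU hU] := ch.
move=> Uy; have [g1 g2 g3] := chart_graph_dot y.
apply/(bdryE oD); split; last by move=> /(hU _ Uy); rewrite g1 g2 g3 -surjective_pairing ltxx.
apply/closureE3 => e e0; have [r r0 rU] := proj1 (openE3 U) oU _ Uy.
pose t := Num.min (r / 2) (e / 2).
have t0 : 0 < t by rewrite lt_min !divr_gt0.
have tr : t <= r / 2 by rewrite ge_min lexx.
have te : t <= e / 2 by rewrite ge_min lexx orbT.
have nt : enorm (graph_pt e1 e2 e3 phi y + t *: e3 - graph_pt e1 e2 e3 phi y) = t.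
  by rewrite addrAC subrr add0r enormZ chart_unit mulr1 gtr0_norm.
exists (graph_pt e1 e2 e3 phi y + t *: e3); last by rewrite nt; lra.
apply/hU; first by apply: rU; rewrite /eball /= nt; lra.
by rewrite !(dotDl (graph_pt e1 e2 e3 phi y)) !(dotZl t) g1 g2 g3 (dotC e3 e1) (dotC e3 e2) e13 e23 e33 !mulr0 !addr0 mulr1 -surjective_pairing ltrDl.
Qed.

(** With L the Lipschitz constant of phi, a point within c t of x - t e3 has moved down by at least
    t - c t, while phi changed by at most 2 L c t. The choice c = 1/(2L+2) makes the first exceed
    the second; upwards likewise. The ball of radius 4 r keeps all these points in the chart. *)
Lemma chart_cone p : U p -> exists2 c : R, 0 < c <= 1 & exists2 r : R, 0 < r & 
  eball p (4 * r) `<=` U /\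
  forall x (t : R), enorm (x - p) < r -> 0 < t -> t < r ->
    (~ D x -> forall y, enorm (y - (x - t *: e3)) < c * t -> exterior D y) /\
    (bdry D x -> forall y, enorm (y - (x + t *: e3)) < c * t -> D y).
Proof.
move=> Up; have [[_ _ e33] [_ e13 e23] /lipschitz_bound[L L0 hL] oU hU] := ch.
have [r4 r40 rU] := proj1 (openE3 U) oU _ Up; pose r := r4 / 4.
have r0 : 0 < r by rewrite divr_gt0.
have c0 : 0 < (2 * L + 2)^-1 by rewrite invr_gt0; lra.
have c1 : (2 * L + 2)^-1 <= 1 by rewrite invf_le1; lra.
exists (2 * L + 2)^-1; first by rewrite c0.
exists r => //; split; first by rewrite /r mulrC divfK.
move=> x t xp t0 tr; set c := (2 * L + 2)^-1 in c0 c1 *.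
have cL : c * (2 * L + 2) = 1 by rewrite /c mulVf // gt_eqF //; lra.
have ct : c * t <= t by rewrite ler_piMl // ltW.
have Ux : U x by apply: rU; rewrite /eball /=; rewrite /r in xp r0; lra.
have dU y (s : R) : `|s| = t -> enorm (y - (x + s *: e3)) < c * t -> U y.
  move=> st yx; apply: rU; rewrite /eball /=.
  have := enormDB y (x + s *: e3) x; rewrite [x + _ - x]addrAC subrr add0r enormZ st chart_unit mulr1.
  have := enormDB y x p; rewrite /r in xp tr *; lra.
have coord y (s : R) : enorm (y - (x + s *: e3)) < c * t ->
    [/\ `|dot y e1 - dot x e1| < c * t, `|dot y e2 - dot x e2| < c * t & `|dot y e3 - (dot x e3 + s)| < c * t].
  move=> yx; have := chart_coord_le (y - (x + s *: e3)).
  rewrite !dotBl !dotDl !dotZl (dotC e3 e1) (dotC e3 e2) e13 e23 e33 !mulr0 !addr0 mulr1.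
  by case=> a b d; split; exact: le_lt_trans yx.
have ctL : 0 < c * t by rewrite mulr_gt0.
have cLt : c * t + L * (c * t + c * t) < t.
  have : (c * (2 * L + 2)) * t = t by rewrite cL mul1r.
  lra.
split=> [nx y|Sx y].
  have next y' : enorm (y' - (x - t *: e3)) < c * t -> ~ D y'.
    rewrite -scaleNr => yx; have st : `|- t| = t by rewrite normrN gtr0_norm.
    have [a b d] := coord _ _ yx.
    move=> /(proj1 (hU _ (dU _ _ st yx))).
    have : dot x e3 <= phi (dot x e1, dot x e2) by rewrite leNgt; apply/negP => /(hU _ Ux).
    have := hL (dot y' e1) (dot y' e2) (dot x e1) (dot x e2).
    rewrite ler_norml => /andP[hL' _]; move: d; rewrite ltr_norml => /andP[_ d].
    have : L * (`|dot y' e1 - dot x e1| + `|dot y' e2 - dot x e2|) <= L * (c * t + c * t).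
      by apply: ler_wpM2l; [exact: ltW|apply: lerD; exact: ltW].
    lra.
  move=> yx; apply/interiorE3; exists (c * t - enorm (y - (x - t *: e3))); first by rewrite subr_gt0.
  by move=> y' y'y; apply: next; rewrite /eball /= in y'y; have := enormDB y' y (x - t *: e3); lra.
move=> yx; have st : `|t| = t by rewrite gtr0_norm.
have [a b d] := coord _ _ yx; apply/(hU _ (dU _ _ st yx)).
have Ex := chart_bdry Sx Ux.
have := hL (dot y e1) (dot y e2) (dot x e1) (dot x e2).
rewrite ler_norml => /andP[_ hL']; move: d; rewrite ltr_norml => /andP[d _].
have : L * (`|dot y e1 - dot x e1| + `|dot y e2 - dot x e2|) <= L * (c * t + c * t).
  by apply: ler_wpM2l; [exact: ltW|apply: lerD; exact: ltW].
lra.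
Qed.

End one_chart.
End charts.

Section nonmeasurable_comparison.
Context d (T : measurableType d) (R : realType) (mu : {measure set T -> \bar R}).
Local Open Scope ereal_scope.

(** The integral of a nonnegative function is a supremum over simple functions below it, so it is
    monotone without measurability. This is needed for the surface density, which contains
    derivatives of an arbitrary Lipschitz function. *)
Lemma le_integral_nonmeas (f g : T -> \bar R) : (forall x, 0 <= f x) -> (forall x, f x <= g x) ->
  \int[mu]_x f x <= \int[mu]_x g x.
Proof.
move=> f0 fg; have g0 x : 0 <= g x by exact: le_trans (f0 x) (fg x).
rewrite !ge0_integralTE //; apply: le_ereal_sup => _ [h hf <-]; exists h => //= x.
exact: le_trans (hf x) (fg x).
Qed.

Lemma le_integral_nonmeas_in (A B : set T) (f g : T -> \bar R) : A `<=` B ->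
  (forall x, A x -> 0 <= f x) -> (forall x, A x -> f x <= g x) -> (forall x, B x -> 0 <= g x) ->
  \int[mu]_(x in A) f x <= \int[mu]_(x in B) g x.
Proof.
move=> AB f0 fg g0; rewrite integral_mkcond [leRHS]integral_mkcond.
apply: le_integral_nonmeas => x; rewrite /patch.
  by case: ifPn => //; rewrite inE; exact: f0.
case: ifPn => [|_].
  by rewrite inE => Ax; rewrite mem_set; [exact: fg|exact: AB].
by case: ifPn => //; rewrite inE; exact: g0.
Qed.

End nonmeasurable_comparison.

(** * Growth of the surface measure on balls and a common cone for finitely many charts *)

Section surface_estimates.
Context {R : realType} (D : set (E3 R)).
Hypotheses (oD : open D) (bD : bounded_set D) (D0 : D 0).
Implicit Types (x y z q p : E3 R).

Lemma leb2_square (a b r : R) : 0 < r ->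
  leb2 R (`]a - r, a + r[%classic `*` `]b - r, b + r[%classic) = (4 * r ^+ 2)%:E.
Proof.
move=> r0; rewrite [LHS](@product_measure1E _ _ _ _ R leb1s leb1s) //.
have h1 (t : R) : leb1s (`]t - r, t + r[%classic) = (2 * r)%:E.
  rewrite [LHS]lebesgue_measure_itv /= lte_fin (_ : t - r < t + r); last lra.
  by rewrite -EFinB; congr _%:E; ring.
transitivity ((2 * r)%:E * (2 * r)%:E)%E; first by congr (_ * _)%E; exact: h1.
by rewrite -EFinM; congr _%:E; ring.
Qed.

(** Where the directional derivative does not exist, ['D_v phi y] is the default [point]; its norm
    enters the bound, which therefore holds at every y. *)
Lemma derive_lipschitz_bound (phi : R * R -> R) (L : R) :
  (forall a b a' b' : R, `|phi (a, b) - phi (a', b')| <= L * (`|a - a'| + `|b - b'|)) ->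
  exists K : R, forall v y : R * R, `|v.1| + `|v.2| <= 1 -> `|'D_v phi y| <= K.
Proof.
move=> hL; exists (`|L| + 1 + `|(point : R^o)|) => v y v1.
have [dv|nd] := pselect (derivable phi y v); last first.
  rewrite /derive dvgP //; first by rewrite lerDr addr_ge0.
have /is_deriveP/(_ 1 ltr01)[r r0 H] := derivableP dv.
have r2 : 0 < r / 2 by rewrite divr_gt0.
have hr : `|r / 2| < r by rewrite gtr0_norm //; lra.
have := H _ hr; set d := 'D_v phi y.
have := hL (y + (r / 2) *: v).1 (y + (r / 2) *: v).2 y.1 y.2.
rewrite -!surjective_pairing (_ : (y + _).1 - y.1 = r / 2 * v.1); last by rewrite /= /GRing.scale /=; ring.
rewrite (_ : (y + _).2 - y.2 = r / 2 * v.2); last by rewrite /= /GRing.scale /=; ring.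
rewrite !(normrM (r / 2)) (gtr0_norm r2) -mulrDr => A.
have {}A : `|phi (y + (r / 2) *: v) - phi y| <= `|L| * (r / 2).
  apply: (le_trans A); apply: (@le_trans _ _ (`|L| * (r / 2 * (`|v.1| + `|v.2|)))).
    by apply: ler_wpM2r; [rewrite mulr_ge0 ?(ltW r2) // addr_ge0|exact: ler_norm].
  by apply: ler_wpM2l => //; rewrite ler_piMr // ltW.
move=> B.
have : r / 2 * `|d| <= (`|L| + 1) * (r / 2).
  rewrite -{1}(gtr0_norm r2) -normrM.
  rewrite (_ : r / 2 * d = (phi (y + (r / 2) *: v) - phi y) - (phi (y + (r / 2) *: v) - phi y - r / 2 * d)); last by ring.
  by apply: (le_trans (ler_normB _ _)); rewrite mulrDl mul1r; apply: lerD => //; rewrite mul1r in B.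
rewrite mulrC ler_pM2r // => /le_trans; apply.
by rewrite lerDl.
Qed.

Variable sigma : {measure set (M3 R) -> \bar R}.
Hypothesis sP : surface_measure D sigma.

Lemma measurable_bdry : measurable (bdry D : set (M3 R)).
Proof. by apply: closed_measurable3; exact: closed_bdry. Qed.

Lemma measurable_bdry_ball (p : E3 R) (r : R) : measurable (bdry D `&` eball p r : set (M3 R)).
Proof. by apply: measurableI; [exact: measurable_bdry|apply: open_measurable3; exact: open_eball]. Qed.

(** The parameters of points in a ball of radius rho lie in a square of half-side rho, and the
    density is bounded. *)
Lemma chart_measure_upper e1 e2 e3 phi U : lipschitz_chart D e1 e2 e3 phi U ->
  exists2 K : R, 0 < K & forall (A : set (M3 R)) y (rho : R), measurable A -> A `<=` bdry D `&` U ->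
    0 < rho -> A `<=` eball y rho -> (sigma A <= (K * rho ^+ 2)%:E)%E.
Proof.
move=> ch; have [_ _ /lipschitz_bound[L L0 hL] _ _] := ch.
have [K1 hK] := derive_lipschitz_bound hL.
pose K := 1 + `|K1| + `|K1|; have K0 : 0 < K by rewrite /K -addrA ltr_wpDr // addr_ge0.
exists (K * 4); first by rewrite mulr_gt0.
move=> A y rho mA AS rho0 Ay; rewrite (sP ch mA AS).
pose B : set (M2 R) := `](dot y e1) - rho, (dot y e1) + rho[%classic `*` `](dot y e2) - rho, (dot y e2) + rho[%classic.
have mB : measurable B by apply: measurableX; exact: measurable_itv.
rewrite -mulrA EFinM -(leb2_square (dot y e1) (dot y e2) rho0) -/B.
rewrite -(@integral_cst _ _ _ (leb2 R) B mB K%:E).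
apply: le_integral_nonmeas_in.
- move=> z /Ay; rewrite /eball /= => zy; have [g1 g2 _] := chart_graph_dot ch z.
  have [c1 c2 _] := chart_coord_le ch (graph_pt e1 e2 e3 phi z - y).
  rewrite !(dotBl (graph_pt e1 e2 e3 phi z)) g1 g2 in c1 c2.
  by split=> /=; rewrite in_itv /= -ltr_distl; [exact: le_lt_trans zy|exact: le_lt_trans zy].
- by move=> z _; rewrite lee_fin sqrtr_ge0.
- move=> z _; rewrite lee_fin.
  have n1 : `|(1, 0 : R).1| + `|(1 : R, 0 : R).2| <= 1 :> R by rewrite /= normr1 normr0 addr0.
  have n2 : `|(0 : R, 1 : R).1| + `|(0 : R, 1 : R).2| <= 1 :> R by rewrite /= normr1 normr0 add0r.
  have h1 := hK (1, 0) z n1; have h2 := hK (0, 1) z n2.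
  have {}h1 := le_trans h1 (ler_norm K1); have {}h2 := le_trans h2 (ler_norm K1).
  rewrite -(ger0_norm (ltW K0)) -sqrtr_sqr ler_sqrt ?exprn_even_ge0 //.
  rewrite -(real_normK (num_real ('D_(1, 0) phi z))) -(real_normK (num_real ('D_(0, 1) phi z))).
  move: h1 h2; rewrite /K; move: `|'D_(1, 0) phi z| (normr_ge0 ('D_(1, 0) phi z)) => a a0.
  move: `|'D_(0, 1) phi z| (normr_ge0 ('D_(0, 1) phi z)) => b b0.
  move: `|K1| (normr_ge0 K1) => k k0; nra.
- by move=> z _; rewrite lee_fin ltW.
Qed.

(** The graph over a square of half-side k rho stays within distance (2L+2) k rho < rho of q, and
    the density is at least 1. *)
Lemma chart_measure_lower e1 e2 e3 phi U : lipschitz_chart D e1 e2 e3 phi U ->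
  exists2 c : R, 0 < c & forall q (rho : R), bdry D q -> 0 < rho -> eball q rho `<=` U ->
    ((c * rho ^+ 2)%:E <= sigma (bdry D `&` eball q rho))%E.
Proof.
move=> ch; have [_ _ /lipschitz_bound[L L0 hL] oU hU] := ch.
pose k := (2 * L + 3)^-1; have k0 : 0 < k by rewrite invr_gt0; lra.
have kL : k * (2 * L + 3) = 1 by rewrite mulVf // gt_eqF //; lra.
exists (4 * k ^+ 2); first by rewrite mulr_gt0 // exprn_gt0.
move=> q rho Sq rho0 qU.
have SU : bdry D `&` eball q rho `<=` bdry D `&` U by move=> x [Sx /qU].
rewrite (sP ch (measurable_bdry_ball q rho) SU).
have kr : 0 < k * rho by rewrite mulr_gt0.
rewrite (_ : 4 * k ^+ 2 * rho ^+ 2 = 4 * (k * rho) ^+ 2); last by ring.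
rewrite -(leb2_square (dot q e1) (dot q e2) kr).
set B := _ `*` _.
have mB : measurable (B : set (M2 R)) by apply: measurableX; exact: measurable_itv.
rewrite -[leLHS]mul1e -(@integral_cst _ _ _ (leb2 R) B mB 1%:E).
apply: le_integral_nonmeas_in => //.
- move=> z [/=]; rewrite !in_itv /= -!ltr_distl => z1 z2.
  have Uq : U q by apply: qU; rewrite /eball /= subrr enorm0.
  have [g1 g2 g3] := chart_graph_dot ch z; have Eq := chart_bdry oD ch Sq Uq.
  have gq : enorm (graph_pt e1 e2 e3 phi z - q) < rho.
    have := chart_enorm_le ch (graph_pt e1 e2 e3 phi z - q).
    rewrite !(dotBl (graph_pt e1 e2 e3 phi z)) g1 g2 g3 -Eq.
    have := hL z.1 z.2 (dot q e1) (dot q e2); rewrite -surjective_pairing => h.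
    have : L * (`|z.1 - dot q e1| + `|z.2 - dot q e2|) <= L * (k * rho + k * rho).
      by apply: ler_wpM2l; [exact: ltW|apply: lerD; exact: ltW].
    have : (k * (2 * L + 3)) * rho = rho by rewrite kL mul1r.
    move: z1 z2 h; move: `|z.1 - _| `|z.2 - _| `|phi z - _| => a b d; lra.
  split; last exact: gq.
  by apply: (chart_graph_bdry oD ch); apply: qU.
- move=> z _; rewrite lee_fin -[leLHS]sqrtr1 ler_sqrt; last by rewrite addr_ge0 ?sqr_ge0 // addr_ge0 ?sqr_ge0.
  by rewrite -addrA lerDl addr_ge0 // sqr_ge0.
Qed.

(** The two halves have different uses: moving by - t e lets v be evaluated at depth c t in the
    exterior, and moving by + t e brings the poles near S into D. *)
Definition cone (c r : R) (e : E3 R) p := forall x (t : R), enorm (x - p) < r -> 0 < t -> t < r ->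
  (~ D x -> forall y, enorm (y - (x - t *: e)) < c * t -> exterior D y) /\
  (bdry D x -> forall y, enorm (y - (x + t *: e)) < c * t -> D y).

Hypothesis lD : lipschitz_boundary D.

Lemma local_chart p : bdry D p -> exists (e : E3 R) (c r K k : R),
  [/\ enorm e = 1, 0 < c <= 1, 0 < r & 0 < K] /\
  [/\ 0 < k, cone c r e p,
   (forall y (rho : R), 0 < rho -> (sigma (bdry D `&` eball p r `&` eball y rho) <= (K * rho ^+ 2)%:E)%E)
  & forall q (rho : R), bdry D q -> enorm (q - p) < r -> 0 < rho -> rho < r ->
     ((k * rho ^+ 2)%:E <= sigma (bdry D `&` eball q rho))%E].
Proof.
move=> Sp; have [e1 [e2 [e3 [phi [U [ch Up]]]]]] := lD Sp.
have [c c01 [r r0 [rU hc]]] := chart_cone oD ch Up.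
have [K K0 hK] := chart_measure_upper ch; have [k k0 hk] := chart_measure_lower ch.
exists e3, c, r, K, k; split; first by split=> //; exact: chart_unit ch.
split=> //.
  move=> y rho rho0; apply: (hK _ y) => //.
  - by apply: measurableI; [exact: measurable_bdry_ball|apply: open_measurable3; exact: open_eball].
  - by move=> x [[Sx xp] _]; split=> //; apply: rU; rewrite /eball /= in xp *; lra.
move=> q rho Sq qp rho0 rhor; apply: hk => // x xq; apply: rU.
rewrite /eball /= in xq *; have := enormDB x q p; lra.
Qed.

Lemma seq_min_pos (s : seq (E3 R)) (f : E3 R -> R) : (forall p, p \in s -> 0 < f p) ->
  exists2 m : R, 0 < m & forall p, p \in s -> m <= f p.
Proof.
elim: s => [|p s IH] H; first by exists 1.
have [m m0 hm] : exists2 m : R, 0 < m & forall p, p \in s -> m <= f p.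
  by apply: IH => q qs; apply: H; rewrite in_cons qs orbT.
exists (Num.min m (f p)); first by rewrite lt_min m0 H // mem_head.
move=> q; rewrite in_cons => /orP[/eqP ->|/hm h]; first by rewrite ge_min lexx orbT.
by rewrite ge_min h.
Qed.

Lemma seq_max (s : seq (E3 R)) (f : E3 R -> R) : exists2 m : R, 0 < m & forall p, p \in s -> f p <= m.
Proof.
elim: s => [|p s [m m0 hm]]; first by exists 1.
exists (m + `|f p|); first by rewrite ltr_wpDr.
move=> q; rewrite in_cons => /orP[/eqP ->|/hm h].
  by rewrite (le_trans (ler_norm _)) // lerDr ltW.
by rewrite (le_trans h) // lerDl.
Qed.

(** The cones are valid on tripled balls, because the cutoffs reach to 5/2 r and the translated
    averages add at most r/2. *)
Lemma finite_cones : exists (s : seq (E3 R)) (e : E3 R -> E3 R) (c r : R),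
  [/\ 0 < c <= 1, 0 < r,
      forall x, bdry D x -> exists2 p, p \in s & enorm (x - p) < r
    & forall p, p \in s -> bdry D p /\ enorm (e p) = 1 /\ cone c (3 * r) (e p) p].
Proof.
have H p : exists (ecr : E3 R * R * R), bdry D p ->
    [/\ enorm ecr.1.1 = 1, 0 < ecr.1.2 <= 1, 0 < ecr.2 & cone ecr.1.2 ecr.2 ecr.1.1 p].
  have [Sp|nSp] := pselect (bdry D p); last by exists (0, 0, 0).
  by have [e [c [r [K [k [[e1 c01 r0 _] [_ hc _ _]]]]]]] := local_chart Sp; exists (e, c, r).
pose ecr p := sval (cid (H p)).
have hecr p : bdry D p -> [/\ enorm (ecr p).1.1 = 1, 0 < (ecr p).1.2 <= 1, 0 < (ecr p).2 & cone (ecr p).1.2 (ecr p).2 (ecr p).1.1 p].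
  exact: (svalP (cid (H p))).
have [s [sS sc]] := @compact_eball_cover R (bdry D) (fun p => (ecr p).2 / 4) (compact_bdry oD bD)
   (fun p Sp => let: And4 _ _ r0 _ := hecr p Sp in divr_gt0 r0 (ltr0Sn _ _)).
have [r r0 hr] : exists2 m : R, 0 < m & forall p, p \in s -> m <= (ecr p).2 / 4.
  by apply: seq_min_pos => p /sS/hecr[_ _ r0 _]; rewrite divr_gt0.
have [c0 c00 hc0] : exists2 m : R, 0 < m & forall p, p \in s -> m <= (ecr p).1.2.
  by apply: seq_min_pos => p /sS/hecr[_ /andP[c0 _] _ _].
(* Refine to balls of a common radius r: a point of the new cover uses the
   frame of an old ball containing it. *)
have [s' [sS' sc']] := @compact_eball_cover R (bdry D) (fun=> r / 3) (compact_bdry oD bD) (fun _ _ => divr_gt0 r0 (ltr0Sn _ _)).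
have F p : exists b, bdry D p -> b \in s /\ enorm (p - b) < (ecr b).2 / 4.
  have [Sp|nSp] := pselect (bdry D p); last by exists 0.
  by have [b bs pb] := sc _ Sp; exists b.
pose b p := sval (cid (F p)).
have hb p : bdry D p -> b p \in s /\ enorm (p - b p) < (ecr (b p)).2 / 4 := svalP (cid (F p)).
exists s', (fun p => (ecr (b p)).1.1), (Num.min c0 1), (r / 3); split.
- by rewrite lt_min c00 ltr01 ge_min lexx orbT.
- by rewrite divr_gt0.
- exact: sc'.
move=> p /sS' Sp; split=> //; have [bs pb] := hb _ Sp.
have [e1 /andP[cp c1] rp hcone] := hecr _ (sS _ bs); split=> // x t xp t0 tr.
have rr := hr _ bs; rewrite mulrC divfK // in xp tr.
have xb : enorm (x - b p) < (ecr (b p)).2 by have := enormDB x p (b p); lra.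
have tr' : t < (ecr (b p)).2 by lra.
have [h1 h2] := hcone x t xb t0 tr'.
have ct : Num.min c0 1 * t <= (ecr (b p)).1.2 * t.
  by rewrite ler_pM2r //; apply: (@le_trans _ _ c0); [rewrite ge_min lexx|exact: hc0].
split=> [nx y yx|Sx y yx]; first by apply: (h1 nx); exact: lt_le_trans ct.
by apply: (h2 Sx); exact: lt_le_trans ct.
Qed.

(** Together with [surface_lower] this says that S is Ahlfors regular of dimension 2. The constants
    of the finitely many charts are added along the list. *)
Lemma surface_upper : exists2 K : R, 0 < K & forall y (rho : R), 0 < rho ->
  (sigma (bdry D `&` eball y rho) <= (K * rho ^+ 2)%:E)%E.
Proof.
have H p : exists (rK : R * R), bdry D p -> [/\ 0 < rK.1, 0 < rK.2 & forall y (rho : R), 0 < rho ->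
    (sigma (bdry D `&` eball p rK.1 `&` eball y rho) <= (rK.2 * rho ^+ 2)%:E)%E].
  have [Sp|nSp] := pselect (bdry D p); last by exists (0, 0).
  by have [e [c [r [K [k [[e1 c01 r0 K0] [_ _ hK _]]]]]]] := local_chart Sp; exists (r, K).
pose rK p := sval (cid (H p)).
have hrK p : bdry D p -> _ := svalP (cid (H p)).
have [s [sS sc]] := @compact_eball_cover R (bdry D) (fun p => (rK p).1) (compact_bdry oD bD)
   (fun p Sp => let: And3 r0 _ _ := hrK p Sp in r0).
pose B (s : seq (E3 R)) : set (E3 R) := [set x | exists2 p, p \in s & enorm (x - p) < (rK p).1].
suff [K K0 hK] : exists2 K : R, 0 < K & forall y (rho : R), 0 < rho ->
    (sigma (bdry D `&` B s `&` eball y rho) <= (K * rho ^+ 2)%:E)%E.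
  exists K => // y rho rho0; rewrite (_ : bdry D `&` eball y rho = bdry D `&` B s `&` eball y rho).
    exact: hK.
  by apply/seteqP; split=> [x [Sx xy]|x [[Sx _] xy]] //; split=> //; split=> //; exact: sc.
elim: s sS {sc} => [|p s IH] sS.
  exists 1 => // y rho rho0; rewrite (_ : _ `&` _ `&` _ = set0) ?measure0 ?lee_fin ?mul1r ?sqr_ge0 //.
  by apply/seteqP; split=> // x [[_ []]].
have [K K0 hK] : exists2 K : R, 0 < K & forall y (rho : R), 0 < rho ->
    (sigma (bdry D `&` B s `&` eball y rho) <= (K * rho ^+ 2)%:E)%E.
  by apply: IH => q qs; apply: sS; rewrite in_cons qs orbT.
have [r0 Kp hp] := hrK _ (sS _ (mem_head _ _)).
exists (K + (rK p).2); first by rewrite addr_gt0.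
move=> y rho rho0.
have oB : open (B s).
  apply/openE3 => x [q qs xq]; exists ((rK q).1 - enorm (x - q)); first by rewrite subr_gt0.
  by move=> z zx; exists q => //; rewrite /eball /= in zx; have := enormDB z x q; lra.
have mE : measurable (eball y rho : set (M3 R)) by apply: open_measurable3; exact: open_eball.
have mB : measurable (bdry D `&` B s `&` eball y rho : set (M3 R)).
  by do 2 apply: measurableI => //; [exact: measurable_bdry|exact: open_measurable3].
have mP : measurable (bdry D `&` eball p (rK p).1 `&` eball y rho : set (M3 R)).
  by apply: measurableI => //; exact: measurable_bdry_ball.
rewrite (_ : _ `&` _ `&` _ = (bdry D `&` B s `&` eball y rho) `|` (bdry D `&` eball p (rK p).1 `&` eball y rho)); last first.
  apply/seteqP; split=> x.
    move=> [[Sx [q + xq]] xy]; rewrite in_cons => /orP[/eqP qp|qs].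
      by right; split=> //; split=> //; rewrite -qp.
    by left; split=> //; split=> //; exists q.
  move=> [[[Sx [q qs xq]] xy]|[[Sx xp] xy]]; split=> //; split=> //; last by exists p => //; exact: mem_head.
  by exists q => //; rewrite in_cons qs orbT.
apply: (le_trans (measureU2 _ mB mP)).
rewrite mulrDl EFinD; apply: leeD; [exact: hK|exact: hp].
Qed.

Lemma surface_finite : (sigma (bdry D) < +oo)%E.
Proof.
have [K K0 hK] := surface_upper; have [r r0 hr] := domain_bounded bD.
have -> : bdry D = bdry D `&` eball 0 (r + 1).
  apply/seteqP; split=> [x Sx|x []//]; split=> //; have [cx _] := proj1 (bdryE oD x) Sx.
  by rewrite /eball /= subr0; have := hr _ cx; lra.
by apply: (le_lt_trans (hK _ _ _)); [rewrite addr_gt0|exact: ltry].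
Qed.

Lemma surface_lower (T : R) : 0 < T -> exists2 k : R, 0 < k & forall q (rho : R), bdry D q -> 0 < rho -> rho <= T ->
  ((k * rho ^+ 2)%:E <= sigma (bdry D `&` eball q rho))%E.
Proof.
move=> T0; have H p : exists (rk : R * R), bdry D p -> [/\ 0 < rk.1, 0 < rk.2 & forall q (rho : R), bdry D q -> enorm (q - p) < rk.1 -> 0 < rho -> rho < rk.1 ->
     ((rk.2 * rho ^+ 2)%:E <= sigma (bdry D `&` eball q rho))%E].
  have [Sp|nSp] := pselect (bdry D p); last by exists (0, 0).
  by have [e [c [r [K [k [[e1 c01 r0 K0] [k0 _ _ hk]]]]]]] := local_chart Sp; exists (r, k).
pose rk p := sval (cid (H p)).
have hrk p : bdry D p -> _ := svalP (cid (H p)).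
have [s [sS sc]] := @compact_eball_cover R (bdry D) (fun p => (rk p).1) (compact_bdry oD bD)
   (fun p Sp => let: And3 r0 _ _ := hrk p Sp in r0).
have [r r0 hr] : exists2 m : R, 0 < m & forall p, p \in s -> m <= (rk p).1.
  by apply: seq_min_pos => p /sS/hrk[].
have [k k0 hk] : exists2 m : R, 0 < m & forall p, p \in s -> m <= (rk p).2.
  by apply: seq_min_pos => p /sS/hrk[].
(* Scaling by l brings every radius up to T below the smallest chart radius, at the cost of the
   factor l^2. *)
pose l := Num.min 1 (r / 2 / T).
have l0 : 0 < l by rewrite lt_min ltr01 !divr_gt0.
have l1 : l <= 1 by rewrite ge_min lexx.
exists (k * l ^+ 2); first by rewrite mulr_gt0 // exprn_gt0.
move=> q rho Sq rho0 rhoT; have [p ps qp] := sc _ Sq.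
have [_ kp hp] := hrk _ (sS _ ps).
have lr : l * rho < (rk p).1.
  apply: (@lt_le_trans _ _ r); last exact: hr.
  apply: (@le_lt_trans _ _ (r / 2 / T * T)); last by rewrite mulfVK ?gt_eqF //; lra.
  by apply: ler_pM => //; [exact: ltW|exact: ltW|rewrite ge_min lexx orbT].
have lr0 : 0 < l * rho by rewrite mulr_gt0.
apply: (@le_trans _ _ ((rk p).2 * (l * rho) ^+ 2)%:E).
  rewrite lee_fin (_ : k * l ^+ 2 * rho ^+ 2 = k * (l * rho) ^+ 2); last by ring.
  by apply: ler_wpM2r; [exact: sqr_ge0|exact: hk].
apply: (le_trans (hp _ _ Sq qp lr0 lr)).
apply: le_measure; rewrite ?inE; try exact: measurable_bdry_ball.
move=> x [Sx xq]; split=> //; rewrite /eball /= in xq *; apply: (lt_le_trans xq).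
by rewrite ler_piMl // ltW.
Qed.

End surface_estimates.

(** * Riesz potentials and cone averages *)

Section dyadic_integrals.
Context {R : realType}.

Lemma dyadic_index (b s : R) : 2 <= b -> 1 < s -> exists k : nat, b ^+ k < s <= b ^+ k.+1.
Proof.
move=> b2 s1; have P : exists n : nat, s <= b ^+ n.+1.
  exists (Num.truncn s); apply: (@le_trans _ _ (Num.truncn s).+1%:R); first exact/ltW/truncnS_gt.
  apply: (@le_trans _ _ (2 ^+ (Num.truncn s).+1)); first by rewrite -natrX ler_nat ltnW // ltn_expl.
  by rewrite lerXn2r // nnegrE //; lra.
exists (ex_minn P); case: ex_minnP => -[|n] sn min; first by rewrite expr0 s1.
by rewrite sn andbT ltNge; apply/negP => /min; rewrite ltnn.
Qed.

Context d (T : measurableType d) (mu : {measure set T -> \bar R}).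

(** f lies below the sum of the functions c_k 1_(A_k), which is integrated term by term; only the
    sets A_k need to be measurable. *)
Lemma series_bound (f : T -> R) (c m : nat -> R) (A : nat -> set T) (W r : R) :
  (forall x, 0 <= f x) -> (forall k, 0 <= c k) -> (forall k, measurable (A k)) ->
  (forall x, f x != 0 -> exists2 k, A k x & f x <= c k) ->
  (forall k, (mu (A k) <= (m k)%:E)%E) -> 0 <= W -> 0 < r < 1 -> (forall k, c k * m k <= W * r ^+ k) ->
  (\int[mu]_x (f x)%:E <= (W * (1 - r)^-1)%:E)%E.
Proof.
move=> f0 c0 mA fA mm W0 /andP[r0 r1] cm.
pose g k x : \bar R := (c k * \1_(A k) x)%:E.
have g0 k x : (0 <= g k x)%E by rewrite lee_fin mulr_ge0.
have mg k : measurable_fun setT (g k).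
  by apply/measurable_EFinP; apply: measurable_funM => //; exact: measurable_indic.
apply: (@le_trans _ _ (\int[mu]_x \sum_(k <oo) g k x)%E).
  apply: le_integral_nonmeas => x; first by rewrite lee_fin.
  have [->|fx] := eqVneq (f x) 0; first by rewrite nneseries_ge0.
  have [k Ak fk] := fA _ fx.
  apply: (@le_trans _ _ (g k x)); first by rewrite lee_fin indicE mem_set // mulr1.
  apply: (@le_trans _ _ (\sum_(0 <= j < k.+1) g j x)%E).
    by rewrite big_nat_recr //= leeDr // sume_ge0.
  exact: nneseries_lim_ge.
rewrite integral_nneseries //.
have ig k : (\int[mu]_x g k x <= (W * r ^+ k)%:E)%E.
  rewrite /g; under eq_integral do rewrite EFinM.
  rewrite ge0_integralZl_EFin //; last exact/measurable_EFinP/measurable_indic.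
  rewrite integral_indic // setIT.
  apply: (@le_trans _ _ ((c k)%:E * (m k)%:E)%E); first by apply: lee_wpmul2l; rewrite ?lee_fin.
  by rewrite -EFinM lee_fin.
apply: lime_le; first by apply: is_cvg_nneseries => n _ _; apply: integral_ge0.
apply: nearW => n; apply: (@le_trans _ _ (\sum_(0 <= k < n) (W * r ^+ k)%:E)%E).
  by apply: lee_sum => k _; exact: ig.
rewrite sumEFin lee_fin.
have r1' : `|r| < 1 by rewrite gtr0_norm.
by have := geometric_le_lim n W0 r0 r1'; rewrite /series /=.
Qed.

End dyadic_integrals.

Section potentials.
Context {R : realType}.
Implicit Types (x y z q p : E3 R).

Lemma le_of_eq (a b : R) : a = b -> a <= b. Proof. by move=> ->. Qed.

(** By the conventions of [powR] the value at s = 0 is 0 when a is nonzero. The singular kernel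
    therefore vanishes on the diagonal, and bounds by it are claimed only off the diagonal. *)
Definition wt (a s : R) : R := s `^ (- a).

Lemma wt_ge0 a s : 0 <= wt a s. Proof. exact: powR_ge0. Qed.

Lemma wt_anti a s t : 0 <= a -> 0 < s -> s <= t -> wt a t <= wt a s.
Proof.
move=> a0 s0 st; rewrite /wt !powRN lef_pV2 ?posrE ?powR_gt0 ?(lt_le_trans s0) //.
by apply: ge0_ler_powR => //; rewrite nnegrE ltW // (lt_le_trans s0).
Qed.

Lemma powR_exp (b a : R) k : 0 <= b -> (b ^+ k) `^ a = (b `^ a) ^+ k.
Proof. by move=> b0; rewrite -powR_mulrn // -powRrM mulrC powRrM powR_mulrn ?powR_ge0. Qed.

Lemma powR_inv (x a : R) : 0 < x -> x^-1 `^ a = (x `^ a)^-1.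
Proof.
move=> x0; have n : x `^ a != 0 by rewrite gt_eqF // powR_gt0.
apply: (mulIf n); rewrite mulVf // -powRM ?invr_ge0 ?ltW //.
by rewrite mulVf ?gt_eqF // powR1.
Qed.

Lemma wt_pow a b k : 0 < b -> wt a (b ^+ k)^-1 = (b `^ a) ^+ k.
Proof.
move=> b0; rewrite /wt powRN powR_inv ?exprn_gt0 // invrK powR_exp // ltW //.
Qed.

Lemma measurable_wt a : measurable_fun setT (wt a).
Proof. exact: measurable_powR. Qed.

Lemma measurable_enormB (p : E3 R) : measurable_fun setT ((fun x => enorm (x - p)) : M3 R -> R).
Proof.
apply: continuous_measurable3; apply: (@lipschitz_continuousE3 _ _ 1) => x y.
rewrite mul1r; apply: (le_trans (enorm_sub_le _ _)).
by rewrite (_ : x - p - (y - p) = x - y) //; apply: E3ext; rewrite /=; ring.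
Qed.

(** Dyadic shells with ratio 4, for which powers with half-integer exponents are powers of 2. The
    third hypothesis means a <= dim - 1/2 and makes the shell contributions decay like 2^(-k). The
    complement of the unit ball contributes at most the total mass. *)
Lemma riesz_bound (mu : {measure set (M3 R) -> \bar R}) (a C M : R) (dim : nat) :
  0 < a -> 0 <= C -> 2 * 4 `^ a <= 4 ^+ dim ->
  (forall y (rho : R), 0 < rho -> rho <= 1 -> (mu (eball y rho) <= (C * rho ^+ dim)%:E)%E) ->
  (mu setT <= M%:E)%E ->
  forall y, (\int[mu]_x (wt a (enorm (x - y)))%:E <= (4 * C * 4 `^ a + M)%:E)%E.
Proof.
move=> /[dup] a0' /ltW a0 C0 ad hC hM y.
have mE k : measurable (eball y (4 ^- k) : set (M3 R)).
  by apply: open_measurable3; exact: open_eball.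
have mB : measurable (eball y 1 : set (M3 R)) by apply: open_measurable3; exact: open_eball.
pose f x := wt a (enorm (x - y)) * \1_(eball y 1) x.
have H1 : (\int[mu]_x (f x)%:E <= (2 * C * 4 `^ a * (1 - 2^-1)^-1)%:E)%E.
  apply: (@series_bound R _ _ mu f (fun k => (4 `^ a) ^+ k.+1) (fun k => C * (4 ^- k) ^+ dim) (fun k => eball y (4 ^- k))) => //.
  - by move=> x; rewrite mulr_ge0 ?wt_ge0.
  - move=> x; rewrite /f indicE; case: (boolP (x \in _)) => [|_]; last by rewrite mulr0 eqxx.
    rewrite inE /eball /= mulr1 => xy1 wx.
    have n0 : 0 < enorm (x - y).
      rewrite lt_neqAle enorm_ge0 andbT eq_sym; apply: contraNneq wx => ->.
      by rewrite /wt powR0 ?eqxx // oppr_eq0 gt_eqF.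
    have [k /andP[k1 k2]] := @dyadic_index R 4 (enorm (x - y))^-1 (ltac:(lra)) (ltac:(by rewrite invf_gt1)).
    exists k.
      by rewrite /eball /= -(invrK (enorm _)) ltf_pV2 ?posrE ?invr_gt0 ?exprn_gt0.
    rewrite -wt_pow //; apply: wt_anti => //.
    by rewrite -(invrK (enorm _)) lef_pV2 ?posrE ?invr_gt0 ?exprn_gt0.
  - by move=> k; apply: hC; [rewrite invr_gt0 exprn_gt0|rewrite invf_le1 ?exprn_gt0 // exprn_ege1 // ler1n].
  - by rewrite !mulr_ge0 // ltW.
  - by apply/andP; split; lra.
  - move=> k; rewrite -exprVn -exprM mulnC exprM.
    apply: (@le_trans _ _ (C * 4 `^ a * ((4 `^ a) * (4^-1) ^+ dim) ^+ k)).
      by rewrite exprS exprMn; apply: le_of_eq; ring.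
    have h : 4 `^ a * 4^-1 ^+ dim <= 2^-1 :> R.
      by rewrite exprVn ler_pdivrMr ?exprn_gt0 // -ler_pdivrMl // invrK.
    apply: (@le_trans _ _ (C * 4 `^ a * 2^-1 ^+ k)).
      apply: ler_wpM2l; first by rewrite mulr_ge0 // ltW.
      by rewrite lerXn2r ?nnegrE ?invr_ge0 // mulr_ge0 ?exprn_ge0 ?invr_ge0 // ltW.
    apply: ler_wpM2r; first by rewrite exprn_ge0.
    by rewrite -mulrA ler_peMl ?ler1n // mulr_ge0 // ltW.
apply: (@le_trans _ _ (\int[mu]_x ((f x)%:E + 1))%E).
  apply: le_integral_nonmeas => x; first by rewrite lee_fin wt_ge0.
  rewrite -EFinD lee_fin /f indicE; case: (boolP (x \in _)) => [_|]; first by rewrite mulr1 lerDl.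
  rewrite notin_setE /eball /= => /negP; rewrite -leNgt => h.
  rewrite mulr0 add0r; apply: (le_trans (wt_anti a0 _ h)) => //.
  by rewrite /wt powR1.
have mf : measurable_fun setT (EFin \o f).
  apply/measurable_EFinP; apply: measurable_funM; last exact: measurable_indic.
  apply: (measurableT_comp (measurable_wt a)); exact: measurable_enormB.
rewrite ge0_integralD //; last by move=> x _; rewrite lee_fin mulr_ge0 ?wt_ge0.
rewrite EFinD; apply: leeD; last by rewrite integral_cst // mul1e.
by apply: (le_trans H1); rewrite lee_fin; apply: le_of_eq; field.
Qed.

Lemma leb3_eball y (rho : R) : 0 < rho -> (leb3 R (eball y rho) <= (8 * rho ^+ 3)%:E)%E.
Proof.
move=> r0; rewrite -(leb3_box y r0); apply: le_measure; rewrite ?inE.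
- by apply: open_measurable3; exact: open_eball.
- exact: measurable_box.
- exact: eball_sub_box.
Qed.

(** The ball of radius 2^k has volume of order 8^k, and 8 < 2^b exactly when b > 3. *)
Lemma decay_integral (b : R) : 3 < b -> (\int[leb3 R]_x ((1 + enorm x) `^ (- b))%:E < +oo)%E.
Proof.
move=> b3; have b0 : 0 < b by lra.
have p8 : 8 < 2 `^ b :> R.
  have -> : 8 = 2 `^ 3%:R :> R by rewrite powR_mulrn //; ring.
  by rewrite /powR pnatr_eq0 /= ltr_expR ltr_pM2r // ln_gt0 // ltr1n.
apply: (@le_lt_trans _ _ ((8 * 2 `^ b * (1 - 8 / 2 `^ b)^-1)%:E)); last exact: ltry.
apply: (@series_bound R _ _ (leb3 R) (fun x => (1 + enorm x) `^ (- b)) (fun k => 2 `^ b * (2 `^ b)^-1 ^+ k) (fun k => 8 * (2 ^+ k) ^+ 3) (fun k => eball 0 (2 ^+ k))).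
- by move=> x; exact: powR_ge0.
- by move=> k; rewrite mulr_ge0 ?exprn_ge0 ?invr_ge0 // ltW.
- by move=> k; apply: open_measurable3; exact: open_eball.
- move=> x _; have n0 := enorm_ge0 x.
  have [k /andP[k1 k2]] := @dyadic_index R 2 (2 * (1 + enorm x)) (lexx _) (ltac:(lra)).
  exists k; first by rewrite /eball /= subr0; rewrite exprS ler_pM2l // in k2; lra.
  rewrite -/(wt b (1 + enorm x)) (_ : 2 `^ b * _ = wt b (2 ^+ k / 2)).
    apply: wt_anti; [exact: ltW|by rewrite divr_gt0 ?exprn_gt0|].
    by rewrite ler_pdivrMr // mulrC ltW.
  rewrite /wt powRN powRM ?exprn_ge0 ?invr_ge0 // powR_inv // powR_exp // invfM invrK.
  by rewrite mulrC exprVn.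
- by move=> k; apply: leb3_eball; rewrite exprn_gt0.
- by rewrite mulr_ge0 // ltW.
- by rewrite divr_gt0 // ltr_pdivrMr // mul1r.
- move=> k; rewrite exprMn -exprM mulnC exprM (_ : 2 ^+ 3 = 8 :> R); last by ring.
  by apply: le_of_eq; ring.
Qed.

End potentials.

Section integral_tools.
Context d (T : measurableType d) (R : realType) (mu : {measure set T -> \bar R}).

(** Young's inequality f g <= (l f^2 + g^2 / l) / 2 is integrated for all l > 0. It also shows that
    the left side is finite as soon as f is square integrable. *)
Lemma cauchy_schwarz_integral (f g : T -> R) (C : R) :
  measurable_fun setT f -> measurable_fun setT g -> (forall x, 0 <= f x) -> (forall x, 0 <= g x) ->
  0 < C -> (\int[mu]_x (g x ^+ 2)%:E <= C%:E)%E ->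
  ((\int[mu]_x (f x * g x)%:E) * (\int[mu]_x (f x * g x)%:E) <= C%:E * \int[mu]_x (f x ^+ 2)%:E)%E.
Proof.
move=> mf mg f0 g0 C0 gC.
have A0 : (0 <= \int[mu]_x (f x ^+ 2)%:E)%E by apply: integral_ge0 => x _; rewrite lee_fin sqr_ge0.
have I0 : (0 <= \int[mu]_x (f x * g x)%:E)%E by apply: integral_ge0 => x _; rewrite lee_fin mulr_ge0.
case EA : (\int[mu]_x (f x ^+ 2)%:E)%E A0 => [a| |] // A0; last by rewrite mulry gtr0_sg // mul1e leey.
rewrite lee_fin in A0.
have H (l : R) : 0 < l -> (\int[mu]_x (f x * g x)%:E <= ((l * a + l^-1 * C) / 2)%:E)%E.
  move=> l0; have li : 0 < l^-1 by rewrite invr_gt0.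
  apply: (@le_trans _ _ (\int[mu]_x ((l / 2)%:E * (f x ^+ 2)%:E + (l^-1 / 2)%:E * (g x ^+ 2)%:E))%E).
    apply: le_integral_nonmeas => x; first by rewrite lee_fin mulr_ge0.
    rewrite -!EFinM -EFinD lee_fin.
    have s0 : 0 <= l^-1 * (l * f x - g x) ^+ 2 by rewrite mulr_ge0 ?sqr_ge0 // ltW.
    have : l^-1 * (l * f x - g x) ^+ 2 = l * f x ^+ 2 + l^-1 * g x ^+ 2 - 2 * (f x * g x) by field; rewrite gt_eqF.
    lra.
  have l2 : 0 <= l / 2 by rewrite divr_ge0 // ltW.
  have li2 : 0 <= l^-1 / 2 by rewrite divr_ge0 // ltW.
  have mf2 : measurable_fun setT (fun x => (f x ^+ 2)%:E) by apply/measurable_EFinP; exact: measurable_funX.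
  have mg2 : measurable_fun setT (fun x => (g x ^+ 2)%:E) by apply/measurable_EFinP; exact: measurable_funX.
  rewrite ge0_integralD //; last 4 first.
  - by move=> x _; rewrite -EFinM lee_fin mulr_ge0 ?sqr_ge0.
  - exact: measurable_funeM.
  - by move=> x _; rewrite -EFinM lee_fin mulr_ge0 ?sqr_ge0.
  - exact: measurable_funeM.
  rewrite !ge0_integralZl_EFin //; try by move=> x _; rewrite lee_fin sqr_ge0.
  rewrite EA; apply: (@le_trans _ _ ((l / 2)%:E * a%:E + (l^-1 / 2)%:E * C%:E)%E).
    by apply: leeD => //; apply: lee_wpmul2l; rewrite ?lee_fin.
  by rewrite -!EFinM -EFinD lee_fin; apply: le_of_eq; ring.
case EI : (\int[mu]_x (f x * g x)%:E)%E I0 H => [i| |] // I0 H; last by have := H 1 ltr01; rewrite leye_eq.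
rewrite -!EFinM lee_fin leNgt; apply/negP => ia.
have i0 : 0 < i.
  rewrite lt_neqAle -lee_fin I0 andbT; apply: contraTneq ia => <-; rewrite mul0r -leNgt.
  by rewrite mulr_ge0 // ltW.
(* This value of l turns the second term into i / 2, half of the left side. *)
have := H (C / i) (divr_gt0 C0 i0); rewrite lee_fin => h.
have E : (C / i * a + (C / i)^-1 * C) / 2 = (C * a / i + i) / 2 by field; rewrite !gt_eqF.
rewrite E in h; have : i * i <= C * a.
  by rewrite -ler_pdivlMr //; lra.
lra.
Qed.

Lemma integral_mrestr (D : set T) (mD : measurable D) (f : T -> \bar R) :
  measurable_fun setT f -> (forall x, (0 <= f x)%E) ->
  (\int[mrestr mu mD]_x f x = \int[mu]_(x in D) f x)%E.
Proof.
move=> mf f0; rewrite (@ge0_negligible_integral _ _ _ _ setT (~` D)) //; last 2 first.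
- exact: measurableC.
- by rewrite /= /mrestr setICl measure0.
rewrite setTD setCK; apply: eq_measure_integral => A mA AD.
by rewrite /= /mrestr setIidl.
Qed.

Lemma L2_dominated (D : set T) (h : nat -> T -> R) (g : T -> \bar R) : measurable D ->
  (forall n, measurable_fun D (h n)) -> mu.-integrable D g ->
  {ae mu, forall x, D x -> h n x @[n --> \oo] --> (0 : R)} ->
  {ae mu, forall x n, D x -> ((h n x ^+ 2)%:E <= g x)%E} ->
  (\int[mu]_(x in D) (h n x ^+ 2)%:E)%E @[n --> \oo] --> 0%E.
Proof.
move=> mD mh ig h0 hg.
have := @dominated_convergence _ _ _ mu D mD (fun n x => (h n x ^+ 2)%:E) (cst 0%E) g.
case=> //.
- by move=> n; apply/measurable_EFinP; exact: measurable_funX.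
- apply: filterS h0 => x H Dx; have c := H Dx.
  apply: cvg_EFin; first exact: nearW.
  have c2 : (h n x * h n x) @[n --> \oo] --> (0 * 0 : R) by exact: cvgM.
  by rewrite mul0r in c2.
- apply: filterS hg => x H n Dx; rewrite gee0_abs; [exact: H|by rewrite lee_fin sqr_ge0].
- by rewrite integral0 => _ _.
Qed.

End integral_tools.

Section potential_estimates.
Context {R : realType}.
Implicit Types (x y z q p : E3 R).

Lemma measurable_enorm2 : measurable_fun setT ((fun z : M3 R * M3 R => enorm ((z.1 : E3 R) - (z.2 : E3 R))) : M3 R * M3 R -> R).
Proof.
have m1 : measurable_fun setT (fun z : M3 R * M3 R => z.1) by exact: measurable_fst.
have m2 : measurable_fun setT (fun z : M3 R * M3 R => z.2) by exact: measurable_snd.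
have c1 (f : M3 R -> R) : measurable_fun setT f -> measurable_fun setT (fun z : M3 R * M3 R => (f z.1 - f z.2) * (f z.1 - f z.2)).
  move=> mf; apply: measurable_funM; apply: measurable_funB; by [exact: measurableT_comp mf m1|exact: measurableT_comp mf m2].
have ms : measurable_fun setT (@Num.sqrt R : R -> R) by apply: continuous_measurable_fun; exact: sqrt_continuous.
apply: (measurableT_comp ms).
apply: measurable_funD; first apply: measurable_funD.
- exact: (c1 _ measurable_coord11).
- exact: (c1 _ measurable_coord12).
- exact: (c1 _ measurable_coord2).
Qed.

Lemma wtM a b (s : R) : 0 < a -> 0 < b -> wt a s * wt b s = wt (a + b) s.
Proof.
move=> a0 b0; rewrite /wt opprD powRD //; apply/implyP => /eqP h; exfalso; lra.
Qed.

Lemma four_powR (n : nat) : (4 : R) `^ (n%:R / 2) = 2 ^+ n.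
Proof.
rewrite (_ : 4 = 2 `^ 2 :> R); last by rewrite (powR_mulrn 2) //; ring.
by rewrite -powRrM mulrC divfK // powR_mulrn.
Qed.

Variable mu : sfin3 R.
Variables (C M : R).
Hypotheses (C0 : 0 <= C) (mu_ball : forall y (rho : R), 0 < rho -> rho <= 1 -> (mu (eball y rho) <= (C * rho ^+ 2)%:E)%E)
  (mu_fin : (mu setT <= M%:E)%E).

Lemma measurable_eball (p : E3 R) (r : R) : measurable (eball p r : set (M3 R)).
Proof. by apply: open_measurable3; exact: open_eball. Qed.

Lemma leb_ball_riesz (T a : R) : 0 < T -> 0 < a -> 2 * 4 `^ a <= 4 ^+ 3 ->
  exists2 K : R, 0 < K & forall y,
    (\int[leb3 R]_(x in eball (0%R : E3 R) T) (wt a (enorm (x - y)))%:E <= K%:E)%E.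
Proof.
move=> T0 a0 ad; exists (4 * 8 * 4 `^ a + 8 * T ^+ 3).
  by rewrite addr_gt0 // !mulr_gt0 // ?powR_gt0 // exprn_gt0.
move=> y; rewrite -(integral_mrestr (leb3 R) (measurable_eball 0 T)); last 2 first.
- apply/measurable_EFinP; exact: measurableT_comp (measurable_wt _) (measurable_enormB y).
- by move=> x; rewrite lee_fin wt_ge0.
apply: (@riesz_bound R _ a 8 (8 * T ^+ 3) 3) => //.
- move=> z rho rho0 _; apply: (le_trans _ (leb3_eball z rho0)); rewrite /= /mrestr.
  apply: le_measure; rewrite ?inE; last exact: subIsetl.
    by apply: measurableI; exact: measurable_eball.
  exact: measurable_eball.
- by rewrite /= /mrestr setTI; exact: leb3_eball.
Qed.

(** A Schur argument: |x-y|^(-2) is split as |x-y|^(-3/4) |x-y|^(-5/4). After Cauchy-Schwarz the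
    exponents are 5/2 < 3, integrable for the volume, and 3/2 < 2, integrable for a measure of
    quadratic growth. So the potential of an L^2 density is in L^2 of the surface. *)
Lemma riesz_potential_L2 (u : E3 R -> R) (T : R) : 0 < T ->
  measurable_fun setT (u : M3 R -> R) -> (forall y, 0 <= u y) -> (forall y, T <= enorm y -> u y = 0) ->
  (\int[leb3 R]_y (u y ^+ 2)%:E < +oo)%E ->
  let G x := (\int[leb3 R]_y (u y * wt 2 (enorm (x - y)))%:E)%E in
  measurable_fun setT (G : M3 R -> \bar R) /\ (\int[mu]_x (G x * G x) < +oo)%E.
Proof.
move=> T0 mu' u0 uT uL G.
have me (x : E3 R) : measurable_fun setT ((fun y => enorm (x - y)) : M3 R -> R).
  rewrite (_ : (fun y => _) = (fun y => enorm (y - x))); last by apply/funext => y; exact: enormB.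
  exact: measurable_enormB.
have mw b : measurable_fun setT ((fun z : M3 R * M3 R => wt b (enorm ((z.1 : E3 R) - (z.2 : E3 R)))) : M3 R * M3 R -> R).
  exact: measurableT_comp (measurable_wt b) measurable_enorm2.
have mG : measurable_fun setT (G : M3 R -> \bar R).
  apply: (@measurable_fun_fubini_tonelli_F _ _ (M3 R) (M3 R) R (leb3s : sfin3 R)
     (fun z : M3 R * M3 R => (u z.2 * wt 2 (enorm ((z.1 : E3 R) - (z.2 : E3 R))))%:E)).
    apply/measurable_EFinP; apply: measurable_funM; last exact: mw.
    exact: (measurableT_comp mu' measurable_snd).
  by move=> z; rewrite lee_fin mulr_ge0 ?wt_ge0.
split=> //.
have [K1 K10 hK1] : exists2 K : R, 0 < K & forall y,
    (\int[leb3 R]_(x in eball (0%R : E3 R) T) (wt (5 / 2) (enorm (x - y)))%:E <= K%:E)%E.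
  by apply: leb_ball_riesz => //; rewrite (four_powR 5); lra.
have GH x : (G x * G x <= K1%:E * \int[leb3 R]_y ((u y * wt (3 / 4) (enorm (x - y))) ^+ 2)%:E)%E.
  pose g y := \1_(eball 0 T) y * wt (5 / 4) (enorm (x - y)).
  have mg : measurable_fun setT (g : M3 R -> R).
    apply: measurable_funM; first by apply: measurable_indic; apply: open_measurable3; exact: open_eball.
    exact: measurableT_comp (measurable_wt _) (me x).
  rewrite [G x](_ : _ = \int[leb3 R]_y ((u y * wt (3 / 4) (enorm (x - y))) * g y)%:E)%E; last first.
    apply: eq_integral => y _; congr (_%:E); rewrite /g indicE.
    have [yT|yT] := boolP (y \in _).
      by rewrite mul1r -mulrA wtM //; congr (_ * wt _ _); lra.
    by rewrite uT ?mul0r // leNgt; apply: contra yT => yT; rewrite inE /eball /= subr0.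
  apply: cauchy_schwarz_integral => //.
  - apply: measurable_funM => //; exact: measurableT_comp (measurable_wt _) (me x).
  - by move=> y; rewrite mulr_ge0 ?wt_ge0.
  - by move=> y; rewrite mulr_ge0 ?wt_ge0.
  apply: (le_trans _ (hK1 x)); rewrite [leRHS]integral_mkcond.
  apply: le_integral_nonmeas => y; first by rewrite lee_fin sqr_ge0.
  rewrite /g indicE /patch; case: ifP => _; last by rewrite mul0r expr0n.
  rewrite mul1r lee_fin expr2 wtM; [|lra|lra].
  by rewrite enormB; apply: le_of_eq; congr (wt _ _); lra.
pose F (z : M3 R * M3 R) : \bar R := ((u z.2 * wt (3 / 4) (enorm ((z.1 : E3 R) - (z.2 : E3 R)))) ^+ 2)%:E.
have F0 (z : M3 R * M3 R) : (0 <= F z)%E by rewrite lee_fin sqr_ge0.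
have mF : measurable_fun setT F.
  apply/measurable_EFinP; apply: measurable_funX; apply: measurable_funM; last exact: mw.
  exact: (measurableT_comp mu' measurable_snd).
pose H x := (\int[leb3 R]_y F (x, y))%E.
have mH : measurable_fun setT (H : M3 R -> \bar R).
  exact: (@measurable_fun_fubini_tonelli_F _ _ (M3 R) (M3 R) R (leb3s : sfin3 R) F mF F0).
have H0 x : (0 <= H x)%E by apply: integral_ge0 => y _.
apply: (@le_lt_trans _ _ (\int[mu]_x (K1%:E * H x))%E).
  by apply: le_integral_nonmeas => x; [rewrite mule_ge0 // integral_ge0 // => y _; rewrite lee_fin mulr_ge0 ?wt_ge0|exact: GH].
rewrite ge0_integralZl_EFin //; last exact: ltW.
have -> : (\int[mu]_x H x = \int[leb3 R]_y \int[mu]_x F (x, y))%E.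
  exact: (@fubini_tonelli _ _ (M3 R) (M3 R) R mu (leb3s : sfin3 R) F mF F0).
pose K2 := 4 * C * 4 `^ (3 / 2) + M.
have hK2 y : (\int[mu]_x F (x, y) <= (K2 * u y ^+ 2)%:E)%E.
  rewrite (_ : (fun x => F (x, y)) = (fun x => (u y ^+ 2)%:E * (wt (3 / 2) (enorm (x - y)))%:E)%E); last first.
    apply/funext => x; rewrite /F /= -EFinM exprMn; congr (_%:E); congr (_ * _).
    by rewrite expr2 wtM; [congr (wt _ _); lra|lra|lra].
  rewrite ge0_integralZl_EFin ?sqr_ge0 //; last 2 first.
  - by move=> x _; rewrite lee_fin wt_ge0.
  - apply/measurable_EFinP; exact: measurableT_comp (measurable_wt _) (measurable_enormB y).
  rewrite (mulrC K2) (EFinM (u y ^+ 2) K2); apply: lee_wpmul2l; first by rewrite lee_fin sqr_ge0.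
  by apply: (@riesz_bound R mu (3 / 2) C M 2) => //; rewrite (four_powR 3); lra.
have K20 : 0 <= K2.
  have M0 : 0 <= M by rewrite -lee_fin (le_trans _ mu_fin).
  by rewrite addr_ge0 // !mulr_ge0 // powR_ge0.
apply: (@le_lt_trans _ _ (K1%:E * \int[leb3 R]_y (K2%:E * (u y ^+ 2)%:E))%E).
  apply: lee_wpmul2l; first by rewrite lee_fin ltW.
  apply: le_integral_nonmeas => y; first by apply: integral_ge0 => x _.
  by rewrite -EFinM.
rewrite ge0_integralZl_EFin //; last 2 first.
- by move=> y _; rewrite lee_fin sqr_ge0.
- by apply/measurable_EFinP; exact: measurable_funX.
by rewrite !lte_mul_pinfty // ?lee_fin ?mule_ge0 ?integral_ge0 // ?ltW // => y _; rewrite lee_fin sqr_ge0.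
Qed.


End potential_estimates.

(** * Averages of the squared maximal function over the boundary points seen from an exterior
    point *)

Section cone_averages.
Context {R : realType} (D : set (E3 R)).
Hypotheses (oD : open D) (bD : bounded_set D) (D0 : D 0).
Implicit Types (x y q p : E3 R).
Local Notation delta x := (dist x (bdry D)).
Variable mu : sfin3 R.
Variable N : E3 R -> \bar R.
Hypotheses (mN : measurable_fun setT (N : M3 R -> \bar R)) (N0 : forall q, (0 <= N q)%E)
  (N2 : (\int[mu]_q (N q * N q) < +oo)%E).

(** Division by delta^2 normalises by the order of the surface measure of the patch seen from x. The
    condition |x - q| < 3 delta is written through a difference, so that joint measurability in x
    and q is a composition. *)
Definition cone_kernel (T : R) x q : R :=
  \1_(exterior D `&` eball 0 T) x * \1_(bdry D) q * \1_(`]0, +oo[%classic) (3 * delta x - enorm (x - q)) * wt 2 (delta x).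

Definition cone_average (T : R) x : \bar R :=
  (\int[mu]_q (N q * N q * (cone_kernel T x q)%:E))%E.

Lemma wt2E (s : R) : 0 <= s -> wt 2 s = (s ^+ 2)^-1.
Proof. by move=> s0; rewrite /wt powRN (powR_mulrn 2). Qed.

Lemma cone_kernel_ge0 T x q : 0 <= cone_kernel T x q.
Proof. by rewrite /cone_kernel !mulr_ge0 ?wt_ge0. Qed.

Lemma cone_kernel_le T x q : cone_kernel T x q <= 9 * (\1_(eball 0 T) x * wt 2 (enorm (x - q))).
Proof.
have p0 : 0 <= 9 * (\1_(eball 0 T) x * wt 2 (enorm (x - q))) by rewrite mulr_ge0 // mulr_ge0 ?wt_ge0.
rewrite /cone_kernel !indicE; case: (boolP (x \in exterior D `&` eball 0 T)) => [|_]; last by rewrite !mul0r.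
rewrite inE => -[ex xT]; have -> : x \in eball 0 T by rewrite inE.
case: (boolP (q \in bdry D)) => [|_]; last by rewrite mulr0 !mul0r mul1r mulr_ge0 ?wt_ge0.
rewrite inE => Sq; case: (boolP (3 * delta x - enorm (x - q) \in `]0, +oo[%classic)) => [|_]; last by rewrite mulr0 !mul0r mul1r mulr_ge0 ?wt_ge0.
rewrite inE /= in_itv /= andbT => h; rewrite !mul1r.
have dq := dist_le oD bD D0 x Sq.
have d0 : 0 < delta x by lra.
have q0 : 0 < enorm (x - q) by lra.
rewrite !wt2E ?enorm_ge0 ?(ltW d0) //.
rewrite -[9]invrK -invfM lef_pV2 ?posrE ?exprn_gt0 //; last by rewrite mulr_gt0 ?exprn_gt0.
by rewrite -(ler_pM2l (_ : 0 < 9)) // mulrA divff // mul1r !expr2; nra.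
Qed.

Lemma measurable_delta : measurable_fun setT ((fun x => delta x) : M3 R -> R).
Proof. by apply: continuous_measurable3; exact: (continuous_dist oD bD D0). Qed.

(** Tonelli: on its support the kernel is at most 9 |x-q|^(-2), whose volume integral over a bounded
    set is bounded uniformly in q. *)
Lemma cone_average_finite T : 0 < T -> measurable_fun setT (cone_average T : M3 R -> \bar R) /\
  (\int[leb3 R]_x cone_average T x < +oo)%E.
Proof.
move=> T0; pose F (z : M3 R * M3 R) : \bar R := (N z.2 * N z.2 * (cone_kernel T z.1 z.2)%:E)%E.
have F0 (z : M3 R * M3 R) : (0 <= F z)%E by rewrite !mule_ge0 // lee_fin cone_kernel_ge0.
have m1 : measurable_fun setT (fun z : M3 R * M3 R => z.1) by exact: measurable_fst.
have m2 : measurable_fun setT (fun z : M3 R * M3 R => z.2) by exact: measurable_snd.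
have mE : measurable (exterior D `&` eball 0 T : set (M3 R)).
  by apply: measurableI; [apply: open_measurable3; exact: open_exterior|exact: measurable_eball].
have mS := measurable_bdry oD.
have md : measurable_fun setT (fun z : M3 R * M3 R => delta z.1).
  exact: (measurableT_comp measurable_delta m1).
have mF : measurable_fun setT F.
  apply: emeasurable_funM.
    by apply: emeasurable_funM; exact: (measurableT_comp mN m2).
  apply/measurable_EFinP; apply: measurable_funM; last exact: (measurableT_comp (measurable_wt 2) md).
  apply: measurable_funM; first apply: measurable_funM.
  - exact: (measurableT_comp (measurable_indic mE) m1).
  - exact: (measurableT_comp (measurable_indic mS) m2).
  - have mi : measurable_fun setT (\1_(`]0, +oo[%classic) : R -> R) by exact: measurable_indic.
    apply: (measurableT_comp mi); apply: measurable_funB; last exact: measurable_enorm2.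
    by apply: measurable_funM.
split.
  exact: (@measurable_fun_fubini_tonelli_F _ _ (M3 R) (M3 R) R mu F mF F0).
have -> : (\int[leb3 R]_x cone_average T x = \int[mu]_q \int[leb3 R]_x F (x, q))%E.
  exact: (@fubini_tonelli _ _ (M3 R) (M3 R) R (leb3s : sfin3 R) mu F mF F0).
have [K K0 hK] : exists2 K : R, 0 < K & forall y, (\int[leb3 R]_(x in eball (0%R : E3 R) T) (wt 2 (enorm (x - y)))%:E <= K%:E)%E.
  apply: leb_ball_riesz => //; rewrite (_ : 2 = 4%:R / 2 :> R); last by field.
  by rewrite (four_powR 4); lra.
have mk (q : E3 R) : measurable_fun setT (fun x : M3 R => (cone_kernel T x q)%:E).
  apply/measurable_EFinP; apply: measurable_funM; last exact: (measurableT_comp (measurable_wt 2) measurable_delta).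
  apply: measurable_funM; first by apply: measurable_funM => //; exact: measurable_indic.
  have mi : measurable_fun setT (\1_(`]0, +oo[%classic) : R -> R) by exact: measurable_indic.
  apply: (measurableT_comp mi); apply: measurable_funB; last exact: measurable_enormB.
  by apply: measurable_funM => //; exact: measurable_delta.
have H q : (\int[leb3 R]_x F (x, q) <= (9 * K)%:E * (N q * N q))%E.
  rewrite /F /= ge0_integralZl //; last 2 first.
  - by move=> x _; rewrite lee_fin cone_kernel_ge0.
  - by rewrite mule_ge0.
  rewrite muleC; apply: lee_wpmul2r; first by rewrite mule_ge0.
  apply: (@le_trans _ _ (\int[leb3 R]_x (9%:E * (\1_(eball 0 T) x * wt 2 (enorm (x - q)))%:E))%E).
    apply: le_integral_nonmeas => x; first by rewrite lee_fin cone_kernel_ge0.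
    by rewrite -EFinM lee_fin cone_kernel_le.
  rewrite ge0_integralZl_EFin //; last 2 first.
  - by move=> x _; rewrite lee_fin mulr_ge0 ?wt_ge0.
  - apply/measurable_EFinP; apply: measurable_funM; first by apply: measurable_indic; exact: measurable_eball.
    exact: measurableT_comp (measurable_wt _) (measurable_enormB q).
  rewrite EFinM; apply: lee_wpmul2l; first by rewrite lee_fin.
  apply: (le_trans _ (hK q)); rewrite [leRHS]integral_mkcond.
  apply: le_integral_nonmeas => x; first by rewrite lee_fin mulr_ge0 ?wt_ge0.
  by rewrite /patch indicE; case: ifP => _; rewrite ?mul1r ?mul0r.
apply: (@le_lt_trans _ _ (\int[mu]_q ((9 * K)%:E * (N q * N q)))%E).
  by apply: le_integral_nonmeas => q; [apply: integral_ge0 => x _|].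
rewrite ge0_integralZl_EFin //; last 3 first.
- by move=> q _; rewrite mule_ge0.
- by apply: emeasurable_funM.
- by rewrite mulr_ge0 // ltW.
by rewrite lte_mul_pinfty // ?lee_fin ?mulr_ge0 // ltW.
Qed.

(** Some boundary point q0 is within 2 delta of x, and the boundary points within delta of q0 are
    within 3 delta of x; their surface measure is at least k delta^2. *)
Lemma cone_average_lower (T k T' : R) x (b : R) : 0 < k ->
  (forall q (rho : R), bdry D q -> 0 < rho -> rho <= T' -> ((k * rho ^+ 2)%:E <= mu (bdry D `&` eball q rho))%E) ->
  exterior D x -> enorm x < T -> delta x <= T' -> 0 <= b ->
  (forall q, bdry D q -> enorm (x - q) < 3 * delta x -> (b%:E <= N q)%E) ->
  ((k * b ^+ 2)%:E <= cone_average T x)%E.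
Proof.
move=> k0 hk ex xT dT b0 bN; have d0 := dist_gt0 oD bD D0 ex.
have [q0 Sq0 xq0] := dist_approx oD bD D0 x d0.
have mB : measurable (bdry D `&` eball q0 (delta x) : set (M3 R)) by exact: measurable_bdry_ball.
apply: (@le_trans _ _ (\int[mu]_(q in bdry D `&` eball q0 (delta x)) (b ^+ 2 * wt 2 (delta x))%:E)%E).
  rewrite integral_cst //; apply: (@le_trans _ _ ((b ^+ 2 * wt 2 (delta x))%:E * (k * (delta x) ^+ 2)%:E)%E).
    by rewrite -EFinM lee_fin wt2E ?(ltW d0) //; apply: le_of_eq; field; rewrite gt_eqF.
  apply: lee_wpmul2l; first by rewrite lee_fin mulr_ge0 ?wt_ge0 // sqr_ge0.
  exact: hk.
rewrite integral_mkcond; apply: le_integral_nonmeas => q; rewrite /patch; case: ifPn => [|_] //.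
- by move=> _; rewrite lee_fin mulr_ge0 ?wt_ge0 // sqr_ge0.
- rewrite inE => -[Sq qq0]; rewrite /eball /= in qq0.
  have xq : enorm (x - q) < 3 * delta x.
    by have := enormDB x q0 q; rewrite (enormB q0 q); lra.
  rewrite /cone_kernel !indicE !mem_set //; last 2 first.
  + by rewrite /= in_itv /= andbT subr_gt0.
  + by split=> //; rewrite /eball /= subr0.
  rewrite !mul1r EFinM; apply: lee_wpmul2r; first by rewrite lee_fin wt_ge0.
  by rewrite expr2 EFinM; apply: lee_pmul; rewrite ?lee_fin //; exact: bN.
- by rewrite (_ : point = 0%E) // !mule_ge0 // lee_fin cone_kernel_ge0.
Qed.

End cone_averages.

(** * Localised potentials *)

Section cutoffs.
Context {R : realType}.
Implicit Types (x y z p : E3 R) (psi : E3 R -> R) (r : R).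

Definition C2f psi := D2on setT psi (fun i => partial i psi) (fun i => partial i (partial i psi)).
Definition laplacian psi := lap (fun i => partial i (partial i psi)).

Lemma D2on_partial psi g h : D2on setT psi g h ->
  (fun i => partial i psi) = g /\ (fun i => partial i (partial i psi)) = h.
Proof.
move=> [d1 d2 _ _ _].
have E1 i : partial i psi = g i by apply: is_derive_partialE => y; exact: d1.
split; apply/funext => i; first exact: E1.
by rewrite E1; apply: is_derive_partialE => y; exact: d2.
Qed.

Lemma D2on_laplacian psi g h y : D2on setT psi g h -> laplacian psi y = lap h y.
Proof. by move=> /D2on_partial[_ E]; rewrite /laplacian; congr (lap _ _). Qed.

Lemma D2on_C2f psi g h : D2on setT psi g h -> C2f psi.
Proof. by move=> D; rewrite /C2f; have [-> ->] := D2on_partial D. Qed.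

Lemma C2fM psi psi' : C2f psi -> C2f psi' -> C2f (fun y => psi y * psi' y).
Proof. by move=> D D'; exact: D2on_C2f (D2onM D D'). Qed.
Lemma C2fB psi psi' : C2f psi -> C2f psi' -> C2f (fun y => psi y - psi' y).
Proof. by move=> D D'; exact: D2on_C2f (D2onB D D'). Qed.
Lemma C2f_cst c : C2f (fun=> c).
Proof. exact: D2on_C2f (D2on_cst _ c). Qed.

Lemma C2f_prod n (f : nat -> E3 R -> R) : (forall k, C2f (f k)) -> C2f (fun y => \prod_(k < n) f k y).
Proof.
move=> H; elim: n => [|n IH].
  rewrite (_ : (fun y => _) = (fun=> 1)); first exact: C2f_cst.
  by apply/funext => y; rewrite big_ord0.
rewrite (_ : (fun y => _) = (fun y => \prod_(k < n) f k y * f n y)); first exact: (C2fM IH (H n)).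
by apply/funext => y; rewrite big_ord_recr.
Qed.

Lemma C2f_sum n (f : nat -> E3 R -> R) : (forall k, C2f (f k)) -> C2f (fun y => \sum_(k < n) f k y).
Proof.
by move=> H; exact: D2on_C2f (@D2on_sum R n xpredT setT f _ _ (fun j _ => H j)).
Qed.

Lemma C2f_continuous psi : C2f psi -> [/\ continuous psi, forall i, continuous (partial i psi) & continuous (laplacian psi)].
Proof.
move=> [_ _ c0 c1 c2]; split=> [y|i y|y]; [exact: c0|exact: c1|].
rewrite (_ : laplacian psi = fun y => partial ord0 (partial ord0 psi) y + partial ax1 (partial ax1 psi) y
  + partial ax2 (partial ax2 psi) y); last by apply/funext => z; rewrite /laplacian /lap sum3.
by apply: cvgD; [apply: cvgD; exact: c2|exact: c2].
Qed.

Lemma C2f_locally_cst psi y r c : C2f psi -> 0 < r -> (forall z, enorm (z - y) < r -> psi z = c) ->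
  (forall i, partial i psi y = 0) /\ laplacian psi y = 0.
Proof.
move=> [d1 d2 _ _ _] r0 z0.
have H i z : enorm (z - y) < r -> partial i psi z = 0.
  move=> zy; apply: (@is_derive_zero_ball _ (fun z => psi z - c) i z _ (r - enorm (z - y))).
  - by rewrite subr_gt0.
  - by move=> z' z'z; apply/eqP; rewrite subr_eq0 z0 //; have := enormDB z' z y; lra.
  - exact: (is_derive_eqf (is_deriveDf (d1 i z I) (is_derive_cst (- c) z (basis3 i))) (addr0 _)).
split=> [i|]; first by apply: H; rewrite subrr enorm0.
rewrite /laplacian /lap big1 // => i _.
by apply: (@is_derive_zero_ball _ (partial i psi) i y _ r) => //; [exact: H|exact: d2].
Qed.

Lemma C2f_bounded psi T : C2f psi -> 0 < T -> (forall y, T <= enorm y -> psi y = 0) ->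
  exists2 B : R, 0 < B & forall y, [/\ `|psi y| <= B, forall i, `|partial i psi y| <= B & `|laplacian psi y| <= B].
Proof.
move=> C T0 pT; have [c0 c1 c2] := C2f_continuous C.
have bd (f : E3 R -> R) : continuous f -> exists M : R, forall x, enorm (x - 0) <= T + 1 -> `|f x| <= M.
  move=> cf; have := @continuous_bounded_on R [set x | enorm (x - 0) <= T + 1] f.
  by apply; [exact: compact_cball|move=> x _; exact: cf].
have [M0 h0] := bd _ c0; have [M2 h2] := bd _ c2.
have [M1 h1] : exists M : R, forall i x, enorm (x - 0) <= T + 1 -> `|partial i psi x| <= M.
  have [Ms hs] : exists Ms : 'I_3 -> R, forall i x, enorm (x - 0) <= T + 1 -> `|partial i psi x| <= Ms i.
    exists (fun i => sval (cid (bd _ (c1 i)))) => i; exact: (svalP (cid (bd _ (c1 i)))).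
  exists (\sum_i `|Ms i|) => i x /hs xT; apply: (le_trans (xT i)).
  by rewrite (bigD1 i) //= (le_trans (ler_norm _)) // lerDl sumr_ge0.
exists (`|M0| + `|M1| + `|M2| + 1); first by rewrite ltr_wpDl // !addr_ge0.
have n0 := normr_ge0 M0; have n1 := normr_ge0 M1; have n2 := normr_ge0 M2.
move=> y; have [yT|yT] := leP (enorm y) (T + 1).
  have := h0 y; have := h1 ^~ y; have := h2 y; rewrite subr0 => /(_ yT) a b /(_ yT) d.
  have := ler_norm M0; have := ler_norm M1; have := ler_norm M2 => e2 e1 e0.
  split=> [|i|]; [lra|have := b i yT; lra|lra].
have z z' : enorm (z' - y) < 1 -> psi z' = 0.
  by move=> zy; apply: pT; have := enormDB y z' 0; rewrite !subr0 (enormB y); lra.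
have [a b] := C2f_locally_cst C ltr01 z.
have -> : psi y = 0 by apply: z; rewrite subrr enorm0.
by rewrite b; split=> [|i|]; rewrite ?a normr0 !addr_ge0.
Qed.

(** Nested cubes of positive parts give a C^2 transition: as 8 (1/2)^3 = 1, the outer cube vanishes
    for s <= 1/2, and for s >= 1 the inner one does. *)
Definition step (s : R) : R := 1 - cube_pos (1 - 8 * cube_pos (1 - s)).
Definition step1 (s : R) : R := - (cube_pos1 (1 - 8 * cube_pos (1 - s)) * (8 * cube_pos1 (1 - s))).
Definition step2 (s : R) : R :=
  - (cube_pos1 (1 - 8 * cube_pos (1 - s)) * (8 * - cube_pos2 (1 - s)) + cube_pos2 (1 - 8 * cube_pos (1 - s)) * (8 * cube_pos1 (1 - s)) ^+ 2).

Lemma is_derive_1B (F F' : R -> R) (t : R) : (forall s : R, is_derive s 1 F (F' s)) ->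
  is_derive t 1 (fun s => F (1 - s)) (- F' (1 - t)).
Proof.
move=> dF; have d : is_derive t 1 (fun s : R => 1 - s) (-1).
  have := is_deriveDf (is_derive_cst (1 : R) t (1 : R)) (is_deriveMf (is_derive_cst (-1 : R) t (1 : R)) (is_derive_id t (1 : R))).
  rewrite (_ : (fun s => _ + _) = (fun s : R => 1 - s)); last by apply/funext => s /=; rewrite mulN1r.
  by move=> H; apply: (is_derive_eqf H); rewrite mulr0 addr0 add0r mulr1.
have := @is_derive_comp1 R _ F (fun s : R => 1 - s) t 1 _ _ (dF (1 - t)) d => H.
by apply: (is_derive_eqf H); rewrite mulrN1.
Qed.

Lemma inner_step_derive (t : R) : is_derive t 1 (fun s : R => 1 - 8 * cube_pos (1 - s)) (8 * cube_pos1 (1 - t)).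
Proof.
have := is_deriveDf (is_derive_cst (1 : R) t (1 : R)) (is_deriveMf (is_derive_cst (- 8 : R) t (1 : R)) (is_derive_1B t cube_pos_derive)).
rewrite (_ : (fun s => _ + _) = (fun s : R => 1 - 8 * cube_pos (1 - s))); last by apply/funext => s /=; rewrite mulNr.
by move=> H; apply: (is_derive_eqf H); rewrite mulr0 addr0 add0r mulNr mulrN opprK.
Qed.

Lemma step_derive (t : R) : is_derive t 1 step (step1 t).
Proof.
have := is_deriveDf (is_derive_cst (1 : R) t (1 : R)) (is_deriveMf (is_derive_cst (-1 : R) t (1 : R)) (is_derive_comp1 (cube_pos_derive _) (inner_step_derive t))).
rewrite (_ : (fun s => _ + _) = step); last by apply/funext => s /=; rewrite /step mulN1r.
by move=> H; apply: (is_derive_eqf H); rewrite mulr0 addr0 add0r mulN1r.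
Qed.

Lemma step1_derive (t : R) : is_derive t 1 step1 (step2 t).
Proof.
have := is_deriveMf (is_derive_cst (- 8 : R) t (1 : R)) (is_deriveMf (is_derive_comp1 (cube_pos1_derive _) (inner_step_derive t)) (is_derive_1B t cube_pos1_derive)).
rewrite (_ : (fun s => _ * _) = step1); last by apply/funext => s /=; rewrite /step1; ring.
by move=> H; apply: (is_derive_eqf H); rewrite /step2 /= mulr0 addr0; ring.
Qed.

Lemma step2_continuous : continuous step2.
Proof.
have c1B (F : R -> R) : continuous F -> continuous (fun s : R => F (1 - s)).
  move=> cF t; apply: continuous_comp; last exact: cF.
  by apply: cvgB; [exact: cvg_cst|exact: cvg_id].
have c0 : continuous (fun s : R => cube_pos (1 - s)).
  by apply: c1B => t; exact: is_derive_continuous (cube_pos_derive t).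
have c1 : continuous (fun s : R => cube_pos1 (1 - s)).
  by apply: c1B => t; exact: is_derive_continuous (cube_pos1_derive t).
have c2 : continuous (fun s : R => cube_pos2 (1 - s)) by apply: c1B; exact: cube_pos2_continuous.
have cq (F : R -> R) : continuous F -> continuous (fun s : R => F (1 - 8 * cube_pos (1 - s))).
  move=> cF t; apply: continuous_comp; last exact: cF.
  by apply: cvgB; [exact: cvg_cst|apply: cvgM; [exact: cvg_cst|exact: c0]].
have d1 := cq _ (fun t => is_derive_continuous (cube_pos1_derive t)).
have d2 := cq _ (@cube_pos2_continuous R).
rewrite /step2 => t; apply: cvgN.
apply: cvgD.
  by apply: cvgM; [exact: d1|apply: cvgM; [exact: cvg_cst|apply: cvgN; exact: c2]].
apply: cvgM; first exact: d2.
by rewrite expr2; apply: cvgM; apply: cvgM; (exact: cvg_cst || exact: c1).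
Qed.

Lemma step_in s : 0 <= s -> s <= 2^-1 -> step s = 1.
Proof.
move=> s0 s1; have h : 2^-1 <= 1 - s by lra.
rewrite /step (@cube_pos_in _ (1 - s)) ?(le_trans _ h) ?invr_ge0 //.
rewrite cube_pos_out ?subr0 // subr_le0.
have h2 : 1 <= 2 * (1 - s) by lra.
have := exprn_ege1 3 h2; rewrite exprMn (_ : 2 ^+ 3 = 8 :> R) //; ring.
Qed.

Lemma step_out s : 1 <= s -> step s = 0.
Proof.
move=> s1; rewrite /step (@cube_pos_out _ (1 - s)) ?subr_le0 // mulr0 subr0.
by rewrite cube_pos_in // expr1n subrr.
Qed.

Lemma step_itv s : 0 <= step s <= 1.
Proof.
have h0 := cube_pos_ge0 (1 - s); have h1 := cube_pos_ge0 (1 - 8 * cube_pos (1 - s)).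
have h2 : cube_pos (1 - 8 * cube_pos (1 - s)) <= 1.
  have [q0|q0] := leP 0 (1 - 8 * cube_pos (1 - s)); last by rewrite cube_pos_out // ltW.
  rewrite cube_pos_in //; apply: exprn_ile1 => //; lra.
rewrite /step; apply/andP; split; lra.
Qed.

Lemma step_bound : exists2 C : R, 0 < C & forall s, 0 <= s -> `|step1 s| <= C /\ `|step2 s| <= C.
Proof.
have [C [C0 C1 C2]] : exists C : R, [/\ 0 < C, 3 * (8 * 3) <= C & 3 * (8 * 6) + 6 * (8 * 3) ^+ 2 <= C].
  exists (3 * (8 * 6) + 6 * (8 * 3) ^+ 2); split=> //; lra.
exists C => // s s0; have h0 := cube_pos_ge0 (1 - s).
have a := @cube_pos1_le R (1 - 8 * cube_pos (1 - s)) (ltac:(lra)).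
have b := @cube_pos1_le R (1 - s) (ltac:(lra)).
have a2 := @cube_pos2_le R (1 - 8 * cube_pos (1 - s)) (ltac:(lra)).
have b2 := @cube_pos2_le R (1 - s) (ltac:(lra)).
have b8 : `|8 * cube_pos1 (1 - s)| <= 8 * 3 by rewrite normrM ger0_norm // ler_pM2l.
rewrite /step1 /step2 !normrN; split.
  by apply: le_trans C1; rewrite normrM; apply: ler_pM.
apply: le_trans C2; apply: (le_trans (ler_normD _ _)); apply: lerD; rewrite normrM; apply: ler_pM => //.
  by rewrite normrM normrN ger0_norm // ler_pM2l.
by rewrite normrX lerXn2r ?nnegrE.
Qed.

Lemma step1_out s : 1 <= s -> step1 s = 0.
Proof.
move=> s1; rewrite /step1 (_ : cube_pos1 (1 - s) = 0) ?mulr0 ?oppr0 //.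
rewrite /cube_pos1 /piecewise; case: ifP => // h.
have E : 1 - s = 0 by apply/eqP; rewrite eq_le subr_le0 s1 leNgt; move: h; rewrite subr_le0 s1.
rewrite E; ring.
Qed.

Lemma step2_out s : 1 <= s -> step2 s = 0.
Proof.
move=> s1; rewrite /step2 (_ : cube_pos1 (1 - s) = 0); last first.
  by rewrite /cube_pos1 /piecewise subr_le0 s1.
by rewrite (_ : cube_pos2 (1 - s) = 0) ?(oppr0, mulr0, expr0n, addr0) // /cube_pos2 /piecewise subr_le0 s1.
Qed.

Definition cut r p y : R := step ((2 * r) ^- 2 * sqd p y).

Lemma cut_D2on r p : D2on setT (cut r p)
  (fun i y => step1 ((2 * r) ^- 2 * sqd p y) * ((2 * r) ^- 2 * (2 * co i (y - p))))
  (fun i y => step1 ((2 * r) ^- 2 * sqd p y) * ((2 * r) ^- 2 * 2)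
     + step2 ((2 * r) ^- 2 * sqd p y) * ((2 * r) ^- 2 * (2 * co i (y - p))) ^+ 2).
Proof.
apply: (D2on_comp step_derive step1_derive step2_continuous).
exact: D2onZ (sqd_D2on _ _).
Qed.

Lemma C2f_cut r p : C2f (cut r p). Proof. exact: D2on_C2f (cut_D2on r p). Qed.

Lemma cut_arg r p y : 0 < r -> (2 * r) ^- 2 * sqd p y = (enorm (y - p) / (2 * r)) ^+ 2.
Proof. by move=> r0; rewrite sqd_enorm expr_div_n mulrC. Qed.

Lemma cut_in r p y : 0 < r -> enorm (y - p) <= r -> cut r p y = 1.
Proof.
move=> r0 yr; rewrite /cut cut_arg // step_in ?sqr_ge0 //.
have : enorm (y - p) / (2 * r) <= 2^-1.
  by rewrite ler_pdivrMr ?mulr_gt0 // mulrA mulVf // mul1r.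
have : 0 <= enorm (y - p) / (2 * r) by rewrite divr_ge0 ?enorm_ge0 // mulr_ge0 // ltW.
rewrite expr2; nra.
Qed.

Lemma cut_arg_ge1 r p y : 0 < r -> 2 * r <= enorm (y - p) -> 1 <= (2 * r) ^- 2 * sqd p y.
Proof.
by move=> r0 yr; rewrite cut_arg // exprn_ege1 // ler_pdivlMr ?mulr_gt0 // mul1r.
Qed.

Lemma cut_out r p y : 0 < r -> 2 * r <= enorm (y - p) -> cut r p y = 0.
Proof. by move=> r0 yr; rewrite /cut step_out // cut_arg_ge1. Qed.

Lemma cut_itv r p y : 0 <= cut r p y <= 1. Proof. exact: step_itv. Qed.

(** The dependence on r matters: the lemma is used with r tending to infinity in [pot_near1]. *)
Lemma cut_bound : exists2 C : R, 0 < C & forall r p y, 0 < r ->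
  (forall i, `|partial i (cut r p) y| <= C / r) /\ `|laplacian (cut r p) y| <= C / r ^+ 2.
Proof.
have [C C0 HC] := step_bound; exists (5 * C) => [|r p y r0]; first by rewrite mulr_gt0.
have r2 : 0 < r ^+ 2 by rewrite exprn_gt0.
have [E1 E2] := D2on_partial (cut_D2on r p); rewrite /laplacian E2 /lap.
have [yr|yr] := leP (2 * r) (enorm (y - p)).
  have a1 := cut_arg_ge1 r0 yr.
  split=> [i|]; first by rewrite (congr1 (@^~ i) E1) step1_out // mul0r normr0 divr_ge0 ?ltW // mulr_gt0.
  rewrite big1 ?normr0 => [|i _]; last by rewrite step1_out ?step2_out // !mul0r addr0.
  by apply: ltW; rewrite divr_gt0 // mulr_gt0.
have [|h1 h2] := HC ((2 * r) ^- 2 * sqd p y); first by rewrite cut_arg // sqr_ge0.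
have w0 : 0 < (2 * r) ^- 2 by rewrite invr_gt0 exprn_gt0 // mulr_gt0.
have d i : `|(2 * r) ^- 2 * (2 * co i (y - p))| <= r^-1.
  rewrite normrM (gtr0_norm w0) normrM (ger0_norm (_ : 0 <= 2)) //.
  rewrite (_ : r^-1 = (2 * r) ^- 2 * (2 * (2 * r))); last by field; exact: lt0r_neq0.
  by rewrite ler_pM2l // ler_pM2l // (le_trans (co_le i _)) // ltW.
split=> [i|].
  rewrite (congr1 (@^~ i) E1) normrM; apply: (@le_trans _ _ (C * r^-1)); first by apply: ler_pM.
  by rewrite ler_pM2r ?invr_gt0 // ler_peMl ?(ltW C0) ?ler1n.
have t i : `|step1 ((2 * r) ^- 2 * sqd p y) * ((2 * r) ^- 2 * 2)
     + step2 ((2 * r) ^- 2 * sqd p y) * ((2 * r) ^- 2 * (2 * co i (y - p))) ^+ 2| <= C * (3 / 2) / r ^+ 2.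
  apply: (le_trans (ler_normD _ _)); rewrite (normrM (step1 _)) (normrM (step2 _)) normrX (normrM ((2 * r) ^- 2) 2).
  rewrite (_ : C * (3 / 2) / r ^+ 2 = C * ((2 * r) ^- 2 * 2) + C * r^-1 ^+ 2); last by field; exact: lt0r_neq0.
  apply: lerD; first by rewrite (gtr0_norm w0) (ger0_norm (_ : 0 <= 2)) // ler_wpM2r // mulr_ge0 // ltW.
  by apply: ler_pM => //; rewrite lerXn2r ?nnegrE ?invr_ge0 // ltW.
apply: (le_trans (ler_norm_sum _ _ _)); apply: (le_trans (ler_sum _ (fun i _ => t i))).
rewrite sumr_const card_ord -mulrnAl -mulrnAr ler_pM2r ?invr_gt0 // [leRHS]mulrC ler_pM2l //; lra.
Qed.

End cutoffs.

Section regularised_kernel.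
Context {R : realType}.
Implicit Types (x y z p : E3 R) (psi : E3 R -> R) (r T : R).

Lemma newt_bound : exists2 C : R, 0 < C & forall r p y, 0 < r ->
  `|newt r p y| <= C / (r + enorm (y - p)) /\
  forall i, `|newt1 r p i y| <= C / (r + enorm (y - p)) ^+ 2.
Proof.
have [C [C1 HC]] : exists C : R, 1 <= C /\ forall t : R, 0 <= t <= 1 ->
    `|newton_profile t| <= C /\ `|newton_profile1 t| <= C.
  exists 4; split=> [|t /andP[t0 t1]]; first by rewrite ler1n.
  rewrite /newton_profile /newton_profile1 /piecewise t1.
  have s0 : 0 <= 1 - t by lra. have s1 : 1 - t <= 1 by lra.
  have -> : t - 1 = - (1 - t) by ring.
  move: (1 - t) s0 s1 => s s0 s1.
  have p k : 0 <= s ^+ k <= 1 by rewrite exprn_ge0 // exprn_ile1.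
  have /andP[p2 q2] := p 2; have /andP[p3 q3] := p 3; have /andP[p4 q4] := p 4.
  have -> : (- s) ^+ 2 = s ^+ 2 by ring.
  have -> : (- s) ^+ 3 = - s ^+ 3 by ring.
  have -> : (- s) ^+ 4 = s ^+ 4 by ring.
  rewrite expr1 !ler_norml; move: (s ^+ 2) (s ^+ 3) (s ^+ 4) p2 q2 p3 q3 p4 q4 => a b c *.
  by split; apply/andP; split; lra.
have C0 : 0 < C by exact: lt_le_trans ltr01 C1.
exists (8 * C) => [|r p y r0]; first by rewrite mulr_gt0.
have [ry|yr] := ltP r (enorm (y - p)).
  have e0 := lt_trans r0 ry; rewrite newt_far ?(ltW ry) //.
  have s0 : 0 < r + enorm (y - p) by rewrite addr_gt0.
  have s1 : (enorm (y - p))^-1 <= 2 / (r + enorm (y - p)).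
    by rewrite ler_pdivlMr // mulrC ler_pdivrMr //; lra.
  have v0 : 0 < (r + enorm (y - p))^-1 by rewrite invr_gt0.
  rewrite normfV (gtr0_norm e0); split=> [|i].
    by apply: (le_trans s1); rewrite ler_pM2r //; lra.
  rewrite newt1_far ?(ltW ry) // normrN normrM normfV (ger0_norm (exprn_ge0 3 (enorm_ge0 _))).
  apply: (@le_trans _ _ ((enorm (y - p))^-1 ^+ 2)).
    rewrite ler_pdivrMr ?exprn_gt0 // (_ : _ * _ ^+ 3 = enorm (y - p)); first exact: co_le.
    by field; exact: lt0r_neq0.
  apply: (@le_trans _ _ ((2 / (r + enorm (y - p))) ^+ 2)).
    by rewrite lerXn2r ?nnegrE ?invr_ge0 ?divr_ge0 ?enorm_ge0 ?(ltW s0).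
  rewrite expr_div_n ler_pM2r ?invr_gt0 ?exprn_gt0 //; lra.
have a0 : 0 <= r ^- 2 * sqd p y <= 1.
  rewrite mulr_ge0 ?sqd_ge0 ?invr_ge0 ?sqr_ge0 //= mulrC ler_pdivrMr ?exprn_gt0 // mul1r sqd_enorm.
  by rewrite lerXn2r ?nnegrE ?enorm_ge0 ?(ltW r0).
have [h0 h1] := HC _ a0.
have s0 : 0 < r + enorm (y - p) by rewrite ltr_pwDl.
have s1 : r^-1 <= 2 / (r + enorm (y - p)) by rewrite ler_pdivlMr // mulrC ler_pdivrMr //; lra.
have v0 : 0 < (r + enorm (y - p))^-1 by rewrite invr_gt0.
have r1 : 0 < r^-1 by rewrite invr_gt0.
split=> [|i].
  rewrite /newt normrM (gtr0_norm r1); apply: (@le_trans _ _ (2 / (r + enorm (y - p)) * C)).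
    by apply: ler_pM => //; exact: ltW.
  by rewrite mulrAC ler_pM2r // ler_pM2r //; lra.
rewrite /newt1 normrM (gtr0_norm r1) normrM.
have c : `|r ^- 2 * (2 * co i (y - p))| <= 2 * r^-1.
  rewrite normrM (ger0_norm (_ : 0 <= r ^- 2)) ?invr_ge0 ?sqr_ge0 // normrM (ger0_norm (_ : 0 <= 2)) //.
  rewrite (_ : 2 * r^-1 = r ^- 2 * (2 * r)); last by field; exact: lt0r_neq0.
  by rewrite ler_pM2l ?invr_gt0 ?exprn_gt0 // ler_pM2l // (le_trans (co_le _ _)).
apply: (@le_trans _ _ (2 * C * r^-1 ^+ 2)).
  rewrite (_ : 2 * C * r^-1 ^+ 2 = r^-1 * (C * (2 * r^-1))); last by ring.
  by rewrite ler_pM2l //; apply: ler_pM.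
apply: (@le_trans _ _ (2 * C * (2 / (r + enorm (y - p))) ^+ 2)).
  rewrite ler_pM2l ?mulr_gt0 // lerXn2r ?nnegrE ?(ltW r1) // divr_ge0 // ltW //.
by apply: le_of_eq; rewrite expr_div_n; ring.
Qed.

#[local] Opaque newt newt1 newt2 bump cut.

(** By the product rule the Laplacian of [newt] psi contains - [bump] psi, which concentrates at x
    as r tends to 0. Adding it back leaves [reg_kernel], in which psi is differentiated at least
    once; its singularity is of order |x-y|^(-2) uniformly in r. *)
Definition pot_kernel r psi x y := laplacian (fun z => newt r x z * psi z) y.
Definition reg_kernel r psi x y := pot_kernel r psi x y + bump r x y * psi y.

Lemma C2f_newt r x : C2f (newt r x). Proof. exact: D2on_C2f (newt_D2on setT r x). Qed.

Lemma reg_kernelE r psi x y : 0 < r -> C2f psi -> reg_kernel r psi x y =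
  newt r x y * laplacian psi y + \sum_(i < 3) 2 * (newt1 r x i y * partial i psi y).
Proof.
move=> r0 cp; rewrite /reg_kernel /pot_kernel (D2on_laplacian y (D2onM (newt_D2on setT r x) cp)) /laplacian.
have E : lap (newt2 r x) y = - bump r x y by exact: lap_newt.
rewrite /lap !big_split /= -[X in X + _ + _ + _]mulr_sumr -[X in _ + X + _ + _]mulr_sumr.
move: E; rewrite /lap => ->; move: (\sum_i _ * _) (\sum_i partial _ _ _) (bump r x y) (newt r x y) (psi y) => a1 a2 a3 a4 a5.
by ring.
Qed.

Lemma reg_kernel_bound psi T : C2f psi -> 0 < T -> (forall y, T <= enorm y -> psi y = 0) ->
  exists2 C : R, 0 < C & forall r x y, 0 < r ->
    `|reg_kernel r psi x y| <= C * ((r + enorm (y - x))^-1 + (r + enorm (y - x)) ^- 2).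
Proof.
move=> cp T0 pT; have [B B0 HB] := C2f_bounded cp T0 pT; have [C C0 HC] := newt_bound.
exists (6 * (C * B)) => [|r x y r0]; first by rewrite !mulr_gt0.
rewrite reg_kernelE //; have [h0 h1] := HC r x y r0; have [_ b1 b2] := HB y.
have s0 : 0 < r + enorm (y - x) by rewrite ltr_wpDr.
have si : 0 < (r + enorm (y - x))^-1 by rewrite invr_gt0.
have CB : 0 < C * B by rewrite mulr_gt0.
apply: (@le_trans _ _ (C * B * (r + enorm (y - x))^-1 + 6 * (C * B) * (r + enorm (y - x)) ^- 2)).
  apply: (le_trans (ler_normD _ _)); apply: lerD.
    by rewrite normrM mulrAC; apply: ler_pM.
  apply: (le_trans (ler_norm_sum _ _ _)).
  have t i : `|2 * (newt1 r x i y * partial i psi y)| <= 2 * (C * B * (r + enorm (y - x)) ^- 2).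
    rewrite normrM (ger0_norm (ler0n _ 2)) ler_pM2l // normrM mulrAC.
    by apply: ler_pM.
  apply: (le_trans (ler_sum _ (fun i _ => t i))); rewrite sumr_const card_ord.
  by apply: le_of_eq; ring.
rewrite mulrDr lerD2r ler_pM2r //; lra.
Qed.

Lemma C2f_out psi T y : C2f psi -> (forall z, T <= enorm z -> psi z = 0) -> T < enorm y -> laplacian psi y = 0.
Proof.
move=> cp pT yT; have r0 : 0 < enorm y - T by rewrite subr_gt0.
have [] // := @C2f_locally_cst _ psi y _ 0 cp r0.
move=> z zy; apply: pT; have := enormDB y z 0; rewrite !subr0 (enormB y); lra.
Qed.

Lemma pot_kernel_out r psi x y T : C2f psi -> (forall z, T <= enorm z -> psi z = 0) ->
  T < enorm y -> pot_kernel r psi x y = 0.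
Proof.
move=> cp pT; apply: C2f_out; first exact: C2fM (C2f_newt r x) cp.
by move=> z /pT ->; rewrite mulr0.
Qed.

Lemma pot_kernel_continuous r psi x : C2f psi -> continuous (pot_kernel r psi x).
Proof. by move=> cp; have [] := C2f_continuous (C2fM (C2f_newt r x) cp). Qed.

(** The limit of [reg_kernel] for r -> 0, reached as soon as r <= |y-x|. Division by zero gives 0 on
    the diagonal. *)
Definition far_kernel psi x y :=
  (enorm (y - x))^-1 * laplacian psi y + \sum_(i < 3) 2 * (- (co i (y - x) / enorm (y - x) ^+ 3) * partial i psi y).

Lemma reg_kernel_far r psi x y : 0 < r -> C2f psi -> r <= enorm (y - x) -> reg_kernel r psi x y = far_kernel psi x y.
Proof.
move=> r0 cp ry; rewrite reg_kernelE // newt_far // /far_kernel; congr (_ + _).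
by apply: eq_bigr => i _; rewrite newt1_far.
Qed.

Lemma far_kernel_diag psi x : far_kernel psi x x = 0.
Proof.
rewrite /far_kernel subrr enorm0 invr0 mul0r add0r big1 // => i _.
by rewrite expr0n /= invr0 mulr0 oppr0 mul0r mulr0.
Qed.

Lemma continuous_co i : continuous (co i : E3 R -> R).
Proof. by rewrite (_ : co i = dot (basis3 i)); [exact: continuous_dot|apply/funext => z; exact: dotC]. Qed.

Lemma far_kernel_cvg psi (xn : nat -> E3 R) x y : xn n @[n --> \oo] --> x -> y <> x ->
  far_kernel psi (xn n) y @[n --> \oo] --> far_kernel psi x y.
Proof.
move=> cx yx; have yx0 : enorm (y - x) != 0.
  by apply/eqP => /enorm_eq0 /eqP; rewrite subr_eq0 => /eqP.
have cB : (y - xn n) @[n --> \oo] --> y - x by apply: cvgB => //; exact: cvg_cst.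
have ce : enorm (y - xn n) @[n --> \oo] --> enorm (y - x).
  by apply: continuous_cvg cB; exact: continuous_enorm.
have ci : (enorm (y - xn n))^-1 @[n --> \oo] --> (enorm (y - x))^-1 by exact: cvgV.
have cc i : co i (y - xn n) @[n --> \oo] --> co i (y - x).
  by apply: continuous_cvg cB; exact: continuous_co.
have ct i : 2 * (- (co i (y - xn n) / enorm (y - xn n) ^+ 3) * partial i psi y) @[n --> \oo] -->
    2 * (- (co i (y - x) / enorm (y - x) ^+ 3) * partial i psi y).
  rewrite -exprVn; under eq_fun do rewrite -exprVn.
  apply: cvgM; first exact: cvg_cst.
  apply: cvgM; last exact: cvg_cst.
  apply: cvgN; apply: cvgM => //; exact: cvgM (cvgM ci ci).
rewrite /far_kernel sum3; under eq_fun do rewrite sum3.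
apply: cvgD; first by apply: cvgM => //; exact: cvg_cst.
by apply: cvgD; [apply: cvgD|]; exact: ct.
Qed.

End regularised_kernel.

(** * Potentials of v Laplacian(N_r psi), their averages and their regular parts *)

Section localised_potentials.
Context {R : realType} (O : set (E3 R)) (oO : open O) (u : E3 R -> R) (hu : harmonic_on O u).
Implicit Types (x y z p : E3 R) (psi : E3 R -> R) (r T : R).
Local Notation U := (ext0 O u).
Hypothesis iU : forall T, int3 (fun y => \1_(eball 0 T) y * U y).

#[local] Opaque newt newt1 newt2 bump cut.

Lemma int3_mulU (F : E3 R -> R) T : continuous F -> (forall y, T < enorm y -> F y = 0) -> int3 (fun y => F y * U y).
Proof.
move=> cF F0; have [M hM] := @continuous_bounded_on _ _ F (@compact_cball R 0 T) (fun x _ => cF x).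
have E y : F y * U y = F y * (\1_(eball 0 (T + 1)) y * U y).
  rewrite indicE; have [yT|yT] := leP (enorm y) T; last by rewrite F0 ?mul0r.
  by rewrite mem_set ?mul1r // /eball /= subr0; lra.
apply: (@eq_int3 _ (fun y => F y * (\1_(eball 0 (T + 1)) y * U y))) => [y|]; first by rewrite E.
apply: (@le_int3 _ _ (fun y => `|M| * `|\1_(eball 0 (T + 1)) y * U y|)).
- apply: measurable_funM; first exact: continuous_measurable3.
  exact: int3_measurable (iU _).
- move=> y; rewrite normrM; have [yT|yT] := leP (enorm y) T.
    by rewrite ler_wpM2r // (le_trans (hM y _)) ?ler_norm //= subr0.
  by rewrite F0 // normr0 mul0r mulr_ge0.
- by apply: int3Z; apply: int3_abs; exact: iU.
Qed.

Lemma D2on_setT psi g h : D2on setT psi g h -> D2on O psi g h.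
Proof. by move=> [a b c d e]; split=> *; [exact: a|exact: b|exact: c|exact: d|exact: e]. Qed.

(** [pot] is the quantity that can be approximated by multipoles, [mean] is the local average of psi
    U, and [reg] is their sum, which has a limit as r tends to 0. *)
Definition pot r psi x := I3 (fun y => pot_kernel r psi x y * U y).
Definition mean r psi x := I3 (fun y => bump r x y * psi y * U y).
Definition reg r psi x := I3 (fun y => reg_kernel r psi x y * U y).

Lemma int3_pot r psi x T : C2f psi -> (forall y, T <= enorm y -> psi y = 0) ->
  int3 (fun y => pot_kernel r psi x y * U y).
Proof.
move=> cp pT; apply: (@int3_mulU _ T); first exact: pot_kernel_continuous.
by move=> y; exact: pot_kernel_out.
Qed.

Lemma int3_mean r psi x : 0 < r -> C2f psi -> int3 (fun y => bump r x y * psi y * U y).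
Proof.
move=> r0 cp; apply: (@int3_mulU _ (r + enorm x)).
  have [c0 _ _] := C2f_continuous cp.
  by move=> y; apply: continuousM; [exact: bump_continuous|exact: c0].
by move=> y /(bump_far r0) ->; rewrite mul0r.
Qed.

Lemma int3_reg r psi x T : 0 < r -> C2f psi -> (forall y, T <= enorm y -> psi y = 0) ->
  int3 (fun y => reg_kernel r psi x y * U y).
Proof.
move=> r0 cp pT; apply: eq_int3 (int3D (int3_pot r x cp pT) (int3_mean x r0 cp)) => y.
by rewrite -mulrDl.
Qed.

Lemma regE r psi x T : 0 < r -> C2f psi -> (forall y, T <= enorm y -> psi y = 0) ->
  reg r psi x = pot r psi x + mean r psi x.
Proof.
move=> r0 cp pT; rewrite -(I3D (int3_pot r x cp pT) (int3_mean x r0 cp)).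
by apply: eq_I3 => y; rewrite -mulrDl.
Qed.

(** [newt] psi is then an admissible test function in Green's formula. Consequently [pot] depends on
    psi only through its values near the boundary of O. *)
Lemma pot_tame r psi x T : C2f psi -> (forall y, T <= enorm y -> psi y = 0) -> tame O psi -> pot r psi x = 0.
Proof.
move=> cp pT tp; have [D hl] := harmonic_D2on oO hu.
have D' := C2fM (C2f_newt r x) cp.
have := @green _ O u _ _ _ _ _ T oO D hl (D2on_setT D') (tameM _ tp).
case=> [y yT|_ E]; first by rewrite pT ?mulr0 // ltW.
by rewrite /pot -E; apply: eq_I3 => y; rewrite /ext0; case: ifP => _; rewrite ?mulr0 // mulrC.
Qed.

Lemma pot_kernelB r psi psi' x y : C2f psi -> C2f psi' ->
  pot_kernel r (fun z => psi z - psi' z) x y = pot_kernel r psi x y - pot_kernel r psi' x y.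
Proof.
move=> cp cp'; have D := C2fM (C2f_newt r x) cp; have D' := C2fM (C2f_newt r x) cp'.
rewrite /pot_kernel (_ : (fun z => newt r x z * (psi z - psi' z)) =
  (fun z => newt r x z * psi z - newt r x z * psi' z)); last by apply/funext => z; rewrite mulrBr.
by rewrite (D2on_laplacian y (D2onB D D')); exact: lapB.
Qed.

Lemma potB r psi psi' x T : C2f psi -> (forall y, T <= enorm y -> psi y = 0) ->
  C2f psi' -> (forall y, T <= enorm y -> psi' y = 0) ->
  pot r (fun z => psi z - psi' z) x = pot r psi x - pot r psi' x.
Proof.
move=> cp pT cp' pT'; rewrite -(I3B (int3_pot r x cp pT) (int3_pot r x cp' pT')).
by apply: eq_I3 => y; rewrite pot_kernelB // mulrBl.
Qed.

Lemma pot_sum r n (f : nat -> E3 R -> R) x T : (forall k, C2f (f k)) ->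
  (forall k y, T <= enorm y -> f k y = 0) ->
  pot r (fun z => \sum_(k < n) f k z) x = \sum_(k < n) pot r (f k) x.
Proof.
move=> cf fT; elim: n => [|n IH].
  rewrite big_ord0 (@pot_tame _ _ _ 0) //; first by apply: (C2f_sum 0 cf).
    by move=> y _; rewrite big_ord0.
  by move=> y _; exists 1 => // z _ _; rewrite big_ord0.
have ST y : T <= enorm y -> \sum_(k < n) f k y = 0.
  by move=> yT; rewrite big1 // => k _; exact: fT.
have cS' := C2f_sum n.+1 cf; have ST' y : T <= enorm y -> \sum_(k < n.+1) f k y = 0.
  by move=> yT; rewrite big1 // => k _; exact: fT.
have := potB r x cS' ST' (cf n) (fT n).
rewrite (_ : (fun z => _ - _) = (fun z => \sum_(k < n) f k z)); last first.
  by apply/funext => z; rewrite big_ord_recr /= addrK.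
by rewrite IH big_ord_recr /= => ->; rewrite subrK.
Qed.

(** Representation formula for the exterior problem. Near the boundary chi may be replaced by a
    cutoff at scale S, by [pot_tame]. For that cutoff the regular kernel is supported where S <= |y|
    <= 2 S; with the decay 1/|y| of U it contributes O(1/S), so only the average survives. *)
Lemma pot_near1 r chi x T C r0 : 0 < r -> C2f chi -> (forall y, T <= enorm y -> chi y = 0) ->
  tame O (fun y => chi y - 1) -> (forall y, ~ O y -> enorm y < T) ->
  (forall y, r0 <= enorm y -> `|U y| <= C / enorm y) ->
  pot r chi x = - mean r (fun=> 1) x.
Proof.
move=> r_gt0 cc cT tc OT dec.
have [Cn Cn0 Hn] := @newt_bound R; have [Cc Cc0 Hc] := @cut_bound R.
apply/eqP; rewrite -subr_eq0 opprK -normr_eq0; apply/eqP/le_anti; rewrite normr_ge0 andbT.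
apply/ler_addgt0Pr => e e0; rewrite add0r.
(* Here 26 = 2 + 3 * 2 * 4: the value of the kernel times the Laplacian of the cutoff, and three
   products of gradients. The integrand has size S^(-4) on a cube of volume 8 (3 S)^3. *)
have [K K0 KE] : exists2 K : R, 0 <= K & forall S : R, S != 0 -> K / S = 26 * Cn * Cc * `|C| / S ^+ 4 * (8 * (3 * S) ^+ 3).
  exists ((26 * Cn * Cc * `|C|) * 8 * 3 ^+ 3); first by rewrite !mulr_ge0 // ltW.
  by move=> S S0; field.
have [S [S0 ST Sr0 Sx [Srx KS]]] : exists S : R, [/\ 0 < S, T + 1 <= S, r0 <= S, 2 * enorm x <= S & r + enorm x <= S /\ K / S <= e].
  have Ke : 0 <= K / e by rewrite divr_ge0 // ltW.
  have := enorm_ge0 x; have := ler_norm T; have := normr_ge0 T; have := ler_norm r0; have := normr_ge0 r0 => a1 a2 a3 a4 a5.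
  have S0 : 0 < `|T| + `|r0| + 2 * enorm x + r + 1 + K / e by lra.
  exists (`|T| + `|r0| + 2 * enorm x + r + 1 + K / e); split; [lra..|split; [lra|]].
  rewrite ler_pdivrMr // mulrC -ler_pdivrMr //; lra.
have cS := C2f_cut S (0 : E3 R).
have cS0 y : 2 * S <= enorm y -> cut S 0 y = 0 by move=> h; apply: cut_out => //; rewrite subr0.
have cS1 y : enorm y <= S -> cut S 0 y = 1 by move=> h; apply: cut_in => //; rewrite subr0.
have c0 y : 2 * S <= enorm y -> chi y = 0 by move=> h; apply: cT; lra.
have tS : tame O (fun y => chi y - cut S 0 y).
  move=> z nz; have [d d0 hd] := tc z nz; have zT := OT z nz.
  exists (Num.min d 1); first by rewrite lt_min d0 ltr01.
  move=> y; rewrite lt_min => /andP[yd y1] Oy; have := hd y yd Oy => <-; congr (_ - _).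
  by rewrite cS1 //; have := enormDB y z 0; rewrite !subr0; lra.
have E1 : pot r chi x = pot r (cut S 0) x.
  apply: subr0_eq; rewrite -(potB r x cc c0 cS cS0); apply: (@pot_tame r _ x (2 * S) (C2fB cc cS) _ tS).
  by move=> y h; rewrite (c0 y h) (cS0 y h) subrr.
have E2 : mean r (fun=> 1) x = mean r (cut S 0) x.
  apply: eq_I3 => y; have [yS|Sy] := leP (enorm y) S; first by rewrite cS1.
  have -> : bump r x y = 0 by apply: (bump_far r_gt0); exact: le_lt_trans Srx Sy.
  by rewrite !mul0r.
rewrite E1 E2 -(regE x r_gt0 cS cS0).
have small y : enorm y < S -> reg_kernel r (cut S 0) x y = 0.
  move=> yS; rewrite (reg_kernelE x y r_gt0 cS).
  have [|z zy|p0 l0] := @C2f_locally_cst _ _ y (S - enorm y) 1 cS; first by rewrite subr_gt0.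
    apply: cS1; apply: ltW; have h := enormDB z y 0; rewrite (subr0 z) (subr0 y) in h.
    by apply: (le_lt_trans h); rewrite -ltrBrDr.
  rewrite l0 (mulr0 (newt r x y)) big1 => [|i _]; first exact: addr0.
  by rewrite p0 (mulr0 (newt1 r x i y)) mulr0.
apply: le_trans KS; rewrite (KE S (lt0r_neq0 S0)).
apply: (@I3_bounded _ _ 0); [by rewrite mulr_gt0|exact: int3_reg r_gt0 cS cS0|move=> y _|move=> y yb]; last first.
  have yS : 3 * S <= enorm y.
    by rewrite leNgt; apply/negP => h; apply: yb; apply: eball_sub_box; rewrite /eball /= subr0.
  have y2 : 2 * S < enorm y by apply: lt_le_trans yS; move: S0; clear => S0; rewrite ltr_pM2r // ltr_nat.
  by rewrite /reg_kernel (pot_kernel_out r x cS cS0 y2) (cS0 y (ltW y2)) (mulr0 (bump r x y)) addr0 mul0r.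
have M0 : 0 <= 26 * Cn * Cc * `|C| / S ^+ 4.
  by move: Cn0 Cc0 S0; clear => Cn0 Cc0 S0; rewrite !mulr_ge0 ?invr_ge0 ?exprn_ge0 // ltW.
have [yS|Sy] := ltP (enorm y) S; first by rewrite (small y yS) mul0r normr0.
rewrite (normrM (reg_kernel r (cut S 0) x y)) (reg_kernelE x y r_gt0 cS).
have yx : S / 2 <= r + enorm (y - x).
  have h := enormDB y x 0; rewrite (subr0 y) (subr0 x) in h.
  move: Sy h Sx r_gt0; clear; move: (enorm _) (enorm _) (enorm _) => a b c; lra.
have [n0 n1] := Hn r x y r_gt0; have [c1 c2] := Hc S 0 y S0.
have dec1 := dec y (le_trans Sr0 Sy).
move: Cn0 Cc0 S0 Sy M0 yx n0 n1 c1 c2 dec1; clear => Cn0 Cc0 S0 Sy M0 yx n0 n1 c1 c2 dec1.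
have S2 : 0 < S / 2 by rewrite divr_gt0.
have s2 := lt_le_trans S2 yx.
have n0' : `|newt r x y| <= 2 * Cn / S.
  apply: (le_trans n0); rewrite (_ : 2 * Cn / S = Cn / (S / 2)); last by field; exact: lt0r_neq0.
  by rewrite ler_pM2l // lef_pV2 ?posrE.
have n1' i : `|newt1 r x i y| <= 4 * Cn / S ^+ 2.
  apply: (le_trans (n1 i)); rewrite (_ : 4 * Cn / S ^+ 2 = Cn / (S / 2) ^+ 2); last by field; exact: lt0r_neq0.
  by rewrite ler_pM2l // lef_pV2 ?posrE ?exprn_gt0 // lerXn2r ?nnegrE ?(ltW S2) ?(ltW s2).
have uS : `|U y| <= `|C| / S.
  have y0 := lt_le_trans S0 Sy; apply: (le_trans dec1).
  apply: (@le_trans _ _ (`|C| / enorm y)); first by rewrite ler_pM2r ?invr_gt0 // ler_norm.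
  by rewrite ler_wpM2l // lef_pV2 ?posrE.
rewrite (_ : 26 * Cn * Cc * `|C| / S ^+ 4 = (2 * Cn / S * (Cc / S ^+ 2) + 3 * (2 * (4 * Cn / S ^+ 2 * (Cc / S)))) * (`|C| / S)); last first.
  by field; exact: lt0r_neq0.
apply: ler_pM; [exact: normr_ge0|exact: normr_ge0| |exact: uS].
apply: (le_trans (ler_normD _ _)); apply: lerD.
  by rewrite (normrM (newt r x y)); apply: ler_pM; [exact: normr_ge0|exact: normr_ge0|exact: n0'|exact: c2].
apply: (le_trans (ler_norm_sum _ _ _)).
have t i : `|2 * (newt1 r x i y * partial i (cut S 0) y)| <= 2 * (4 * Cn / S ^+ 2 * (Cc / S)).
  rewrite (normrM 2) (ger0_norm (ler0n _ 2)); apply: ler_wpM2l; first exact: ler0n.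
  by rewrite (normrM (newt1 r x i y)); apply: ler_pM; [exact: normr_ge0|exact: normr_ge0|exact: n1'|exact: c1].
apply: (le_trans (ler_sum _ (fun i _ => t i))); rewrite sumr_const card_ord.
by apply: le_of_eq; ring.
Qed.

(** The radius absorbs the shift: |x-y| <= (1+k) (r + |y-x'|). Hence the kernel at any x' within k r
    of x is dominated by the same multiple of |x-y|^(-2). *)
Lemma reg_kernel_dominated psi T k : C2f psi -> 0 < T -> (forall y, T <= enorm y -> psi y = 0) -> 0 <= k ->
  exists2 C : R, 0 < C & forall r x' x y, 0 < r -> enorm (x' - x) <= k * r -> enorm x <= T -> y <> x ->
    `|reg_kernel r psi x' y * U y| <= C * (`|\1_(eball 0 (T + 1)) y * U y| * wt 2 (enorm (x - y))).
Proof.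
move=> cp T0 pT k0; have [C C0 HC] := reg_kernel_bound cp T0 pT.
have k1 : 0 < 1 + k by rewrite ltr_pwDl.
exists (C * ((1 + k) * (2 * T) + (1 + k) ^+ 2)); first by rewrite mulr_gt0 // addr_gt0 ?exprn_gt0 // !mulr_gt0.
move=> r x' x y r0 x'x xT yx.
have xy0 : 0 < enorm (x - y).
  by rewrite lt_neqAle enorm_ge0 andbT eq_sym; apply/eqP => /enorm_eq0 /subr0_eq E; apply: yx.
have [yT|Ty] := leP (enorm y) T; last first.
  rewrite /reg_kernel (pot_kernel_out r x' cp pT Ty) (pT y (ltW Ty)) (mulr0 (bump r x' y)) addr0 mul0r normr0.
  rewrite mulr_ge0 ?mulr_ge0 ?addr_ge0 ?wt_ge0 ?exprn_ge0 ?mulr_ge0 //; exact: ltW.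
rewrite normrM indicE mem_set ?mul1r; last by rewrite /eball /= subr0; lra.
rewrite (mulrC `|U y|) mulrA ler_wpM2r //; apply: (le_trans (HC r x' y r0)).
rewrite wt2E // -mulrA ler_pM2l //.
have d : enorm (x - y) <= (1 + k) * (r + enorm (y - x')).
  have h := enormDB x x' y; rewrite (enormB x x') (enormB x' y) in h.
  move: (enorm_ge0 (y - x')) h x'x; move: (enorm _) (enorm _) (enorm _) => a b c; nra.
have s0 : 0 < r + enorm (y - x') by rewrite ltr_pwDl.
have b1 : (r + enorm (y - x'))^-1 <= (1 + k) * (enorm (x - y))^-1.
  by rewrite ler_pdivlMr // mulrC ler_pdivrMr.
have b2 : (r + enorm (y - x')) ^- 2 <= (1 + k) ^+ 2 * (enorm (x - y) ^+ 2)^-1.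
  rewrite -exprVn -[X in _ <= _ * X]exprVn -exprMn lerXn2r ?nnegrE ?invr_ge0 ?mulr_ge0 ?invr_ge0 //; exact: ltW.
rewrite mulrDl; apply: lerD => //; apply: (le_trans b1); rewrite -mulrA ler_pM2l //.
rewrite expr2 invfM mulrA ler_peMl ?invr_ge0 //.
rewrite ler_pdivlMr // mul1r; have := enormDB x 0 y; rewrite subr0 (enormB 0 y) subr0.
lra.
Qed.

Lemma closed_point x : closed [set x].
Proof. by apply: accessible_closed_set1; apply: hausdorff_accessible; exact: norm_hausdorff. Qed.

Lemma negligible_point x : (leb3 R).-negligible [set x : M3 R].
Proof.
have m1 : measurable [set x : M3 R].
  by apply: closed_measurable3; exact: closed_point.
exists [set x : M3 R]; split=> //.
apply/eqP; rewrite eq_le measure_ge0 andbT; apply/lee_addgt0Pr => e e0; rewrite add0e.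
have r0 : 0 < Num.min 1 (e / 8) by rewrite lt_min ltr01 divr_gt0.
apply: (@le_trans _ _ (leb3 R (box x (Num.min 1 (e / 8))))).
  apply: le_measure; rewrite ?inE //; first exact: measurable_box.
  by move=> y ->; apply: eball_sub_box; rewrite /eball /= subrr enorm0.
rewrite leb3_box // lee_fin; move: r0; set m := Num.min _ _ => m0.
have m1' : m <= 1 by rewrite ge_min lexx.
have m2 : m <= e / 8 by rewrite ge_min lexx orbT.
have : m ^+ 3 <= m by rewrite exprS ger_pMr // exprn_ile1 // ltW.
lra.
Qed.

Lemma I3_dominated (F : nat -> E3 R -> R) (G g : E3 R -> R) x :
  (forall n, int3 (F n)) -> measurable_fun setT (G : M3 R -> R) -> int3 g ->
  (forall y, y <> x -> F n y @[n --> \oo] --> G y) ->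
  (forall n y, y <> x -> `|F n y| <= g y) -> I3 (F n) @[n --> \oo] --> I3 G.
Proof.
move=> iF mG ig FG Fg.
have N := negligible_point x.
have := @dominated_convergence _ _ _ (leb3 R) setT measurableT (fun n y => (F n y)%:E) (EFin \o G) (EFin \o g).
case=> //.
- by move=> n; exact: measurable_int (iF n).
- by apply/measurable_EFinP.
- apply: negligibleS N => y /=; apply: contra_notP => yx _.
  by apply: cvg_EFin; [exact: nearW|exact: FG].
- apply: negligibleS N => y /=; apply: contra_notP => yx n _.
  by rewrite lee_fin; exact: Fg.
move=> iG _; rewrite (I3_integral iG) => C.
exact: (fine_cvg C).
Qed.

(** Dominated convergence with the integrand of the Riesz potential at x. The limit does not depend
    on the sequence of shifted points, so shifted and unshifted regular parts differ by a null
    sequence. *)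
Lemma reg_cvg psi T k (rn : nat -> R) (xn : nat -> E3 R) x : C2f psi -> 0 < T -> (forall y, T <= enorm y -> psi y = 0) ->
  0 <= k -> (forall n, 0 < rn n) -> rn n @[n --> \oo] --> (0 : R) -> (forall n, enorm (xn n - x) <= k * rn n) -> enorm x <= T ->
  int3 (fun y => `|\1_(eball 0 (T + 1)) y * U y| * wt 2 (enorm (x - y))) ->
  reg (rn n) psi (xn n) @[n --> \oo] --> I3 (fun y => far_kernel psi x y * U y).
Proof.
move=> cp T0 pT k0 rn0 cr xnx xT ig; have [C C0 HC] := reg_kernel_dominated cp T0 pT k0.
have cx : xn n @[n --> \oo] --> x.
  apply/cvgrPdist_lt => e e0.
  have e1 : 0 < e / (k + 1) by rewrite divr_gt0 // ltr_wpDl.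
  near=> n; apply: (le_lt_trans (norm_le_enorm _)); rewrite enormB; apply: (le_lt_trans (xnx n)).
  have : `|rn n - 0| < e / (k + 1) by near: n; move/cvgrPdist_lt: cr => /(_ _ e1); apply: filterS => n; rewrite distrC.
  rewrite subr0 ltr_pdivlMr ?ltr_wpDl // gtr0_norm // => h; have := rn0 n; nra.
have lim y : y <> x -> reg_kernel (rn n) psi (xn n) y * U y @[n --> \oo] --> far_kernel psi x y * U y.
  move=> yx; apply: cvgM; last exact: cvg_cst.
  have := far_kernel_cvg (psi := psi) cx yx; apply: cvg_trans; apply: near_eq_cvg.
  have yx0 : 0 < enorm (y - x) by apply: enorm_gt0; rewrite subr_eq0; apply/eqP.
  have e1 : 0 < enorm (y - x) / (k + 1) by rewrite divr_gt0 // ltr_wpDl.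
  near=> n; apply/esym/reg_kernel_far => //.
  have : `|rn n - 0| < enorm (y - x) / (k + 1) by near: n; move/cvgrPdist_lt: cr => /(_ _ e1); apply: filterS => n; rewrite distrC.
  rewrite subr0 ltr_pdivlMr ?ltr_wpDl // gtr0_norm // => h; have := rn0 n.
  have := enormDB y (xn n) x; have := xnx n; move: (enorm _) (enorm _) (enorm _) h; move=> a b c; nra.
apply: (@I3_dominated _ _ (fun y => C * (`|\1_(eball 0 (T + 1)) y * U y| * wt 2 (enorm (x - y)))) x).
- by move=> n; exact: int3_reg (rn0 n) cp pT.
(* Measurability of the limit needs convergence at every y. Multiplying by the indicator of the
   complement of x is harmless, since [far_kernel] is 0 on the diagonal. *)
- have E y : \1_(~` [set x]) y * (far_kernel psi x y * U y) = far_kernel psi x y * U y.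
    rewrite indicE; have [->|yx] := pselect (y = x); last by rewrite mem_set ?mul1r.
    by rewrite memNset ?mul0r //= far_kernel_diag mul0r.
  rewrite -(_ : (fun y => \1_(~` [set x]) y * (far_kernel psi x y * U y)) = (fun y => far_kernel psi x y * U y)); last by apply/funext.
  apply: (@measurable_fun_cvg _ _ _ _ (fun n y => \1_(~` [set x]) y * (reg_kernel (rn n) psi (xn n) y * U y))).
    move=> n; apply: measurable_funM; last exact: int3_measurable (int3_reg (xn n) (rn0 n) cp pT).
    by apply: measurable_indic; apply: open_measurable3; apply: closed_openC; exact: closed_point.
  move=> y _; rewrite indicE; have [->|yx] := pselect (y = x).
    by rewrite memNset //= mul0r; under eq_fun do rewrite mul0r; exact: cvg_cst.
  by rewrite mem_set // mul1r; under eq_fun do rewrite mul1r; exact: lim.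
- exact: int3Z.
- exact: lim.
- by move=> n y yx; apply: HC.
Unshelve. all: by end_near.
Qed.

End localised_potentials.

Section partition.
Context {R : realType} (p : nat -> E3 R) (rho : R).
Hypothesis rho0 : 0 < rho.
Implicit Types (x y z : E3 R).

#[local] Opaque cut.

Definition near_sum n y : R := 1 - \prod_(k < n) (1 - cut rho (p k) y).
(** The usual telescoping construction: the first n pieces sum to [near_sum], which is 1 wherever
    one of the cutoffs is 1. *)
Definition part k y : R := cut rho (p k) y * \prod_(i < k) (1 - cut rho (p i) y).

Lemma cutC_itv q y : 0 <= 1 - cut rho q y <= 1.
Proof. by have /andP[h0 h1] := cut_itv rho q y; rewrite subr_ge0 h1 gerBl h0. Qed.

Lemma cutC_prod_itv n y : 0 <= \prod_(k < n) (1 - cut rho (p k) y) <= 1.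
Proof.
rewrite prodr_ge0 => [|k _]; last by have /andP[] := cutC_itv (p k) y.
by rewrite prodr_ile1 // => k _; exact: cutC_itv.
Qed.

Lemma part_sum n y : \sum_(k < n) part k y = near_sum n y.
Proof.
rewrite /near_sum; elim: n => [|n IH]; first by rewrite !big_ord0 subrr.
rewrite !big_ord_recr /= IH /part; ring.
Qed.

Lemma C2f_cutC q : C2f (fun y => 1 - cut rho q y). Proof. exact: C2fB (C2f_cst 1) (C2f_cut rho q). Qed.

Lemma C2f_part k : C2f (part k).
Proof. exact: C2fM (C2f_cut rho (p k)) (C2f_prod k (fun i => C2f_cutC (p i))). Qed.

Lemma C2f_near_sum n : C2f (near_sum n).
Proof. exact: C2fB (C2f_cst 1) (C2f_prod n (fun i => C2f_cutC (p i))). Qed.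

Lemma part_itv k y : 0 <= part k y <= 1.
Proof.
have /andP[a b] := cut_itv rho (p k) y; have /andP[c d] := cutC_prod_itv k y.
by rewrite /part mulr_ge0 //= mulr_ile1.
Qed.

Lemma near_sum_itv n y : 0 <= near_sum n y <= 1.
Proof. by have /andP[c d] := cutC_prod_itv n y; rewrite /near_sum subr_ge0 d gerBl c. Qed.

Lemma part_out k y : 2 * rho <= enorm (y - p k) -> part k y = 0.
Proof. by move=> h; rewrite /part (cut_out rho0 h) mul0r. Qed.

Lemma near_sum_in n k y : (k < n)%N -> enorm (y - p k) <= rho -> near_sum n y = 1.
Proof.
move=> kn h; rewrite /near_sum (bigD1 (Ordinal kn)) //= (cut_in rho0 h) subrr mul0r.
exact: subr0.
Qed.

Lemma near_sum_out n y : (forall k, (k < n)%N -> 2 * rho <= enorm (y - p k)) -> near_sum n y = 0.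
Proof.
move=> H; rewrite /near_sum big1 ?subrr // => k _.
by rewrite (cut_out rho0 (H k (ltn_ord k))) subr0.
Qed.

End partition.

(** * Translated potentials are limits of multipole sums *)

Section potential_closure.
Context {R : realType} (D : set (E3 R)) (oD : open D) (cD : connected D) (bD : bounded_set D) (D0 : D 0).
Context (Y : forall l : nat, 'I_(l.*2.+1) -> E3 R -> R[i]) (YP : orthonormal_spherical_harmonics Y).
Context (u : E3 R -> R) (hu : harmonic_on (exterior D) u).
Local Notation U := (ext0 (exterior D) u).
Hypothesis iU : forall T : R, int3 (fun y => \1_(eball 0 T) y * U y).
Implicit Types (x y z h : E3 R) (psi : E3 R -> R) (r T : R).
Local Notation pot := (@pot R (exterior D) u).
Local Notation mean := (@mean R (exterior D) u).
Local Notation reg := (@reg R (exterior D) u).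

#[local] Opaque newt newt1 newt2 bump cut.

Lemma tame_exterior psi :
  (forall q, bdry D q -> exists2 d : R, 0 < d & forall y, enorm (y - q) < d -> psi y = 0) -> tame (exterior D) psi.
Proof.
move=> H z nz; have [Dz|nDz] := pselect (D z).
  have [d d0 hd] := proj1 (openE3 _) oD _ Dz.
  by exists d => // y /hd Dy /(exterior_notD oD).
have Sz : bdry D z by case: (proj1 (notDE oD z) nDz).
by have [d d0 hd] := H z Sz; exists d => // y yd _; exact: hd.
Qed.

(** The density is carried by K, whose points are at distance at least r from every x - h. There the
    kernels are not regularised and the average vanishes, so the potential consists of Newton and
    dipole kernels with poles y + h in D. *)
Lemma pot_mclosure_thin psi T K h r : 0 < r -> C2f psi -> (forall y, T <= enorm y -> psi y = 0) ->
  compact K -> (forall y, K y -> D (y + h)) ->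
  (forall y, exterior D y -> ~ K y -> exists2 d : R, 0 < d & forall z, enorm (z - y) < d -> psi z = 0) ->
  (forall x y, ~ D x -> K y -> r <= enorm (y - (x - h))) ->
  mclosure Y D (fun x => pot r psi (x - h)).
Proof.
move=> r0 cp pT cK KD pK Kfar.
have Kz y : ~ K y -> [/\ psi y * U y = 0, forall i, partial i psi y * U y = 0 & laplacian psi y * U y = 0].
  move=> nK; have [ey|ney] := pselect (exterior D y); last by rewrite /ext0 memNset // !mulr0; split=> // i; rewrite mulr0.
  have [d d0 hd] := pK y ey nK; have [z1 z2] := C2f_locally_cst cp d0 hd.
  by rewrite hd ?subrr ?enorm0 // z2 !mul0r; split=> // i; rewrite z1 mul0r.
have [c0 c1 c2] := C2f_continuous cp.
have p0 y : T + 1 < enorm y -> (forall i, partial i psi y = 0) /\ laplacian psi y = 0.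
  move=> yT; apply: (@C2f_locally_cst _ psi y 1 0 cp ltr01) => z zy; apply: pT.
  by have := enormDB y z 0; rewrite !subr0 (enormB y z); lra.
have iL : int3 (fun y => laplacian psi y * U y).
  by apply: (@int3_mulU _ _ _ iU _ (T + 1) c2) => y yT; exact: (p0 y yT).2.
have iP i : int3 (fun y => partial i psi y * U y).
  by apply: (@int3_mulU _ _ _ iU _ (T + 1) (c1 i)) => y yT; exact: (p0 y yT).1.
have cn x : continuous (newt r x) by have [] := C2f_continuous (C2f_newt r x).
have cn1 i x : continuous (newt1 r x i) by have [_ _ _ d _] := newt_D2on setT r x => y; exact: d.
have vec x y : x - (y + h) = - (y - (x - h)) by rewrite opprB addrAC opprD addrA.
have kN x y : ~ D x -> K y -> newt r (x - h) y = (enorm (x - (y + h)))^-1.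
  by move=> nx Ky; rewrite (newt_far r0 (Kfar x y nx Ky)) vec enormN.
have kD i x y : ~ D x -> K y -> newt1 r (x - h) i y = dipole i (x - (y + h)).
  move=> nx Ky; rewrite (newt1_far i r0 (Kfar x y nx Ky)) /dipole vec enormN.
  by rewrite /co dotNl mulNr.
have eN x : ~ D x -> (fun y => laplacian psi y * U y * (enorm (x - (y + h)))^-1) =1 (fun y => newt r (x - h) y * laplacian psi y * U y).
  move=> nx y; rewrite [RHS]mulrAC; have [Ky|nK] := pselect (K y); first by rewrite -kN // [LHS]mulrC mulrA mulrAC.
  by have [_ _ z] := Kz y nK; rewrite z mul0r mulrAC -mulrA z mulr0.
have eD i x : ~ D x -> (fun y => partial i psi y * U y * dipole i (x - (y + h))) =1 (fun y => newt1 r (x - h) i y * partial i psi y * U y).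
  move=> nx y; have [Ky|nK] := pselect (K y); first by rewrite -kD // [LHS]mulrC mulrA.
  by have [_ z _] := Kz y nK; rewrite z mul0r -mulrA z mulr0.
have iN x : int3 (fun y => newt r (x - h) y * laplacian psi y * U y).
  apply: (@int3_mulU _ _ _ iU _ (T + 1)) => [y|y yT]; first by apply: continuousM; [exact: cn|exact: c2].
  by rewrite (p0 y yT).2 mulr0.
have iD i x : int3 (fun y => newt1 r (x - h) i y * partial i psi y * U y).
  apply: (@int3_mulU _ _ _ iU _ (T + 1)) => [y|y yT]; first by apply: continuousM; [exact: cn1|exact: c1].
  by rewrite (p0 y yT).1 mulr0.
have mN : mclosure Y D (fun x => I3 (fun y => laplacian psi y * U y * (enorm (x - (y + h)))^-1)).
  apply: (mclosure_newton_potential YP oD cD D0 cK KD _ iL) => [y nK|x nx]; first by have [] := Kz y nK.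
  exact: eq_int3 (fsym (eN x nx)) (iN x).
have mD i : mclosure Y D (fun x => I3 (fun y => partial i psi y * U y * dipole i (x - (y + h)))).
  apply: (mclosure_dipole_potential YP oD cD D0 cK KD _ (iP i)) => [y nK|x nx]; first by have [] := Kz y nK.
  exact: eq_int3 (fsym (eD i x nx)) (iD i x).
have mS := mclosure_sum (index_enum 'I_3) mD.
apply: mclosure_ext (mclosureDZ 2 mN mS) => x nx.
rewrite (eq_I3 (eN x nx)).
have -> : pot r psi (x - h) = reg r psi (x - h).
  have mz : mean r psi (x - h) = 0; last by rewrite (regE iU (x - h) r0 cp pT) mz addr0.
  rewrite -[RHS](@I3_0 R); apply: eq_I3 => y.
  have [Ky|nK] := pselect (K y); last by have [z _ _] := Kz y nK; rewrite -mulrA z mulr0.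
  by rewrite (bump_out r0 (Kfar x y nx Ky)) !mul0r.
have -> : \sum_(i < 3) I3 (fun y => partial i psi y * U y * dipole i (x - (y + h))) =
    I3 (fun y => \sum_(i < 3) newt1 r (x - h) i y * partial i psi y * U y).
  rewrite I3_sum => [|i _]; last exact: iD.
  by apply: eq_bigr => i _; apply: eq_I3; exact: eD.
rewrite -I3Z -?I3D; [|exact: iN|by apply: int3Z; apply: int3_sum => i _; exact: iD|by apply: int3_sum => i _; exact: iD].
apply: eq_I3 => y; rewrite (reg_kernelE (x - h) y r0 cp) [RHS]mulrDl; congr (_ + _).
by rewrite mulr_sumr mulr_suml; apply: eq_bigr => i _; rewrite !mulrA.
Qed.

(* The densities are first multiplied by a cutoff equal to 1 near the
   boundary; Green's formula makes this harmless, and the translated layer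
   then lies inside the domain. *)
Lemma pot_mclosure psi p e c rho w t : C2f psi -> (forall y, 2 * rho <= enorm (y - p) -> psi y = 0) -> 0 < rho ->
  0 < c <= 1 -> enorm e = 1 -> cone D c w e p -> 0 < t -> 2 * rho + t <= w ->
  mclosure Y D (fun x => pot (c * t / 2) psi (x - t *: e)).
Proof.
move=> cp pout rho0 /andP[c0 c1] e1 hc t0 tw.
have ct : 0 < c * t by rewrite mulr_gt0.
have ctt : c * t <= t by rewrite ler_piMl // ltW.
have d0 : 0 < c * t / 16 by rewrite divr_gt0.
have [s [sS sc]] := @compact_eball_cover R (bdry D) (fun=> c * t / 16) (compact_bdry oD bD) (fun _ _ => d0).
pose ka := near_sum (nth 0 s) (c * t / 16) (size s).
have cka : C2f ka by exact: C2f_near_sum.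
have ka1 q : bdry D q -> exists2 d : R, 0 < d & forall y, enorm (y - q) < d -> ka y = 1.
  move=> Sq; have [b bs qb] := sc _ Sq; exists (c * t / 16 - enorm (q - b)); first by rewrite subr_gt0.
  move=> y yq; apply: (near_sum_in d0 (k := index b s)); rewrite ?index_mem // nth_index //.
  by apply: ltW; have := enormDB y q b; lra.
have ka0 y : (forall q, bdry D q -> c * t / 8 <= enorm (y - q)) -> ka y = 0.
  move=> H; apply: (near_sum_out d0) => k kn.
  by rewrite (_ : 2 * (c * t / 16) = c * t / 8); [apply: H; apply: sS; exact: mem_nth|field].
have cpk : C2f (fun y => psi y * ka y) by exact: C2fM.
pose T := enorm p + 2 * rho.
have pT y : T <= enorm y -> psi y = 0.
  by move=> yT; apply: pout; have := enormDB y p 0; rewrite !subr0; rewrite /T in yT; lra.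
have pkT y : T <= enorm y -> psi y * ka y = 0 by move=> /pT ->; rewrite mul0r.
have E x : pot (c * t / 2) psi (x - t *: e) = pot (c * t / 2) (fun y => psi y * ka y) (x - t *: e).
  apply: subr0_eq; rewrite -(potB iU _ _ cp pT cpk pkT).
  apply: (@pot_tame _ _ (@open_exterior R D) _ hu _ _ _ T (C2fB cp cpk)) => [y yT|].
    by rewrite (pT y yT) mul0r subrr.
  apply: tame_exterior => q /ka1[d d0' hd]; exists d => // y /hd ->.
  by rewrite mulr1 subrr.
(* Points of this layer are within c t / 4 of some q in S, and the ball of radius c t about q + t e
   lies in D. So y + t e is in D; and for x outside D the point x - t e is at distance at least c t
   from q, hence more than c t / 2 from y. *)
pose K := [set y | [/\ enorm (y - p) <= 2 * rho, ~ D y & dist y (bdry D) <= c * t / 8]].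
have near y : K y -> exists q, [/\ bdry D q, enorm (y - q) < c * t / 4 & enorm (q - p) < w].
  move=> [yp _ yd]; have e0 : 0 < c * t / 8 by rewrite divr_gt0.
  have [q Sq yq] := dist_approx oD bD D0 y e0; exists q.
  have yq' : enorm (y - q) < c * t / 4 by lra.
  by split=> //; have := enormDB q y p; rewrite (enormB q y); lra.
apply: mclosure_ext (fun x _ => esym (E x)) _.
apply: (@pot_mclosure_thin _ T K) => //; first by rewrite divr_gt0.
- rewrite (_ : K = [set y | enorm (y - p) <= 2 * rho] `&` (~` D `&` [set y | dist y (bdry D) <= c * t / 8])); last first.
    by apply/seteqP; split=> y /= [a]; [move=> b d|case=> b d].
  apply: compact_closedI; first exact: compact_cball.
  apply: closedI; first by apply: open_closedC.
  apply: (@closed_comp _ _ (fun y => dist y (bdry D)) [set z : R | z <= c * t / 8]) => [y _|]; last exact: closed_le.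
  exact: continuous_dist.
- move=> y /near[q [Sq yq qp]]; have t3 : t < w by lra.
  have [_ h] := hc q t qp t0 t3; apply: (h Sq).
  by rewrite (_ : _ - _ = y - q); [lra|rewrite opprD addrACA subrr addr0].
- move=> y ey nK; have [yp|py] := leP (enorm (y - p)) (2 * rho); last first.
    exists (enorm (y - p) - 2 * rho); first by rewrite subr_gt0.
    move=> z zy; rewrite pout ?mul0r //; have := enormDB y z p; rewrite (enormB y z); lra.
  have yd : c * t / 8 < dist y (bdry D).
    by rewrite ltNge; apply/negP => h; apply: nK; split=> //; exact: exterior_notD.
  exists (dist y (bdry D) - c * t / 8); first by rewrite subr_gt0.
  move=> z zy; rewrite ka0 ?mulr0 // => q Sq.
  have := dist_le oD bD D0 z Sq; have := dist_lip oD bD D0 y z; rewrite (enormB y z); lra.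
- move=> x y nx /near[q [Sq yq qp]]; have t3 : t < w by lra.
  have [_ h] := hc q t qp t0 t3; rewrite leNgt; apply/negP => yx; apply: nx; apply: (h Sq).
  rewrite (_ : x - (q + t *: e) = (x - t *: e) - q); last by rewrite opprD addrA addrAC.
  have := enormDB (x - t *: e) y q; rewrite (enormB (x - t *: e) y); lra.
Qed.

End potential_closure.

(** * Square integrability of u up to the boundary from its nontangential maximal function *)

Section nontangential_estimates.
Context {R : realType} (D : set (E3 R)) (oD : open D) (bD : bounded_set D) (D0 : D 0).
Context (mu : sfin3 R) (K M : R) (K0 : 0 <= K).
Hypothesis mu_ball : forall (y : E3 R) (s : R), 0 < s -> (mu (eball y s) <= (K * s ^+ 2)%:E)%E.
Hypothesis mu_fin : (mu setT <= M%:E)%E.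
Hypothesis mu_lower : forall T : R, 0 < T -> exists2 k : R, 0 < k & forall (q : E3 R) (s : R),
  bdry D q -> 0 < s -> s <= T -> ((k * s ^+ 2)%:E <= mu (bdry D `&` eball q s))%E.
Context (u : E3 R -> R) (hu : harmonic_on (exterior D) u).
Context (N : E3 R -> \bar R) (mN : measurable_fun setT (N : M3 R -> \bar R)) (N0 : forall q, (0%R <= N q)%E).
Hypothesis N2 : (\int[mu]_q (N q * N q) < +oo)%E.
Context (alpha : R) (a2 : 2 < alpha).
Hypothesis uN : forall q x, bdry D q -> nt_region D alpha q x -> (`|u x|%:E <= N q)%E.
Implicit Types (x y z q : E3 R) (T : R).
Local Notation U := (ext0 (exterior D) u).
Local Notation Q := (cone_average D mu N).

Lemma cone_average_ge T : 0 < T -> exists2 k : R, 0 < k & forall x (b : R), exterior D x -> enorm x < T -> 0 <= b ->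
  (forall q, bdry D q -> enorm (x - q) < 3 * dist x (bdry D) -> (b%:E <= N q)%E) -> ((k * b ^+ 2)%:E <= Q T x)%E.
Proof.
move=> T0; have d0 := dist_ge0 oD bD D0 0.
have [k k0 Hk] := mu_lower (ltr_wpDr d0 T0).
exists k => // x b ex xT b0 H; apply: (cone_average_lower oD bD D0 N0 k0 Hk ex xT _ b0 H).
by have := dist_lip oD bD D0 x 0; rewrite subr0; lra.
Qed.

(** Every boundary point within 3 delta(x) of x has x in its nontangential region, because 1 + alpha
    > 3; so the maximal function at all these points is at least |u x|. *)
Lemma sqr_cone_average T : 0 < T -> exists2 k : R, 0 < k & forall x, exterior D x -> enorm x < T ->
  ((k * u x ^+ 2)%:E <= Q T x)%E.
Proof.
move=> T0; have [k k0 Hk] := cone_average_ge T0; exists k => // x ex xT.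
rewrite -[u x ^+ 2]real_normK ?num_real //; apply: Hk => // q Sq xq; apply: (uN Sq); split=> //.
apply: (lt_le_trans xq); apply: ler_wpM2r; first exact: dist_ge0.
by rewrite -lerBlDl (le_trans _ (ltW a2)) // lerBlDl -natr1 addrC.
Qed.

Lemma measurable_ext0 : measurable_fun setT (U : M3 R -> R).
Proof.
have oE := @open_exterior R D; have [[c1 _] _] := hu.
have : measurable_fun (exterior D : set (M3 R)) (u : M3 R -> R).
  by apply: continuous_measurable_on => //; have [_ _ c _ _] := (harmonic_D2on oE hu).1.
by move=> /(measurable_restrictT _ (open_measurable3 oE)).
Qed.

Lemma int3_sqr_ext0 T : int3 (fun y => \1_(eball 0 T) y * U y ^+ 2).
Proof.
have m : measurable_fun setT ((fun y => \1_(eball 0 T) y * U y ^+ 2) : M3 R -> R).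
  apply: measurable_funM; first by apply: measurable_indic; exact: measurable_eball.
  by apply: measurable_funX; exact: measurable_ext0.
have p y : 0 <= \1_(eball 0 T) y * U y ^+ 2 by rewrite mulr_ge0 // sqr_ge0.
apply/integrableP; split; first exact/measurable_EFinP.
have [T0|T0] := leP T 0.
  rewrite (eq_integral (cst 0%E)) ?integral0 ?ltry // => y _ /=.
  by rewrite indicE memNset ?mul0r ?normr0 // /eball /= subr0 => h; have := enorm_ge0 y; lra.
have [k k0 Hk] := sqr_cone_average T0; have [mQ Qoo] := cone_average_finite oD bD D0 mN N0 N2 T0.
have Q0 x : (0%R <= Q T x)%E.
  by apply: integral_ge0 => q _; rewrite mule_ge0 ?mule_ge0 // lee_fin cone_kernel_ge0.
apply: (@le_lt_trans _ _ (\int[leb3 R]_x ((k^-1)%:E * Q T x))%E); last first.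
  by rewrite ge0_integralZl_EFin ?lte_mul_pinfty ?lee_fin ?invr_ge0 // ltW.
apply: le_integral_nonmeas => y; first exact: abse_ge0.
rewrite /= ger0_norm // indicE; have [yT|yT] := pselect (eball 0 T y); last first.
  by rewrite memNset // mul0r mule_ge0 // lee_fin invr_ge0 ltW.
have [ey|ney] := pselect (exterior D y); last first.
  have -> : U y = 0 by rewrite /ext0 memNset.
  by rewrite expr2 !mulr0 mule_ge0 // lee_fin invr_ge0 ltW.
rewrite mem_set // mul1r ext0_in // -[X in (X%:E <= _)%E](mulKf (lt0r_neq0 k0)) EFinM lee_pmul2l ?lte_fin ?invr_gt0 //.
by apply: Hk => //; rewrite /eball /= subr0 in yT.
Qed.

Lemma int3_ext0_ball T : int3 (fun y => \1_(eball 0 T) y * U y).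
Proof.
have [T0|T0] := leP T 0.
  apply: eq_int3 (@int3_0 R) => y; rewrite indicE memNset ?mul0r // /eball /= subr0 => h.
  by have := enorm_ge0 y; lra.
apply: (@le_int3 _ _ (fun y => \1_(box 0 T) y + \1_(eball 0 T) y * U y ^+ 2)).
- apply: measurable_funM; last exact: measurable_ext0.
  by apply: measurable_indic; exact: measurable_eball.
- move=> y; rewrite indicE; have [yT|yT] := pselect (eball 0 T y); last first.
    by rewrite memNset // !mul0r normr0 addr0.
  rewrite mem_set // !mul1r indicE mem_set; last exact: eball_sub_box.
  have t1 : (true : nat)%:R = 1 :> R by [].
  rewrite t1 -[U y ^+ 2]real_normK ?num_real //; have := normr_ge0 (U y); move: `|U y| => a a0; nra.
- by apply: int3D; [exact: int3_box|exact: int3_sqr_ext0].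
Qed.

Definition riesz T x : \bar R := (\int[leb3 R]_y (`|\1_(eball 0 T) y * U y| * wt 2 (enorm (x - y)))%:E)%E.

Lemma riesz_L2 T (nu : sfin3 R) (C M' : R) : 0 < T -> 0 <= C ->
  (forall y (s : R), 0 < s -> s <= 1 -> (nu (eball y s) <= (C * s ^+ 2)%:E)%E) -> (nu setT <= M'%:E)%E ->
  measurable_fun setT (riesz T : M3 R -> \bar R) /\ (\int[nu]_x (riesz T x * riesz T x) < +oo)%E.
Proof.
move=> T0 C0 nuC nuM; apply: (riesz_potential_L2 C0 nuC nuM T0) => [|y|y yT|].
- by have := int3_measurable (int3_abs (int3_ext0_ball T)).
- exact: normr_ge0.
- by rewrite indicE memNset ?mul0r ?normr0 // /eball /= subr0; move: yT; rewrite leNgt => /negP.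
- have iI := int3_sqr_ext0 T; rewrite (eq_integral (fun y : M3 R => (\1_(eball 0 T) y * U y ^+ 2)%:E)) => [|y _].
    by rewrite (I3_integral iI) ltry.
  by congr _%:E; rewrite real_normK ?num_real // exprMn indicE; case: (_ \in _); rewrite ?expr1n ?expr0n.
Qed.

Lemma int3_riesz T x : (riesz T x < +oo)%E -> int3 (fun y => `|\1_(eball 0 T) y * U y| * wt 2 (enorm (x - y))).
Proof.
move=> h; apply/integrableP; split.
  apply/measurable_EFinP; apply: measurable_funM; first exact: int3_measurable (int3_abs (int3_ext0_ball T)).
  have mE := measurable_enormB x; have := measurableT_comp (measurable_wt 2) mE.
  by apply: eq_measurable_fun => y _ /=; rewrite enormB.
rewrite (eq_integral (fun y : M3 R => (`|\1_(eball 0 T) y * U y| * wt 2 (enorm (x - y)))%:E)) // => y _.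
by rewrite /= ger0_norm // mulr_ge0 // wt_ge0.
Qed.

End nontangential_estimates.

Lemma far_kernel_osc (R : realType) (psi : E3 R -> R) (T : R) : C2f psi -> 0 < T -> (forall y, T <= enorm y -> psi y = 0) ->
  exists2 C : R, 0 < C & forall (d : R) (x x' y : E3 R), 1 <= d -> d <= enorm (y - x) -> d <= enorm (y - x') ->
    `|far_kernel psi x' y - far_kernel psi x y| <= C * enorm (x' - x) / d.
Proof.
(* 25 = 1 + 3 * 2 * 4: the Newton term, and three dipole terms with factor 2 and oscillation
   constant 4. *)
move=> cp T0 pT; have [B B0 HB] := C2f_bounded cp T0 pT; exists (25 * B) => [|d x x' y d1 dx dx']; first by rewrite mulr_gt0.
have d0 : 0 < d by exact: lt_le_trans ltr01 d1.
have [_ b1 b2] := HB y.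
have vec : (y - x') - (y - x) = - (x' - x) by rewrite opprB addrC addrA subrK opprB addrC.
have o1 := inv_enorm_osc d0 dx' dx; rewrite vec enormN in o1.
have o2 i := dipole_osc i d0 dx' dx; rewrite vec enormN in o2.
have y0 := lt_le_trans d0 dx; have y0' := lt_le_trans d0 dx'.
have {}o1 : `|(enorm (y - x'))^-1 - (enorm (y - x))^-1| <= enorm (x' - x) / d.
  apply: (le_trans o1); rewrite ler_wpM2l // lef_pV2 ?posrE ?mulr_gt0 //.
  by apply: (le_trans dx'); rewrite ler_peMr ?(ltW y0') // (le_trans d1).
have {}o2 i : `|dipole i (y - x') - dipole i (y - x)| <= 4 * enorm (x' - x) / d.
  apply: (le_trans (o2 i)); rewrite mulrA (mulrC _ 4) ler_wpM2l ?mulr_ge0 // lef_pV2 ?posrE ?mulr_gt0 ?exprn_gt0 //.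
  by rewrite -[leLHS]mul1r; apply: ler_pM => //; [exact: ltW|rewrite exprn_ege1].
have E z : far_kernel psi z y = (enorm (y - z))^-1 * laplacian psi y - \sum_(i < 3) 2 * (dipole i (y - z) * partial i psi y).
  by rewrite /far_kernel -sumrN; congr (_ + _); apply: eq_bigr => i _; rewrite /dipole mulNr mulrN.
rewrite !E (_ : _ - _ = ((enorm (y - x'))^-1 - (enorm (y - x))^-1) * laplacian psi y
    - \sum_(i < 3) 2 * ((dipole i (y - x') - dipole i (y - x)) * partial i psi y)); last first.
  have -> : \sum_(i < 3) 2 * ((dipole i (y - x') - dipole i (y - x)) * partial i psi y) =
      \sum_(i < 3) 2 * (dipole i (y - x') * partial i psi y) - \sum_(i < 3) 2 * (dipole i (y - x) * partial i psi y).
    by rewrite -sumrB; apply: eq_bigr => i _; ring.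
  by ring.
apply: (le_trans (ler_normB _ _)).
rewrite (_ : 25 * B * enorm (x' - x) / d = enorm (x' - x) / d * B + 3 * (2 * (4 * enorm (x' - x) / d * B))); last by ring.
apply: lerD; first by rewrite normrM; apply: ler_pM.
apply: (le_trans (ler_norm_sum _ _ _)).
have t i : `|2 * ((dipole i (y - x') - dipole i (y - x)) * partial i psi y)| <= 2 * (4 * enorm (x' - x) / d * B).
  by rewrite (normrM 2) (ger0_norm (ler0n _ 2)) ler_pM2l // normrM; apply: ler_pM.
apply: (le_trans (ler_sum _ (fun i _ => t i))); rewrite sumr_const card_ord.
by apply: le_of_eq; ring.
Qed.

(** * Convergence of the translated potentials *)

Section integral_criteria.
Context {R : realType} d (S : measurableType d) (nu : {measure set S -> \bar R}).

Lemma ge0_integrable (A : set S) (F : S -> \bar R) :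
  measurable A -> measurable_fun A F -> (forall x, (0%R <= F x)%E) -> (\int[nu]_(x in A) F x < +oo)%E -> nu.-integrable A F.
Proof.
move=> mA mF F0 Foo; apply/integrableP; split=> //.
by rewrite (eq_integral F) // => x _; rewrite gee0_abs.
Qed.

(** Convergence and domination are only available at points where the potential and the maximal
    function are finite. Integrability of the F_i makes this almost everywhere, and the hypotheses
    are phrased so that they can be checked pointwise. *)
Lemma L2_dominated_sum (A : set S) (h : nat -> S -> R)
    (F1 F2 F3 : S -> \bar R) (K : R) :
  measurable A -> (nu A < +oo)%E -> (forall m, measurable_fun A (h m)) ->
  (forall x, (0%R <= F1 x)%E) -> (forall x, (0%R <= F2 x)%E) -> (forall x, (0%R <= F3 x)%E) ->
  nu.-integrable A F1 -> nu.-integrable A F2 -> nu.-integrable A F3 ->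
  {ae nu, forall x, A x -> F2 x \is a fin_num -> h m x @[m --> \oo] --> (0 : R)} ->
  (forall m x (a b k : R), A x -> F1 x = a%:E -> F2 x = b%:E -> F3 x = k%:E -> h m x ^+ 2 <= K * (1 + a + b + k)) ->
  (\int[nu]_(x in A) (h m x ^+ 2)%:E)%E @[m --> \oo] --> 0%E.
Proof.
move=> mA nA mh F10 F20 F30 i1 i2 i3 hc hb.
have ic : nu.-integrable A (cst 1%:E).
  by apply/integrableP; split=> //; rewrite (eq_integral (cst 1%:E)) => [|x _]; [rewrite integral_cst // mul1e|rewrite /= normr1].
have iS := integrableD mA (integrableD mA (integrableD mA ic i1) i2) i3.
apply: (L2_dominated mA mh (integrableZl mA K iS)).
  by apply: filterS2 hc (integrable_ae mA i2) => x H f Ax; apply: H => //; exact: f.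
apply: filterS3 (integrable_ae mA i1) (integrable_ae mA i2) (integrable_ae mA i3) => x f1 f2 f3 m Ax.
move: (hb m x (fine (F1 x)) (fine (F2 x)) (fine (F3 x)) Ax).
rewrite !fineK ?f1 ?f2 ?f3 // => /(_ erefl erefl erefl) H.
rewrite /= -(fineK (f1 Ax)) -(fineK (f2 Ax)) -(fineK (f3 Ax)) -!EFinD -EFinM lee_fin.
exact: H.
Qed.

Lemma finite_sigma_finite : (nu setT < +oo)%E -> sigma_finite setT nu.
Proof. by move=> h; exists (fun=> setT) => [|i]; [rewrite bigcup_const|split]. Qed.

Lemma fin_sqr (a : \bar R) : (0%R <= a)%E -> (a * a)%E \is a fin_num -> exists2 b : R, 0 <= b & a = b%:E.
Proof.
by case: a => [b| |] //; rewrite lee_fin => b0 _; exists b.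
Qed.

Lemma sqr_domination (K w a b g : R) : 0 <= a -> 0 <= b -> `|w| <= K * (1 + a + b) ->
  (w - g) ^+ 2 <= (6 * K ^+ 2 + 2) * (1 + a * a + b * b + g ^+ 2).
Proof.
move=> a0 b0 wK; have w2 : w ^+ 2 <= K ^+ 2 * (1 + a + b) ^+ 2.
  by rewrite -exprMn -(real_normK (num_real w)) lerXn2r ?nnegrE // (le_trans _ wK).
have h : (1 + a + b) ^+ 2 <= 3 * (1 + a * a + b * b).
  by have := sqr_ge0 (1 - a); have := sqr_ge0 (1 - b); have := sqr_ge0 (a - b); nra.
have K2 := sqr_ge0 K; have g2 := sqr_ge0 g.
have h2 : K ^+ 2 * (1 + a + b) ^+ 2 <= K ^+ 2 * (3 * (1 + a * a + b * b)) by rewrite ler_wpM2l.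
have h3 : (w - g) ^+ 2 <= 2 * w ^+ 2 + 2 * g ^+ 2 by have := sqr_ge0 (w + g); nra.
have : 0 <= a * a + b * b by rewrite addr_ge0 // mulr_ge0.
have : 0 <= K ^+ 2 * g ^+ 2 by rewrite mulr_ge0.
nra.
Qed.

End integral_criteria.

Section translated_potentials.
Context {R : realType} (D : set (E3 R)) (oD : open D) (cD : connected D) (bD : bounded_set D) (D0 : D 0).
Context (Y : forall l : nat, 'I_(l.*2.+1) -> E3 R -> R[i]) (YP : orthonormal_spherical_harmonics Y).
Context (u : E3 R -> R) (hu : harmonic_on (exterior D) u).
Local Notation U := (ext0 (exterior D) u).
Hypothesis iU : forall T : R, int3 (fun y => \1_(eball 0 T) y * U y).
Context (n : nat) (p ev : nat -> E3 R) (c r T C1 : R).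
Hypotheses (c01 : 0 < c <= 1) (r0 : 0 < r) (T1 : 1 <= T).
Hypothesis cover : forall x, bdry D x -> exists2 k, (k < n)%N & enorm (x - p k) < r.
Hypothesis cones : forall k, (k < n)%N -> enorm (ev k) = 1 /\ cone D c (3 * r) (ev k) (p k).
Hypothesis pT : forall k, enorm (p k) + 3 * r <= T.
Hypothesis notDT : forall y, ~ exterior D y -> enorm y < T.
Hypothesis dec : forall y, T <= enorm y -> `|U y| <= C1 / enorm y.
Implicit Types (x y z : E3 R) (psi : E3 R -> R) (t : R).
Local Notation pot := (@pot R (exterior D) u).
Local Notation mean := (@mean R (exterior D) u).
Local Notation reg := (@reg R (exterior D) u).
(** With radius 5/4 r the sum is 1 within r/4 of S, which the balls of radius r cover, and each
    piece vanishes beyond 5/2 r, well inside the range 3 r of the cones. *)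
Local Notation chi := (part p (5 / 4 * r)).
Local Notation Chi := (near_sum p (5 / 4 * r) n).

#[local] Opaque newt newt1 newt2 bump cut.

Let rho0 : 0 < 5 / 4 * r. Proof. by rewrite mulr_gt0 // divr_gt0. Qed.
Let c0 : 0 < c. Proof. by case/andP: c01. Qed.
Let T0 : 0 < T. Proof. exact: lt_le_trans ltr01 T1. Qed.

Lemma chi_out k y : 5 / 2 * r <= enorm (y - p k) -> chi k y = 0.
Proof. by move=> h; apply: part_out => //; rewrite mulrA (_ : 2 * (5 / 4) = 5 / 2) //; field. Qed.

Lemma chi_far k y : T <= enorm y -> chi k y = 0.
Proof.
move=> yT; apply: chi_out; have := enormDB y (p k) 0; rewrite !subr0; have := pT k => a b.
have : 5 / 2 * r <= 3 * r by rewrite ler_pM2r //; lra.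
lra.
Qed.

Lemma Chi_far y : T <= enorm y -> Chi y = 0.
Proof. by move=> yT; rewrite -part_sum big1 // => k _; exact: chi_far. Qed.

Lemma Chi_near q y : bdry D q -> enorm (y - q) < r / 4 -> Chi y = 1.
Proof.
move=> /cover[k kn qk] yq; apply: (near_sum_in rho0 kn).
have := enormDB y q (p k); lra.
Qed.

(** The factor vanishes within r/4 of S; away from S and inside the ball of radius T compactness
    applies, and outside it the decay of u. *)
Lemma outer_bounded : exists2 B : R, 0 < B & forall y, `|(1 - Chi y) * U y| <= B.
Proof.
pose K := [set y | [/\ enorm (y - 0) <= T, ~ D y & r / 4 <= dist y (bdry D)]].
have cK : compact K.
  rewrite (_ : K = [set y | enorm (y - 0) <= T] `&` (~` D `&` [set y | r / 4 <= dist y (bdry D)])); last first.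
    by apply/seteqP; split=> y /= [a]; [move=> b d|case=> b d].
  apply: compact_closedI; first exact: compact_cball.
  apply: closedI; first by apply: open_closedC.
  apply: (@closed_comp _ _ (fun y => dist y (bdry D)) [set z : R | r / 4 <= z]) => [y _|]; last exact: closed_ge.
  exact: continuous_dist.
have Ke y : K y -> exterior D y.
  move=> [_ nDy yd]; case: (proj1 (notDE oD y) nDy) => // Sy.
  by have h := r0; move: yd; rewrite (dist_bdry oD bD D0 Sy) => h'; exfalso; lra.
have [_ _ cu _ _] := (harmonic_D2on (@open_exterior R D) hu).1.
have [M hM] := continuous_bounded_on cK (fun x Kx => cu x (Ke x Kx)).
exists (`|M| + `|C1| + 1) => [|y]; first by rewrite ltr_wpDl // addr_ge0.
have /andP[h0 h1] := near_sum_itv p (5 / 4 * r) n y.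
have a1 : `|1 - Chi y| <= 1 by rewrite ger0_norm ?subr_ge0 // gerBl.
have nM := normr_ge0 M; have nC := normr_ge0 C1.
have red b : `|U y| <= b -> b <= `|M| + `|C1| + 1 -> `|(1 - Chi y) * U y| <= `|M| + `|C1| + 1.
  move=> ub bb; apply: le_trans bb; apply: le_trans ub; rewrite normrM -[leRHS]mul1r.
  by apply: ler_wpM2r.
have [Ty|yT] := leP T (enorm y).
  apply: (red `|C1|); last lra.
  have y0 := lt_le_trans T0 Ty; apply: (le_trans (dec Ty)); rewrite ler_pdivrMr //.
  have := ler_norm C1; have : `|C1| <= `|C1| * enorm y by rewrite ler_peMr // (le_trans T1).
  lra.
have [ey|ney] := pselect (exterior D y); last first.
  by rewrite /ext0 memNset // mulr0 normr0; lra.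
have [yd|yd] := leP (r / 4) (dist y (bdry D)).
  apply: (red `|M|); last lra.
  rewrite ext0_in //; apply: le_trans (ler_norm _); apply: hM; split=> //; first by rewrite subr0 ltW.
  exact: exterior_notD.
have e0 : 0 < r / 4 - dist y (bdry D) by rewrite subr_gt0.
have [q Sq yq] := dist_approx oD bD D0 y e0; rewrite (@Chi_near q) // ?subrr ?mul0r ?normr0; lra.
Qed.

Lemma mean_near s psi x (L eps : R) : 0 < s -> C2f psi ->
  (forall y, enorm (y - x) < s -> `|psi y * U y - L| <= eps) ->
  `|mean s psi x - mass * L| <= mass * eps.
Proof.
move=> s0 cp H; have ib := int3_bump x s0; have ic := int3_mean iU x s0 cp.
rewrite -(I3_bump x s0) mulrC -(I3Z _ ib) -(I3B ic (int3Z _ ib)) [leRHS]mulrC -(I3Z _ ib).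
have id := int3B ic (int3Z L ib).
apply: (le_trans (I3_norm id)); apply: I3_le; [exact: int3_abs|exact: int3Z|].
move=> y; have -> : bump s x y * psi y * U y - L * bump s x y = bump s x y * (psi y * U y - L) by ring.
have b0 := bump_ge0 x y s0; rewrite normrM (ger0_norm b0) (mulrC eps).
have [ys|sy] := ltP (enorm (y - x)) s; last by rewrite (bump_out s0 sy) !mul0r.
by apply: ler_wpM2l => //; exact: H.
Qed.

Lemma mean_le s psi x (b : R) : 0 < s -> C2f psi ->
  (forall y, enorm (y - x) < s -> `|psi y * U y| <= b) -> `|mean s psi x| <= mass * b.
Proof.
move=> s0 cp H; have := @mean_near s psi x 0 b s0 cp; rewrite mulr0 subr0; apply=> y ys.
by rewrite subr0; exact: H.
Qed.

(** Without the translations the value would be u far from S, since by [pot_Chi] the untranslated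
    sum is minus the average of u, that is - [mass] * u. The radius c t / 2 is half the depth of x -
    t e_k in the exterior. *)
Definition W t x : R := - mass^-1 * \sum_(k < n) pot (c * t / 2) (chi k) (x - t *: ev k).

Lemma W_mclosure t : 0 < t -> t <= r / 3 -> mclosure Y D (W t).
Proof.
move=> t0 tr; apply: mclosureZ; apply: mclosure_sum => k; have [e1 hc] := cones (ltn_ord k).
apply: (pot_mclosure oD cD bD D0 YP hu iU (C2f_part _ _ _) _ rho0 c01 e1 hc t0) => [y|].
  exact: part_out.
by have h := r0; lra.
Qed.

Lemma half_ct t : 0 < t -> 0 < c * t / 2 /\ c * t / 2 <= t / 2.
Proof.
move=> t0; rewrite divr_gt0 ?mulr_gt0 //; split=> //; rewrite ler_pM2r // ler_piMl ?(ltW t0) //.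
by case/andP: c01.
Qed.

Lemma tame_Chi : tame (exterior D) (fun y => Chi y - 1).
Proof.
apply: (tame_exterior oD) => q Sq; exists (r / 4) => [|y yq]; first by rewrite divr_gt0.
by rewrite (Chi_near Sq yq) subrr.
Qed.

Lemma pot_Chi s x : 0 < s -> \sum_(k < n) pot s (chi k) x = - mean s (fun=> 1) x.
Proof.
move=> s0; have := pot_near1 (@open_exterior R D) hu iU x s0 (C2f_near_sum p _ n) Chi_far tame_Chi notDT dec.
move=> <-; rewrite -(pot_sum (@open_exterior R D) hu iU s n x (C2f_part p _) chi_far).
have E : (fun z => \sum_(k < n) chi k z) = Chi by apply/funext => y; rewrite part_sum.
by rewrite E.
Qed.

Lemma meanB s psi psi' x : 0 < s -> C2f psi -> C2f psi' ->
  mean s (fun y => psi y - psi' y) x = mean s psi x - mean s psi' x.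
Proof.
move=> s0 cp cp'; rewrite -(I3B (int3_mean iU x s0 cp) (int3_mean iU x s0 cp')).
by apply: eq_I3 => y; ring.
Qed.

Lemma mean_Chi s x : 0 < s -> \sum_(k < n) mean s (chi k) x = mean s Chi x.
Proof.
move=> s0; rewrite -I3_sum => [|k _]; last exact: (int3_mean iU x s0 (C2f_part p (5 / 4 * r) k)).
by apply: eq_I3 => y; rewrite -mulr_suml -mulr_sumr part_sum.
Qed.

(** Each potential is its regular part minus an average, and [pot_Chi] at the unshifted x supplies
    an expression equal to zero. Adding it pairs every shifted regular part with the unshifted one,
    and completes the averages of the pieces by that of 1 - Chi. *)
Lemma W_decomp t x : 0 < t -> W t x = mass^-1 *
  (\sum_(k < n) mean (c * t / 2) (chi k) (x - t *: ev k) + mean (c * t / 2) (fun y => 1 - Chi y) x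
   - \sum_(k < n) (reg (c * t / 2) (chi k) (x - t *: ev k) - reg (c * t / 2) (chi k) x)).
Proof.
have alg (a b a' b' : R) : - (a - b) = b + (- (a' - b') - b') - (a - a') by ring.
move=> t0; have [s0 _] := half_ct t0; set s := c * t / 2 in s0 *.
have E k x' : pot s (chi k) x' = reg s (chi k) x' - mean s (chi k) x'.
  by rewrite (regE iU x' s0 (C2f_part _ _ _) (chi_far k)) addrK.
rewrite /W -/s mulNr -mulrN; congr (_ * _).
rewrite sumrB (meanB x s0 (C2f_cst 1) (C2f_near_sum _ _ _)) -(mean_Chi x s0) -[mean s (fun=> 1) x]opprK -(pot_Chi x s0).
have E1 : \sum_(k < n) pot s (chi k) (x - t *: ev k) =
    \sum_(k < n) reg s (chi k) (x - t *: ev k) - \sum_(k < n) mean s (chi k) (x - t *: ev k).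
  by rewrite -sumrB; apply: eq_bigr => k _; exact: E.
have E2 : \sum_(k < n) pot s (chi k) x = \sum_(k < n) reg s (chi k) x - \sum_(k < n) mean s (chi k) x.
  by rewrite -sumrB; apply: eq_bigr => k _; exact: E.
rewrite [X in - X = _]E1 [X in _ + (- X - _) - _]E2.
exact: alg.
Qed.

Lemma chi_far_derivs k y : T <= enorm y -> (forall i, partial i (chi k) y = 0) /\ laplacian (chi k) y = 0.
Proof.
move=> yT; have r2 : 0 < r / 2 by rewrite divr_gt0.
apply: (@C2f_locally_cst _ (chi k) y (r / 2) 0 (C2f_part p _ k) r2) => z zy; apply: chi_out.
have := pT k; have := enormDB y z (p k); have := enormDB y (p k) 0; rewrite !subr0 (enormB y z); have h := r0.
lra.
Qed.

Lemma pot_far s k x : 0 < s -> s <= r -> 2 * T <= enorm x ->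
  int3 (fun y => far_kernel (chi k) x y * U y) /\ pot s (chi k) x = I3 (fun y => far_kernel (chi k) x y * U y).
Proof.
move=> s0 sr xT; have cp := C2f_part p (5 / 4 * r) k.
have rT : r <= T by have := pT k; have := enorm_ge0 (p k); have h := r0; lra.
have E y : pot_kernel s (chi k) x y = far_kernel (chi k) x y.
  have [yT|Ty] := ltP (enorm y) T; last first.
    have [z1 z2] := chi_far_derivs k Ty.
    have zs (F : 'I_3 -> R) : \sum_(i < 3) 2 * (F i * partial i (chi k) y) = 0.
      by rewrite big1 // => i _; rewrite z1 (mulr0 (F i)) mulr0.
    transitivity (reg_kernel s (chi k) x y).
      by rewrite /reg_kernel (chi_far k Ty) (mulr0 (bump s x y)) addr0.
    rewrite (reg_kernelE x y s0 cp) /far_kernel z2 (mulr0 (newt s x y)) (mulr0 (enorm (y - x))^-1).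
    by rewrite !zs.
  have far : s <= enorm (y - x) by have := enormDB x y 0; rewrite !subr0 (enormB x y); lra.
  rewrite -(reg_kernel_far s0 cp far) /reg_kernel (bump_out s0 far) (mul0r (chi k y)); exact/esym/addr0.
have i := int3_pot iU s x cp (chi_far k).
by split; [apply: eq_int3 i => y|apply: eq_I3 => y]; rewrite E.
Qed.

Lemma mean_ext s x : 0 < s -> 2 * T <= enorm x -> s <= r -> mean s (fun=> 1) x = mass * u x.
Proof.
move=> s0 xT sr; have [_ H] := harmonic_on_MVP (@open_exterior R D) hu.
rewrite -(H x s s0) => [|y yx]; first by apply: eq_I3 => y; rewrite (mulr1 (bump s x y)).
apply: contrapT => /notDT yT.
have rT : r <= T by have := pT 0; have := enorm_ge0 (p 0); have h := r0; lra.
have := enormDB x y 0; rewrite !subr0 (enormB x y); lra.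
Qed.

(** Far away u is itself the untranslated sum, so the error is a difference of potentials at points
    at distance t. [far_kernel_osc] at distance |x| / 2 yields both the factor t and the decay. *)
Lemma W_far : exists2 C : R, 0 < C & forall t x, 0 < t -> t <= r / 3 -> 4 * T <= enorm x ->
  `|W t x - u x| <= C * t / (1 + enorm x).
Proof.
have H (k : nat) : exists C : R, 0 < C /\ forall t x, (k < n)%N -> 0 < t -> t <= r / 3 -> 4 * T <= enorm x ->
    `|pot (c * t / 2) (chi k) (x - t *: ev k) - pot (c * t / 2) (chi k) x| <= C * (enorm (t *: ev k) / enorm x).
  have [C C0 HC] := far_kernel_osc (C2f_part p (5 / 4 * r) k) T0 (chi_far k).
  have iA := int3_abs (iU T); have I0 : 0 <= I3 (fun y => `|\1_(eball 0 T) y * U y|) by apply: I3_ge0.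
  exists (2 * C * (1 + I3 (fun y => `|\1_(eball 0 T) y * U y|))); split.
    by rewrite !mulr_gt0 // ltr_pwDl.
  move=> t x kn t0 tr xT; have [s0 s1] := half_ct t0.
  have sr : c * t / 2 <= r by have h := r0; lra.
  have x0 : 0 < enorm x by have h := T1; lra.
  have rT : 3 * r <= T by have := pT k; have := enorm_ge0 (p k); lra.
  have e1 : enorm (t *: ev k) = t by rewrite enormZ (gtr0_norm t0) (cones kn).1 mulr1.
  have xx : (x - t *: ev k) - x = - (t *: ev k) by rewrite addrAC subrr add0r.
  have x'x : enorm x - t <= enorm (x - t *: ev k).
    by have := enormDB x (x - t *: ev k) 0; rewrite !subr0 (enormB x (x - _)) xx enormN e1; lra.
  have xT2 : 2 * T <= enorm x by have h := T1; lra.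
  have xT2' : 2 * T <= enorm (x - t *: ev k) by have h := T1; lra.
  have [i1 ->] := pot_far k s0 sr xT2; have [i2 ->] := pot_far k s0 sr xT2'.
  rewrite -(I3B i2 i1); apply: (le_trans (I3_norm (int3B i2 i1))).
  apply: (@le_trans _ _ (I3 (fun y => 2 * C * (t / enorm x) * `|\1_(eball 0 T) y * U y|))).
    apply: I3_le; [exact: int3_abs (int3B i2 i1)|exact: int3Z|move=> y].
    have [yT|Ty] := ltP (enorm y) T; last first.
      have [z1 z2] := chi_far_derivs k Ty.
      have z x1 : far_kernel (chi k) x1 y = 0.
        by rewrite /far_kernel z2 (mulr0 (enorm (y - x1))^-1) add0r big1 // => i _; rewrite z1 !mulr0.
      rewrite !z !mul0r subrr normr0 mulr_ge0 // mulr_ge0 ?divr_ge0 ?enorm_ge0 ?(ltW t0) //.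
      by rewrite mulr_ge0 // ltW.
    rewrite -mulrBl normrM indicE mem_set ?mul1r; last by rewrite /eball /= subr0.
    apply: ler_wpM2r; first exact: normr_ge0.
    have d1 : 1 <= enorm x / 2 by have h := T1; lra.
    have dx : enorm x / 2 <= enorm (y - x) by have := enormDB x y 0; rewrite !subr0 (enormB x y); lra.
    have dx' : enorm x / 2 <= enorm (y - (x - t *: ev k)).
      by have := enormDB (x - t *: ev k) y 0; rewrite !subr0 (enormB (x - _) y); lra.
    apply: (le_trans (HC _ _ _ _ d1 dx dx')); rewrite xx enormN e1.
    by apply: le_of_eq; field; exact: lt0r_neq0.
  rewrite (I3Z _ iA) e1 (_ : 2 * C * (1 + _) * _ = 2 * C * (t / enorm x) * (1 + I3 (fun y => `|\1_(eball 0 T) y * U y|))); last by ring.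
  apply: ler_wpM2l; first by rewrite mulr_ge0 ?divr_ge0 ?mulr_ge0 ?(ltW C0) ?(ltW t0) ?(ltW x0).
  by rewrite lerDr.
pose C k := sval (cid (H k)).
have C0 k : 0 < C k by have [] := svalP (cid (H k)).
have HC k := (svalP (cid (H k))).2.
have m0 : 0 < mass^-1 :> R by rewrite invr_gt0 mass_gt0.
exists (2 * mass^-1 * (1 + \sum_(k < n) C k)) => [|t x t0 tr xT].
  by rewrite !mulr_gt0 // ltr_pwDl // sumr_ge0 // => k _; exact: ltW.
have [s0 s1] := half_ct t0.
have sr : c * t / 2 <= r by have h := r0; lra.
have x1 : 1 <= enorm x by have h := T1; lra.
have x0 : 0 < enorm x by exact: lt_le_trans ltr01 x1.
have xT2 : 2 * T <= enorm x by have h := T1; lra.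
have -> : u x = - mass^-1 * \sum_(k < n) pot (c * t / 2) (chi k) x.
  by rewrite (pot_Chi x s0) (mean_ext s0 xT2 sr) mulrNN mulKf // gt_eqF // mass_gt0.
rewrite /W -mulrBr -sumrB normrM normrN (gtr0_norm m0).
apply: (@le_trans _ _ (mass^-1 * ((1 + \sum_(k < n) C k) * (t / enorm x)))).
  rewrite ler_pM2l //; apply: (le_trans (ler_norm_sum _ _ _)).
  apply: (@le_trans _ _ (\sum_(k < n) C k * (t / enorm x))).
    apply: ler_sum => k _; apply: (le_trans (HC k t x (ltn_ord k) t0 tr xT)).
    by rewrite enormZ (gtr0_norm t0) (cones (ltn_ord k)).1 mulr1.
  by rewrite -mulr_suml ler_pM2r ?divr_gt0 // lerDr.
rewrite (_ : 2 * mass^-1 * _ * t / _ = mass^-1 * ((1 + \sum_(k < n) C k) * (t * (2 / (1 + enorm x))))); last by ring.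
rewrite ler_pM2l // ler_pM2l; last by rewrite ltr_pwDl // sumr_ge0 // => k _; exact: ltW.
rewrite ler_pM2l // ler_pdivlMr ?ltr_pwDl ?enorm_ge0 // mulrC ler_pdivrMr //; lra.
Qed.

(** For y in a translated ball, delta(y) >= c t / 2 and |y - x| <= 3 t / 2. The largest demand on
    the aperture is 6 t + 3 delta(y) < (1 + alpha) delta(y), in [region_cone]; as 6 t <= (12 / c)
    delta(y) and c <= 1, the bound 15 suffices. *)
Context (alpha : R) (alpha_large : 15 < c * (1 + alpha)).

Lemma region_exterior k t x y : (k < n)%N -> ~ D x -> enorm (x - p k) < 3 * r -> 0 < t -> t <= r / 3 ->
  enorm (y - (x - t *: ev k)) < c * t / 2 -> [/\ exterior D y, c * t / 2 <= dist y (bdry D) & enorm (y - x) <= 3 / 2 * t].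
Proof.
move=> kn nx xp t0 tr yx; have [e1 hc] := cones kn; have [s0 s1] := half_ct t0.
have t3 : t < 3 * r by have h := r0; lra.
have H z : enorm (z - y) < c * t / 2 -> exterior D z.
  move=> zy; apply: ((hc x t xp t0 t3).1 nx); have := enormDB z y (x - t *: ev k); lra.
split; [by apply: H; rewrite subrr enorm0|exact: dist_exterior_ge|].
have := enormDB y (x - t *: ev k) x; rewrite (_ : x - _ - x = - (t *: ev k)); last by rewrite addrAC subrr add0r.
rewrite enormN enormZ e1 (gtr0_norm t0); lra.
Qed.

Lemma alpha_dist t (d : R) : 0 < t -> c * t / 2 <= d -> 15 / 2 * t < (1 + alpha) * d.
Proof.
move=> t0 td; have a := alpha_large; have h := c0.
have a0 : 0 < 1 + alpha by rewrite -(pmulr_rgt0 _ h); lra.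
by apply: (@lt_le_trans _ _ ((1 + alpha) * (c * t / 2))); [nra|rewrite ler_pM2l].
Qed.

Lemma region_bdry k t x y : (k < n)%N -> bdry D x -> enorm (x - p k) < 3 * r -> 0 < t -> t <= r / 3 ->
  enorm (y - (x - t *: ev k)) < c * t / 2 -> nt_region D alpha x y.
Proof.
move=> kn Sx xp t0 tr yx; have [ey yd yx'] := region_exterior kn (bdry_notD oD Sx) xp t0 tr yx.
by split=> //; have := alpha_dist t0 yd; lra.
Qed.

(** Links the two ways of controlling u: values of u in the translated ball of an exterior x are
    bounded by the maximal function at all boundary points seen from x, hence by the cone average at
    x. *)
Lemma region_cone k t x y q : (k < n)%N -> exterior D x -> enorm (x - p k) < 3 * r -> 0 < t -> t <= r / 3 ->
  enorm (y - (x - t *: ev k)) < c * t / 2 -> bdry D q -> enorm (x - q) < 3 * dist x (bdry D) -> nt_region D alpha q y.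
Proof.
move=> kn ex xp t0 tr yx Sq xq; have [ey yd yx'] := region_exterior kn (exterior_notD oD ex) xp t0 tr yx.
split=> //; have := enormDB y x q; have := dist_lip oD bD D0 x y; rewrite (enormB x y).
have d0 : 0 < dist y (bdry D) by apply: lt_le_trans yd; have [] := half_ct t0.
have a := alpha_large; have /andP[h h'] := c01.
have a0 : 0 < 1 + alpha by rewrite -(pmulr_rgt0 _ h); lra.
have a15 : 15 < 1 + alpha by apply: (lt_le_trans a); rewrite ler_piMl // ltW.
have := alpha_dist t0 yd.
have : 15 * dist y (bdry D) <= (1 + alpha) * dist y (bdry D) by rewrite ler_pM2r // ltW.
lra.
Qed.

Lemma mean_shift_le k t x (b : R) : (k < n)%N -> 0 < t -> t <= r / 3 -> 0 <= b ->
  (forall y, enorm (x - p k) < 3 * r -> enorm (y - (x - t *: ev k)) < c * t / 2 -> `|U y| <= b) ->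
  `|mean (c * t / 2) (chi k) (x - t *: ev k)| <= mass * b.
Proof.
move=> kn t0 tr b0 H; have [s0 s1] := half_ct t0; have [e1 _] := cones kn.
apply: (mean_le s0 (C2f_part p (5 / 4 * r) k)) => y yx; have /andP[h0 h1] := part_itv p (5 / 4 * r) k y.
rewrite normrM (ger0_norm h0).
have [yp|py] := ltP (enorm (y - p k)) (5 / 2 * r); last by rewrite (chi_out py) mul0r.
apply: (@le_trans _ _ (1 * `|U y|)); first by apply: ler_wpM2r.
rewrite mul1r; apply: H => //.
have := enormDB x (x - t *: ev k) (p k); have := enormDB (x - t *: ev k) y (p k).
rewrite (_ : x - (x - _) = t *: ev k); last by rewrite opprB addrC subrK.
rewrite enormZ e1 (gtr0_norm t0) (enormB (x - _) y); have h := r0; lra.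
Qed.

(** The dominating kernel is 0 on the diagonal by the convention for [wt], so the pointwise bound
    fails at x alone, a null set. *)
Lemma I3_le_point F g x : int3 F -> int3 g -> (forall y, y <> x -> `|F y| <= g y) -> `|I3 F| <= I3 g.
Proof.
move=> iF ig H; have N := negligible_point x.
have mC : measurable (~` [set x : M3 R]).
  by apply: open_measurable3; apply: closed_openC; exact: closed_point.
have E h : int3 h -> I3 h = I3 (fun y => \1_(~` [set x]) y * h y).
  move=> ih; have ih' := int3_indic mC ih; congr fine; apply: ae_eq_integral => //.
  - exact: measurable_int ih.
  - exact: measurable_int ih'.
  - apply: negligibleS N => y /=; apply: contra_notP => yx _.
    by rewrite /= indicE mem_set // mul1r.
rewrite (E F iF) (E g ig); apply: (le_trans (I3_norm (int3_indic mC iF))).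
apply: I3_le; [exact: int3_abs (int3_indic mC iF)|exact: int3_indic|move=> y].
rewrite indicE; have [->|yx] := pselect (y = x); first by rewrite memNset //= !mul0r normr0.
by rewrite mem_set // !mul1r; exact: H.
Qed.

Local Notation G := (riesz D u (4 * T + 1)).

Definition riesz_integrand x y : R := `|\1_(eball 0 (4 * T + 1)) y * U y| * wt 2 (enorm (x - y)).

Lemma shift_le k t x : (k < n)%N -> 0 < t -> enorm (x - t *: ev k - x) <= 2 / c * (c * t / 2) /\ enorm (x - x) <= 2 / c * (c * t / 2).
Proof.
move=> kn t0; have [e1 _] := cones kn; have h := c0.
rewrite (_ : x - _ - x = - (t *: ev k)); last by rewrite addrAC subrr add0r.
have -> : 2 / c * (c * t / 2) = t by field; exact: lt0r_neq0.
by rewrite subrr enorm0 enormN enormZ e1 mulr1 (gtr0_norm t0) lexx ltW.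
Qed.

Lemma reg_le : exists2 C : R, 0 < C & forall k t x, (k < n)%N -> 0 < t -> enorm x <= 4 * T -> int3 (riesz_integrand x) ->
  `|reg (c * t / 2) (chi k) (x - t *: ev k) - reg (c * t / 2) (chi k) x| <= C * I3 (riesz_integrand x).
Proof.
have T4 : 0 < 4 * T by rewrite mulr_gt0.
have far4 k y : 4 * T <= enorm y -> chi k y = 0 by move=> h; apply: chi_far; have h' := T0; lra.
have k0 : 0 <= 2 / c by rewrite divr_ge0 // ltW.
have H k : exists C : R, 0 < C /\ forall s x' x, 0 < s -> enorm (x' - x) <= 2 / c * s -> enorm x <= 4 * T ->
    int3 (riesz_integrand x) -> `|reg s (chi k) x'| <= C * I3 (riesz_integrand x).
  have [C C0 HC] := reg_kernel_dominated (exterior D) u (C2f_part p (5 / 4 * r) k) T4 (far4 k) k0.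
  exists C; split=> // s x' x s0 x'x xT iG; rewrite -(I3Z C iG).
  apply: (@I3_le_point _ _ x); first exact: (int3_reg iU x' s0 (C2f_part p _ k) (chi_far k)).
    exact: int3Z.
  by move=> y yx; exact: HC.
pose C k := sval (cid (H k)).
have C0 k : 0 < C k by have [] := svalP (cid (H k)).
have HC k := (svalP (cid (H k))).2.
exists (1 + 2 * \sum_(k < n) C k) => [|k t x kn t0 xT iG].
  by rewrite ltr_pwDl // mulr_ge0 // sumr_ge0 // => k _; exact: ltW.
have [s0 _] := half_ct t0; have [d1 d2] := shift_le x kn t0.
have I0 : 0 <= I3 (riesz_integrand x) by apply: I3_ge0 => y; rewrite mulr_ge0 // wt_ge0.
apply: (le_trans (ler_normB _ _)); apply: (le_trans (lerD (HC k _ _ _ s0 d1 xT iG) (HC k _ _ _ s0 d2 xT iG))).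
rewrite -/(C k) -mulrDl ler_wpM2r //.
have : C k <= \sum_(k < n) C k.
  by rewrite (bigD1 (Ordinal kn)) //= lerDl sumr_ge0 // => j _; exact: ltW.
lra.
Qed.

(** The three summands correspond to those of [W_decomp]: b for the averages of the pieces, the
    constant for the average of (1 - Chi) U, and the Riesz potential for the regular parts. *)
Lemma W_bound : exists2 K : R, 0 < K & forall t x (b : R), 0 < t -> t <= r / 3 -> enorm x <= 4 * T -> 0 <= b ->
  (forall k y, (k < n)%N -> enorm (x - p k) < 3 * r -> enorm (y - (x - t *: ev k)) < c * t / 2 -> `|U y| <= b) ->
  int3 (riesz_integrand x) -> `|W t x| <= K * (1 + b + I3 (riesz_integrand x)).
Proof.
have [B B0 HB] := outer_bounded; have [C C0 HC] := reg_le.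
have m0 : 0 < mass^-1 :> R by rewrite invr_gt0 mass_gt0.
have nn : 0 <= n%:R :> R by exact: ler0n.
exists (n%:R + B + mass^-1 * n%:R * C) => [|t x b t0 tr xT b0 H iG].
  by rewrite ltr_wpDr ?mulr_ge0 ?(ltW C0) ?(ltW m0) // ltr_wpDl.
have [s0 _] := half_ct t0; rewrite (W_decomp x t0) normrM (gtr0_norm m0).
have I0 : 0 <= I3 (riesz_integrand x) by apply: I3_ge0 => y; rewrite mulr_ge0 // wt_ge0.
have sum_le (F : 'I_n -> R) (a : R) : (forall k, `|F k| <= a) -> `|\sum_k F k| <= n%:R * a.
  move=> Fa; apply: (le_trans (ler_norm_sum _ _ _)); apply: (le_trans (ler_sum _ (fun k _ => Fa k))).
  by rewrite sumr_const card_ord mulr_natl.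
have A1 : `|\sum_(k < n) mean (c * t / 2) (chi k) (x - t *: ev k)| <= n%:R * (mass * b).
  by apply: sum_le => k; apply: (mean_shift_le (ltn_ord k) t0 tr b0) => y xp yx; exact: H (ltn_ord k) xp yx.
have A2 : `|mean (c * t / 2) (fun y => 1 - Chi y) x| <= mass * B.
  by apply: (mean_le s0 (C2fB (C2f_cst 1) (C2f_near_sum p _ n))) => y _; exact: HB.
have A3 : `|\sum_(k < n) (reg (c * t / 2) (chi k) (x - t *: ev k) - reg (c * t / 2) (chi k) x)| <= n%:R * (C * I3 (riesz_integrand x)).
  by apply: sum_le => k; exact: (HC k t x (ltn_ord k) t0 xT iG).
apply: (@le_trans _ _ (mass^-1 * (n%:R * (mass * b) + mass * B + n%:R * (C * I3 (riesz_integrand x))))).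
  apply: ler_wpM2l; first exact: ltW.
  by apply: (le_trans (ler_normB _ _)); apply: lerD A3; apply: (le_trans (ler_normD _ _)); exact: lerD.
rewrite (_ : mass^-1 * _ = n%:R * b + B + mass^-1 * n%:R * C * I3 (riesz_integrand x)); last first.
  by field; rewrite gt_eqF // mass_gt0.
have : 0 <= mass^-1 * n%:R * C by rewrite !mulr_ge0 // ltW.
move: (mass^-1 * n%:R * C) (I3 (riesz_integrand x)) I0 nn B0 b0; move: (n%:R) => N I I0 N0 B0 b0 *; nra.
Qed.

(** One statement for two uses: at boundary points L is the nontangential limit and 1 - Chi vanishes
    nearby; at exterior points L = u x and both hypotheses are continuity. The averages tend to
    chi_k(x) L and (1 - Chi(x)) L, which add up to L. *)
Lemma W_cvg x (L : R) (tn : nat -> R) : ~ D x -> enorm x <= 4 * T -> int3 (riesz_integrand x) ->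
  (forall m, 0 < tn m <= r / 3) -> tn m @[m --> \oo] --> (0 : R) ->
  (forall eps : R, 0 < eps -> exists2 d : R, 0 < d & forall k t y, (k < n)%N -> 0 < t -> t < d ->
    enorm (x - p k) < 3 * r -> enorm (y - (x - t *: ev k)) < c * t / 2 -> `|U y - L| <= eps) ->
  (forall eps : R, 0 < eps -> exists2 d : R, 0 < d & forall t y, 0 < t -> t < d ->
    enorm (y - x) < c * t / 2 -> `|(1 - Chi y) * U y - (1 - Chi x) * L| <= eps) ->
  W (tn m) x @[m --> \oo] --> L.
Proof.
move=> nx xT iG tn0 tnc HA HB.
have tpos m : 0 < tn m by case/andP: (tn0 m).
have tr m : tn m <= r / 3 by case/andP: (tn0 m).
have small d : 0 < d -> \forall m \near \oo, tn m < d.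
  move=> d0; move/cvgrPdist_lt: tnc => /(_ d d0); apply: filterS => m.
  by rewrite sub0r normrN; apply: le_lt_trans; exact: ler_norm.
have red (F : R -> R) (a : R) : (forall eps : R, 0 < eps -> exists2 d : R, 0 < d & forall t, 0 < t -> t < d -> t <= r / 3 ->
    `|F t - mass * a| <= mass * eps) -> F (tn m) @[m --> \oo] --> mass * a.
  move=> H; apply/cvgrPdist_le => eps e0.
  have e1 : 0 < eps / mass by rewrite divr_gt0 // mass_gt0.
  have [d d0 Hd] := H _ e1; apply: filterS (small d d0) => m md; rewrite distrC.
  by have := Hd _ (tpos m) md (tr m); rewrite [mass * (_ / _)]mulrC divfK // gt_eqF // mass_gt0.
have mk (k : 'I_n) : mean (c * tn m / 2) (chi k) (x - tn m *: ev k) @[m --> \oo] --> mass * (chi k x * L).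
  apply: (red (fun t => mean (c * t / 2) (chi k) (x - t *: ev k))) => eps e0.
  have [e1 hc] := cones (ltn_ord k).
  have [c0' _ _] := C2f_continuous (C2f_part p (5 / 4 * r) k).
  have near3 t y : 0 < t -> enorm (y - (x - t *: ev k)) < c * t / 2 -> enorm (y - x) <= 3 / 2 * t.
    move=> t0 yx; have [_ s1] := half_ct t0; have := enormDB y (x - t *: ev k) x.
    by rewrite (_ : x - _ - x = - (t *: ev k)); [rewrite enormN enormZ e1 (gtr0_norm t0); lra|rewrite addrAC subrr add0r].
  (* Outside the range of the cone nothing is known about U at the shifted points, but for t <= r/3
     the piece vanishes on the whole averaging ball and at x. *)
  have [xp|px] := ltP (enorm (x - p k)) (3 * r); last first.
    exists (r / 3) => [|t t0 td tr']; first by rewrite divr_gt0.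
    have [s0 _] := half_ct t0; apply: (mean_near s0 (C2f_part p (5 / 4 * r) k)) => y yx.
    rewrite !chi_out ?mul0r ?subrr ?normr0 ?(ltW e0) //; first by have h := r0; lra.
    by have := near3 t y t0 yx; have := enormDB x y (p k); rewrite (enormB x y); lra.
  have e2 : 0 < eps / 2 by rewrite divr_gt0.
  have e3 : 0 < eps / 2 / (`|L| + 1) by rewrite divr_gt0.
  have [d1 d10 H1] := HA _ e2; have /continuousE3/(_ _ e3)[d2 d20 H2] := c0' x.
  exists (Num.min d1 (d2 / 2)) => [|t t0]; first by rewrite lt_min d10 divr_gt0.
  rewrite lt_min => /andP[td1 td2] tr'.
  have [s0 _] := half_ct t0; apply: (mean_near s0 (C2f_part p (5 / 4 * r) k)) => y yx.
  have a1 := H1 k t y (ltn_ord k) t0 td1 xp yx.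
  have yx2 : enorm (y - x) < d2 by have := near3 t y t0 yx; lra.
  have a2 := H2 y yx2; have /andP[h0 h1] := part_itv p (5 / 4 * r) k y.
  rewrite (_ : _ - _ = chi k y * (U y - L) + (chi k y - chi k x) * L); last by ring.
  apply: (le_trans (ler_normD _ _)); rewrite [leRHS](splitr eps); apply: lerD.
    rewrite normrM (ger0_norm h0) -[leRHS]mul1r; apply: ler_pM => //.
  rewrite normrM; apply: (@le_trans _ _ (eps / 2 / (`|L| + 1) * (`|L| + 1))); last by rewrite divfK // gt_eqF.
  by apply: ler_pM => //; [exact: ltW|rewrite lerDl].
have mo : mean (c * tn m / 2) (fun y => 1 - Chi y) x @[m --> \oo] --> mass * ((1 - Chi x) * L).
  apply: (red (fun t => mean (c * t / 2) (fun y => 1 - Chi y) x)) => eps e0.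
  have [d d0 H] := HB _ e0; exists d => // t t0 td _; have [s0 _] := half_ct t0.
  by apply: (mean_near s0 (C2fB (C2f_cst 1) (C2f_near_sum p _ n))) => y yx; exact: (H t y t0 td yx).
have T4 : 0 < 4 * T by rewrite mulr_gt0.
have k0 : 0 <= 2 / c by rewrite divr_ge0 // ltW.
have sn0 m : 0 < c * tn m / 2 by have [] := half_ct (tpos m).
have sn : c * tn m / 2 @[m --> \oo] --> (0 : R).
  rewrite (_ : 0 = c * 0 / 2 :> R); last by rewrite mulr0 mul0r.
  by apply: cvgM; [apply: cvgM => //; exact: cvg_cst|exact: cvg_cst].
have rk (k : 'I_n) : (reg (c * tn m / 2) (chi k) (x - tn m *: ev k) - reg (c * tn m / 2) (chi k) x) @[m --> \oo] --> (0 : R).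
  have far4 y : 4 * T <= enorm y -> chi k y = 0 by move=> h; apply: chi_far; have h' := T0; lra.
  have A := reg_cvg iU (C2f_part p (5 / 4 * r) k) T4 far4 k0 sn0 sn (fun m => (shift_le x (ltn_ord k) (tpos m)).1) xT iG.
  have B := reg_cvg (xn := fun=> x) iU (C2f_part p (5 / 4 * r) k) T4 far4 k0 sn0 sn (fun m => (shift_le x (ltn_ord k) (tpos m)).2) xT iG.
  rewrite -(subrr (I3 (fun y => far_kernel (chi k) x y * U y))); exact: (cvgB A B).
have E : L = mass^-1 * (\sum_(k < n) mass * (chi k x * L) + mass * ((1 - Chi x) * L) - \sum_(k < n) 0).
  rewrite -mulr_sumr -mulr_suml part_sum big1 // subr0; field; by rewrite gt_eqF // mass_gt0.
rewrite E; under eq_fun do rewrite (W_decomp x (tpos _)).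
apply: cvgM; first exact: cvg_cst.
have csum (F : nat -> 'I_n -> R) (l : 'I_n -> R) : (forall k, F m k @[m --> \oo] --> l k) -> \sum_k F m k @[m --> \oo] --> \sum_k l k.
  move=> H; elim: (index_enum _) => [|k ks IH]; first by rewrite big_nil; under eq_fun do rewrite big_nil; exact: cvg_cst.
  by rewrite big_cons; under eq_fun do rewrite big_cons; apply: cvgD.
by apply: cvgB; [apply: cvgD => //; exact: csum|exact: csum].
Qed.

(** Outside D the function is a uniform limit of multipole sums, which are continuous away from the
    origin. *)
Lemma mclosure_measurable (w : E3 R -> R) : mclosure Y D w -> measurable_fun (~` D : set (M3 R)) (w : M3 R -> R).
Proof.
move=> H; have mD : measurable (~` D : set (M3 R)) by apply: closed_measurable3; exact: open_closedC.
have /openE3/(_ _ D0)[d d0 dD] := oD.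
have nd x : ~ D x -> d <= enorm x.
  by move=> nx; rewrite leNgt; apply/negP => h; apply: nx; apply: dD; rewrite /eball /= subr0.
pose O := [set x : E3 R | d / 2 < enorm x].
have oO : open O.
  apply/openE3 => x /= xd; exists (enorm x - d / 2) => [|y yx]; first by rewrite subr_gt0.
  by rewrite /eball /= in yx; rewrite /O /=; have := enormDB x y 0; rewrite !subr0 (enormB x y); lra.
have d2 : 0 < d / 2 by rewrite divr_gt0.
have mO L k : measurable_fun (~` D : set (M3 R)) (cre (multipole_sum Y L k) : M3 R -> R).
  have [[cc _] _] := multipole_sum_cMVP L k oO d2 (fun x xO => ltW xO) YP.1.
  apply: (@measurable_funS _ _ _ _ O); first exact: open_measurable3.
    by move=> x /nd xd; rewrite /O /=; lra.
  exact: continuous_measurable_on.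
have e0 m : 0 < m.+1%:R^-1 :> R by rewrite invr_gt0.
pose ch m := cid (H _ (e0 m)).
pose ch2 m := cid (svalP (ch m)).
apply: (@measurable_fun_cvg _ _ _ _ (fun m => cre (multipole_sum Y (sval (ch m)) (sval (ch2 m))) : M3 R -> R)) => [m|x nx]; first exact: mO.
apply/cvgrPdist_le => e ep.
have : \forall m \near \oo, m.+1%:R^-1 <= e :> R.
  have := @cvg_harmonic R; move/cvgrPdist_le => /(_ e ep); apply: filterS => m.
  by rewrite sub0r normrN ger0_norm // invr_ge0.
apply: filterS => m; apply: le_trans.
have := svalP (ch2 m) x nx; set z := _%:C - _ => hz.
have zz : w x - cre (multipole_sum Y (sval (ch m)) (sval (ch2 m))) x = complex.Re z.
  by rewrite /z /cre; case: (multipole_sum _ _ _ _).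
rewrite zz; apply: (@le_trans _ _ (cabs z)).
  by rewrite -(ler_pXn2r (n := 2)) ?nnegrE ?cabs_ge0 // cabs_sqr real_normK ?num_real // lerDl sqr_ge0.
apply: le_trans hz; rewrite ler_peMl ?cabs_ge0 // lerDl; exact: enorm_ge0.
Qed.

Context (mu : sfin3 R) (K M : R) (K0 : 0 <= K).
Hypothesis mu_ball : forall (y : E3 R) (s : R), 0 < s -> (mu (eball y s) <= (K * s ^+ 2)%:E)%E.
Hypothesis mu_fin : (mu setT <= M%:E)%E.
Hypothesis mu_lower : forall T : R, 0 < T -> exists2 k : R, 0 < k & forall (q : E3 R) (s : R),
  bdry D q -> 0 < s -> s <= T -> ((k * s ^+ 2)%:E <= mu (bdry D `&` eball q s))%E.
Context (N : E3 R -> \bar R) (mN : measurable_fun setT (N : M3 R -> \bar R)) (N0 : forall q, (0%R <= N q)%E).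
Hypothesis N2 : (\int[mu]_q (N q * N q) < +oo)%E.
Hypothesis uN : forall q x, bdry D q -> nt_region D alpha q x -> (`|u x|%:E <= N q)%E.
Context (g : E3 R -> R) (mg : measurable_fun (bdry D : set (M3 R)) (g : M3 R -> R)).
Hypothesis g2 : (\int[mu]_(x in bdry D) (g x ^+ 2)%:E < +oo)%E.
Hypothesis ntl : {ae mu, forall x, bdry D x -> forall eps : R, 0 < eps -> exists2 d : R, 0 < d & forall y,
  nt_region D alpha x y -> enorm (y - x) < d -> `|u y - g x| <= eps}.

Lemma alpha_gt2 : 2 < alpha.
Proof.
have /andP[h h'] := c01; have a := alpha_large.
have a0 : 0 < 1 + alpha by rewrite -(pmulr_rgt0 _ h); lra.
have : c * (1 + alpha) <= 1 + alpha by rewrite ler_piMl // ltW.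
lra.
Qed.

Definition tseq (m : nat) : R := r / 3 / m.+1%:R.

Lemma tseq_itv m : 0 < tseq m <= r / 3.
Proof.
have r3 : 0 < r / 3 by rewrite divr_gt0.
by rewrite /tseq divr_gt0 //= ler_pdivrMr // ler_peMr ?(ltW r3) // ler1n.
Qed.

Lemma tseq_cvg : tseq m @[m --> \oo] --> (0 : R).
Proof.
rewrite (_ : 0 = r / 3 * 0 :> R); last by rewrite mulr0.
by apply: cvgM; [exact: cvg_cst|exact: cvg_harmonic].
Qed.

Lemma riesz_fin x : (G x \is a fin_num) -> int3 (riesz_integrand x) /\ G x = (I3 (riesz_integrand x))%:E.
Proof.
move=> f; have iG : int3 (riesz_integrand x).
  by apply: (int3_riesz oD bD D0 mu_lower hu mN N0 N2 alpha_gt2 uN); rewrite ltey_eq f.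
by split=> //; rewrite -(I3_integral iG).
Qed.

Lemma riesz_ge0 x : (0%R <= G x)%E.
Proof. by apply: integral_ge0 => y _; rewrite lee_fin mulr_ge0 // wt_ge0. Qed.

(** The dominating functions are the squares of the maximal function, of the Riesz potential and of
    the boundary values. Convergence holds where the nontangential limit exists and the Riesz
    potential is finite, thus almost everywhere. *)
Lemma surface_cvg : (\int[mu]_(x in bdry D) ((W (tseq m) x - g x) ^+ 2)%:E)%E @[m --> \oo] --> 0%E.
Proof.
have mS := measurable_bdry oD; have [Kb Kb0 HW] := W_bound.
have T4 : 0 < 4 * T + 1 by rewrite ltr_wpDl // mulr_ge0 // ltW.
have [mG G2] := riesz_L2 oD bD D0 mu_lower hu mN N0 N2 alpha_gt2 uN T4 K0 (fun y s s0 _ => mu_ball y s0) mu_fin.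
have G0 := riesz_ge0.
apply: (@L2_dominated_sum R _ _ mu (bdry D) _ (fun x => N x * N x)%E (fun x => G x * G x)%E (fun x => (g x ^+ 2)%:E) (6 * Kb ^+ 2 + 2)) => //.
- by apply: le_lt_trans (ltry M); apply: le_trans mu_fin; apply: le_measure; rewrite ?inE.
- move=> m; apply: measurable_funB => //; have /andP[t0 tr] := tseq_itv m.
  apply: measurable_funS (mclosure_measurable (W_mclosure t0 tr)); last by move=> x; exact: bdry_notD.
  by apply: closed_measurable3; exact: open_closedC.
- by move=> x; rewrite mule_ge0.
- by move=> x; rewrite mule_ge0 // G0.
- by move=> x; rewrite lee_fin sqr_ge0.
- apply: integrableS (ge0_integrable measurableT _ _ N2) => //; first exact: emeasurable_funM.
  by move=> x; rewrite mule_ge0.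
- apply: integrableS (ge0_integrable measurableT _ _ G2) => //; first exact: emeasurable_funM.
  by move=> x; rewrite mule_ge0 // G0.
- apply: ge0_integrable => //; first by apply/measurable_EFinP; exact: measurable_funX.
  by move=> x; rewrite lee_fin sqr_ge0.
- apply: negligibleS ntl => x; apply: contra_not => H Sx /fin_sqr -/(_ (G0 x))[ga _ Ga].
  have [|iG _] := @riesz_fin x; first by rewrite Ga.
  have xT : enorm x <= 4 * T.
    have : enorm x < T by apply: notDT; exact: bdry_not_exterior.
    by have h := T0; lra.
  rewrite -(subrr (g x)); apply: cvgB; last exact: cvg_cst.
  apply: (W_cvg (bdry_notD oD Sx) xT iG tseq_itv tseq_cvg) => eps e0.
    have [d d0 Hd] := H Sx eps e0; exists (Num.min (r / 3) (d / 2)) => [|k t y kn t0].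
      by rewrite lt_min !divr_gt0.
    rewrite lt_min => /andP[/ltW tr td] xp yx; have ny := region_bdry kn Sx xp t0 tr yx.
    have [ey _ yx'] := region_exterior kn (bdry_notD oD Sx) xp t0 tr yx.
    by rewrite ext0_in //; apply: Hd => //; lra.
  exists (r / 4) => [|t y t0 tr yx]; first by rewrite divr_gt0.
  have [_ s1] := half_ct t0; have r4 : 0 < r / 4 by rewrite divr_gt0.
  rewrite (Chi_near Sx (y := x)) ?subrr ?enorm0 // (Chi_near Sx (y := y)); last by lra.
  by rewrite subrr !mul0r subrr normr0 ltW.
move=> m x a b k Sx Na Gb [gk]; have /andP[t0 tr] := tseq_itv m.
have [|na na0 Na'] := fin_sqr (N0 x); first by rewrite Na.
have [|ga ga0 Ga'] := fin_sqr (G0 x); first by rewrite Gb.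
have [|iG GI] := @riesz_fin x; first by rewrite Ga'.
move: Na Gb; rewrite Na' Ga' -!EFinM => -[<-] [<-]; rewrite -gk.
have xT : enorm x <= 4 * T.
  have : enorm x < T by apply: notDT; exact: bdry_not_exterior.
  by have h := T0; lra.
have gi : I3 (riesz_integrand x) = ga by move: GI; rewrite Ga' => -[].
apply: sqr_domination => //; rewrite -gi; apply: (HW (tseq m) x na t0 tr xT na0 _ iG) => k0 y kn xp yx.
have ny := region_bdry kn Sx xp t0 tr yx.
by rewrite ext0_in; [rewrite -lee_fin -Na'; exact: uN|case: ny].
Qed.

(** The radius 4 T is where [W_far] takes over. *)
Definition exterior_ball_set : set (M3 R) := exterior D `&` eball 0 (4 * T).

Lemma exterior_cvg : (\int[leb3 R]_(x in exterior_ball_set) ((W (tseq m) x - u x) ^+ 2)%:E)%E @[m --> \oo] --> 0%E.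
Proof.
pose B := exterior_ball_set; rewrite -/B.
have oB : open (B : set (E3 R)) by apply: openI; [exact: open_exterior|exact: open_eball].
have mB : measurable B by exact: open_measurable3.
pose E : set (M3 R) := eball 0 (4 * T).
have mE : measurable E by exact: measurable_eball.
have BE : B `<=` E by move=> x [].
have T4 : 0 < 4 * T by rewrite mulr_gt0.
have T41 : 0 < 4 * T + 1 by rewrite ltr_wpDl // ltW.
have [Kb Kb0 HW] := W_bound; have G0 := riesz_ge0.
have Efin := leb3_eball (0 : E3 R) T4.
have nfin : (mrestr (leb3 R) mE setT < +oo)%E by rewrite /mrestr setTI; exact: le_lt_trans Efin (ltry _).
(* Volume restricted to a ball is a finite measure, and on small balls 8 s^3 <= 8 s^2; so the
   estimate for surfaces also shows that the Riesz potential is square integrable over the ball. *)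
pose nu := sigma_finite_pack (finite_sigma_finite nfin).
have [mG G2] : measurable_fun setT (G : M3 R -> \bar R) /\ (\int[nu]_x (G x * G x) < +oo)%E.
  apply: (@riesz_L2 R D oD bD D0 mu mu_lower u hu N mN N0 N2 alpha alpha_gt2 uN _ nu 8 (8 * (4 * T) ^+ 3) T41) => //.
    move=> y s s0 s1; rewrite /nu /= /sigma_finite_copy /mrestr; apply: (@le_trans _ _ (leb3 R (eball y s))).
      by apply: le_measure; rewrite ?inE //; [apply: measurableI => //; exact: measurable_eball|exact: measurable_eball].
    by apply: (le_trans (leb3_eball y s0)); rewrite lee_fin ler_pM2l // exprS ler_piMl // sqr_ge0.
  by rewrite /nu /= /sigma_finite_copy /mrestr setTI.
have G2' : (\int[leb3 R]_(x in E) (G x * G x) < +oo)%E.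
  rewrite -(integral_mrestr (leb3 R) mE); first by rewrite -(integral_sigma_finite_pack (finite_sigma_finite nfin)).
    exact: emeasurable_funM.
  by move=> x; rewrite mule_ge0 // G0.
have [mQ Qoo] := cone_average_finite oD bD D0 mN N0 N2 T4.
have [k k0 Hk] := cone_average_ge oD bD D0 mu_lower N0 T4.
pose Q := cone_average D mu N (4 * T).
have Q0 x : (0%R <= Q x)%E.
  by apply: integral_ge0 => q _; rewrite mule_ge0 ?mule_ge0 // lee_fin cone_kernel_ge0.
have a2 := alpha_gt2.
have kk : 0 < k^-1 by rewrite invr_gt0.
have uQ x q : B x -> Q x = q%:E -> u x ^+ 2 <= q / k.
  move=> [ex xT] Qx; rewrite ler_pdivlMr // mulrC -lee_fin -Qx -(real_normK (num_real (u x))).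
  rewrite /eball /= subr0 in xT; apply: Hk => // q' Sq' xq; apply: (uN Sq'); split=> //.
  by apply: (lt_le_trans xq); apply: ler_wpM2r; [exact: dist_ge0|lra].
have [_ _ cu _ _] := (harmonic_D2on (@open_exterior R D) hu).1.
have cU x : exterior D x -> {for x, continuous U}.
  move=> ex; have /openE3/(_ _ ex)[d d0 dD] := @open_exterior R D.
  by apply: (@eq_ball_continuous _ u _ _ d d0 _ (cu x ex)) => y yx; rewrite ext0_in //; exact: dD.
apply: (@L2_dominated_sum R _ _ (leb3 R) B _ Q (fun x => G x * G x)%E (cst 0%E) ((6 * Kb ^+ 2 + 2) * (1 + 2 * k^-1))) => //.
- by apply: le_lt_trans (ltry _); apply: le_trans Efin; apply: le_measure; rewrite ?inE.
- move=> m; have /andP[t0 tr] := tseq_itv m; apply: measurable_funB.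
    apply: measurable_funS (mclosure_measurable (W_mclosure t0 tr)); last by move=> x [/(exterior_notD oD)].
    by apply: closed_measurable3; exact: open_closedC.
  by apply: continuous_measurable_on => // x [ex _]; exact: cu.
- by move=> x; rewrite mule_ge0 // G0.
- by apply: integrableS (ge0_integrable measurableT mQ Q0 Qoo).
- apply: (integrableS mE mB BE); apply: ge0_integrable => //; last by move=> x; rewrite mule_ge0 // G0.
  by apply: measurable_funS (emeasurable_funM mG mG).
- exact: integrable0.
- apply: aeW => x [ex xT] /fin_sqr -/(_ (G0 x))[ga _ Ga].
  have [|iG _] := @riesz_fin x; first by rewrite Ga.
  have xT' : enorm x <= 4 * T by rewrite /eball /= subr0 in xT; exact: ltW.
  rewrite -(subrr (u x)); apply: cvgB; last exact: cvg_cst.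
  apply: (W_cvg (exterior_notD oD ex) xT' iG tseq_itv tseq_cvg) => eps e0.
    have /continuousE3/(_ _ e0)[d d0 Hd] := cU x ex.
    exists (Num.min (r / 3) (d / 2)) => [|j t y jn t0]; first by rewrite lt_min !divr_gt0.
    rewrite lt_min => /andP[/ltW tr td] xp yx.
    have [ey _ yx'] := region_exterior jn (exterior_notD oD ex) xp t0 tr yx.
    by rewrite -(ext0_in u ex); apply/ltW/Hd; lra.
  have [cC _ _] := C2f_continuous (C2fB (C2f_cst 1) (C2f_near_sum p (5 / 4 * r) n)).
  have cP : {for x, continuous (fun y => (1 - Chi y) * U y)} by apply: continuousM; [exact: cC|exact: cU].
  have /continuousE3/(_ _ e0)[d d0 Hd] := cP.
  exists d => // t y t0 td yx; rewrite -(ext0_in u ex); apply/ltW/Hd.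
  by have [_ s1] := half_ct t0; lra.
move=> m x a b z [ex xT] Qa Gb [<-]; have /andP[t0 tr] := tseq_itv m.
have [|ga ga0 Ga'] := fin_sqr (G0 x); first by rewrite Gb.
have [|iG GI] := @riesz_fin x; first by rewrite Ga'.
move: Gb; rewrite Ga' -EFinM => -[<-].
have gi : I3 (riesz_integrand x) = ga by move: GI; rewrite Ga' => -[].
have a0 : 0 <= a by rewrite -lee_fin -Qa.
have xT' : enorm x < 4 * T by rewrite /eball /= subr0 in xT.
(* In place of the maximal function, which lives on S, the local bound at an exterior point is the
   square root of the cone average. *)
pose s := Num.sqrt (a / k); have s0 : 0 <= s by exact: sqrtr_ge0.
have s2 : s * s = a / k by rewrite -expr2 sqr_sqrtr // divr_ge0 // ltW.
have dom := @sqr_domination R Kb (W (tseq m) x) s ga (u x) s0 ga0.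
apply: (le_trans (dom _)).
  rewrite -gi; apply: (HW (tseq m) x s t0 tr (ltW xT') s0 _ iG) => j y jn xp yx.
  have [ey _ _] := region_exterior jn (exterior_notD oD ex) xp t0 tr yx.
  rewrite ext0_in // /s -sqrtr_sqr ler_wsqrtr // ler_pdivlMr // mulrC -lee_fin -Qa -(real_normK (num_real (u y))).
  by apply: Hk => // q Sq xq; apply: (uN Sq); exact: (region_cone jn ex xp t0 tr yx Sq xq).
rewrite s2 -mulrA ler_wpM2l; [|by rewrite addr_ge0 // mulr_ge0 // sqr_ge0|].
  by [].
have := uQ x a (conj ex xT) Qa; have : 0 <= ga * ga by rewrite mulr_ge0.
have : 0 <= k^-1 * (ga * ga) by rewrite !mulr_ge0 // ltW.
have : 0 <= a * k^-1 by rewrite mulr_ge0 // ltW.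
move: (k^-1) (ga * ga) kk => k' gg kk; lra.
Qed.

Lemma approximation (e : R) : 0 < e -> exists w : E3 R -> R, [/\ mclosure Y D w,
  (\int[mu]_(x in bdry D) ((w x - g x) ^+ 2)%:E <= e%:E)%E,
  (\int[leb3 R]_(x in exterior_ball_set) ((w x - u x) ^+ 2)%:E <= e%:E)%E &
  forall x, 4 * T <= enorm x -> `|w x - u x| <= e / (1 + enorm x)].
Proof.
move=> e0; have [C C0 HC] := W_far.
have small (F : nat -> \bar R) : F m @[m --> \oo] --> 0%E -> \forall m \near \oo, (F m <= e%:E)%E.
  move=> cF; have : \forall m \near \oo, (F m < e%:E)%E.
    have nb : nbhs (0%E : \bar R) [set y | (y < e%:E)%E].
      by apply: open_nbhs_nbhs; split; [exact: open_ereal_lt_ereal|rewrite /= lte_fin].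
    exact: (cF _ nb).
  by apply: filterS => m /ltW.
have ct : \forall m \near \oo, C * tseq m <= e.
  have e1 : 0 < e / C by rewrite divr_gt0.
  move/cvgrPdist_le: tseq_cvg => /(_ _ e1); apply: filterS => m.
  by rewrite sub0r normrN gtr0_norm ?(andP (tseq_itv m)).1 // ler_pdivlMr // mulrC.
have [m [[s1 s2] s3]] := filter_ex (filterI (filterI (small _ surface_cvg) (small _ exterior_cvg)) ct).
have /andP[t0 tr] := tseq_itv m; exists (W (tseq m)); split=> //; first exact: W_mclosure.
move=> x xT; apply: (le_trans (HC _ x t0 tr xT)); rewrite ler_pM2r // invr_gt0 ltr_pwDl //; exact: enorm_ge0.
Qed.

End translated_potentials.

(** * Approximation of one real component of the solution *)

Section boundary_solution.
Context {R : realType} (D : set (E3 R)) (oD : open D) (cD : connected D) (bD : bounded_set D) (D0 : D 0).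
Hypothesis lD : lipschitz_boundary D.
Context (sigma : {measure set (M3 R) -> \bar R}) (sigmaP : surface_measure D sigma).
Context (Y : forall l : nat, 'I_(l.*2.+1) -> E3 R -> R[i]) (YP : orthonormal_spherical_harmonics Y).
Context (f v : E3 R -> R[i]).
Implicit Types (x y z q : E3 R).

Lemma nt_maximal_ge0 alpha q : (0%R <= nt_maximal D alpha v q)%E.
Proof. by rewrite /nt_maximal le_max lexx. Qed.

Lemma nt_maximal_ge alpha q x : nt_region D alpha q x -> ((cabs (v x))%:E <= nt_maximal D alpha v q)%E.
Proof. by move=> rx; rewrite /nt_maximal le_max; apply/orP; right; apply: ereal_sup_ubound; exists x. Qed.

(** For fixed x the condition that x lies in the nontangential region of y is open in y. So
    superlevel sets are open, that is, the maximal function is lower semicontinuous. *)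
Lemma measurable_nt_maximal alpha : measurable_fun setT (nt_maximal D alpha v : M3 R -> \bar R).
Proof.
apply: (@measurability _ _ _ _ _ _ (@measurable_realfun.ErealGenOInfty.G R)).
  exact: measurable_realfun.ErealGenOInfty.measurableE.
move=> _ [_ [a ->] <-]; rewrite setTI.
have [a0|a0] := ltP a 0.
  rewrite (_ : _ @^-1` _ = setT); first exact: measurableT.
  apply/seteqP; split=> // y _ /=; rewrite in_itv /= andbT.
  by apply: lt_le_trans (nt_maximal_ge0 alpha y); rewrite lte_fin.
apply: open_measurable3; apply/openE3 => y; rewrite /= in_itv /= andbT /nt_maximal lt_max lte_fin (le_gtF a0) /=.
move=> /ereal_sup_gt[_ [x [ex xy] <-]] ax.
exists ((1 + alpha) * dist x (bdry D) - enorm (x - y)) => [|z zy]; first by rewrite subr_gt0.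
rewrite /= in_itv /= andbT; apply: (lt_le_trans ax); apply: nt_maximal_ge; split=> //.
by rewrite /eball /= in zy; have := enormDB x y z; rewrite (enormB y z); lra.
Qed.

Hypotheses (f_L2 : square_integrable sigma (bdry D) f) (v_data : attains_boundary_data D sigma f v)
  (v_dec : decays_like_inverse_r D v).
(** These hypotheses are what the real and the imaginary parts of (v, f) have in common; the section
    is applied once to each. *)
Context (u g : E3 R -> R) (hu : harmonic_on (exterior D) u).
Hypotheses (mg : measurable_fun (bdry D : set (M3 R)) (g : M3 R -> R)) (uv : forall x, `|u x| <= cabs (v x))
  (gf : forall x, `|g x| <= cabs (f x)) (ugvf : forall x y, `|u x - g y| <= cabs (v x - f y)).

Lemma real_approximation : exists T : R, 0 < T /\ forall e : R, 0 < e -> exists w : E3 R -> R, [/\ mclosure Y D w,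
  (\int[sigma]_(x in bdry D) ((w x - g x) ^+ 2)%:E <= e%:E)%E,
  (\int[leb3 R]_(x in exterior_ball_set D T) ((w x - u x) ^+ 2)%:E <= e%:E)%E &
  forall x, 4 * T <= enorm x -> `|w x - u x| <= e / (1 + enorm x)].
Proof.
have [s [e [c [r [c01 r0 cov cns]]]]] := finite_cones oD bD sigmaP lD.
have c0 : 0 < c by case/andP: c01.
(* The data are attained for every aperture, so it may be chosen according to the cones: c (1 +
   alpha) = c + 16 > 15. *)
pose alpha := 16 / c; have alpha0 : 0 < alpha by rewrite divr_gt0.
have al : 15 < c * (1 + alpha) by rewrite mulrDr mulr1 /alpha mulrC divfK ?lt0r_neq0 //; lra.
have [ntl N2] := v_data alpha0.
(* Away from S nothing is known about [sigma]; its restriction to S is finite and has quadratic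
   growth on all balls. *)
have mS := measurable_bdry oD; pose nu0 := mrestr sigma mS.
have [M MS] : exists M : R, sigma (bdry D) = M%:E.
  have h := surface_finite oD bD sigmaP lD; exists (fine (sigma (bdry D))).
  by rewrite fineK // ge0_fin_numE // measure_ge0.
have nu0T : nu0 setT = M%:E by rewrite /nu0 /mrestr setTI.
have nuf : (nu0 setT < +oo)%E by rewrite nu0T ltry.
pose mu := sigma_finite_pack (finite_sigma_finite nuf).
have muE A : mu A = sigma (A `&` bdry D) by [].
have [K K0 HK] := surface_upper oD bD sigmaP lD.
have Eint (F : M3 R -> \bar R) : (\int[mu]_(x in bdry D) F x = \int[sigma]_(x in bdry D) F x)%E.
  by apply: eq_measure_integral => A mA AS; rewrite [LHS]muE (setIidl AS).
have mN := measurable_nt_maximal alpha.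
have [C1 [R1 dec1]] := v_dec.
have [RD RD0 HRD] := domain_bounded bD.
have [pm pm0 Hpm] := seq_max s (@enorm R).
pose T := pm + 3 * r + RD + `|R1| + 1.
have nR := normr_ge0 R1; have nR' := ler_norm R1.
have T1 : 1 <= T by rewrite /T; lra.
pose n := size s; pose p k := nth 0 s k; pose ev k := e (p k).
have cover x : bdry D x -> exists2 k, (k < n)%N & enorm (x - p k) < r.
  by move=> /cov[q qs xq]; exists (index q s); rewrite ?index_mem // /p nth_index.
have cones k : (k < n)%N -> enorm (ev k) = 1 /\ cone D c (3 * r) (ev k) (p k).
  by move=> kn; have [] := cns _ (mem_nth 0 kn).
have pT k : enorm (p k) + 3 * r <= T.
  have [kn|kn] := ltnP k n; first by have := Hpm _ (mem_nth 0 kn); rewrite /T /p; lra.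
  by rewrite /p nth_default // enorm0 /T; lra.
have notDT y : ~ exterior D y -> enorm y < T.
  move=> ny; apply: (@le_lt_trans _ _ RD); last by rewrite /T; lra.
  apply: HRD; have [Dy|nDy] := pselect (D y); first exact: subset_closure.
  by case: (proj1 (notDE oD y) nDy) => // -[].
have dec y : T <= enorm y -> `|ext0 (exterior D) u y| <= C1 / enorm y.
  move=> yT; have ey : exterior D y.
    by apply: contrapT => /notDT; rewrite ltNge yT.
  by rewrite ext0_in //; apply: (le_trans (uv y)); apply: dec1 => //; rewrite /T in yT; lra.
have mu_ball (y : E3 R) (t : R) : 0 < t -> (mu (eball y t) <= (K * t ^+ 2)%:E)%E.
  by move=> t0; rewrite muE setIC; exact: HK.
have mu_fin : (mu setT <= M%:E)%E by rewrite muE setTI MS.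
have mu_lower (T' : R) : 0 < T' -> exists2 k : R, 0 < k & forall (q : E3 R) (t : R),
    bdry D q -> 0 < t -> t <= T' -> ((k * t ^+ 2)%:E <= mu (bdry D `&` eball q t))%E.
  move=> /(surface_lower oD bD sigmaP lD)[k k0 Hk]; exists k => // q t Sq t0 tT.
  by rewrite muE setIAC setIid; exact: Hk.
have NN : (\int[mu]_q (nt_maximal D alpha v q * nt_maximal D alpha v q) < +oo)%E.
  rewrite integral_sigma_finite_pack integral_mrestr //; first exact: emeasurable_funM.
  by move=> x; rewrite mule_ge0 // nt_maximal_ge0.
have uN q x : bdry D q -> nt_region D alpha q x -> (`|u x|%:E <= nt_maximal D alpha v q)%E.
  by move=> _ rx; apply: le_trans (nt_maximal_ge rx); rewrite lee_fin.
have g2 : (\int[mu]_(x in bdry D) (g x ^+ 2)%:E < +oo)%E.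
  rewrite Eint; case: f_L2 => _ _ fL; apply: (@le_lt_trans _ _ (\int[sigma]_(x in bdry D) (cabs (f x) ^+ 2)%:E)%E).
    apply: le_integral_nonmeas_in => // x _; rewrite lee_fin ?sqr_ge0 //.
    by rewrite -(real_normK (num_real (g x))) lerXn2r ?nnegrE ?cabs_ge0.
  have I0 : (0%R <= \int[sigma]_(x in bdry D) (cabs (f x) ^+ 2)%:E)%E by apply: integral_ge0 => x _; rewrite lee_fin sqr_ge0.
  by move: fL; rewrite /L2norm -!ge0_fin_numE ?sqrte_ge0 // sqrte_fin_num.
have ntl' : {ae mu, forall x, bdry D x -> forall eps : R, 0 < eps -> exists2 d : R, 0 < d & forall y,
    nt_region D alpha x y -> enorm (y - x) < d -> `|u y - g x| <= eps}.
  case: ntl => A [mA A0 subA]; exists A; split => //.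
    by apply/eqP; rewrite eq_le measure_ge0 andbT muE -A0; apply: le_measure; rewrite ?inE //; exact: measurableI.
  move=> x; apply: contra_notP => nA; apply: contrapT => H; apply: H => Sx eps e0.
  have : nt_limit D alpha v x (f x) by apply: contrapT => nl; apply: nA; apply: subA => /(_ Sx).
  move/cvgrPdist_le => /(_ _ e0); rewrite near_withinE => /nbhs_eball[d d0 Hd].
  exists d => // y ny yx; apply: (le_trans (ugvf y x)).
  by have := Hd y yx ny; rewrite sub0r normrN ger0_norm ?cabs_ge0.
have hyp2 : 2 < alpha by rewrite /alpha ltr_pdivlMr //; case/andP: c01 => _ h; lra.
have iU := int3_ext0_ball oD bD D0 mu_lower hu mN (nt_maximal_ge0 alpha) NN hyp2 uN.
exists T; split=> [|eps e0]; first exact: lt_le_trans ltr01 T1.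
have [w [w1 w2 w3 w4]] := approximation oD cD bD D0 YP hu iU c01 r0 T1 cover cones pT notDT dec al (ltW K0) mu_ball mu_fin mu_lower
  mN (nt_maximal_ge0 alpha) NN uN mg g2 ntl' e0.
by rewrite Eint in w2; exists w.
Qed.

End boundary_solution.

(** * Interior estimates and conclusion *)

Section interior_norms.
Context {R : realType}.
Implicit Types (x y z : E3 R) (O : set (E3 R)) (h : E3 R -> R).

(** In the mean value formula |h| is bounded by e + (1 + Rm)^2 w h^2 / e, w being the weight; this
    linearised Cauchy-Schwarz inequality turns an L^2 bound of order e into a pointwise bound of
    order e. *)
Lemma MVP_weighted_le O (rho Rm : R) : open O -> 0 < rho -> 0 < Rm ->
  exists2 C : R, 0 < C & forall h y (A e : R), MVP O h -> 0 < e -> 0 <= A ->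
    (forall z, enorm (z - y) <= rho -> O z /\ enorm z <= Rm) ->
    (\int[leb3 R]_(x in (O : set (M3 R))) (h x ^+ 2 * (1 + enorm x) `^ (- 2))%:E <= (A * e ^+ 2)%:E)%E ->
    `|h y| <= C * (1 + A) * e.
Proof.
move=> oO rho0 Rm0; have b0 := bump_coef_gt0 rho0; have m0 := @mass_gt0 R.
have mO : measurable (O : set (M3 R)) by exact: open_measurable3.
pose C := mass^-1 * bump_coef rho * (8 * rho ^+ 3 + (1 + Rm) ^+ 2).
have S0 : 0 < 8 * rho ^+ 3 + (1 + Rm) ^+ 2.
  by rewrite addr_gt0 // ?mulr_gt0 ?exprn_gt0 // addr_gt0.
have C0 : 0 < C by rewrite /C; apply: mulr_gt0 S0; rewrite mulr_gt0 // invr_gt0.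
exists C => // h y A e [ch H] e0 A0 yO hA.
have yO1 z : enorm (z - y) <= rho -> O z by move=> /yO[].
pose F z := ext0 O (fun z => h z ^+ 2 * (1 + enorm z) `^ (- 2)) z.
have F0 z : 0 <= F z by rewrite /F /ext0; case: ifP => // _; rewrite mulr_ge0 ?sqr_ge0 // powR_ge0.
have mF1 : measurable_fun (O : set (M3 R)) ((fun z => h z ^+ 2 * (1 + enorm z) `^ (- 2)) : M3 R -> R).
  apply: measurable_funM; first by apply: measurable_funX; exact: continuous_measurable_on.
  apply: measurable_funTS; apply: (measurableT_comp (measurable_powR _)).
  apply: measurable_funD => //; exact: continuous_measurable3 (@continuous_enorm R).
have mF : measurable_fun setT (F : M3 R -> R) by move: mF1 => /(measurable_restrictT _ mO).
have FI : (\int[leb3 R]_x (F x)%:E <= (A * e ^+ 2)%:E)%E.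
  rewrite integral_mkcond in hA; apply: le_trans hA; apply: le_integral_nonmeas => x; first by rewrite lee_fin.
  by rewrite /F /ext0 /patch; case: ifP.
have iF : int3 F.
  apply/integrableP; split; first exact/measurable_EFinP.
  rewrite (eq_integral (fun x : M3 R => (F x)%:E)) => [|x _]; last by rewrite /= ger0_norm.
  exact: le_lt_trans FI (ltry _).
have {}FI : I3 F <= A * e ^+ 2 by rewrite -lee_fin -(I3_integral iF).
have iB := int3_bump_ext0 oO ch rho0 yO1.
have := H y rho rho0 yO1 => E.
have : mass * `|h y| <= bump_coef rho * (8 * rho ^+ 3 * e + (1 + Rm) ^+ 2 / e * (A * e ^+ 2)).
  rewrite -{1}(gtr0_norm m0) -normrM -E.
  have i1 := int3Z e (int3_box y rho0); have i2 := int3Z ((1 + Rm) ^+ 2 / e) iF.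
  apply: (@le_trans _ _ (bump_coef rho * (e * I3 (\1_(box y rho)) + (1 + Rm) ^+ 2 / e * I3 F))); last first.
    by rewrite ler_pM2l // I3_box // (mulrC e) lerD2l ler_wpM2l // divr_ge0 ?(ltW e0) // sqr_ge0.
  rewrite -(I3Z _ (int3_box y rho0)) -(I3Z _ iF) -(I3D i1 i2) -(I3Z _ (int3D i1 i2)).
  apply: (le_trans (I3_norm iB)); apply: I3_le; [exact: int3_abs|by apply: int3Z; exact: int3D|move=> z].
  rewrite normrM (ger0_norm (bump_ge0 y z rho0)).
  have s0 : 0 <= e * \1_(box y rho) z + (1 + Rm) ^+ 2 / e * F z.
    by rewrite addr_ge0 // mulr_ge0 ?(ltW e0) // divr_ge0 ?(ltW e0) // sqr_ge0.
  have [zy|yz] := ltP (enorm (z - y)) rho; last first.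
    by rewrite (bump_out rho0 yz) mul0r mulr_ge0 // ltW.
  apply: ler_pM => //; [exact: bump_ge0|exact: bump_le|].
  have [Oz zR] := yO z (ltW zy).
  rewrite indicE mem_set; last exact: eball_sub_box.
  have t1 : (true : nat)%:R = 1 :> R by [].
  rewrite t1 mulr1 /F !ext0_in //.
  have z1 : 0 < 1 + enorm z by rewrite ltr_pwDl // enorm_ge0.
  have w : (1 + enorm z) `^ (- 2) = ((1 + enorm z) ^+ 2)^-1 by rewrite powRN (powR_mulrn 2) // ltW.
  have k1 : 1 <= (1 + Rm) ^+ 2 * ((1 + enorm z) ^+ 2)^-1.
    by rewrite ler_pdivlMr ?exprn_gt0 // mul1r lerXn2r ?nnegrE ?(ltW z1) ?lerD2l // addr_ge0 // ltW.
  rewrite w (_ : (1 + Rm) ^+ 2 / e * _ = ((1 + Rm) ^+ 2 * ((1 + enorm z) ^+ 2)^-1) * (h z ^+ 2 / e)); last by ring.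
  have q0 : 0 <= h z ^+ 2 / e by rewrite divr_ge0 ?sqr_ge0 // ltW.
  apply: (@le_trans _ _ (e + h z ^+ 2 / e)); last by rewrite lerD2l ler_peMl.
  rewrite -(real_normK (num_real (h z))) -subr_ge0 (_ : _ - _ = ((`|h z| - e) ^+ 2 + `|h z| * e) / e); last first.
    by field; exact: lt0r_neq0.
  by rewrite divr_ge0 ?addr_ge0 ?sqr_ge0 ?mulr_ge0 ?(ltW e0).
rewrite -ler_pdivlMl // => hy; apply: (le_trans hy).
rewrite (_ : (1 + Rm) ^+ 2 / e * (A * e ^+ 2) = (1 + Rm) ^+ 2 * A * e); last by field; exact: lt0r_neq0.
rewrite (_ : C * (1 + A) * e = mass^-1 * (bump_coef rho * ((8 * rho ^+ 3 + (1 + Rm) ^+ 2) * (1 + A) * e))); last by rewrite /C; ring.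
rewrite ler_pM2l ?invr_gt0 // ler_pM2l // -mulrDl ler_pM2r //.
have : 0 <= 8 * rho ^+ 3 * A by rewrite mulr_ge0 // mulr_ge0 // exprn_ge0 // ltW.
have : 0 <= (1 + Rm) ^+ 2 by rewrite sqr_ge0.
rewrite mulrDl !mulrDr !mulr1; lra.
Qed.

Lemma sum3_bound (m : nat) (F : nat -> nat -> nat -> \bar R) (B : R) : 0 <= B ->
  (forall a b c, (a + b + c <= m)%N -> (F a b c <= B%:E)%E) ->
  (\sum_(a < m.+1) \sum_(b < m.+1) \sum_(c < m.+1 | (a + b + c <= m)%N) F a b c <= (m.+1%:R ^+ 3 * B)%:E)%E.
Proof.
move=> B0 FB.
apply: (@le_trans _ _ (\sum_(a < m.+1) \sum_(b < m.+1) \sum_(c < m.+1) B%:E)%E).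
  apply: lee_sum => a _; apply: lee_sum => b _; rewrite big_mkcond; apply: lee_sum => c _.
  by case: ifP => [/FB//|_]; rewrite lee_fin.
have c (X : R) : (\sum_(i < m.+1) X%:E = (m.+1%:R * X)%:E)%E by rewrite sumEFin sumr_const card_ord mulr_natl.
under eq_bigr do under eq_bigr do rewrite c.
by under eq_bigr do rewrite c; rewrite c lee_fin; apply: le_of_eq; ring.
Qed.

(** The L^2 bound first gives a pointwise bound on a neighbourhood of the closure of Dt, which the
    mean value property passes on to all derivatives. The constant depends on A, but not on w and
    e. *)
Lemma Hnorm_bound (D Dt : set (E3 R)) (m : nat) (A : R) : strictly_inner D Dt -> 0 <= A ->
  exists C : R, forall (w : E3 R -> R[i]) (e : R), 0 < e -> cMVP (exterior D) w ->
    (\int[leb3 R]_(x in (exterior D : set (M3 R))) (cabs (w x) ^+ 2 * (1 + enorm x) `^ (- 2))%:E <= (A * e ^+ 2)%:E)%E ->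
    (Hnorm m Dt w <= (C * e)%:E)%E.
Proof.
move=> [oDt _ cK KO] A0; have oO := @open_exterior R D.
have [d d0 Hd] := compact_open_margin cK oO KO.
have [Rm Rm0 HR] : exists2 Rm : R, 0 < Rm & forall x, closure Dt x -> enorm x <= Rm.
  have [M HM] := @continuous_bounded_on R (closure Dt) enorm cK (fun x _ => continuous_enorm (x := x)).
  exists (`|M| + 1) => [|x /HM]; first by rewrite ltr_wpDl.
  by rewrite ger0_norm // => h; have := ler_norm M; lra.
(* m layers are for the derivatives and one for the pointwise bound; together they fit in the margin
   d. *)
pose rho := d / m.+1%:R; have rho0 : 0 < rho by rewrite divr_gt0.
have rd : rho * m.+1%:R = d by rewrite /rho divfK.
have Rd0 : 0 < Rm + d by rewrite addr_gt0.
pose k := mass^-1 * (6 * bump_coef rho / rho * (8 * (rho + 1) ^+ 3)).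
have k0 : 0 <= k.
  have b0 := bump_coef_gt0 rho0; have m0 := @mass_gt0 R.
  rewrite /k mulr_ge0 ?invr_ge0 ?(ltW m0) // mulr_ge0 //; last by rewrite mulr_ge0 // exprn_ge0 // addr_ge0 // ltW.
  by rewrite divr_ge0 ?(ltW rho0) // mulr_ge0 // ltW.
have [C C0 HC] := MVP_weighted_le oO rho0 Rd0.
pose P := (1 + k) ^+ m * (C * (1 + A)).
have P0 : 0 <= P by rewrite !mulr_ge0 ?exprn_ge0 ?addr_ge0 // ltW.
have part h (e : R) (s : seq 'I_3) x : MVP (exterior D) h -> 0 < e -> (size s <= m)%N -> Dt x ->
   (\int[leb3 R]_(x in (exterior D : set (M3 R))) (h x ^+ 2 * (1 + enorm x) `^ (- 2))%:E <= (A * e ^+ 2)%:E)%E ->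
   `|partials s h x| <= P * e.
  move=> mh e0 sm Dx hA; have Kx : closure Dt x by exact: subset_closure.
  have near y : enorm (y - x) <= (size s)%:R * rho -> exterior D y /\ `|h y| <= C * (1 + A) * e.
    move=> yx; have sm' : (size s)%:R * rho + rho <= d.
      by rewrite -rd -[X in _ + X]mul1r -mulrDl [leRHS]mulrC ler_pM2r // natr1 ler_nat.
    split; first by apply: (Hd x y Kx); lra.
    apply: HC => // z zy; have := enormDB z y x => zx; split; first by apply: (Hd x z Kx); lra.
    by have := enormDB z x 0; rewrite !subr0; have := HR x Kx; lra.
  apply: (le_trans (MVP_partials_le oO mh rho0 near)).
  have M0 : 0 <= C * (1 + A) * e by rewrite !mulr_ge0 ?(ltW C0) ?(ltW e0) // addr_ge0.
  have -> : P * e = (1 + k) ^+ m * (C * (1 + A) * e) by rewrite /P; ring.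
  apply: ler_wpM2r => //; rewrite -/k.
  apply: (@le_trans _ _ ((1 + k) ^+ size s)); first by rewrite lerXn2r ?nnegrE ?addr_ge0 // lerDr.
  by rewrite ler_weXn2l // lerDl.
have mDt : measurable (Dt : set (M3 R)) by exact: open_measurable3.
have mO : measurable (exterior D : set (M3 R)) by exact: open_measurable3.
have V : (leb3 R Dt <= (8 * (Rm + d) ^+ 3)%:E)%E.
  rewrite -(leb3_box 0) //; apply: le_measure; rewrite ?inE //; first exact: measurable_box.
  move=> x Dx; apply: eball_sub_box; rewrite /eball /= subr0.
  by apply: (le_lt_trans (HR x (subset_closure Dx))); rewrite ltrDl.
pose V0 := 8 * (Rm + d) ^+ 3; have V00 : 0 <= V0 by rewrite mulr_ge0 // exprn_ge0 // ltW.
exists (Num.sqrt (m.+1%:R ^+ 3 * (2 * P ^+ 2 * V0))) => w e e0 [mr mi] hA.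
have le_w (h : E3 R -> R) : (forall x, h x ^+ 2 <= cabs (w x) ^+ 2) ->
    (\int[leb3 R]_(x in (exterior D : set (M3 R))) (h x ^+ 2 * (1 + enorm x) `^ (- 2))%:E <= (A * e ^+ 2)%:E)%E.
  move=> hw; apply: le_trans hA; apply: le_integral_nonmeas_in => // x _; rewrite lee_fin.
  - by apply: mulr_ge0; [exact: sqr_ge0|exact: powR_ge0].
  - by apply: ler_wpM2r => //; exact: powR_ge0.
  - by apply: mulr_ge0; [exact: sqr_ge0|exact: powR_ge0].
have wr : (\int[leb3 R]_(x in (exterior D : set (M3 R))) (cre w x ^+ 2 * (1 + enorm x) `^ (- 2))%:E <= (A * e ^+ 2)%:E)%E.
  by apply: le_w => x; rewrite cabs_sqr lerDl sqr_ge0.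
have wi : (\int[leb3 R]_(x in (exterior D : set (M3 R))) (cim w x ^+ 2 * (1 + enorm x) `^ (- 2))%:E <= (A * e ^+ 2)%:E)%E.
  by apply: le_w => x; rewrite cabs_sqr lerDr sqr_ge0.
have e20 := sqr_ge0 e; have P20 := sqr_ge0 P.
have B1 : 0 <= 2 * P ^+ 2 by exact: mulr_ge0.
have B2 : 0 <= 2 * P ^+ 2 * V0 by exact: mulr_ge0.
have B0 : 0 <= 2 * P ^+ 2 * V0 * e ^+ 2 by exact: mulr_ge0.
have B3 : 0 <= 2 * P ^+ 2 * e ^+ 2 by exact: mulr_ge0.
have m3 : 0 <= m.+1%:R ^+ 3 :> R by exact: exprn_ge0.
have -> : (Num.sqrt (m.+1%:R ^+ 3 * (2 * P ^+ 2 * V0)) * e)%:E = sqrte (m.+1%:R ^+ 3 * (2 * P ^+ 2 * V0 * e ^+ 2))%:E.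
  by rewrite [in RHS]mulrA /= (sqrtrM _ (mulr_ge0 m3 B2)) sqrtr_sqr (gtr0_norm e0).
rewrite /Hnorm lee_sqrt; last by rewrite lee_fin; exact: mulr_ge0.
apply: (@sum3_bound m (fun a b c => \int[leb3 R]_(x in Dt) (Dmulti a b c (cre w) x ^+ 2 + Dmulti a b c (cim w) x ^+ 2)%:E)%E _ B0) => a b c abc.
apply: (@le_trans _ _ (\int[leb3 R]_(x in (Dt : set (M3 R))) (cst (2 * P ^+ 2 * e ^+ 2)%:E x))%E).
  apply: le_integral_nonmeas_in => // x Dx; rewrite lee_fin //; first by rewrite addr_ge0 ?sqr_ge0.
  have sz : (size (nseq a (inord 0 : 'I_3) ++ nseq b (inord 1) ++ nseq c (inord 2)) <= m)%N.
    by rewrite !size_cat !size_nseq addnA.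
  have sq (h : E3 R -> R) : `|Dmulti a b c h x| <= P * e -> Dmulti a b c h x ^+ 2 <= P ^+ 2 * e ^+ 2.
    by move=> hb; rewrite -(real_normK (num_real (Dmulti _ _ _ _ _))) -exprMn lerXn2r ?nnegrE // mulr_ge0 // ltW.
  have h1 : Dmulti a b c (cre w) x ^+ 2 <= P ^+ 2 * e ^+ 2 by apply: sq; rewrite DmultiE; exact: part mr e0 sz Dx wr.
  have h2 : Dmulti a b c (cim w) x ^+ 2 <= P ^+ 2 * e ^+ 2 by apply: sq; rewrite DmultiE; exact: part mi e0 sz Dx wi.
  lra.
rewrite integral_cst // (_ : 2 * P ^+ 2 * V0 * e ^+ 2 = 2 * P ^+ 2 * e ^+ 2 * V0); last by ring.
by rewrite (EFinM _ V0); apply: lee_wpmul2l; rewrite ?lee_fin.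
Qed.

End interior_norms.

Section final_estimates.
Context {R : realType}.

Lemma Re_le_cabs (z : R[i]) : `|complex.Re z| <= cabs z.
Proof. by rewrite -(ler_pXn2r (n := 2)) ?nnegrE ?cabs_ge0 // cabs_sqr real_normK ?num_real // lerDl sqr_ge0. Qed.

Lemma Im_le_cabs (z : R[i]) : `|complex.Im z| <= cabs z.
Proof. by rewrite -(ler_pXn2r (n := 2)) ?nnegrE ?cabs_ge0 // cabs_sqr real_normK ?num_real // lerDr sqr_ge0. Qed.

Lemma creB_le (w f : E3 R -> R[i]) x y : `|cre w x - cre f y| <= cabs (w x - f y).
Proof. by have := Re_le_cabs (w x - f y); rewrite /cre; case: (w x) (f y) => [a b] [a' b']. Qed.

Lemma cimB_le (w f : E3 R -> R[i]) x y : `|cim w x - cim f y| <= cabs (w x - f y).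
Proof. by have := Im_le_cabs (w x - f y); rewrite /cim; case: (w x) (f y) => [a b] [a' b']. Qed.

(* [m] is the complex sum, [m1] and [m2] approximate the real and imaginary
   parts of the target [z] through the real numbers [a] and [b]. *)
Lemma cabs_split_le (m m1 m2 z : R[i]) (a b t : R) : m = m1 + (0 +i* 1) * m2 ->
  cabs (a%:C - m1) <= t -> cabs (b%:C - m2) <= t ->
  cabs (m - z) ^+ 2 <= 4 * (2 * t ^+ 2 + (a - complex.Re z) ^+ 2 + (b - complex.Im z) ^+ 2).
Proof.
move=> -> h1 h2; have t0 : 0 <= t by exact: le_trans (cabs_ge0 _) h1.
have sq (q : R[i]) : cabs q <= t -> complex.Re q ^+ 2 + complex.Im q ^+ 2 <= t ^+ 2.
  by move=> h; rewrite -cabs_sqr lerXn2r ?nnegrE ?cabs_ge0.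
move: (sq _ h1) (sq _ h2); rewrite cabs_sqr.
have three (p q r : R) : (p + q + r) ^+ 2 <= 3 * (p ^+ 2 + q ^+ 2 + r ^+ 2).
  by have := sqr_ge0 (p - q); have := sqr_ge0 (p - r); have := sqr_ge0 (q - r); nra.
case: m1 h1 => [x1 y1] _; case: m2 h2 => [x2 y2] _; case: z => [x y] /=.
have := three (- (a - x1)) (- y2) (a - x); have := three y1 (- (b - x2)) (b - y).
have -> : - (a - x1) + - y2 + (a - x) = x1 + (0 * x2 - 1 * y2) - x by ring.
have -> : y1 + - (b - x2) + (b - y) = y1 + (0 * y2 + 1 * x2) - y by ring.
rewrite !sub0r !sqrrN; have := sqr_ge0 (a - x); have := sqr_ge0 (b - y); have := sqr_ge0 t.
move: (_ ^+ 2) (_ ^+ 2) (_ ^+ 2) (_ ^+ 2) (_ ^+ 2) (_ ^+ 2) (_ ^+ 2) (_ ^+ 2) (_ ^+ 2) => *; lra.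
Qed.

Lemma weighted_split (c a1 a2 q w z1 z2 : R) : 0 <= w -> w <= 1 -> 0 <= a1 -> 0 <= a2 ->
  c <= 4 * (2 * q + z1 + z2) -> z1 <= a1 + q -> z2 <= a2 + q -> c * w <= 16 * q * w + 4 * a1 + 4 * a2.
Proof.
move=> w0 w1 a10 a20 hc h1 h2.
apply: (@le_trans _ _ ((4 * (4 * q + a1 + a2)) * w)); first by apply: ler_wpM2r => //; lra.
have : a1 * w <= a1 by rewrite ler_piMr.
have : a2 * w <= a2 by rewrite ler_piMr.
lra.
Qed.

Lemma integral_le3 d (S : measurableType d) (nu : {measure set S -> \bar R}) (A : set S) (F F1 F2 F3 : S -> R)
    (k1 k2 k3 b1 b2 b3 : R) : measurable A ->
  measurable_fun A F1 -> measurable_fun A F2 -> measurable_fun A F3 ->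
  (forall x, 0 <= F1 x) -> (forall x, 0 <= F2 x) -> (forall x, 0 <= F3 x) -> 0 <= k1 -> 0 <= k2 -> 0 <= k3 ->
  (forall x, A x -> 0 <= F x <= k1 * F1 x + k2 * F2 x + k3 * F3 x) ->
  (\int[nu]_(x in A) (F1 x)%:E <= b1%:E)%E -> (\int[nu]_(x in A) (F2 x)%:E <= b2%:E)%E ->
  (\int[nu]_(x in A) (F3 x)%:E <= b3%:E)%E ->
  (\int[nu]_(x in A) (F x)%:E <= (k1 * b1 + k2 * b2 + k3 * b3)%:E)%E.
Proof.
move=> mA m1 m2 m3 p1 p2 p3 k10 k20 k30 FF h1 h2 h3.
apply: (@le_trans _ _ (\int[nu]_(x in A) (k1%:E * (F1 x)%:E + k2%:E * (F2 x)%:E + k3%:E * (F3 x)%:E))%E).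
  apply: le_integral_nonmeas_in => // x Ax; last first.
    by rewrite -!EFinM -!EFinD lee_fin !addr_ge0 // mulr_ge0.
  - by rewrite -!EFinM -!EFinD lee_fin; have /andP[] := FF x Ax.
  - by rewrite lee_fin; have /andP[] := FF x Ax.
have q (k : R) (G : S -> R) : 0 <= k -> (forall x, 0 <= G x) -> forall x, A x -> (0%R <= k%:E * (G x)%:E)%E.
  by move=> k0 G0 x _; rewrite -EFinM lee_fin mulr_ge0.
have mq (k : R) (G : S -> R) : measurable_fun A G -> measurable_fun A (fun x => k%:E * (G x)%:E)%E.
  by move=> mG; apply: measurable_funeM; apply/measurable_EFinP.
rewrite ge0_integralD //; last 4 first.
- by move=> x Ax; apply: adde_ge0; exact: q.
- by apply: emeasurable_funD; exact: mq.
- exact: q.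
- exact: mq.
rewrite ge0_integralD //; [|exact: q|exact: mq|exact: q|exact: mq].
have z (k b : R) (G : S -> R) : 0 <= k -> measurable_fun A G -> (forall x, 0 <= G x) -> (\int[nu]_(x in A) (G x)%:E <= b%:E)%E ->
    (\int[nu]_(x in A) (k%:E * (G x)%:E) <= (k * b)%:E)%E.
  move=> k0 mG G0 h; rewrite ge0_integralZl_EFin //; last by apply/measurable_EFinP.
    by rewrite EFinM; apply: lee_wpmul2l.
  by move=> x _; rewrite lee_fin.
by rewrite !EFinD; apply: leeD; [apply: leeD|]; apply: z.
Qed.

End final_estimates.

Theorem theorem6p1 (R : realType) (D : set (E3 R))
  (D_open : open D) (D_connected : connected D) (D_bounded : bounded_set D)
  (D_lipschitz : lipschitz_boundary D) (D_origin : D 0)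
  (sigma : {measure set (M3 R) -> \bar R}) (sigmaP : surface_measure D sigma)
  (Y : forall l : nat, 'I_(l.*2.+1) -> E3 R -> R[i])
  (YP : orthonormal_spherical_harmonics Y)
  (f : E3 R -> R[i]) (f_L2 : square_integrable sigma (bdry D) f)
  (v : E3 R -> R[i]) (vP : exterior_dirichlet_solution D sigma f v) :
  exists (L : R -> nat) (c : R -> forall l : nat, 'I_(l.*2.+1) -> R[i]),
    (forall e : R, 0 < e ->
       (L2norm sigma (bdry D)
          (fun x => (multipole_sum Y (L e) (c e) x - f x)%R) <= e%:E)%E) /\
    (forall (gamma : R) (m : nat) (Dt : set (E3 R)),
       1 < gamma -> (0 < m)%N -> strictly_inner D Dt ->
       exists C : R, \forall e \near (0 : R)^'+,
         (Hnorm m Dt (fun x => (multipole_sum Y (L e) (c e) x - v x)%R)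
          + L2wnorm gamma (exterior D)
              (fun x => (multipole_sum Y (L e) (c e) x - v x)%R)
          <= (C * e)%:E)%E).
Proof.
case: vP => [[hr hi] data dec]; case: (f_L2) => mfr mfi _.
have [T1 [T10 A1]] := real_approximation D_open D_connected D_bounded D_origin D_lipschitz sigmaP YP f_L2 data dec hr mfr
  (fun x => Re_le_cabs (v x)) (fun x => Re_le_cabs (f x)) (creB_le v f).
have [T2 [T20 A2]] := real_approximation D_open D_connected D_bounded D_origin D_lipschitz sigmaP YP f_L2 data dec hi mfi
  (fun x => Im_le_cabs (v x)) (fun x => Im_le_cabs (f x)) (cimB_le v f).
have mS := measurable_bdry D_open.
have oE := @open_exterior R D; have mE : measurable (exterior D : set (M3 R)) by exact: open_measurable3.
have [M M0 SM] : exists2 M : R, 0 <= M & sigma (bdry D) = M%:E.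
  have h := surface_finite D_open D_bounded sigmaP D_lipschitz; exists (fine (sigma (bdry D))); first exact: fine_ge0.
  by rewrite fineK // ge0_fin_numE // measure_ge0.
(* The squared error on S will be at most 8 M e'^2 + 4 t + 4 t <= [ka] e'^2. With e = [ka] e' and
   [ka] >= 1 this is at most e^2, so the bound e holds without a constant. *)
pose ka : R := 8 * (M + 1); have ka1 : 1 <= ka by rewrite /ka; lra.
have ka0 : 0 < ka by exact: lt_le_trans ltr01 ka1.
pose I (gamma : R) := fine (\int[leb3 R]_x ((1 + enorm x) `^ (- (2 + gamma)))%:E)%E.
(* One choice has to serve all gamma, m and Dt, so these are quantified after the coefficients. For
   e <= 0 a dummy makes the choice function total. *)
have H e : exists Lc : nat * (forall l : nat, 'I_(l.*2.+1) -> R[i]), 0 < e ->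
    (\int[sigma]_(x in bdry D) (cabs (multipole_sum Y Lc.1 Lc.2 x - f x) ^+ 2)%:E <= (e ^+ 2)%:E)%E /\
    forall gamma : R, 1 < gamma -> (\int[leb3 R]_(x in (exterior D : set (M3 R)))
      (cabs (multipole_sum Y Lc.1 Lc.2 x - v x) ^+ 2 * (1 + enorm x) `^ (- gamma))%:E <= ((16 * I gamma + 8) * e ^+ 2)%:E)%E.
  have [e0|e0] := ltP 0 e; last by exists (0%N, fun _ _ => 0).
  have [e' [e'0 e'e ek]] : exists e' : R, [/\ 0 < e', e' <= e & e = ka * e'].
    exists (e / ka); split; first exact: divr_gt0; last by rewrite mulrC divfK ?lt0r_neq0.
    by rewrite ler_pdivrMr // ler_peMr // ltW.
  (* The approximation bounds squared L^2 errors by t but pointwise errors far away also by t; both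
     conditions on t are therefore needed. *)
  have [t [t0 t1 t2]] : exists t : R, [/\ 0 < t, t <= e' ^+ 2 & t <= e'].
    by exists (Num.min (e' ^+ 2) e'); rewrite lt_min e'0 exprn_gt0 // !ge_min !lexx orbT.
  have [w1 [c1 s1 n1 f1]] := A1 t t0; have [w2 [c2 s2 n2 f2]] := A2 t t0.
  have mw1 := mclosure_measurable D_open D_origin YP c1; have mw2 := mclosure_measurable D_open D_origin YP c2.
  have [L1 [k1 E1]] := c1 e' e'0; have [L2 [k2 E2]] := c2 e' e'0.
  (* [0 +i* 1] is the imaginary unit: the two real approximations become one complex multipole
     sum. *)
  have [L [k E]] := multipole_sumDZ Y (0 +i* 1) L1 k1 L2 k2.
  exists (L, k) => _.
  have shrink x : 0 <= e' / (1 + enorm x) <= e'.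
    have x1 := @enorm1_gt0 R x; rewrite divr_ge0 ?(ltW e'0) ?(ltW x1) //= ler_pdivrMr // ler_peMr ?(ltW e'0) // lerDl.
    exact: enorm_ge0.
  have near x (z : R[i]) : ~ D x -> 0 <= cabs (multipole_sum Y L k x - z) ^+ 2 <=
      4 * (2 * (e' / (1 + enorm x)) ^+ 2 + (w1 x - complex.Re z) ^+ 2 + (w2 x - complex.Im z) ^+ 2).
    move=> nx; have x1 : 0 < 1 + enorm x by exact: enorm1_gt0.
    apply/andP; split; first exact: sqr_ge0.
    apply: (cabs_split_le z (E x) (a := w1 x) (b := w2 x)); rewrite ler_pdivlMr // mulrC; [exact: E1|exact: E2].
  split.
    have mwS (w : E3 R -> R) : measurable_fun (~` D : set (M3 R)) (w : M3 R -> R) -> measurable_fun (bdry D : set (M3 R)) (w : M3 R -> R).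
      apply: measurable_funS; last by move=> x; exact: bdry_notD.
      by apply: closed_measurable3; exact: open_closedC.
    have B := @integral_le3 R _ _ sigma (bdry D) (fun x => cabs (multipole_sum Y L k x - f x) ^+ 2) (cst 1)
      (fun x => (w1 x - cre f x) ^+ 2) (fun x => (w2 x - cim f x) ^+ 2) (8 * e' ^+ 2) 4 4 M t t mS.
    apply: (le_trans (B _ _ _ _ _ _ _ _ _ _ _ s1 s2)) => //.
    - by apply: measurable_funX; apply: measurable_funB => //; exact: mwS.
    - by apply: measurable_funX; apply: measurable_funB => //; exact: mwS.
    - by move=> x; exact: sqr_ge0.
    - by move=> x; exact: sqr_ge0.
    - by rewrite mulr_ge0 // sqr_ge0.
    - move=> x Sx; have /andP[-> h] /= := near x (f x) (bdry_notD D_open Sx); apply: (le_trans h).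
      have /andP[q0 q1] := shrink x.
      have q : (e' / (1 + enorm x)) ^+ 2 <= e' ^+ 2 by rewrite lerXn2r ?nnegrE // ltW.
      rewrite /cre /cim /=; lra.
    - by rewrite (eq_integral (cst 1%:E)) // integral_cst // mul1e SM.
    rewrite lee_fin ek.
    have e2 : 0 <= e' ^+ 2 by exact: sqr_ge0.
    rewrite exprMn; apply: (@le_trans _ _ (ka * e' ^+ 2)).
      rewrite (_ : ka * e' ^+ 2 = 8 * e' ^+ 2 * M + 4 * e' ^+ 2 + 4 * e' ^+ 2); last by rewrite /ka; ring.
      by apply: lerD; [apply: lerD => //|]; apply: ler_wpM2l.
    by rewrite ler_wpM2r // expr2 ler_peMr // ltW.
  (* The pointwise error of order 1/(1+|x|) contributes (1+|x|)^(-(2+gamma)) to the weighted square,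
     integrable over R^3 exactly because gamma > 1. *)
  move=> gamma g1; have g3 : 3 < 2 + gamma by lra.
  pose B1 := exterior_ball_set D T1; pose B2 := exterior_ball_set D T2.
  have mB (T : R) : measurable (exterior_ball_set D T) by apply: measurableI => //; exact: measurable_eball.
  have mh (w u : E3 R -> R) (B : set (M3 R)) : measurable B -> measurable_fun (~` D : set (M3 R)) (w : M3 R -> R) -> harmonic_on (exterior D) u ->
      measurable_fun (exterior D : set (M3 R)) ((fun x => \1_B x * (w x - u x) ^+ 2) : M3 R -> R).
    move=> mB' mw hu; apply: measurable_funM; first by apply: measurable_funTS; exact: measurable_indic.
    apply: measurable_funX; apply: measurable_funB.
      apply: measurable_funS mw; last by move=> x; exact: exterior_notD.
      by apply: closed_measurable3; exact: open_closedC.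
    by apply: continuous_measurable_on => //; have [] := harmonic_on_MVP oE hu.
  have le_near (w u : E3 R -> R) (T : R) : (\int[leb3 R]_(x in exterior_ball_set D T) ((w x - u x) ^+ 2)%:E <= t%:E)%E ->
      (\int[leb3 R]_(x in (exterior D : set (M3 R))) (\1_(exterior_ball_set D T) x * (w x - u x) ^+ 2)%:E <= t%:E)%E.
    apply: le_trans; rewrite integral_mkcond [leRHS]integral_mkcond; apply: le_integral_nonmeas => x; rewrite /patch.
      by case: ifP => // _; rewrite lee_fin mulr_ge0 ?sqr_ge0.
    rewrite indicE; case: (x \in exterior_ball_set D T); last by rewrite mul0r; case: ifP.
    by rewrite mul1r; case: ifP => // _; rewrite lee_fin sqr_ge0.
  have wt0 x : 0 <= (1 + enorm x) `^ (- (2 + gamma)) by exact: powR_ge0.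
  have sq0 (w u : E3 R -> R) (B : set (M3 R)) x : 0 <= \1_B x * (w x - u x) ^+ 2 by rewrite mulr_ge0 ?sqr_ge0.
  have BB := @integral_le3 R _ _ (leb3 R) (exterior D) (fun x => cabs (multipole_sum Y L k x - v x) ^+ 2 * (1 + enorm x) `^ (- gamma))
    (fun x => (1 + enorm x) `^ (- (2 + gamma))) (fun x => \1_B1 x * (w1 x - cre v x) ^+ 2) (fun x => \1_B2 x * (w2 x - cim v x) ^+ 2)
    (16 * e' ^+ 2) 4 4 (I gamma) t t mE _ (mh _ _ _ (mB T1) mw1 hr) (mh _ _ _ (mB T2) mw2 hi) wt0 (sq0 _ _ _) (sq0 _ _ _).
  have e2 : 0 <= e' ^+ 2 by exact: sqr_ge0.
  apply: (le_trans (BB _ _ _ _ _ _ (le_near _ _ _ n1) (le_near _ _ _ n2))) => //.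
  - apply: measurable_funTS; apply: (measurableT_comp (measurable_powR _)).
    by apply: measurable_funD => //; exact: continuous_measurable3 (@continuous_enorm R).
  - by rewrite mulr_ge0.
  - move=> x ex; have nx := exterior_notD D_open ex; have x1 := @enorm1_gt0 R x.
    have /andP[h0 h1] := near x (v x) nx; have g0 : 0 <= (1 + enorm x) `^ (- gamma) by exact: powR_ge0.
    apply/andP; split; first by rewrite mulr_ge0.
    have gl : (1 + enorm x) `^ (- gamma) <= 1.
      rewrite -[leRHS](powRr0 (1 + enorm x)); apply: ler_powR; first by rewrite lerDl enorm_ge0.
      by rewrite oppr_le0 (le_trans ler01) // ltW.
    have -> : (1 + enorm x) `^ (- (2 + gamma)) = (1 + enorm x) ^- 2 * (1 + enorm x) `^ (- gamma).
      by rewrite -(wt2E (ltW x1)) -/(wt gamma _) -/(wt (2 + gamma) _) wtM //; lra.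
    (* Inside the ball the square is kept for the L^2 estimate; outside it is absorbed by the
       uniform decay, as t <= e'. *)
    have far (w u : E3 R -> R) (T : R) : (forall y, 4 * T <= enorm y -> `|w y - u y| <= t / (1 + enorm y)) ->
        (w x - u x) ^+ 2 <= \1_(exterior_ball_set D T) x * (w x - u x) ^+ 2 + (e' / (1 + enorm x)) ^+ 2.
      move=> fa; rewrite indicE; have [xT|Tx] := ltP (enorm x) (4 * T).
        by rewrite mem_set ?mul1r ?lerDl ?sqr_ge0 //; split=> //; rewrite /eball /= subr0.
      apply: (@le_trans _ _ ((e' / (1 + enorm x)) ^+ 2)); last by rewrite lerDr mulr_ge0 // sqr_ge0.
      have /andP[q0 _] := shrink x.
      rewrite -(real_normK (num_real (w x - u x))) lerXn2r ?nnegrE // (le_trans (fa x Tx)) // ler_pM2r // invr_gt0 //.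
    rewrite (_ : 16 * e' ^+ 2 * ((1 + enorm x) ^- 2 * _) = 16 * (e' / (1 + enorm x)) ^+ 2 * (1 + enorm x) `^ (- gamma)); last first.
      by rewrite expr_div_n; ring.
    exact: weighted_split g0 gl (sq0 _ _ _ _) (sq0 _ _ _ _) h1 (far _ _ _ f1) (far _ _ _ f2).
  - rewrite /I fineK; last first.
      by rewrite ge0_fin_numE ?decay_integral // integral_ge0 // => x _; rewrite lee_fin.
    by apply: le_integral_nonmeas_in => // x _; rewrite lee_fin.
  rewrite lee_fin; have I0 : 0 <= I gamma by rewrite fine_ge0 // integral_ge0 // => x _; rewrite lee_fin.
  apply: (@le_trans _ _ ((16 * I gamma + 8) * e' ^+ 2)).
    rewrite (_ : (16 * I gamma + 8) * e' ^+ 2 = 16 * e' ^+ 2 * I gamma + 4 * e' ^+ 2 + 4 * e' ^+ 2); last by ring.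
    by apply: lerD; [apply: lerD => //|]; apply: ler_wpM2l.
  by apply: ler_wpM2l; [rewrite addr_ge0 // mulr_ge0|rewrite lerXn2r ?nnegrE // ltW].
pose Lc e := sval (cid (H e)); have HLc e := svalP (cid (H e)).
exists (fun e => (Lc e).1), (fun e => (Lc e).2); split=> [e e0|gamma m Dt g1 _ sDt].
  have [h _] := HLc e e0; rewrite /L2norm (_ : e%:E = sqrte (e ^+ 2)%:E); last by rewrite /= sqrtr_sqr gtr0_norm.
  by rewrite lee_sqrt // lee_fin sqr_ge0.
have Ige g : 0 <= 16 * I g + 8.
  by rewrite addr_ge0 // mulr_ge0 // fine_ge0 // integral_ge0 // => x _; rewrite lee_fin powR_ge0.
(* The interior estimate uses the weighted bound for the particular exponent 2, independently of the
   gamma in the statement. *)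
have [CH HC] := Hnorm_bound m sDt (Ige 2).
exists (CH + Num.sqrt (16 * I gamma + 8)); near=> e.
have e0 : 0 < e by near: e; exact: nbhs_right_gt.
have [_ h] := HLc e e0.
rewrite mulrDl EFinD; apply: leeD.
  apply: (HC _ e e0); last by apply: h; rewrite ltr1n.
  have [d d0 dD] := (proj1 (openE3 _) D_open _ D_origin).
  have nd x : exterior D x -> d <= enorm x.
    by move=> /(exterior_notD D_open) nx; rewrite leNgt; apply/negP => xd; apply: nx; apply: dD; rewrite /eball /= subr0.
  have cM := multipole_sum_cMVP (Lc e).1 (Lc e).2 oE d0 nd YP.1.
  have cv : cMVP (exterior D) v by split; exact: harmonic_on_MVP.
  by apply: eq_cMVP (cMVPDZ (-1) oE cM cv) => // x _; rewrite mulN1r.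
have -> : (Num.sqrt (16 * I gamma + 8) * e)%:E = sqrte ((16 * I gamma + 8) * e ^+ 2)%:E.
  by rewrite /= (sqrtrM _ (Ige gamma)) sqrtr_sqr gtr0_norm.
rewrite /L2wnorm lee_sqrt; first exact: h.
by rewrite lee_fin mulr_ge0 ?sqr_ge0.
Unshelve. all: by end_near.
Qed.
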